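(* Let $N\ge 1$ be an integer and $N<p<\infty$. Let $a\in L^\infty(\mathbb{R}^N)$ with $a_-=\operatorname{ess\,inf}_{\mathbb{R}^N} a>0$, let $h\in L^1(\mathbb{R}^N)$ with $h\ge 0$, $h\not\equiv 0$, and let $g\in C(\mathbb{R})$ with $g\ge 0$ and $g\not\equiv 0$ in $[0,+\infty)$. Put $G(t)=\int_0^t g(\xi)\,d\xi$. Fix $x_0\in\mathbb{R}^N$ and $R>0$ such that $\int_{B(x_0,\frac R2)}h(x)\,dx>0$. Assume that there exist three positive constants $c_1,c_2,d$ such that: (i) $2^{\frac1p}c_1<d<c_2$; (ii) $\displaystyle\frac{G(c_1)}{c_1^p}<\frac23\,\tilde K_R\,\frac{G(d)}{d^p}$; (iii) $\displaystyle\frac{G(c_2)}{c_2^p}<\frac13\,\tilde K_R\,\frac{G(d)}{d^p}$. Then, for each $\lambda\in(\tilde\lambda_1',\tilde\lambda_2')$, where $$\tilde\lambda_1'=\frac32\,\frac{1}{p\,k_a^p\,\|h\|_1\,\tilde K_R}\,\frac{d^p}{G(d)},\qquad \tilde\lambda_2'=\min\left\{\frac{1}{p\,k_a^p\,\|h\|_1}\,\frac{c_1^p}{G(c_1)}\,,\ \frac{1}{2p\,k_a^p\,\|h\|_1}\,\frac{c_2^p}{G(c_2)}\right\},$$ the problem $$-\Delta_p u+a(x)|u|^{p-2}u=\lambda h(x)g(u)\ \text{ in }\mathbb{R}^N,\qquad u\in W^{1,p}(\mathbb{R}^N),\ u\ge 0,$$ admits at least three (distinct) nonnegative weak solutions $u_1,u_2,u_3\in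 W^{1,p}(\mathbb{R}^N)$ such that $\|u_i\|<\frac{c_2}{k_a}$ and $\|u_i\|_\infty<c_2$ for every $i=1,2,3$.
   Context: $\Delta_p u=\operatorname{div}(|\nabla u|^{p-2}\nabla u)$. $B(x_0,\rho)$ is the ball of $\mathbb{R}^N$ with centre $x_0$ and radius $\rho$; $\|h\|_1$ is the $L^1(\mathbb{R}^N)$ norm. A weak solution of the problem is a function $u\in W^{1,p}(\mathbb{R}^N)$, $u\ge 0$, such that $$\int_{\mathbb{R}^N}\left(|\nabla u|^{p-2}\nabla u\cdot\nabla v+a(x)|u|^{p-2}uv\right)dx=\lambda\int_{\mathbb{R}^N}h(x)g(u)\,v\,dx\quad\text{for all }v\in W^{1,p}(\mathbb{R}^N).$$ The norm $\|\cdot\|$ on $W^{1,p}(\mathbb{R}^N)$ is $$\|u\|=\left(\int_{\mathbb{R}^N}|\nabla u|^p\,dx+\int_{\mathbb{R}^N}a(x)|u|^p\,dx\right)^{1/p}.$$ Constants: $$k_a=\left(\frac1{a_-}\right)^{\frac{p-N}{p^2}}2^{\frac{p-1}{p}}\left(\frac{\Gamma(1+\frac N2)}{\pi^{N/2}}\right)^{\frac1p}\frac{1}{N^{\frac{N}{p^2}}}\left(\frac{p-1}{p-N}\right)^{\frac{N(p-1)}{p^2}},$$ $$K_R=\frac{1}{k_a^p}\,\frac{\Gamma(1+\frac N2)}{\pi^{N/2}}\left(\frac{R^{p-N}}{2^p-2^{p-N}+R^p\|a\|_\infty}\right),\qquad \tilde K_R=K_R\,\frac{\int_{B(x_0,\frac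 R2)}h(x)\,dx}{\|h\|_1},$$ where $\Gamma$ is the Gamma function. The condition on $g$ is read as: $g(t)\ge 0$ for all $t\ge 0$, and $g$ is not identically zero on $[0,+\infty)$. Convention: if $G(c_1)=0$, the quotient $c_1^p/G(c_1)$ is read as $+\infty$. *)

(* Defs.v *)
From HB Require Import structures.
From mathcomp Require Import all_boot all_order all_algebra.
From mathcomp Require Import all_classical all_reals all_analysis.
From mathcomp Require Import ess_sup_inf.

Set Implicit Arguments.
Unset Strict Implicit.
Unset Printing Implicit Defensive.

Import Order.TTheory GRing.Theory Num.Theory.
Import numFieldNormedType.Exports.

Local Open Scope classical_set_scope.
Local Open Scope ring_scope.

(* Borel sigma-algebra on R^n, generated by the coordinates. *)
Definition rV_display : measure_display.
Proof. exact. Qed.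

Section measurable_rV.
Variables (R : realType) (n : nat).

Let coord (i : 'I_n) (x : 'rV[R]_n) : R := x ord0 i.

Let rV_set0 : g_sigma_preimage coord set0.
Proof. exact: sigma_algebra0. Qed.

Let rV_setC A : g_sigma_preimage coord A -> g_sigma_preimage coord (~` A).
Proof. exact: sigma_algebraC. Qed.

Let rV_bigcup (F : _^nat) : (forall i, g_sigma_preimage coord (F i)) ->
  g_sigma_preimage coord (\bigcup_i (F i)).
Proof. exact: sigma_algebra_bigcup. Qed.

HB.instance Definition _ := @isMeasurable.Build rV_display
  'rV[R]_n (g_sigma_preimage coord) rV_set0 rV_setC rV_bigcup.

End measurable_rV.

Section measurable_rV_theory.
Variables (R : realType) (n : nat).

Lemma measurable_coord (i : 'I_n) :
  measurable_fun [set: 'rV[R]_n] (fun x : 'rV[R]_n => x ord0 i).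
Proof.
move=> _ Y mY; rewrite setTI; apply: sub_sigma_algebra => /=.
rewrite -bigcup_seq/=; exists i => /=; first by rewrite mem_index_enum.
by exists Y => //; rewrite setTI.
Qed.

Lemma measurable_fun_rV d (T : measurableType d) (f : T -> 'rV[R]_n) :
  (forall i, measurable_fun setT (fun t => f t ord0 i)) -> measurable_fun setT f.
Proof.
move=> mf; have H : g_sigma_preimage (fun i => (fun x : 'rV[R]_n => x ord0 i) \o f) `<=` measurable.
  apply: smallest_sub; first exact: sigma_algebra_measurable.
  case: n f mf => [|m] f mf; first by rewrite big_ord0.
  rewrite -bigcup_mkord_ord; apply: bigcup_sub => i Ii.
  by move=> A [B mB <-]; exact: mf.
move: H; rewrite g_sigma_preimage_comp => H _ A mA; apply: H.
by exists A.
Qed.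

End measurable_rV_theory.

Section lebesgue_step.
Variables (R : realType) (n : nat).

Definition rV_cons (y : measurableTypeR R * 'rV[R]_n) : 'rV[R]_n.+1 :=
  \row_i (if unlift ord0 i is Some j then y.2 ord0 j else y.1).

Definition rV_uncons (x : 'rV[R]_n.+1) : measurableTypeR R * 'rV[R]_n :=
  (x ord0 ord0, \row_j x ord0 (lift ord0 j)).

Lemma rV_consK : cancel rV_cons rV_uncons.
Proof.
move=> [y z]; congr pair; first by rewrite mxE unlift_none.
by apply/rowP => j; rewrite !mxE liftK.
Qed.

Lemma rV_unconsK : cancel rV_uncons rV_cons.
Proof.
by move=> x; apply/rowP => i; rewrite mxE; case: unliftP => [j ->|->//]; rewrite mxE.
Qed.

Lemma measurable_rV_cons : measurable_fun setT rV_cons.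
Proof.
apply: measurable_fun_rV => i.
under eq_fun do rewrite mxE.
case: unliftP => [j _|_]; last exact: measurable_fst.
exact: (measurableT_comp (@measurable_coord R n j) measurable_snd).
Qed.

Lemma measurable_rV_uncons : measurable_fun setT rV_uncons.
Proof.
apply: measurable_fun_pair; first exact: (@measurable_coord R n.+1 ord0).
apply: measurable_fun_rV => i.
under eq_fun do rewrite mxE.
exact: measurable_coord.
Qed.

Variable m : {sigma_finite_measure set 'rV[R]_n -> \bar R}.

Definition rV_step : set 'rV[R]_n.+1 -> \bar R :=
  pushforward (@lebesgue_measure R \x m)%E rV_cons.


Let rV_step0 : rV_step set0 = 0%E.
Proof. by rewrite /rV_step /pushforward preimage_set0 measure0. Qed.

Let rV_step_ge0 A : (0 <= rV_step A)%E.
Proof. by rewrite /rV_step /pushforward measure_ge0. Qed.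

Let measurable_preimage_rV_cons A : measurable A -> measurable (rV_cons @^-1` A).
Proof. by move=> mA; rewrite -[X in measurable X]setTI; exact: measurable_rV_cons. Qed.

Let rV_step_sigma_additive : semi_sigma_additive rV_step.
Proof.
move=> F mF tF mUF; rewrite /rV_step /pushforward preimage_bigcup.
apply: measure_semi_sigma_additive.
- by move=> k; exact: measurable_preimage_rV_cons.
- apply/trivIsetP => /= i j _ _ ij; rewrite -preimage_setI.
  by move/trivIsetP : tF => /(_ _ _ _ _ ij) ->//; rewrite preimage_set0.
- by rewrite -preimage_bigcup; exact: measurable_preimage_rV_cons.
Qed.

HB.instance Definition _ := isMeasure.Build _ _ _ rV_step
  rV_step0 rV_step_ge0 rV_step_sigma_additive.

Let rV_step_sigma_finite : sigma_finite setT rV_step.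
Proof.
have /sigma_finiteP[F [FT ndF Foo]] := sigma_finiteT (@lebesgue_measure R).
have /sigma_finiteP[G [GT ndG Goo]] := sigma_finiteT m.
exists (fun k => rV_uncons @^-1` (F k `*` G k)).
  rewrite -preimage_bigcup (_ : \bigcup_k _ = setT) ?preimage_setT//.
  apply/seteqP; split => // -[y z] _.
  have [k _ Fky] : (\bigcup_k F k) y by rewrite -FT.
  have [l _ Glz] : (\bigcup_k G k) z by rewrite -GT.
  exists (maxn k l) => //; split => /=.
    by move: y Fky; exact/subsetPset/ndF/leq_maxl.
  by move: z Glz; exact/subsetPset/ndG/leq_maxr.
move=> k; have [mFk Fkoo] := Foo k; have [mGk Gkoo] := Goo k; split.
  rewrite -[X in measurable X]setTI; apply: measurable_rV_uncons => //.
  exact: measurableX.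
rewrite /rV_step /pushforward -comp_preimage.
rewrite (_ : rV_uncons \o rV_cons = id); last first.
  by apply/funext => y /=; rewrite rV_consK.
by rewrite preimage_id product_measure1E// lte_mul_pinfty// ge0_fin_numE.
Qed.

HB.instance Definition _ := Measure_isSigmaFinite.Build _ _ _ rV_step
  rV_step_sigma_finite.

End lebesgue_step.

(* n-dimensional Lebesgue measure on the Borel sets; lebesgue_rV_box below
   determines it. *)
Fixpoint lebesgue_rV (R : realType) (n : nat) :
    {sigma_finite_measure set 'rV[R]_n -> \bar R} :=
  match n with
  | 0 => (\d_(0 : 'rV[R]_0))
  | k.+1 => rV_step (lebesgue_rV R k)
  end.

Lemma lebesgue_rV_box (R : realType) (n : nat) (A : 'I_n -> set R) :
  (forall i, measurable (A i)) ->
  lebesgue_rV R n [set x | forall i, A i (x ord0 i)] =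
  (\prod_(i < n) lebesgue_measure (A i))%E.
Proof.
elim: n A => [|n IHn] A mA.
  rewrite big_ord0 /= diracE mem_set//; by case.
rewrite big_ord_recl -(IHn (fun i => A (lift ord0 i)))//= /rV_step /pushforward.
have mB : measurable [set z : 'rV[R]_n | forall i, A (lift ord0 i) (z ord0 i)].
  rewrite (_ : mkset _ = \bigcap_(i in [set: 'I_n])
     (fun x : 'rV[R]_n => x ord0 i) @^-1` A (lift ord0 i)); last first.
    by apply/seteqP; split => [x /= H i _|x /= H i]; exact: H.
  apply: fin_bigcap_measurable => // i _.
  by rewrite -[X in measurable X]setTI; exact: measurable_coord.
rewrite -product_measure1E//; last exact: mA.
apply: (congr1 (product_measure1 lebesgue_measure (lebesgue_rV R n))).
apply/seteqP; split => [[y z] /= H|[y z] /= [Hy Hz] i].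
  split; first by have := H ord0; rewrite mxE unlift_none.
  by move=> i; have := H (lift ord0 i); rewrite mxE liftK.
by rewrite mxE; case: unliftP => [j ->|->]; [exact: Hz|exact: Hy].
Qed.

Section euclidean.
Context {R : realType} {N : nat}.
Implicit Types x y : 'rV[R]_N.

Definition dotv x y : R := \sum_(i < N) x ord0 i * y ord0 i.

(* The library's norm on 'rV[R]_N is the sup norm. *)
Definition enorm x : R := Num.sqrt (dotv x x).

Definition eball x0 (r : R) : set 'rV[R]_N := [set x | enorm (x - x0) < r].

End euclidean.

Section sobolev.
Context {R : realType} {N : nat}.
Local Notation E := ('rV[R]_N).
Local Notation mu := (lebesgue_rV R N).
Implicit Types (u v : E -> R) (phi : E -> R) (p : R).

Definition basis_vec (i : 'I_N) : E := delta_mx ord0 i.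

Definition partial (i : 'I_N) phi (x : E) : R := 'D_(basis_vec i) phi x.

Fixpoint Ck (k : nat) phi : Prop :=
  match k with
  | 0 => continuous phi
  | k'.+1 => [/\ continuous phi,
      forall i x, derivable phi x (basis_vec i) &
      forall i, Ck k' (partial i phi)]
  end.

Definition test_function phi : Prop :=
  (forall k, Ck k phi) /\ compact (closure [set x | phi x != 0]).

(* Functions on R^N are Borel representatives of their classes: relations
   between them are required mu-almost everywhere only. *)
Definition weak_gradient p u (Du : E -> E) : Prop :=
  (forall i, (fun x => Du x ord0 i) \in Lfun mu p%:E) /\
  forall phi, test_function phi -> forall i,
    \int[mu]_x (u x * partial i phi x) = - \int[mu]_x (Du x ord0 i * phi x).

Definition W1p p u : Prop :=
  u \in Lfun mu p%:E /\ exists Du, weak_gradient p u Du.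

(* A weak gradient in L^p is unique up to mu-null sets, so the choice is
   irrelevant under the integral sign. *)
Definition grad p u : E -> E := xget (fun=> 0) [set Du | weak_gradient p u Du].

Definition W1p_norm p (a u : E -> R) : R :=
  (\int[mu]_x (enorm (grad p u x) `^ p) +
   \int[mu]_x (a x * `|u x| `^ p)) `^ p^-1.

(* Since 0 `^ s = 0 for s != 0, both |grad u|^(p-2) grad u and |u|^(p-2) u
   vanish where grad u, resp. u, does, for p < 2 too. For p > N all integrands
   below are integrable, because W^{1,p}(R^N) embeds in L^oo. *)
Definition weak_solution p (a h : E -> R) (g : R -> R) (lambda : R) u : Prop :=
  [/\ W1p p u, {ae mu, forall x, 0 <= u x} &
   forall v, W1p p v ->
     \int[mu]_x (enorm (grad p u x) `^ (p - 2) * dotv (grad p u x) (grad p v x)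
                 + a x * `|u x| `^ (p - 2) * u x * v x)
     = lambda * \int[mu]_x (h x * g (u x) * v x)].

End sobolev.

Section constants.
Context {R : realType} {N : nat}.
Local Notation E := ('rV[R]_N).
Local Notation mu := (lebesgue_rV R N).

Definition Gamma (s : R) : R :=
  \int[lebesgue_measure]_(t in `]0, +oo[) (t `^ (s - 1) * expR (- t)).

Definition primitive (g : R -> R) (t : R) : R :=
  if 0 <= t then \int[lebesgue_measure]_(xi in `[0, t]) g xi
  else - \int[lebesgue_measure]_(xi in `[t, 0]) g xi.

Definition essinf (a : E -> R) : R := fine (ess_inf mu (EFin \o a)).
Definition normoo (a : E -> R) : R := fine ('N[mu]_+oo[EFin \o a])%E.
Definition norm1 (h : E -> R) : R := fine ('N[mu]_1[EFin \o h])%E.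

Definition inv_ball_volume : R :=
  Gamma (1 + N%:R / 2) / pi `^ (N%:R / 2).

Definition k_ (p : R) (a : E -> R) : R :=
  (1 / essinf a) `^ ((p - N%:R) / p ^+ 2) * 2 `^ ((p - 1) / p)
  * inv_ball_volume `^ (1 / p) * (1 / N%:R `^ (N%:R / p ^+ 2))
  * ((p - 1) / (p - N%:R)) `^ (N%:R * (p - 1) / p ^+ 2).

Definition K_ (p : R) (a : E -> R) (r : R) : R :=
  1 / k_ p a `^ p * inv_ball_volume
  * (r `^ (p - N%:R) / (2 `^ p - 2 `^ (p - N%:R) + r `^ p * normoo a)).

Definition Ktilde (p : R) (a h : E -> R) (x0 : E) (r : R) : R :=
  K_ p a r * (\int[mu]_(x in eball x0 (r / 2)) h x / norm1 h).

(* x / y for x > 0 and y >= 0, with the convention x / 0 = +oo. *)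
Definition quotoo (x y : R) : \bar R := if y == 0 then +oo%E else (x / y)%:E.

Definition lambda1 (p : R) (a h : E -> R) (g : R -> R) (x0 : E) (r d : R) : R :=
  3 / 2 * (1 / (p * k_ p a `^ p * norm1 h * Ktilde p a h x0 r))
  * (d `^ p / primitive g d).

Definition lambda2 (p : R) (a h : E -> R) (g : R -> R) (c1 c2 : R) : \bar R :=
  Order.min
    ((1 / (p * k_ p a `^ p * norm1 h))%:E * quotoo (c1 `^ p) (primitive g c1))%E
    (1 / (2 * p * k_ p a `^ p * norm1 h) * (c2 `^ p / primitive g c2))%:E.

End constants.
Arguments inv_ball_volume : clear implicits.

(* Main.v *)
Require Import Defs.
From HB Require Import structures.
From mathcomp Require Import all_boot all_order all_algebra.
From mathcomp Require Import all_classical all_reals all_analysis.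
From mathcomp Require Import ess_sup_inf.
From mathcomp Require Import measurable_realfun.
From mathcomp Require Import ring lra.

Set Implicit Arguments.
Unset Strict Implicit.
Unset Printing Implicit Defensive.

Import Order.TTheory GRing.Theory Num.Theory.
Import numFieldNormedType.Exports.

Local Open Scope classical_set_scope.
Local Open Scope ring_scope.

(* A solution is a critical point of J(u) = q(u)/p - lambda * int h G(u), where q(u) = ||u||^p.
   Morrey's inequality, with explicit constants and an optimal radius, gives the
   embedding |u| <= k_a ||u||. As G may be modified beyond c2, the reaction term is taken
   bounded and uniformly continuous; it is then compact.

   On the sphere q/p = r1 := c1^p/(p k_a^p) we have |u| <= c1, so that J >= m > 0 there,
   while J < m at 0, inside the sphere, and at the tent function of height d, which lies
   outside. Let A u minimize q/p minus the linearized reaction term at u; short steps from u towards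
   A u decrease J continuously. They preserve both components of {J < m} separated by the sphere;
   the orbits of 0 and of the tent yield one critical point in each, and
   a point of the segment [0, tent] whose orbit never enters {J < m} yields a third one.
   All levels are at most q(tent)/p, hence the three points satisfy ||u|| < c2/k_a
   and the truncation of g is invisible. *)

(** * A three critical points theorem *)

(** As [g] is only continuous, the derivative of [J] need not be Lipschitz and offers no well-posed
    gradient flow; hence discrete steps, whose length vanishes where the convexity defect of [q]
    between [u] and [A u] is small. Orbits need not converge: they only reach points of small
    defect, and compactness of the reaction term produces a critical point as the threshold tends to
    0. The constants 1/3 and 1/2 of the hypotheses fit an energy budget. Write rho for c2^p/(p
    k_a^p). Hypothesis (iii) puts the energy of the tent, divided by p, below rho/3; the second
    bound on lambda keeps lambda times the integral of h G(c2) below rho/2; the cutoff of g beyond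
    c2 is made narrow enough to add at most rho/6. As q/p is J plus the reaction potential, it is
    below rho at every critical point obtained. The sign of the solutions comes from testing with
    min(u, 0)^2. This requires a chain rule for weak gradients, proved through difference quotients;
    the same device gives the gradient of the tent. *)

Section descent.
Variables (R : realType) (V : lmodType R) (W : V -> Prop) (q : V -> R) (p : R).
Variables (T : V -> V -> R) (Ps : V -> R) (M M2 : R).

Let nm w := q w `^ p^-1.
(** The convexity defect of [q] at the midpoint. Applied below to [u] and its argmin [A u], it
    measures how far [u] is from being critical. *)
Let gap u v := (q u + q v) / 2 - q (2^-1 *: (u + v)).

Hypothesis p_gt1 : 1 < p.
Hypothesis W0 : W 0.
Hypothesis WL : forall (t : R) u v, W u -> W v -> W (t *: u + v).
Hypothesis q_ge0 : forall u, 0 <= q u.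
Hypothesis qZ : forall (t : R) u, W u -> q (t *: u) = `|t| `^ p * q u.
Hypothesis q_cvx : forall u v (t : R), W u -> W v -> 0 <= t -> t <= 1 ->
  q ((1 - t) *: u + t *: v) <= (1 - t) * q u + t * q v.
(** Uniform convexity in a form that covers all exponents [p > 1] alike: the first term is absorbed
    on sets where [q] is bounded, so there a small [gap] forces a small [q (u - v)]. *)
Hypothesis q_ucvx : forall e : R, 0 < e -> exists2 C : R, 0 < C &
  forall u v, W u -> W v -> q (u - v) <= e * (q u + q v) + C * gap u v.
Hypothesis q_complete : forall s : nat -> V, (forall n, W (s n)) ->
  (forall e : R, 0 < e -> exists K, forall m n, (K <= m)%N -> (K <= n)%N ->
     q (s m - s n) <= e) ->
  exists2 u, W u & forall e : R, 0 < e -> exists K, forall n, (K <= n)%N ->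
     q (u - s n) <= e.
Hypothesis M_ge0 : 0 <= M.
(** [T u] plays the derivative of [Ps] at [u]. The moduli in [T_ucont] and [Ps_diff] are uniform in
    the base point; the latter gives one step size for a whole sublevel set. *)
Hypothesis TL : forall u (t : R) v w, W u -> W v -> W w ->
  T u (t *: v + w) = t * T u v + T u w.
Hypothesis T_bnd : forall u w, W u -> W w -> `|T u w| <= M * nm w.
Hypothesis T_ucont : forall e : R, 0 < e -> exists2 dl : R, 0 < dl &
  forall u u' w, W u -> W u' -> W w -> q (u - u') <= dl ->
    `|T u w - T u' w| <= e * nm w.
Hypothesis Ps_diff : forall e : R, 0 < e -> exists2 dl : R, 0 < dl &
  forall u w, W u -> W w -> q w <= dl ->
    `|Ps (u + w) - Ps u - T u w| <= e * nm w.
Hypothesis Ps_bnd : forall u, W u -> Ps u <= M2.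
(** Compactness is asked of [T] only: along a subsequence the functionals [T (s n)] are Cauchy for
    the dual norm. *)
Hypothesis T_compact : forall (s : nat -> V) (B : R), (forall n, W (s n)) ->
  (forall n, q (s n) <= B) ->
  exists2 phi : nat -> nat, (forall n, (n <= phi n)%N) &
  forall e : R, 0 < e -> exists K, forall i j, (K <= i)%N -> (K <= j)%N ->
    forall w, W w -> `|T (s (phi i)) w - T (s (phi j)) w| <= e * nm w.

Let J u := q u / p - Ps u.
(** The reaction term is frozen at [u]. A critical point of [J] is a [w] that minimizes the convex
    and coercive functional [E w]. *)
Let E u w := q w / p - T u w.

Let p_gt0 : 0 < p. Proof. by apply: lt_trans p_gt1. Qed.
Let p_neq0 : p != 0. Proof. by rewrite gt_eqF. Qed.

Let WZ t u : W u -> W (t *: u).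
Proof. by move=> Wu; rewrite -[_ *: _]addr0; exact: WL. Qed.
Let WD u v : W u -> W v -> W (u + v).
Proof. by move=> Wu Wv; rewrite -[u]scale1r; exact: WL. Qed.
Let WB u v : W u -> W v -> W (u - v).
Proof. by move=> Wu Wv; rewrite -scaleN1r; apply: WD => //; exact: WZ. Qed.

Let q0 : q 0 = 0.
Proof. by have := qZ 0 W0; rewrite scale0r normr0 powR0// mul0r. Qed.
Let qN u : W u -> q (- u) = q u.
Proof. by move=> Wu; rewrite -scaleN1r qZ// normrN normr1 powR1 mul1r. Qed.
Let qC u v : W u -> W v -> q (u - v) = q (v - u).
Proof. by move=> Wu Wv; rewrite -qN ?opprB//; exact: WB. Qed.
Let nm_ge0 w : 0 <= nm w. Proof. exact: powR_ge0. Qed.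
Let nmZ t w : W w -> nm (t *: w) = `|t| * nm w.
Proof.
move=> Ww; rewrite /nm qZ// powRM ?powR_ge0// -powRrM mulfV// powRr1//.
Qed.
Let nm_q w : nm w `^ p = q w.
Proof. by rewrite /nm -powRrM mulVf// powRr1. Qed.
Let nm_le w (B : R) : q w <= B -> nm w <= B `^ p^-1.
Proof. by move=> H; apply: ge0_ler_powR; rewrite ?nnegrE ?invr_ge0 ?(ltW p_gt0)// (le_trans (q_ge0 w)). Qed.
Let nm_small (e : R) : 0 < e -> exists2 dl : R, 0 < dl & forall w, q w <= dl -> nm w <= e.
Proof.
move=> e0; exists (e `^ p); first exact: powR_gt0.
by move=> w /nm_le; rewrite -powRrM mulfV// powRr1// ltW.
Qed.

Let T0 u : W u -> T u 0 = 0.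
Proof. by move=> Wu; have := TL 1 Wu W0 W0; rewrite scaler0 addr0; lra. Qed.
Let TZ u t v : W u -> W v -> T u (t *: v) = t * T u v.
Proof. by move=> Wu Wv; rewrite -[_ *: _]addr0 TL// T0// addr0. Qed.
Let TD u v w : W u -> W v -> W w -> T u (v + w) = T u v + T u w.
Proof. by move=> Wu Wv Ww; rewrite -[v]scale1r TL// mul1r scale1r. Qed.
Let TB u v w : W u -> W v -> W w -> T u (v - w) = T u v - T u w.
Proof. by move=> Wu Wv Ww; rewrite addrC -scaleN1r TL// mulN1r addrC. Qed.

(** The triangle inequality for [nm] is not among the hypotheses; [qD], which follows from convexity
    and homogeneity, takes its place with this constant. *)
Let C0 := 2 `^ p.
Let C0_gt0 : 0 < C0. Proof. exact: powR_gt0. Qed.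
Let C0_ge1 : 1 <= C0.
Proof. by rewrite -[1](@powRr0 R 2); apply: ler_powR; [lra|exact: ltW]. Qed.

Let qD u v : W u -> W v -> q (u + v) <= C0 * (q u + q v).
Proof.
move=> Wu Wv.
have -> : u + v = 2 *: ((1 - 2^-1) *: u + 2^-1 *: v).
  have -> : (1 - 2^-1 : R) = 2^-1 by lra.
  by rewrite -scalerDr scalerA mulfV// scale1r.
rewrite qZ; last by apply: WD; exact: WZ.
rewrite normr_nat ler_pM2l//.
apply: le_trans (q_cvx Wu Wv _ _) _; [lra|lra|].
by have := q_ge0 u; have := q_ge0 v; lra.
Qed.

Let qB3 u v w : W u -> W v -> W w -> q (u - w) <= C0 * (q (u - v) + q (v - w)).
Proof.
move=> Wu Wv Ww; have -> : u - w = (u - v) + (v - w) by rewrite addrA subrK.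
by apply: qD; exact: WB.
Qed.

(** With [v] written as [(1 - t) u + t (u + t^-1 (v - u))] for a small fixed [t], convexity bounds
    the increase of [q] by a small multiple of [q u] plus a large multiple of [q (u - v)].
    Exchanging [u] and [v] gives the continuity in [q_cont]. *)
Let q_usc (B e : R) : 0 <= B -> 0 < e -> exists2 dl : R, 0 < dl & forall u v, W u -> W v -> q u <= B ->
  q (u - v) <= dl -> q v <= q u + e.
Proof.
move=> B0 e0; pose t := Num.min 1 (e / 2 / (C0 * (B + 1))).
have t0 : 0 < t by rewrite lt_min ltr01 divr_gt0 ?divr_gt0 ?mulr_gt0//; lra.
have t1 : t <= 1 by rewrite ge_min lexx.
have tB : t * (C0 * B) <= e / 2.
  have : t <= e / 2 / (C0 * (B + 1)) by rewrite ge_min lexx orbT.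
  rewrite ler_pdivlMr; last by rewrite mulr_gt0//; lra.
  apply: le_trans; rewrite ler_pM2l// ler_pM2l//; lra.
exists (e / 2 / (t * (C0 * (t^-1) `^ p))).
  by rewrite divr_gt0 ?divr_gt0 ?mulr_gt0 ?powR_gt0 ?invr_gt0.
move=> u v Wu Wv uB; rewrite ler_pdivlMr ?mulr_gt0 ?powR_gt0 ?invr_gt0// => H.
have -> : v = (1 - t) *: u + t *: (u + t^-1 *: (v - u)).
  rewrite scalerDr scalerA mulfV ?gt_eqF// scale1r addrA -scalerDl subrK scale1r.
  by rewrite addrC subrK.
have Wv' := WZ t^-1 (WB Wv Wu).
apply: le_trans (q_cvx Wu (WD Wu Wv') (ltW t0) t1) _.
have H1 := qD Wu Wv'.
rewrite qZ ?(ger0_norm) ?invr_ge0 ?(ltW t0)// in H1; last exact: WB.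
rewrite (qC Wv Wu) in H1.
have H2 := ler_wpM2l (ltW t0) H1.
have H3 : t * (C0 * q u) <= e / 2.
  by apply: le_trans tB; rewrite ler_pM2l// ler_pM2l.
have H4 := mulr_ge0 (ltW t0) (q_ge0 u).
by nra.
Qed.

Let q_cont (B e : R) : 0 <= B -> 0 < e -> exists2 dl : R, 0 < dl & forall u v, W u -> W v ->
  q u <= B -> q (u - v) <= dl -> `|q u - q v| <= e.
Proof.
move=> B0 e0; have [d1 d10 H1] := q_usc B0 e0.
have B'0 : 0 <= C0 * (B + 1) by rewrite mulr_ge0 ?ltW//; lra.
have [d2 d20 H2] := q_usc B'0 e0.
exists (Num.min 1 (Num.min d1 d2)); first by rewrite !lt_min ltr01 d10.
move=> u v Wu Wv uB; rewrite !le_min => /and3P[h1 h2 h3].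
have vB : q v <= C0 * (B + 1).
  have -> : v = u + (v - u) by rewrite addrC subrK.
  apply: le_trans (qD Wu (WB Wv Wu)) _.
  by rewrite ler_pM2l// qC//; lra.
rewrite ler_norml; have := H1 _ _ Wu Wv uB h2.
rewrite qC// in h3; have := H2 _ _ Wv Wu vB h3; lra.
Qed.

(** As [p > 1], the linear term is at most [q w / (2 p)] once [nm w] exceeds the threshold [X];
    below it, [q w] is at most the p-th power of [X]. *)
Let coercive (L : R) : exists2 B : R, 0 <= B & forall w, q w / p <= L + M * nm w -> q w <= B.
Proof.
pose X := (2 * p * M) `^ (p - 1)^-1.
exists (X `^ p + 2 * p * `|L|); first by rewrite addr_ge0 ?powR_ge0 ?mulr_ge0// ltW.
move=> w H; have qw := q_ge0 w; case: (leP (nm w) X) => hX.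
  have : q w <= X `^ p.
    by rewrite -nm_q; apply: ge0_ler_powR => //; rewrite ?nnegrE ?powR_ge0 ?ltW.
  have : 0 <= 2 * p * `|L| by rewrite mulr_ge0// mulr_ge0// ltW.
  lra.
have nm0 : 0 < nm w by apply: le_lt_trans hX; exact: powR_ge0.
have : 2 * p * M <= nm w `^ (p - 1).
  have -> : 2 * p * M = X `^ (p - 1).
    rewrite /X -powRrM mulVf ?powRr1//; last by rewrite subr_eq0 gt_eqF.
    by rewrite !mulr_ge0// ltW.
  by apply: ge0_ler_powR; rewrite ?nnegrE;
    [rewrite subr_ge0 ltW|exact: powR_ge0|exact: nm_ge0|exact: ltW].
move/(ler_wpM2l (ltW nm0)).
have -> : nm w * nm w `^ (p - 1) = q w.
  rewrite -nm_q -[X in X * _](powRr1 (nm_ge0 w)) -powRD; first by congr (_ `^ _); lra.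
  by apply/implyP => _; exact: lt0r_neq0.
move=> H1.
have := ler_wpM2l (ltW p_gt0) (ler_norm L); have := powR_ge0 X p.
move: H; rewrite ler_pdivrMr// => H.
lra.
Qed.

(** The linear functional [T u] has no convexity defect, so that of [E u] is [gap / p]. *)
Let gap_le_E u w w' : W u -> W w -> W w' ->
  E u (2^-1 *: (w + w')) = (E u w + E u w') / 2 - gap w w' / p.
Proof.
move=> Wu Ww Ww'; rewrite /E /gap TZ//; last exact: WD.
by rewrite TD//; lra.
Qed.

Let E_lb u : W u -> exists m : R, forall w, W w -> m <= E u w.
Proof.
move=> Wu; have [B B0 H] := coercive 0.
exists (- (M * B `^ p^-1)) => w Ww; rewrite /E.
have := T_bnd Wu Ww; rewrite ler_norml => /andP[_ h].
have qp : 0 <= q w / p by rewrite divr_ge0// ltW.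
have [h1|/ltW h1] := leP (q w / p) (0 + M * nm w).
  have := ler_wpM2l M_ge0 (nm_le (H _ h1)); lra.
have := mulr_ge0 M_ge0 (powR_ge0 B p^-1); lra.
Qed.

(** A minimizing sequence is Cauchy: midpoints cannot go below the infimum, so the gaps tend to 0 by
    [gap_le_E], and uniform convexity applies. Completeness thus replaces weak compactness. *)
Let min_ex u : W u -> exists2 w, W w & forall v, W v -> E u w <= E u v.
Proof.
move=> Wu; pose S := [set E u w | w in W].
have [m0 m0P] := E_lb Wu.
have hS : has_inf S.
  split; first by exists (E u 0); exists 0.
  by exists m0 => _ [w Ww <-]; exact: m0P.
pose m := inf S.
have mP w : W w -> m <= E u w.
  by move=> Ww; apply: ge_inf; [case: hS|exists w].
have /choice[s sP] : forall n, exists w, W w /\ E u w < m + n.+1%:R^-1.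
  move=> n.
  have n0 : (0 : R) < n.+1%:R^-1 by rewrite invr_gt0.
  by have [_ [w Ww <-] h] := inf_adherent n0 hS; exists w.
have sW n := (sP n).1.
have [B B0 HB] := coercive (m + 1).
have sB n : q (s n) <= B.
  apply: HB; have [Wn hn] := sP n.
  have : (n.+1%:R^-1 : R) <= 1 by rewrite invf_le1// ler1n.
  have := T_bnd Wu Wn; rewrite ler_norml => /andP[_ h].
  by move: hn; rewrite /E; move: (n.+1%:R^-1) => z; lra.
have s_cauchy (e : R) : 0 < e -> exists K, forall i j, (K <= i)%N -> (K <= j)%N -> q (s i - s j) <= e.
  move=> e0; have e'0 : 0 < e / (2 * (2 * B + 1)) by rewrite divr_gt0//; lra.
  have [C C0' HC] := q_ucvx e'0.
  have [K HK] : exists K : nat, (K.+1%:R^-1 : R) <= e / (2 * C * p).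
    have [K /ltW HK] := ltr_add_invr (divr_gt0 e0 (mulr_gt0 (mulr_gt0 (ltr0n _ 2) C0') p_gt0)).
    by exists K; move: HK; rewrite add0r.
  exists K => i j Ki Kj; apply: le_trans (HC _ _ (sW i) (sW j)) _.
  have h1 : e / (2 * (2 * B + 1)) * (q (s i) + q (s j)) <= e / 2.
    rewrite mulrAC ler_pdivrMr; last by lra.
    have := sB i; have := sB j; have := q_ge0 (s i); have := q_ge0 (s j); nra.
  have h2 : gap (s i) (s j) / p <= K.+1%:R^-1.
    have := gap_le_E Wu (sW i) (sW j).
    have := mP _ (WZ 2^-1 (WD (sW i) (sW j))).
    have hi : E u (s i) < m + K.+1%:R^-1.
      by apply: lt_le_trans (sP i).2 _; rewrite lerD2l lef_pV2 ?posrE// ler_nat ltnS.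
    have hj : E u (s j) < m + K.+1%:R^-1.
      by apply: lt_le_trans (sP j).2 _; rewrite lerD2l lef_pV2 ?posrE// ler_nat ltnS.
    move: hi hj; move: (K.+1%:R^-1) => z; lra.
  have h3 : C * gap (s i) (s j) <= e / 2.
    have -> : e / 2 = C * (e / (2 * C * p) * p).
      by field; rewrite p_neq0 gt_eqF.
    rewrite ler_pM2l//.
    by move: (le_trans h2 HK); rewrite ler_pdivrMr.
  lra.
have [w Ww wP] := q_complete sW s_cauchy.
exists w => // v Wv; apply: le_trans (mP _ Wv).
rewrite -[leRHS]addr0; apply/ler_addgt0Pr => e e0.
have e3 : 0 < e / 3 by lra.
have M1 : 0 < e / 3 / (M + 1) by rewrite divr_gt0// ltr_wpDl.
have [d1 d10 H1] := q_cont B0 (mulr_gt0 e3 p_gt0).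
have [d2 d20 H2] := nm_small M1.
have d120 : 0 < Num.min d1 d2 by rewrite lt_min d10.
have [K HK] := wP _ d120.
have [K2 HK2] := ltr_add_invr e3.
pose n := maxn K K2.
have := HK n (leq_maxl _ _); rewrite le_min => /andP[h1 h2].
have a1 := H1 _ _ (sW n) Ww (sB n); rewrite qC// in a1; have {}a1 := a1 h1.
have a2 := H2 _ h2.
have a3 : E u (s n) < m + e / 3.
  apply: lt_trans (sP n).2 _; rewrite ltrD2l; apply: le_lt_trans (_ : K2.+1%:R^-1 < _).
    by rewrite lef_pV2 ?posrE// ler_nat ltnS leq_maxr.
  by move: HK2; rewrite add0r.
have a4 := T_bnd Wu (WB Ww (sW n)); rewrite TB// in a4.
have a5 : M * nm (w - s n) <= e / 3.
  apply: le_trans (ler_wpM2l M_ge0 a2) _.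
  rewrite mulrA ler_pdivrMr ?ltr_wpDl// mulrC ler_wpM2l//; last by rewrite lerDl.
  by rewrite divr_ge0// ltW.
move: a1; rewrite ler_norml => /andP[a1 _].
have a6 : q w / p <= q (s n) / p + e / 3.
  by rewrite ler_pdivrMr// mulrDl divfK//; lra.
move: a4; rewrite ler_norml => /andP[a4 _].
move: a3; rewrite /E addr0; lra.
Qed.

Section argmin.
Variable A : V -> V.
Hypothesis AW : forall u, W u -> W (A u).
Hypothesis A_min : forall u v, W u -> W v -> E u (A u) <= E u v.

Let A_bnd : exists2 B : R, 0 <= B & forall u, W u -> q (A u) <= B.
Proof.
have [B B0 H] := coercive 0; exists B => // u Wu; apply: H.
have := A_min Wu W0; have := T_bnd Wu (AW Wu); rewrite ler_norml => /andP[_ h].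
by rewrite /E q0 T0//; lra.
Qed.

(** [A u] depends on [u] through the functional [T u] alone, and continuously so. Both minimalities
    are tested at the common midpoint of [A u] and [A u'] and added: the energies cancel and leave
    [gap / p] at most a quarter of [T u - T u'] evaluated at [A u - A u']. *)
Let A_dep (e : R) : 0 < e -> exists2 eta : R, 0 < eta & forall u u', W u -> W u' ->
  (forall w, W w -> `|T u w - T u' w| <= eta * nm w) -> q (A u - A u') <= e.
Proof.
move=> e0; have [B B0 HB] := A_bnd.
have e'0 : 0 < e / (2 * (2 * B + 1)) by rewrite divr_gt0//; lra.
have [C C0' HC] := q_ucvx e'0.
pose D := (C0 * (2 * B)) `^ p^-1.
have D0 : 0 <= D by exact: powR_ge0.
exists (2 * e / (C * p * (D + 1))).
  by rewrite divr_gt0 ?mulr_gt0//; lra.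
move=> u u' Wu Wu' H; have [Wa Wa'] := (AW Wu, AW Wu').
apply: le_trans (HC _ _ Wa Wa') _.
have h1 : e / (2 * (2 * B + 1)) * (q (A u) + q (A u')) <= e / 2.
  rewrite mulrAC ler_pdivrMr; last by lra.
  have := HB _ Wu; have := HB _ Wu'; have := q_ge0 (A u); have := q_ge0 (A u'); nra.
have mid := WZ 2^-1 (WD Wa Wa').
have m1 := A_min Wu mid; have m2 := A_min Wu' mid.
rewrite !gap_le_E// in m1 m2.
have h2 := H _ (WB Wa Wa'); rewrite !TB// in h2.
move: h2; rewrite ler_norml => /andP[_ h2].
have h3 : nm (A u - A u') <= D.
  apply: nm_le; apply: le_trans (qD Wa (_ : W (- A u'))) _.
    by rewrite -scaleN1r; exact: WZ.
  by rewrite qN// ler_pM2l//; have := HB _ Wu; have := HB _ Wu'; lra.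
have h4 : gap (A u) (A u') / p <= (2 * e / (C * p * (D + 1)) * nm (A u - A u')) / 4.
  by move: m1 m2 h2; rewrite /E; lra.
have h5 : 2 * e / (C * p * (D + 1)) * nm (A u - A u') <= 2 * e / (C * p).
  have -> : 2 * e / (C * p * (D + 1)) = 2 * e / (C * p) / (D + 1).
    by field; rewrite p_neq0 !gt_eqF//; lra.
  rewrite mulrAC ler_pdivrMr; last by lra.
  rewrite ler_wpM2l//; last by lra.
  by rewrite divr_ge0// ?mulr_ge0// ltW.
have h6 : C * gap (A u) (A u') <= e / 2.
  have h7 : gap (A u) (A u') / p <= 2 * e / (C * p) / 4 by lra.
  move: h7; rewrite ler_pdivrMr// => h7.
  have -> : e / 2 = C * (2 * e / (C * p) / 4 * p) by field; rewrite p_neq0 gt_eqF.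
  by rewrite ler_pM2l.
lra.
Qed.

Let A_cont (e : R) : 0 < e -> exists2 dl : R, 0 < dl & forall u u', W u -> W u' ->
  q (u - u') <= dl -> q (A u - A u') <= e.
Proof.
move=> e0; have [eta eta0 H] := A_dep e0.
have [dl dl0 Hd] := T_ucont eta0.
by exists dl => // u u' Wu Wu' h; apply: H => // w Ww; exact: Hd.
Qed.

Let J_cont u (e : R) : W u -> 0 < e -> exists2 dl : R, 0 < dl & forall v, W v -> q (u - v) <= dl ->
  `|J u - J v| <= e.
Proof.
move=> Wu e0; have e3 : 0 < e / 3 by lra.
have [d1 d10 H1] := q_cont (q_ge0 u) (mulr_gt0 e3 p_gt0).
have [d2 d20 H2] := Ps_diff (ltr01 : 0 < 1 :> R).
have M1 : 0 < e / 3 / (M + 1) by rewrite divr_gt0// ltr_wpDl.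
have [d3 d30 H3] := nm_small M1.
exists (Num.min d1 (Num.min d2 d3)); first by rewrite !lt_min d10 d20.
move=> v Wv; rewrite !le_min => /and3P[h1 h2 h3].
have a1 := H1 _ _ Wu Wv (lexx _) h1.
rewrite qC// in h2 h3.
have Wvu := WB Wv Wu.
have a2 := H2 _ _ Wu Wvu h2.
have a3 := H3 _ h3.
have a4 := T_bnd Wu Wvu.
have a5 : (M + 1) * nm (v - u) <= e / 3.
  by rewrite mulrC -ler_pdivlMr// ltr_wpDl.
have vE : u + (v - u) = v by rewrite addrC subrK.
rewrite vE in a2.
have a6 : `|q u / p - q v / p| <= e / 3.
  by rewrite -mulrBl normrM (gtr0_norm (_ : 0 < p^-1)) ?invr_gt0// ler_pdivrMr.
move: a2 a4 a6; rewrite /J !ler_norml => /andP[? ?] /andP[? ?] /andP[? ?].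
lra.
Qed.

Let pw_le1 (x : R) : 0 <= x -> x <= 1 -> `|x| `^ p <= 1.
Proof.
move=> x0 x1; rewrite ger0_norm//; apply: le_trans (_ : 1 `^ p <= 1); last by rewrite powR1.
by apply: ge0_ler_powR; rewrite ?nnegrE// ltW.
Qed.

Let gap_cont u u' (e : R) : W u -> W u' -> 0 < e -> exists2 dl : R, 0 < dl & forall v v', W v -> W v' ->
  q (u - v) <= dl -> q (u' - v') <= dl -> `|gap u u' - gap v v'| <= e.
Proof.
move=> Wu Wu' e0; have e2 : 0 < e / 2 by lra.
have [d1 d10 H1] := q_cont (q_ge0 u) e2.
have [d2 d20 H2] := q_cont (q_ge0 u') e2.
have [d3 d30 H3] := q_cont (q_ge0 (2^-1 *: (u + u'))) e2.
have d4 : 0 < d3 / C0 / 2 by rewrite !divr_gt0.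
exists (Num.min d1 (Num.min d2 (d3 / C0 / 2))); first by rewrite !lt_min d10 d20.
move=> v v' Wv Wv'; rewrite !le_min => /and3P[h1 _ h3] /and3P[_ h2 h4].
have a1 := H1 _ _ Wu Wv (lexx _) h1.
have a2 := H2 _ _ Wu' Wv' (lexx _) h2.
have mu := WZ 2^-1 (WD Wu Wu'). have mv := WZ 2^-1 (WD Wv Wv').
have a3 : q (2^-1 *: (u + u') - 2^-1 *: (v + v')) <= d3.
  rewrite -scalerBr opprD addrACA qZ; last by apply: WD; exact: WB.
  have a4 := qD (WB Wu Wv) (WB Wu' Wv').
  have : C0 * (q (u - v) + q (u' - v')) <= d3.
    rewrite mulrC -ler_pdivlMr//; lra.
  have : `|2^-1 : R| `^ p <= 1.
    by apply: pw_le1; rewrite ?invr_ge0 ?invf_le1 ?ler1n.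
  have := powR_ge0 `|2^-1 : R| p; have := q_ge0 (u - v + (u' - v')); nra.
have a5 := H3 _ _ mu mv (lexx _) a3.
move: a1 a2 a5; rewrite /gap !ler_norml => /andP[? ?] /andP[? ?] /andP[? ?].
apply/andP; split; lra.
Qed.

(** Along the segment [q] lies below its chord and [Ps] follows its linear part up to [e]. The
    resulting slope is [E u (A u) - E u u], and minimality of [A u], tested at the midpoint of [u]
    and [A u], makes it at most [- (2 / p) * gap u (A u)]. *)
Let step u s e dl : W u -> 0 <= s -> s <= 1 -> 0 <= e ->
  (forall u w, W u -> W w -> q w <= dl -> `|Ps (u + w) - Ps u - T u w| <= e * nm w) ->
  q (s *: (A u - u)) <= dl ->
  J (u + s *: (A u - u)) <= J u - s * (2 / p * gap u (A u) - e * nm (A u - u)).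
Proof.
move=> Wu s0 s1 e0 H qs; have Wa := AW Wu; have Wd := WB Wa Wu.
have h1 := H _ _ Wu (WZ s Wd) qs.
rewrite TZ// TB// nmZ// (ger0_norm s0) ler_norml in h1; case/andP: h1 => h1 _.
have h2 : q (u + s *: (A u - u)) <= (1 - s) * q u + s * q (A u).
  have -> : u + s *: (A u - u) = (1 - s) *: u + s *: A u.
    by rewrite scalerBr scalerBl scale1r addrCA [RHS]addrC.
  exact: q_cvx.
have h3 : E u (A u) <= E u u - 2 / p * gap u (A u).
  have h := A_min Wu (WZ 2^-1 (WD Wu Wa)).
  rewrite gap_le_E// in h; move: h.
  rewrite mulrAC -mulrA; lra.
have h4 : q (u + s *: (A u - u)) / p <= (1 - s) * (q u / p) + s * (q (A u) / p).
  by rewrite ler_pdivrMr//; apply: le_trans h2 _; rewrite le_eqVlt; apply/orP; left; apply/eqP; field.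
have h5 := ler_wpM2l s0 h3.
move: h5; rewrite /J /E.
move: h1 h4; lra.
Qed.

(** * The descent flow on a sublevel set *)

Section flow.
Variables (L eps : R).
Hypothesis eps0 : 0 < eps.

Let low u := W u /\ J u <= L.

Lemma low_bnd : exists2 B : R, 0 <= B & forall u, low u -> q u <= B.
Proof.
exists (p * (`|L| + `|M2|)); first by rewrite mulr_ge0 ?(ltW p_gt0)// addr_ge0.
move=> u [Wu]; rewrite /J => h; have := Ps_bnd Wu.
have := ler_norm L; have := ler_norm M2 => ? ? ?.
have : q u / p <= `|L| + `|M2| by lra.
by rewrite ler_pdivrMr// mulrC.
Qed.

(** The sublevel set [J <= L] is bounded in [q] because [Ps] is bounded above, and the range of [A]
    is bounded too; as the modulus in [Ps_diff] does not depend on [u], one step size serves the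
    whole sublevel set. *)
Lemma step_size : exists2 tau : R, 0 < tau <= 1 &
  forall u s, low u -> 0 <= s -> s <= tau ->
   J (u + s *: (A u - u)) <= J u - s * (2 / p * gap u (A u) - eps / p).
Proof.
have [B B0 HB] := low_bnd; have [B' B'0 HB'] := A_bnd.
pose D := C0 * (B' + B); have D0 : 0 <= D by rewrite mulr_ge0 ?addr_ge0// ltW.
have HD u : low u -> q (A u - u) <= D.
  move=> lu; have [Wu _] := lu; apply: le_trans (qD (AW Wu) (_ : W (- u))) _.
    by rewrite -scaleN1r; exact: WZ.
  by rewrite qN// ler_pM2l// lerD// ?HB'// HB.
pose e := eps / p / (D `^ p^-1 + 1).
have De0 : 0 < D `^ p^-1 + 1 by rewrite ltr_wpDl// powR_ge0.
have e0 : 0 < e by rewrite !divr_gt0.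
have [dl dl0 Hd] := Ps_diff e0.
(* This keeps [q (s *: (A u - u))], which is the p-th power of [s] times a quantity at most [D],
   within the radius [dl] of the expansion. *)
pose tau := Num.min 1 ((dl / (D + 1)) `^ p^-1).
have D1 : 0 < D + 1 by rewrite ltr_wpDl.
have tau0 : 0 < tau by rewrite lt_min ltr01 powR_gt0// divr_gt0.
exists tau; first by rewrite tau0 ge_min lexx.
move=> u s lu s0 st; have [Wu _] := lu.
have s1 : s <= 1 by apply: le_trans st _; rewrite ge_min lexx.
apply: le_trans (step Wu s0 s1 (ltW e0) Hd _) _.
  rewrite qZ; last by apply: WB => //; exact: AW.
  rewrite ger0_norm//.
  have : s `^ p <= dl / (D + 1).
    have -> : dl / (D + 1) = (dl / (D + 1)) `^ p^-1 `^ p.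
      by rewrite -powRrM mulVf// powRr1// divr_ge0// ltW.
    apply: ge0_ler_powR; rewrite ?nnegrE ?powR_ge0 ?(ltW p_gt0)//.
    by apply: le_trans st _; rewrite ge_min lexx orbT.
  rewrite ler_pdivlMr// => h; apply: le_trans h.
  apply: ler_wpM2l; first exact: powR_ge0.
  by apply: le_trans (HD _ lu) _; rewrite lerDl.
rewrite lerD2l lerN2 ler_wpM2l// lerD2l lerN2.
rewrite /e mulrAC ler_pdivrMr// ler_wpM2l ?divr_ge0 ?(ltW eps0) ?(ltW p_gt0)//.
by apply: le_trans (nm_le (HD _ lu)) _; rewrite lerDl.
Qed.

Let clip_lip (a b : R) :
  `|Num.min 1 (Num.max 0 a) - Num.min 1 (Num.max 0 b)| <= `|a - b|.
Proof.
have H (x : R) : exists y, Num.min 1 (Num.max 0 x) = y /\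
    ((x <= 0 /\ y = 0) \/ (0 <= x <= 1 /\ y = x) \/ (1 <= x /\ y = 1)).
  have [x0|x0] := leP x 0.
    by exists 0; rewrite (min_idPr _)//; split=> //; left.
  have [x1|x1] := leP x 1.
    by exists x; split=> //; right; left; rewrite (ltW x0).
  by exists 1; split=> //; right; right; split=> //; exact: ltW.
have [y [-> hy]] := H a; have [z [-> hz]] := H b.
have := ler_norm (a - b); have := ler_norm (b - a); rewrite [`|b - a|]distrC ler_norml.
case: hy => [[? ->]|[[/andP[? ?] ->]|[? ->]]];
case: hz => [[? ->]|[[/andP[? ?] ->]|[? ->]]] => ? ?; apply/andP; split; lra.
Qed.

Variable tau : R.
Hypothesis tau01 : 0 < tau <= 1.
Hypothesis tauP : forall u s, low u -> 0 <= s -> s <= tau ->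
   J (u + s *: (A u - u)) <= J u - s * (2 / p * gap u (A u) - eps / p).

(* A step is taken only where the gap between [u] and [A u] is at least [eps];
   [F] is thus continuous, and the orbits of [F] reach points of small gap. *)
Let sg u := tau * Num.min 1 (Num.max 0 (gap u (A u) - eps)).
Let F u := u + sg u *: (A u - u).

Let tau0 : 0 < tau. Proof. by case/andP: tau01. Qed.
Let sg_ge0 u : 0 <= sg u.
Proof. by rewrite mulr_ge0 ?(ltW tau0)// le_min ler01 le_max lexx. Qed.
Let sg_le u : sg u <= tau.
Proof. by rewrite ger_pMr// ge_min lexx. Qed.

Let FW u : W u -> W (F u).
Proof. by move=> Wu; apply: WD => //; apply: WZ; apply: WB => //; exact: AW. Qed.

(** [J] stays below its initial value on the whole step and not merely at its end: this is what
    prevents a step from jumping over the sphere. *)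
Let J_seg u s : low u -> 0 <= s -> s <= sg u -> J (u + s *: (A u - u)) <= J u.
Proof.
move=> lu s0 ss; have := tauP lu s0 (le_trans ss (sg_le u)).
have [g|g] := leP (gap u (A u)) eps.
  have : s = 0.
    apply/eqP; rewrite eq_le s0 andbT; apply: le_trans ss _.
    rewrite /sg; have -> : Num.max 0 (gap u (A u) - eps) = 0.
      by apply/max_idPl; rewrite subr_le0.
    by rewrite (min_idPr _) ?mulr0.
  by move=> ->; rewrite mul0r subr0.
move/le_trans; apply; rewrite gerBl mulr_ge0// subr_ge0.
have -> : 2 / p * gap u (A u) = 2 * gap u (A u) / p by rewrite mulrAC.
rewrite ler_pM2r ?invr_gt0//; have := eps0; lra.
Qed.

Let F_low u : low u -> low (F u).
Proof.
move=> lu; split; first exact: FW lu.1.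
by apply: le_trans lu.2; apply: J_seg.
Qed.

Let F_dec u : low u -> 2 * eps <= gap u (A u) ->
  J (F u) <= J u - tau * Num.min 1 eps * (eps / p).
Proof.
move=> lu g; have := tauP lu (sg_ge0 u) (sg_le u) => /le_trans; apply.
rewrite lerD2l lerN2.
have h1 : tau * Num.min 1 eps <= sg u.
  rewrite ler_pM2l//; rewrite le_min ge_min lexx/= ge_min; apply/orP; right.
  by rewrite le_max; apply/orP; right; lra.
have h2 : eps / p <= 2 / p * gap u (A u) - eps / p.
  rewrite lerBrDr mulrAC -mulrDl ler_pM2r ?invr_gt0//; have := eps0; lra.
apply: ler_pM => //.
- by rewrite mulr_ge0 ?(ltW tau0)// le_min ler01 (ltW eps0).
- by rewrite divr_ge0 ?ltW.
Qed.

(** The modulus depends on [u] through [q (A u - u)]; continuity at each point is what the iterates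
    inherit and what the openness of the basins uses. *)
Let F_cont u e : W u -> 0 < e -> exists2 dl : R, 0 < dl & forall v, W v -> q (u - v) <= dl ->
  q (F u - F v) <= e.
Proof.
move=> Wu e0; have Wa := AW Wu.
pose k := e / C0 / C0 / 4; have k0 : 0 < k by rewrite !divr_gt0.
pose Q := q (A u - u).
have Q0 : 0 <= Q by exact: q_ge0.
have [d3 d30 H3] : exists2 d3 : R, 0 < d3 & forall x : R, `|x| <= d3 -> `|x| `^ p * Q <= k.
  exists ((k / (Q + 1)) `^ p^-1); first by rewrite powR_gt0// divr_gt0// ltr_wpDl.
  move=> x hx; have : `|x| `^ p <= k / (Q + 1).
    have -> : k / (Q + 1) = (k / (Q + 1)) `^ p^-1 `^ p.
      by rewrite -powRrM mulVf// powRr1// divr_ge0// ltW// ltr_wpDl.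
    by apply: ge0_ler_powR; rewrite ?nnegrE ?powR_ge0 ?(ltW p_gt0).
  rewrite ler_pdivlMr; last by rewrite ltr_wpDl.
  apply: le_trans; apply: ler_wpM2l; [exact: powR_ge0|by rewrite lerDl].
have [d1 d10 H1] := A_cont k0.
have [d2 d20 H2] := gap_cont Wu Wa d30.
have [d4 d40 H4] := A_cont d20.
exists (Num.min d1 (Num.min d2 (Num.min d4 k))); first by rewrite !lt_min d10 d20 d40.
move=> v Wv; rewrite !le_min => /and4P[h1 h2 h4 h5]; have Wa' := AW Wv.
have a1 := H1 _ _ Wu Wv h1.
have a2 := H2 _ _ Wv Wa' h2 (H4 _ _ Wu Wv h4).
have a3 : `|sg u - sg v| <= d3.
  rewrite /sg -mulrBr normrM gtr0_norm//.
  apply: le_trans (ler_piMl _ (_ : tau <= 1)) _ => //; first by case/andP: tau01.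
  apply: le_trans a2; apply: le_trans (clip_lip _ _) _.
  by rewrite opprB addrA subrK.
(* Three contributions: from the base points, from the targets, and from the lengths of the
   steps. *)
have -> : F u - F v = ((1 - sg v) *: (u - v) + sg v *: (A u - A v)) + (sg u - sg v) *: (A u - u).
  rewrite /F; move: (sg u) (sg v) (A u) (A v) => x y U V'.
  have -> : x *: (U - u) = y *: (U - u) + (x - y) *: (U - u).
    by rewrite -scalerDl addrCA subrr addr0.
  have key : y *: (U - u) - y *: (V' - v) = y *: (U - V') - y *: (u - v).
    by rewrite -!scalerBr; congr (_ *: _); rewrite !opprB [v - V']addrC addrACA [- u + v]addrC.
  rewrite opprD addrACA [_ + _ - y *: (V' - v)]addrAC key addrA; congr (_ + _).
  by rewrite [(1 - y) *: _]scalerBl scale1r -[in RHS]addrA [- _ + _]addrC.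
have y0 := sg_ge0 v; have y1 : sg v <= 1 by apply: le_trans (sg_le v) _; case/andP: tau01.
have b1 : q ((1 - sg v) *: (u - v)) <= k.
  rewrite qZ; last exact: WB.
  apply: le_trans (ler_piMl (q_ge0 _) (pw_le1 _ _)) _ => //; lra.
have b2 : q (sg v *: (A u - A v)) <= k.
  rewrite qZ; last exact: WB.
  by apply: le_trans (ler_piMl (q_ge0 _) (pw_le1 _ _)) _.
have b3 : q ((sg u - sg v) *: (A u - u)) <= k.
  by rewrite qZ; [exact: H3|exact: WB].
have Wd1 := WZ (1 - sg v) (WB Wu Wv); have Wd2 := WZ (sg v) (WB Wa Wa').
apply: le_trans (qD (WD Wd1 Wd2) (WZ _ (WB Wa Wu))) _.
have c1 := qD Wd1 Wd2.
have c2 : q ((1 - sg v) *: (u - v) + sg v *: (A u - A v)) <= C0 * (2 * k).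
  by apply: le_trans c1 _; rewrite ler_pM2l//; lra.
have c3 : k <= C0 * k by rewrite ler_peMl// ltW.
have -> : e = C0 * (C0 * (4 * k)) by rewrite /k; field; rewrite gt_eqF.
by rewrite ler_pM2l//; lra.
Qed.

Let iterW n u : W u -> W (iter n F u).
Proof. by move=> Wu; elim: n => //= n; exact: FW. Qed.

Let iter_low n u : low u -> low (iter n F u).
Proof. by move=> lu; elim: n => //= n; exact: F_low. Qed.

Let iter_cont n u e : W u -> 0 < e -> exists2 dl : R, 0 < dl & forall v, W v -> q (u - v) <= dl ->
  q (iter n F u - iter n F v) <= e.
Proof.
move=> Wu; elim: n e => [|n IH] e e0 /=; first by exists e.
have [d1 d10 H1] := F_cont (iterW n Wu) e0.
have [d2 d20 H2] := IH _ d10.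
by exists d2 => // v Wv h; apply: H1; [exact: iterW|exact: H2].
Qed.

(** While the defect is at least [2 * eps], each step lowers [J] by a fixed amount, and [J] is
    bounded below by [- M2]. *)
Let orbit_crit u : low u -> exists n, gap (iter n F u) (A (iter n F u)) <= 2 * eps.
Proof.
move=> lu; apply: contrapT => /forallNP H.
pose k := tau * Num.min 1 eps * (eps / p).
have k0 : 0 < k by rewrite !mulr_gt0// ?invr_gt0// lt_min ltr01 eps0.
have hJ n : J (iter n F u) <= J u - n%:R * k.
  elim: n => [|n IH] /=; first by rewrite mul0r subr0.
  apply: le_trans (F_dec (iter_low n lu) _) _.
    by have /negP := H n; rewrite -ltNge => /ltW.
  by rewrite -natr1 mulrDl mul1r -/k; lra.
have [n Hn] : exists n : nat, J u + M2 < n%:R * k.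
  exists (Num.bound `|(J u + M2) / k|).
  rewrite -ltr_pdivrMr//; apply: le_lt_trans (ler_norm _) _.
  exact/archi_boundP/normr_ge0.
have := hJ n; have Wn := iterW n lu.1; have := Ps_bnd Wn.
have : 0 <= q (iter n F u) / p by rewrite divr_ge0// ltW.
rewrite {1}/J; lra.
Qed.

Variables (r m : R) (v0 : V).
Hypothesis r0 : 0 < r.
Hypothesis mL : m <= L.
Hypothesis barrier : forall u, W u -> q u / p = r -> m <= J u.
Hypothesis Wv0 : W v0.
Hypothesis J0m : J 0 < m.
Hypothesis v0m : J v0 < m.
Hypothesis v0r : r < q v0 / p.
Hypothesis segL : forall s, 0 <= s -> s <= 1 -> J (s *: v0) <= L.

Let U1 u := [/\ W u, J u < m & q u / p < r].
Let U2 u := [/\ W u, J u < m & r < q u / p].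

Let ltm_low u : W u -> J u < m -> low u.
Proof. by move=> Wu h; split=> //; apply: le_trans mL; exact: ltW. Qed.

Let qp_cont u e : W u -> 0 < e -> exists2 dl : R, 0 < dl & forall v, W v -> q (u - v) <= dl ->
  `|q u / p - q v / p| <= e.
Proof.
move=> Wu e0; have [d d0 H] := q_cont (q_ge0 u) (mulr_gt0 e0 p_gt0).
exists d => // v Wv h; rewrite -mulrBl normrM [`|p^-1|]gtr0_norm ?invr_gt0//.
by rewrite ler_pdivrMr//; exact: H.
Qed.

Let U1_open u : U1 u -> exists2 dl : R, 0 < dl & forall v, W v -> q (u - v) <= dl -> U1 v.
Proof.
move=> [Wu h1 h2].
have e1 : 0 < (m - J u) / 2 by lra.
have e2 : 0 < (r - q u / p) / 2 by lra.
have [d1 d10 H1] := J_cont Wu e1; have [d2 d20 H2] := qp_cont Wu e2.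
exists (Num.min d1 d2); first by rewrite lt_min d10.
move=> v Wv; rewrite le_min => /andP[/(H1 _ Wv) + /(H2 _ Wv)].
by rewrite !ler_norml => /andP[? ?] /andP[? ?]; split => //; lra.
Qed.

Let U2_open u : U2 u -> exists2 dl : R, 0 < dl & forall v, W v -> q (u - v) <= dl -> U2 v.
Proof.
move=> [Wu h1 h2].
have e1 : 0 < (m - J u) / 2 by lra.
have e2 : 0 < (q u / p - r) / 2 by lra.
have [d1 d10 H1] := J_cont Wu e1; have [d2 d20 H2] := qp_cont Wu e2.
exists (Num.min d1 d2); first by rewrite lt_min d10.
move=> v Wv; rewrite le_min => /andP[/(H1 _ Wv) + /(H2 _ Wv)].
by rewrite !ler_norml => /andP[? ?] /andP[? ?]; split => //; lra.
Qed.

Let line_cont u w s e : W u -> W w -> 0 < e -> exists2 dl : R, 0 < dl & forall t, `|s - t| <= dl ->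
  q ((u + s *: w) - (u + t *: w)) <= e.
Proof.
move=> Wu Ww e0; exists ((e / (q w + 1)) `^ p^-1).
  by rewrite powR_gt0// divr_gt0// ltr_wpDl.
move=> t hx; rewrite opprD addrACA subrr add0r -scalerBl qZ//.
have : `|s - t| `^ p <= e / (q w + 1).
  have -> : e / (q w + 1) = (e / (q w + 1)) `^ p^-1 `^ p.
    by rewrite -powRrM mulVf// powRr1// divr_ge0// ltW// ltr_wpDl.
  by apply: ge0_ler_powR; rewrite ?nnegrE ?powR_ge0 ?(ltW p_gt0).
rewrite ler_pdivlMr; last by rewrite ltr_wpDl.
apply: le_trans; apply: ler_wpM2l; [exact: powR_ge0|by rewrite lerDl].
Qed.

Let line_IVT u w b : W u -> W w -> 0 <= b -> 
  (q u / p < r < q (u + b *: w) / p) \/ (q (u + b *: w) / p < r < q u / p) ->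
  exists s, 0 <= s <= b /\ q (u + s *: w) / p = r.
Proof.
move=> Wu Ww b0 H; pose f s := q (u + s *: w) / p.
have f0 : f 0 = q u / p by rewrite /f scale0r addr0.
have cf : continuous f.
  move=> s; apply/cvgrPdist_le => e e0.
  have Ws := WD Wu (WZ s Ww).
  have [d1 d10 H1] := qp_cont Ws e0.
  have [d2 d20 H2] := line_cont s Wu Ww d10.
  near=> t; apply: H1; first by apply: WD => //; exact: WZ.
  apply: H2; near: t; exact: cvgr_dist_le.
have cf' : {within `[0, b], continuous f} by apply: continuous_subspaceT.
have [] := @IVT R f 0 b r b0 cf'.
  by rewrite f0 -/(f b) in H *; rewrite ge_min le_max; case: H => /andP[/ltW -> /ltW ->]; rewrite ?orbT.
by move=> s; rewrite in_itv/= => hs fs; exists s.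
Unshelve. all: by end_near. Qed.

(** Leaving the ball would put some point of the step on the sphere, where [J] is at least [m]; but
    [J] stays below [m] along the step. *)
Let U1_F u : U1 u -> U1 (F u).
Proof.
move=> [Wu h1 h2]; have lu := ltm_low Wu h1.
have JF := J_seg lu (sg_ge0 u) (lexx _).
split; [exact: FW|exact: le_lt_trans JF h1|].
rewrite ltNge; apply/negP => h3.
have [s [/andP[s0 ss] sr]] : exists s, 0 <= s <= sg u /\ q (u + s *: (A u - u)) / p = r.
  move: h3; rewrite le_eqVlt => /orP[/eqP h3|h3].
    by exists (sg u); split => //; rewrite sg_ge0 lexx.
  apply: line_IVT => //; first by apply: WB => //; exact: AW.
  by left; rewrite h2.
have := barrier _ sr; have := J_seg lu s0 ss.
move=> a b; have : W (u + s *: (A u - u)) by apply: WD => //; apply: WZ; apply: WB => //; exact: AW.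
by move/b; lra.
Qed.

Let U2_F u : U2 u -> U2 (F u).
Proof.
move=> [Wu h1 h2]; have lu := ltm_low Wu h1.
have JF := J_seg lu (sg_ge0 u) (lexx _).
split; [exact: FW|exact: le_lt_trans JF h1|].
rewrite ltNge; apply/negP => h3.
have [s [/andP[s0 ss] sr]] : exists s, 0 <= s <= sg u /\ q (u + s *: (A u - u)) / p = r.
  move: h3; rewrite le_eqVlt => /orP[/eqP h3|h3].
    by exists (sg u); split => //; rewrite sg_ge0 lexx.
  apply: line_IVT => //; first by apply: WB => //; exact: AW.
  by right; rewrite h2 andbT.
have := barrier _ sr; have := J_seg lu s0 ss.
move=> a b; have : W (u + s *: (A u - u)) by apply: WD => //; apply: WZ; apply: WB => //; exact: AW.
by move/b; lra.
Qed.

Let U1_iter n u : U1 u -> U1 (iter n F u).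
Proof. by move=> h; elim: n => //= n; exact: U1_F. Qed.
Let U2_iter n u : U2 u -> U2 (iter n F u).
Proof. by move=> h; elim: n => //= n; exact: U2_F. Qed.

(** The orbit is followed up to the common time [n + k], where the two conditions on [q] contradict
    each other. *)
Let U12 u n k : U1 (iter n F u) -> U2 (iter k F u) -> False.
Proof.
move=> h1 h2.
have := U1_iter k h1; have := U2_iter n h2; rewrite -!iterD addnC.
by move=> [_ _ a] [_ _ b]; lra.
Qed.

Let J_zero : q 0 / p < r. Proof. by rewrite q0 mul0r. Qed.

(* [0] enters [U1] and [v0] enters [U2]; both basins are open, so by connectedness
   some point of the segment stays above the level [m] forever. *)
Let separating : exists s, 0 <= s <= 1 /\ forall n, m <= J (iter n F (s *: v0)).
Proof.
apply: contrapT => /forallNP H.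
pose O1 := [set s : R | exists n, U1 (iter n F (s *: v0))].
pose O2 := [set s : R | exists n, U2 (iter n F (s *: v0))].
(* A basin is open because [U] is open and each iterate is continuous at the points of the
   segment. *)
have oO (U : V -> Prop) : (forall u, U u -> W u /\ exists2 dl : R, 0 < dl & forall v, W v -> q (u - v) <= dl -> U v) ->
    open [set s : R | exists n, U (iter n F (s *: v0))].
  move=> HU; rewrite openE => s [n Un].
  have [_ [dl dl0 Hd]] := HU _ Un.
  have [d2 d20 H2] := iter_cont n (WZ s Wv0) dl0.
  have [d3 d30 H3] := line_cont s W0 Wv0 d20.
  apply/nbhs_ballP; exists d3 => //= t; rewrite /ball/= => /ltW st.
  exists n; apply: Hd; first exact: iterW (WZ t Wv0).
  apply: H2; first exact: WZ.
  by have := H3 _ st; rewrite !add0r.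
have oO1 : open O1 by apply: oO => u hu; split; [case: hu|exact: U1_open].
have oO2 : open O2 by apply: oO => u hu; split; [case: hu|exact: U2_open].
have cov s : 0 <= s <= 1 -> O1 s \/ O2 s.
  move=> hs; have /not_andP[//|/existsNP[n /negP]] := H s.
  rewrite -ltNge => hn; have Wn := iterW n (WZ s Wv0).
  have [h|h|h] := ltgtP (q (iter n F (s *: v0)) / p) r.
  - by left; exists n.
  - by right; exists n.
  - by have := barrier Wn h; lra.
have disj s : O1 s -> O2 s -> False by move=> [n hn] [k hk]; exact: U12 hn hk.
have conn : connected `[(0:R), 1] by exact: segment_connected.
have E1 : `[(0:R), 1]%classic `&` O1 = `[(0:R), 1]%classic.
  apply: conn.
  - exists 0; split; first by rewrite /= in_itv/= lexx ler01.
    by exists 0%N; rewrite /= scale0r; split.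
  - by exists O1.
  - exists (~` O2); first exact: open_closedC.
    apply/seteqP; split => s [hs h]; split => //; first exact: disj h.
    by have [] := cov s; rewrite ?in_itv// => /h.
have : (`[(0:R), 1]%classic `&` O1) 1 by rewrite E1 /= in_itv/= ler01 lexx.
move=> [_ h]; apply: disj h _; exists 0%N; rewrite /= scale1r; split => //.
Qed.

(** For a fixed threshold only almost critical points are obtained; their levels and their side of
    the sphere are recorded because these pass to the limit. *)
Lemma flow_out : [/\
  exists u, [/\ W u, J u <= J 0, q u / p < r & gap u (A u) <= 2 * eps],
  exists u, [/\ W u, J u <= J v0, r < q u / p & gap u (A u) <= 2 * eps] &
  exists u, [/\ W u, m <= J u, J u <= L & gap u (A u) <= 2 * eps]].
Proof.
have mono n u : low u -> J (iter n F u) <= J u.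
  move=> lu; elim: n => //= n; apply: le_trans.
  by apply: J_seg => //; exact: iter_low.
split.
- have [n hn] := orbit_crit (ltm_low W0 J0m).
  exists (iter n F 0); split => //; first exact: iterW.
    by apply: mono; exact: ltm_low.
  by have [] : U1 (iter n F 0) by apply: U1_iter; split.
- have [n hn] := orbit_crit (ltm_low Wv0 v0m).
  exists (iter n F v0); split => //; first exact: iterW.
    by apply: mono; exact: ltm_low.
  by have [] : U2 (iter n F v0) by apply: U2_iter; split.
- have [s [/andP[s0 s1] hs]] := separating.
  have ls : low (s *: v0) by split; [exact: WZ|exact: segL].
  have [n hn] := orbit_crit ls.
  by exists (iter n F (s *: v0)); split => //; [exact: iterW (WZ s Wv0)|exact: (iter_low n ls).2].
Qed.
End flow.

Let crit w := forall v, W v -> E w w <= E w v.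

Let q_small u v : W u -> W v -> (forall e : R, 0 < e -> q (u - v) <= e) -> q (u - v) = 0.
Proof.
move=> Wu Wv H; apply/eqP; rewrite eq_le q_ge0 andbT; apply/ler_addgt0Pr => e e0.
by rewrite add0r; exact: H.
Qed.

(** [q] is not assumed definite (it will vanish on functions that are null almost everywhere), so
    [w] and [A w] agree only up to [q]; neither [q] nor [T w] sees the difference. *)
Let crit_fix w : W w -> q (w - A w) = 0 -> crit w.
Proof.
move=> Ww h v Wv; apply: le_trans (A_min Ww Wv); have Wa := AW Ww.
have a1 : T w (w - A w) = 0.
  apply/eqP; rewrite -normr_eq0 eq_le normr_ge0 andbT.
  apply: le_trans (T_bnd Ww (WB Ww Wa)) _.
  by rewrite /nm h powR0 ?mulr0// invr_eq0.
have a2 : q w = q (A w).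
  apply/eqP; rewrite -subr_eq0 -normr_eq0 eq_le normr_ge0 andbT; apply/ler_addgt0Pr => e e0.
  have [d d0 H] := q_cont (q_ge0 w) e0.
  by rewrite add0r; apply: H => //; rewrite h ltW.
rewrite TB// in a1; rewrite /E a2 lerD2l lerN2.
by move/eqP : a1; rewrite subr_eq0 => /eqP ->.
Qed.

(** By compactness the functionals [T (s (phi n))] are Cauchy, hence by [A_dep] so are the points
    [A (s (phi n))]. The vanishing gap drives [s (phi n)] to the same limit, which continuity of [A]
    makes a fixed point up to [q]. *)
Let limit (P : V -> Prop) (B : R) :
  (forall eps : R, 0 < eps -> exists u, [/\ W u, q u <= B, gap u (A u) <= eps & P u]) ->
  exists w, [/\ W w, crit w & forall e : R, 0 < e -> exists u, [/\ W u, P u & q (w - u) <= e]].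
Proof.
move=> H.
have /choice[s sP] : forall n : nat, exists u,
    [/\ W u, q u <= B, gap u (A u) <= n.+1%:R^-1 & P u].
  by move=> n; apply: H; rewrite invr_gt0.
have sW n : W (s n) by have [] := sP n.
have sB n : q (s n) <= B by have [] := sP n.
have B0 : 0 <= B by exact: le_trans (sB 0%N).
have [phi phi_ge Hphi] := T_compact sW sB.
have cA (e : R) : 0 < e -> exists K, forall m n, (K <= m)%N -> (K <= n)%N ->
    q (A (s (phi m)) - A (s (phi n))) <= e.
  move=> e0; have [eta eta0 He] := A_dep e0; have [K HK] := Hphi _ eta0.
  by exists K => m n Km Kn; apply: He => //; exact: HK.
have [w Ww wP] := q_complete (fun n => AW (sW (phi n))) cA.
have [BA BA0 HBA] := A_bnd.
have near (e : R) : 0 < e -> exists K, forall n, (K <= n)%N -> q (s (phi n) - A (s (phi n))) <= e.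
  move=> e0; have e1 : 0 < e / 2 / (B + BA + 1).
    by rewrite !divr_gt0// ltr_wpDl// addr_ge0.
  have [C C1 HC] := q_ucvx e1.
  have [K HK] := ltr_add_invr (divr_gt0 e0 (mulr_gt0 (ltr0n R 2) C1)).
  exists K => n Kn; apply: le_trans (HC _ _ (sW _) (AW (sW _))) _.
  have h1 : e / 2 / (B + BA + 1) * (q (s (phi n)) + q (A (s (phi n)))) <= e / 2.
    rewrite mulrAC ler_pdivrMr ?ltr_wpDl ?addr_ge0// ler_wpM2l ?divr_ge0 ?(ltW e0)//.
    by apply: le_trans (lerD (sB _) (HBA _ (sW _))) _; rewrite lerDl.
  have h2 : gap (s (phi n)) (A (s (phi n))) <= e / (2 * C).
    have [_ _ + _] := sP (phi n); move/le_trans; apply.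
    move: HK; rewrite add0r => /ltW; apply: le_trans.
    by rewrite lef_pV2 ?posrE// ler_nat ltnS (leq_trans Kn).
  have h3 : C * gap (s (phi n)) (A (s (phi n))) <= e / 2.
    have -> : e / 2 = C * (e / (2 * C)) by field; rewrite gt_eqF.
    by rewrite ler_pM2l.
  by apply: le_trans (lerD h1 h3) _; rewrite -splitr.
have lim (e : R) : 0 < e -> exists n, q (w - s (phi n)) <= e /\ q (w - A (s (phi n))) <= e.
  move=> e0; have e1 : 0 < Num.min e (e / C0 / 2) by rewrite lt_min e0 !divr_gt0.
  have [K1 H1] := wP _ e1; have [K2 H2] := near _ e1.
  exists (maxn K1 K2); have := H1 _ (leq_maxl K1 K2); have := H2 _ (leq_maxr K1 K2).
  rewrite !le_min => /andP[h1 h2] /andP[h3 h4]; split => //.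
  apply: le_trans (qB3 Ww (AW (sW (phi (maxn K1 K2)))) (sW _)) _.
  rewrite [q (A _ - s _)]qC//; last exact: AW.
  have -> : e = C0 * (e / C0 / 2 + e / C0 / 2) by field; rewrite gt_eqF.
  by rewrite ler_pM2l// lerD.
exists w; split => //.
  apply: crit_fix => //; apply: q_small => //; first exact: AW.
  move=> e e0; have e1 : 0 < e / C0 / 2 by rewrite !divr_gt0.
  have [d d0 Hd] := A_cont e1.
  have dd : 0 < Num.min d (e / C0 / 2) by rewrite lt_min d0.
  have [n [+ +]] := lim _ dd; rewrite !le_min => /andP[h1 _] /andP[_ h2].
  apply: le_trans (qB3 Ww (AW (sW (phi n))) (AW Ww)) _.
  rewrite [q (A _ - A w)]qC//; try exact: AW.
  have -> : e = C0 * (e / C0 / 2 + e / C0 / 2) by field; rewrite gt_eqF.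
  by rewrite ler_pM2l// lerD//; exact: Hd.
move=> e e0; have [n [h _]] := lim _ e0; exists (s (phi n)); split => //.
by have [] := sP (phi n).
Qed.

(** In the limit the inequalities on [q] are only weak. The first two points still avoid the sphere:
    there [J] is at least [m], while their levels are at most those of [0] and [v0]. *)
Lemma three_critical_argmin (L r m : R) (v0 : V) : 0 < r -> m <= L ->
  (forall u, W u -> q u / p = r -> m <= J u) -> W v0 -> J 0 < m -> J v0 < m ->
  r < q v0 / p -> (forall s : R, 0 <= s -> s <= 1 -> J (s *: v0) <= L) ->
  exists w1 w2 w3, [/\ [/\ W w1, crit w1, J w1 < m & q w1 / p < r],
    [/\ W w2, crit w2, J w2 < m & r < q w2 / p] &
    [/\ W w3, crit w3, m <= J w3 & J w3 <= L]].
Proof.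
move=> r0 mL bar Wv0 J0m v0m v0r segL.
(* The flow is run with [eps / 2], so that the final defect is at most [eps]. *)
have out (eps : R) : 0 < eps -> _ := fun eps0 => 
  let: ex_intro2 tau tau01 tauP := step_size L (divr_gt0 eps0 (ltr0n R 2)) in
  flow_out (divr_gt0 eps0 (ltr0n R 2)) tau01 tauP r0 mL bar Wv0 J0m v0m v0r segL.
have eE (eps : R) : 2 * (eps / 2) = eps by rewrite mulrC divfK.
have [B B0 HB] := low_bnd L.
have J0L : J 0 <= L by apply: le_trans mL; exact: ltW.
have v0L : J v0 <= L by apply: le_trans mL; exact: ltW.
have [w1 [W1 c1 H1]] : exists w, [/\ W w, crit w & forall e : R, 0 < e ->
    exists u, [/\ W u, J u <= J 0 /\ q u / p < r & q (w - u) <= e]].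
  apply: (@limit _ B) => eps eps0; have [[u [Wu a b c]] _ _] := out _ eps0.
  rewrite eE in c; exists u; split => //; apply: HB; split => //; exact: le_trans J0L.
have [w2 [W2 c2 H2]] : exists w, [/\ W w, crit w & forall e : R, 0 < e ->
    exists u, [/\ W u, J u <= J v0 /\ r < q u / p & q (w - u) <= e]].
  apply: (@limit _ B) => eps eps0; have [_ [u [Wu a b c]] _] := out _ eps0.
  rewrite eE in c; exists u; split => //; apply: HB; split => //; exact: le_trans v0L.
have [w3 [W3 c3 H3]] : exists w, [/\ W w, crit w & forall e : R, 0 < e ->
    exists u, [/\ W u, m <= J u /\ J u <= L & q (w - u) <= e]].
  apply: (@limit _ B) => eps eps0; have [_ _ [u [Wu a b c]]] := out _ eps0.
  by rewrite eE in c; exists u; split => //; apply: HB.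
have Jle w (e : R) (P : V -> Prop) : W w -> 0 < e ->
    (forall e : R, 0 < e -> exists u, [/\ W u, P u & q (w - u) <= e]) ->
    exists u, [/\ P u, `|J w - J u| <= e & `|q w / p - q u / p| <= e].
  move=> Ww e0 H; have [d1 d10 Hd1] := J_cont Ww e0.
  have [d2 d20 Hd2] := q_cont (q_ge0 w) (mulr_gt0 e0 p_gt0).
  have d0 : 0 < Num.min d1 d2 by rewrite lt_min d10.
  have [u [Wu Pu]] := H _ d0; rewrite le_min => /andP[h1 h2].
  exists u; split => //; first exact: Hd1.
  by rewrite -mulrBl normrM [`|p^-1|]gtr0_norm ?invr_gt0// ler_pdivrMr//; exact: Hd2.
have J1 : J w1 <= J 0.
  apply/ler_addgt0Pr => e e0; have [u [[h1 h2] h3 h4]] := Jle _ _ _ W1 e0 H1.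
  by move: h3; rewrite ler_norml => /andP[_ h3]; lra.
have q1 : q w1 / p <= r.
  apply/ler_addgt0Pr => e e0; have [u [[h1 h2] h3 h4]] := Jle _ _ _ W1 e0 H1.
  by move: h4; rewrite ler_norml => /andP[_ h4]; lra.
have J2 : J w2 <= J v0.
  apply/ler_addgt0Pr => e e0; have [u [[h1 h2] h3 h4]] := Jle _ _ _ W2 e0 H2.
  by move: h3; rewrite ler_norml => /andP[_ h3]; lra.
have q2 : r <= q w2 / p.
  apply/ler_addgt0Pr => e e0; have [u [[h1 h2] h3 h4]] := Jle _ _ _ W2 e0 H2.
  by move: h4; rewrite ler_norml => /andP[h4 _]; lra.
have J3 : m <= J w3.
  apply/ler_addgt0Pr => e e0; have [u [[h1 h2] h3 h4]] := Jle _ _ _ W3 e0 H3.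
  by move: h3; rewrite ler_norml => /andP[h3 _]; lra.
have J3' : J w3 <= L.
  apply/ler_addgt0Pr => e e0; have [u [[h1 h2] h3 h4]] := Jle _ _ _ W3 e0 H3.
  by move: h3; rewrite ler_norml => /andP[_ h3]; lra.
exists w1, w2, w3; split; split => //; [exact: le_lt_trans J0m| |exact: le_lt_trans v0m|].
- rewrite lt_neqAle q1 andbT; apply/eqP => h; have := bar _ W1 h; lra.
- rewrite lt_neqAle q2 andbT; apply/eqP => /esym h; have := bar _ W2 h; lra.
Qed.
End argmin.

Theorem three_critical_points (L r m : R) (v0 : V) : 0 < r -> m <= L ->
  (forall u, W u -> q u / p = r -> m <= J u) -> W v0 -> J 0 < m -> J v0 < m ->
  r < q v0 / p -> (forall s : R, 0 <= s -> s <= 1 -> J (s *: v0) <= L) ->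
  let crit w := forall v, W v -> q w / p - T w w <= q v / p - T w v in
  exists w1 w2 w3, [/\ [/\ W w1, crit w1, J w1 < m & q w1 / p < r],
    [/\ W w2, crit w2, J w2 < m & r < q w2 / p] &
    [/\ W w3, crit w3, m <= J w3 & J w3 <= L]].
Proof.
have /choice[A AP] : forall u, exists w, W u -> W w /\ forall v, W v -> E u w <= E u v.
  move=> u; have [Wu|nWu] := pselect (W u); last by exists 0.
  by have [w Ww h] := min_ex Wu; exists w.
move=> r0 mL bar Wv0 J0m v0m v0r segL crit.
apply: (three_critical_argmin (A := A) _ _ r0 mL bar Wv0 J0m v0m v0r segL).
- by move=> u Wu; have [] := AP u Wu.
- by move=> u v Wu Wv; have [_] := AP u Wu; exact.
Qed.
End descent.

(** * Lebesgue measure on boxes *)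

Section lebesgue_rV_theory.
Variables (R : realType) (N : nat).
Local Notation E := 'rV[R]_N.
Local Notation mu := (lebesgue_rV R N).

Definition obox (a b : 'I_N -> R) : set E := [set x | forall i, a i < x ord0 i < b i].

Let oboxE a b : obox a b = [set x | forall i, `]a i, b i[%classic (x ord0 i)].
Proof. by apply/seteqP; split => x /= H i; have := H i; rewrite in_itv. Qed.

Lemma measurable_obox a b : measurable (obox a b).
Proof.
rewrite (_ : obox a b = \bigcap_(i in [set: 'I_N])
   (fun x : E => x ord0 i) @^-1` `]a i, b i[%classic); last first.
  by rewrite oboxE; apply/seteqP; split => [x /= H i _|x /= H i]; exact: H.
apply: fin_bigcap_measurable => // i _.
by rewrite -[X in measurable X]setTI; exact: measurable_coord.
Qed.

Lemma mu_obox a b : mu (obox a b) = (\prod_(i < N) (Num.max 0 (b i - a i))%:E)%E.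
Proof.
rewrite oboxE (@lebesgue_rV_box R N (fun i => `]a i, b i[%classic))//.
apply: eq_bigr => i _; rewrite lebesgue_measure_itv/= lte_fin.
case: ltP => ab; first by rewrite (max_idPr _) ?subr_ge0 ?(ltW ab)// EFinB.
by rewrite (max_idPl _)// subr_le0.
Qed.

Lemma mu_obox_lty a b : (mu (obox a b) < +oo)%E.
Proof. by rewrite mu_obox prodEFin ltry. Qed.

Definition oboxes : set (set E) := [set B | exists a b, B = obox a b].

Lemma oboxes_setI : setI_closed oboxes.
Proof.
move=> A B [a [b ->]] [c [d ->]].
exists (fun i => Num.max (a i) (c i)), (fun i => Num.min (b i) (d i)).
apply/seteqP; split => x /=.
  move=> [h1 h2] i; rewrite gt_max lt_min; move: (h1 i) (h2 i) => /andP[a1 a2] /andP[a3 a4].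
  by rewrite a1 a2 a3 a4.
move=> h; split=> i; have := h i; rewrite gt_max lt_min => /andP[/andP[a1 a2] /andP[a3 a4]];
by rewrite ?a1 ?a2 ?a3 ?a4.
Qed.

Lemma obox_cover : \bigcup_n obox (fun=> - n%:R) (fun=> n%:R) = setT.
Proof.
apply/seteqP; split => // x _.
pose M := \sum_(i < N) `|x ord0 i|.
exists (Num.bound M) => //= i; rewrite -ltr_norml.
apply: le_lt_trans (archi_boundP (sumr_ge0 _ _)); last by move=> j _; exact: normr_ge0.
by rewrite /M (bigD1 i)//= lerDl sumr_ge0.
Qed.

(** The preimage of an open interval under a coordinate is a countable union of boxes, bounded by
    [n] in the other coordinates. *)
Lemma oboxes_generate : @measurable _ E = <<s oboxes >>.
Proof.
rewrite eqEsubset; split; last first.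
  apply: smallest_sub; first exact: sigma_algebra_measurable.
  by move=> _ [a [b ->]]; exact: measurable_obox.
apply: smallest_sub; first exact: smallest_sigma_algebra.
move=> A; rewrite -bigcup_seq/= => -[i _ [B mB <-]]; rewrite setTI.
have {mB} : <<s @RGenOpens.G R >> B.
  by move: mB; have := RGenOpens.measurableE R; rewrite /measurable/= => <-.
move: B; apply: smallest_sub.
  split.
  - by rewrite /= preimage_set0; exact: sigma_algebra0.
  - move=> B /= hB; rewrite setTD preimage_setC; exact: sigma_algebraC.
  - move=> F hF /=; rewrite preimage_bigcup; exact: sigma_algebra_bigcup.
move=> _ [x [y ->]] /=.
rewrite (_ : _ @^-1` _ = \bigcup_n (obox (fun j => if j == i then x else - n%:R)
     (fun j => if j == i then y else n%:R))); last first.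
  apply/seteqP; split => z /=.
    rewrite in_itv/= => hz.
    have [n _ hn] : (\bigcup_n obox (fun=> - n%:R) (fun=> n%:R)) z by rewrite obox_cover.
    by exists n => // j /=; case: eqP => [->//|_]; exact: hn.
  by move=> [n _ /(_ i)]; rewrite eqxx in_itv.
by apply: sigma_algebra_bigcup => n; apply: sub_sigma_algebra; eexists; eexists.
Qed.

(** Boxes form a generating class stable under intersection, and countably many of them exhaust the
    space. This identifies scaled measures, and later the measures whose densities are the two parts
    of a function. *)
Lemma obox_measure_unique (m1 m2 : {measure set E -> \bar R}) :
  (forall a b, m1 (obox a b) = m2 (obox a b)) ->
  (forall a b, (m1 (obox a b) < +oo)%E) ->
  forall A, measurable A -> m1 A = m2 A.
Proof.
move=> H1 H2; apply: (measure_unique oboxes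
   (fun n => obox (fun=> - n%:R) (fun=> n%:R))).
- exact: oboxes_generate.
- exact: oboxes_setI.
- by move=> n; eexists; eexists.
- exact: obox_cover.
- by move=> _ [a [b ->]].
- by move=> n; exact: H2.
Qed.

Lemma measurable_affine (t : R) (c : E) : measurable_fun setT (fun x : E => t *: x + c).
Proof.
apply: measurable_fun_rV => i; under eq_fun do rewrite !mxE.
by apply: measurable_funD => //; apply: measurable_funM => //; exact: measurable_coord.
Qed.

(** Both sides are measures in [A], so boxes suffice; a negative [t] exchanges the endpoints of each
    interval. *)
Lemma mu_affine (t : R) (c : E) A : t != 0 -> measurable A ->
  mu ((fun x : E => t *: x + c) @^-1` A) = ((`|t|^-1 ^+ N)%:E * mu A)%E.
Proof.
move=> t0 mA.
have k0 : 0 <= `|t|^-1 ^+ N by rewrite exprn_ge0// invr_ge0.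
pose m1 := measure_function_pushforward__canonical__measure_function_Measure mu
  (measurable_affine t c).
pose m2 : {measure set E -> \bar R} := mscale (NngNum k0) mu.
have pre a b : (fun x : E => t *: x + c) @^-1` obox a b =
   obox (fun i => if 0 < t then t^-1 * (a i - c ord0 i) else t^-1 * (b i - c ord0 i))
        (fun i => if 0 < t then t^-1 * (b i - c ord0 i) else t^-1 * (a i - c ord0 i)).
  have H (u v w z : R) : (u < t * w + z < v) =
      ((if 0 < t then t^-1 * (u - z) else t^-1 * (v - z)) < w <
       (if 0 < t then t^-1 * (v - z) else t^-1 * (u - z))).
    case: (ltP 0 t) => h; rewrite -[u < _]ltrBlDr -[_ < v]ltrBrDr.
      by rewrite ltr_pdivrMl// ltr_pdivlMl.
    have {}h : t < 0 by rewrite lt_neqAle t0.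
    by rewrite ltr_ndivrMl// ltr_ndivlMl// andbC.
  by apply/seteqP; split => x /= hx i; have := hx i; rewrite !mxE H.
have e a b : mu ((fun x : E => t *: x + c) @^-1` obox a b) = ((`|t|^-1 ^+ N)%:E * mu (obox a b))%E.
  rewrite pre !mu_obox !prodEFin -EFinM; congr (_%:E).
  rewrite -[X in X * _](_ : \prod_(i < N) `|t|^-1 = _); last by rewrite prodr_const card_ord.
  rewrite -big_split/=; apply: eq_bigr => i _; case: ltP => h.
    rewrite -mulrBr gtr0_norm// maxr_pMr ?invr_ge0 ?ltW// mulr0.
    by congr (Num.max _ (_ * _)); lra.
  have {}h : t < 0 by rewrite lt_neqAle t0.
  rewrite -mulrBr ltr0_norm// maxr_pMr ?invr_ge0 ?oppr_ge0 ?(ltW h)// mulr0.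
  by rewrite invrN mulNr -mulrN; congr (Num.max _ (_ * _)); lra.
have H2 a b : (m1 (obox a b) < +oo)%E.
  by rewrite /m1 /= /pushforward/= pre; exact: mu_obox_lty.
exact: (@obox_measure_unique m1 m2 e H2 A mA).
Qed.

Lemma ge0_integral_affine (t : R) (c : E) (f : E -> \bar R) : t != 0 ->
  measurable_fun setT f -> (forall x, 0 <= f x)%E ->
  (\int[mu]_x f (t *: x + c)%R = (`|t|^-1 ^+ N)%:E * \int[mu]_x f x)%E.
Proof.
move=> t0 mf f0.
have k0 : 0 <= `|t|^-1 ^+ N by rewrite exprn_ge0// invr_ge0.
rewrite -(@ge0_integral_mscale _ _ _ mu setT measurableT (NngNum k0))//.
have := ge0_integral_pushforward (measurable_affine t c) mu (D := setT) (f := f) measurableT mf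
  (fun x _ => f0 x).
rewrite preimage_setT => <-.
apply: (@eq_measure_integral _ _ R setT (mscale (NngNum k0) mu)) => [|? A mA _];
  [exact: measurable_affine|exact: mu_affine].
Qed.

Lemma ge0_integral_shift (c : E) (f : E -> \bar R) :
  measurable_fun setT f -> (forall x, 0 <= f x)%E ->
  (\int[mu]_x f (x + c)%R = \int[mu]_x f x)%E.
Proof.
move=> mf f0; have := @ge0_integral_affine 1 c f (oner_neq0 _) mf f0.
rewrite normr1 invr1 expr1n mul1e => <-.
by apply: eq_integral => x _; rewrite scale1r.
Qed.

Lemma measurable_shift (c : E) : measurable_fun setT (fun x : E => x + c).
Proof. by have := measurable_affine 1 c; under eq_fun do rewrite scale1r. Qed.

Lemma integral_shift (c : E) (f : E -> \bar R) :
  measurable_fun setT f ->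
  (\int[mu]_x f (x + c)%R = \int[mu]_x f x)%E.
Proof.
move=> mf; rewrite [LHS]integralE [RHS]integralE.
have := @ge0_integral_shift c _ (measurable_funepos mf) (funepos_ge0 f).
have := @ge0_integral_shift c _ (measurable_funeneg mf) (funeneg_ge0 f).
move=> h1 h2; congr (_ - _)%E; 
  [rewrite -h2|rewrite -h1]; congr (integral mu setT _);
  [exact: (funepos_comp f (fun x : E => x + c))|exact: (funeneg_comp f (fun x : E => x + c))].
Qed.

Lemma Rintegral_shift (c : E) (f : E -> R) : measurable_fun setT f ->
  \int[mu]_x f (x + c)%R = \int[mu]_x f x.
Proof. by move=> mf; rewrite /Rintegral (integral_shift c (f := EFin \o f))//; exact/measurable_EFinP. Qed.

Lemma integrable_shift (c : E) (f : E -> \bar R) :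
  mu.-integrable setT f -> mu.-integrable setT (fun x => f (x + c)).
Proof.
move=> /integrableP[mf fi]; apply/integrableP; split.
  by apply: (measurableT_comp mf); exact: measurable_shift.
rewrite (ge0_integral_shift c (f := fun x => `|f x|%E))//.
exact: measurableT_comp.
Qed.

Lemma negligible_shift (c : E) (P : E -> Prop) :
  {ae mu, forall x, P x} -> {ae mu, forall x, P (x + c)}.
Proof.
move=> [A [mA A0 PA]]; exists ((fun x : E => x + c) @^-1` A); split.
- by rewrite -[X in measurable X]setTI; exact: measurable_shift.
- have := @mu_affine 1 c A (oner_neq0 _) mA.
  rewrite normr1 invr1 expr1n mul1e A0 => <-; congr (mu _).
  by apply/seteqP; split => x; rewrite /preimage/= scale1r.
- by move=> x /= Px; apply: PA.
Qed.

(** Lattice points of mesh [1 / (n + 1)], indexed by a countable type: this serves both the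
    measurability of open sets and the diagonal extraction over ball means. *)
Definition grid_pt (k : nat * {ffun 'I_N -> int}) : E :=
  \row_i ((k.2 i)%:~R / k.1.+1%:R).

Lemma grid_near (n : nat) (x : E) : exists z : {ffun 'I_N -> int},
  forall i, 0 <= x ord0 i - grid_pt (n, z) ord0 i < n.+1%:R^-1.
Proof.
exists [ffun i => Num.floor (n.+1%:R * x ord0 i)] => i; rewrite mxE ffunE/=.
have n0 : (0 : R) < n.+1%:R by [].
have /andP[h1 h2] := real_floor_itv (num_real (n.+1%:R * x ord0 i)).
rewrite intrD1 in h2; rewrite subr_ge0 ler_pdivrMr// [x ord0 i * _]mulrC h1/=.
rewrite ltrBlDr -[X in X + _]mul1r -mulrDl ltr_pdivlMr// [x ord0 i * _]mulrC.
by rewrite addrC.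
Qed.

(** The sigma-algebra comes from the coordinates and the topology from the sup norm; an open set is
    the union of the grid boxes that it contains, and these are countably many. *)
Lemma open_measurable_rV (A : set E) : open A -> measurable A.
Proof.
move=> oA.
pose B k := obox (fun i => grid_pt k ord0 i - k.1.+1%:R^-1) (fun i => grid_pt k ord0 i + k.1.+1%:R^-1).
have -> : A = \bigcup_(k in [set k | B k `<=` A]) B k.
  apply/seteqP; split; last by move=> x [k /= kA kx]; exact: kA.
  move=> x Ax; have := open_subball oA Ax.
  move=> [e /= e0 He].
  have e2 : 0 < e / 2 by rewrite divr_gt0.
  have hb := He _ _ e2.
  have {hb}hA : ball x (e / 2) `<=` A.
    by apply: hb => //=; rewrite sub0r normrN gtr0_norm// ltr_pdivrMr// ltr_pMr// ltr1n.
  have [n] := ltr_add_invr (divr_gt0 e2 (ltr0n R 2)); rewrite add0r => hn.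
  have [z hz] := grid_near n x.
  exists (n, z); last first.
    by move=> i /=; have := hz i; move: (n.+1%:R^-1) => w; lra.
  move=> y hy; apply: hA; split => // i j; rewrite ord1 /ball/=.
  have := hy j; have := hz j => /=; move: (n.+1%:R^-1) hn => w hn ? ?.
  rewrite ltr_norml; apply/andP; split; lra.
rewrite bigcup_mkcond; apply: countable_bigcupT_measurable => [|k]; first exact: countableP.
by case: ifP => _; [exact: measurable_obox|exact: measurable0].
Qed.

Lemma continuous_measurable_rV (f : E -> R) : continuous f -> measurable_fun setT f.
Proof.
move=> /continuousP cf; apply: (measurability _ (RGenOpens.measurableE R)).
move=> _ [_ [a [b ->] <-]]; rewrite setTI; apply: open_measurable_rV.
exact/cf/interval_open.
Qed.
End lebesgue_rV_theory.

(** * The Euclidean norm and the volume of balls *)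

Section euclidean_norm.
Variables (R : realType) (N : nat).
Local Notation E := 'rV[R]_N.
Local Notation mu := (lebesgue_rV R N).
Implicit Types x y z : E.

Lemma dotvC x y : dotv x y = dotv y x.
Proof. by apply: eq_bigr => i _; rewrite mulrC. Qed.

Lemma dotvDl x y z : dotv (x + y) z = dotv x z + dotv y z.
Proof. by rewrite /dotv -big_split; apply: eq_bigr => i _; rewrite mxE mulrDl. Qed.

Lemma dotvZl (t : R) x z : dotv (t *: x) z = t * dotv x z.
Proof. by rewrite /dotv mulr_sumr; apply: eq_bigr => i _; rewrite mxE mulrA. Qed.

Lemma dotvDr x y z : dotv z (x + y) = dotv z x + dotv z y.
Proof. by rewrite dotvC dotvDl ![dotv _ z]dotvC. Qed.

Lemma dotvZr (t : R) x z : dotv z (t *: x) = t * dotv z x.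
Proof. by rewrite dotvC dotvZl dotvC. Qed.

Lemma dotvNl x z : dotv (- x) z = - dotv x z.
Proof. by rewrite -scaleN1r dotvZl mulN1r. Qed.

Lemma dotv_ge0 x : 0 <= dotv x x.
Proof. by apply: sumr_ge0 => i _; rewrite -expr2 sqr_ge0. Qed.

Lemma enorm_ge0 x : 0 <= enorm x. Proof. exact: sqrtr_ge0. Qed.

Lemma enorm_sqr x : enorm x ^+ 2 = dotv x x.
Proof. by rewrite sqr_sqrtr// dotv_ge0. Qed.

Lemma coord_le_enorm x i : `|x ord0 i| <= enorm x.
Proof.
rewrite -sqrtr_sqr; apply: ler_wsqrtr; rewrite /dotv (bigD1 i)//= -expr2 lerDl.
by apply: sumr_ge0 => j _; rewrite -expr2 sqr_ge0.
Qed.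

Lemma enorm_eq0 x : enorm x = 0 -> x = 0.
Proof.
move=> x0; apply/rowP => i; rewrite mxE; apply/eqP; rewrite -normr_eq0 eq_le normr_ge0 andbT.
by rewrite -x0 coord_le_enorm.
Qed.

Lemma enorm0 : enorm (0 : E) = 0.
Proof. by rewrite /enorm /dotv big1 ?sqrtr0// => i _; rewrite mxE mul0r. Qed.

Lemma enormZ (t : R) x : enorm (t *: x) = `|t| * enorm x.
Proof. by rewrite /enorm dotvZl dotvZr mulrA -expr2 sqrtrM ?sqr_ge0// sqrtr_sqr. Qed.

Lemma enormN x : enorm (- x) = enorm x.
Proof. by rewrite -scaleN1r enormZ normrN normr1 mul1r. Qed.

Lemma dotv_le x y : `|dotv x y| <= enorm x * enorm y.
Proof.
have [/enorm_eq0 ->|y0] := eqVneq (enorm y) 0.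
  by rewrite dotvC -(scale0r (0 : E)) dotvZl mul0r normr0 mulr_ge0 ?enorm_ge0.
have yy : 0 < dotv y y by rewrite -enorm_sqr exprn_gt0// lt_neqAle eq_sym y0 enorm_ge0.
have := dotv_ge0 (dotv y y *: x - dotv x y *: y).
rewrite -scaleNr dotvDl !dotvDr !dotvZl !dotvZr [dotv y x]dotvC => h.
have {}h : 0 <= dotv y y * (dotv x x * dotv y y - dotv x y ^+ 2).
  by apply: le_trans h _; rewrite le_eqVlt; apply/orP; left; apply/eqP; ring.
rewrite pmulr_rge0// subr_ge0 -!enorm_sqr -exprMn in h.
rewrite -(@ler_pXn2r _ 2) ?nnegrE ?mulr_ge0 ?enorm_ge0//.
by rewrite real_normK ?num_real.
Qed.

Lemma enormD x y : enorm (x + y) <= enorm x + enorm y.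
Proof.
rewrite -(@ler_pXn2r _ 2) ?nnegrE ?addr_ge0 ?enorm_ge0//.
rewrite enorm_sqr dotvDl !dotvDr -!enorm_sqr [dotv y x]dotvC.
have := le_trans (ler_norm _) (dotv_le x y); rewrite sqrrD; lra.
Qed.

Lemma enormB x y : `|enorm x - enorm y| <= enorm (x - y).
Proof.
have := enormD (x - y) y; have := enormD (y - x) x; rewrite !subrK.
by rewrite -(enormN (y - x)) opprB ler_norml => ? ?; apply/andP; split; lra.
Qed.

Lemma continuous_coord i : continuous (fun x : E => x ord0 i).
Proof. exact: coord_continuous. Qed.

Lemma continuous_sum_rV (I : Type) (s : seq I) (f : I -> E -> R) :
  (forall i, continuous (f i)) -> continuous (fun x => \sum_(i <- s) f i x).
Proof.
move=> cf; elim: s => [|i s IH].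
  by under eq_fun do rewrite big_nil; move=> x; exact: cst_continuous.
under eq_fun do rewrite big_cons.
by move=> x; apply: continuousD; [exact: cf|exact: IH].
Qed.

Lemma continuous_dotv : continuous (fun x : E => dotv x x).
Proof.
rewrite /dotv; apply: continuous_sum_rV => i x.
by apply: continuousM; exact: continuous_coord.
Qed.

Lemma continuous_enorm : continuous (fun x : E => enorm x).
Proof.
move=> x; apply: (@continuous_comp _ _ _ (fun x : E => dotv x x) Num.sqrt).
  exact: continuous_dotv.
exact: sqrt_continuous.
Qed.

Lemma measurable_enorm : measurable_fun setT (fun x : E => enorm x).
Proof. by apply: continuous_measurable_rV; exact: continuous_enorm. Qed.

Lemma measurable_dotv d (T : measurableType d) (f g : T -> E) :
  measurable_fun setT f -> measurable_fun setT g ->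
  measurable_fun setT (fun t => dotv (f t) (g t)).
Proof.
move=> mf mg; rewrite /dotv.
apply: measurable_sum => i; apply: measurable_funM.
  exact: (measurableT_comp (@measurable_coord R N i) mf).
exact: (measurableT_comp (@measurable_coord R N i) mg).
Qed.

Lemma measurable_eball c r : measurable (eball c r : set E).
Proof.
have -> : eball c r = (fun x => enorm (x + - c)) @^-1` `]-oo, r[%classic.
  by apply/seteqP; split => x; rewrite /eball/= in_itv.
rewrite -[X in measurable X]setTI.
have := measurableT_comp measurable_enorm (@measurable_shift R N (- c)).
by apply.
Qed.

Lemma eball_obox c r : 
  (eball c r : set E) `<=` obox (fun i => c ord0 i - r) (fun i => c ord0 i + r).
Proof.
move=> x /= hx i; have := le_lt_trans (coord_le_enorm (x - c) i) hx.
by rewrite !mxE ltr_norml => /andP[? ?]; apply/andP; split; lra.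
Qed.

Lemma mu_eball_lty c r : (mu (eball c r) < +oo)%E.
Proof.
apply: le_lt_trans (mu_obox_lty _ _); apply: le_measure (@eball_obox c r); rewrite inE.
  exact: measurable_eball.
exact: measurable_obox.
Qed.

Definition ball_vol : R := fine (mu (eball 0 1)).

Lemma ball_vol_ge0 : 0 <= ball_vol. Proof. exact: fine_ge0. Qed.

Lemma mu_eball c r : 0 < r -> mu (eball c r) = (r ^+ N * ball_vol)%:E.
Proof.
move=> r0.
have := @mu_affine R N r^-1 (- (r^-1 *: c)) (eball 0 1) _ (measurable_eball 0 1).
rewrite invr_eq0 gt_eqF// => /(_ isT).
rewrite normrV ?unitfE ?gt_eqF// invrK gtr0_norm//.
rewrite EFinM fineK ?ge0_fin_numE ?mu_eball_lty// => <-; congr (mu _).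
apply/seteqP; split => x; rewrite /eball/= subr0 -scalerBr enormZ gtr0_norm ?invr_gt0//;
by rewrite mulrC ltr_pdivrMr// mul1r.
Qed.

End euclidean_norm.

(** * Two improper integrals *)

Section improper.
Variable R : realType.
Local Notation leb := (@lebesgue_measure R).

Lemma integral_powRNy (a k : R) : 0 < a -> 1 < k ->
  (\int[leb]_(t in `[a, +oo[) (t `^ (- k))%:E = (a `^ (1 - k) / (k - 1))%:E)%E.
Proof.
move=> a0 k1; have k1' : 1 - k != 0 by rewrite subr_eq0 eq_sym gt_eqF.
have cp (s x : R) : 0 < x -> {for x, continuous (fun t : R => t `^ s)}.
  move=> x0; apply: differentiable_continuous; apply/derivable1_diffP.
  by apply: derivable_powR; rewrite in_itv/= x0.
rewrite (@ge0_continuous_FTC2y _ _ (fun t => t `^ (1 - k) / (1 - k)) _ 0).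
- by rewrite sub0e -EFinN -mulrN -invrN opprB.
- by move=> x _; exact: powR_ge0.
- apply: continuous_in_subspaceT => x; rewrite inE/= in_itv/= andbT => ax.
  by apply: cp; exact: lt_le_trans ax.
- rewrite -[0](mul0r (1 - k)^-1); apply: cvgMl.
  apply/cvgrPdist_le => e e0.
  near=> x.
  have x0 : 0 < x by near: x; exact: nbhs_pinfty_gt.
  have x1 : (e^-1) `^ (k - 1)^-1 <= x by near: x; apply: nbhs_pinfty_ge; exact: num_real.
  rewrite sub0r normrN ger0_norm ?powR_ge0// -opprB powRN.
  rewrite invf_ple ?posrE ?powR_gt0//.
  have -> : e^-1 = ((e^-1) `^ (k - 1)^-1) `^ (k - 1).
    by rewrite -powRrM mulVf ?powRr1 ?invr_ge0 ?(ltW e0)// subr_eq0 gt_eqF.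
  by apply: ge0_ler_powR; rewrite ?nnegrE ?powR_ge0 ?subr_ge0 ?(ltW k1) ?(ltW x0).
- move=> x ax; apply: derivableM => //.
  by apply: derivable_powR; rewrite in_itv/= (lt_trans a0 ax).
- apply: cvgMl; apply: cvg_at_right_filter; exact: cp.
- move=> x; rewrite in_itv/= andbT => ax; have x0 := lt_trans a0 ax.
  have dp : derivable (fun t : R => t `^ (1 - k)) x 1 by apply: derivable_powR; rewrite in_itv/= x0.
  rewrite derive1E deriveMr// -derive1E powR_derive1 ?in_itv/= ?x0//.
  by rewrite mulrA mulVf// mul1r; congr (_ `^ _); lra.
Unshelve. all: by end_near. Qed.

Lemma integral_expRNy (a : R) :
  (\int[leb]_(t in `[a, +oo[) (expR (- t))%:E = (expR (- a))%:E)%E.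
Proof.
rewrite (@ge0_continuous_FTC2y _ _ (fun t => - expR (- t)) _ 0).
- by rewrite sub0e -EFinN opprK.
- by move=> x _; exact: expR_ge0.
- apply: continuous_subspaceT => x; apply: continuous_comp; first exact: opp_continuous.
  exact: continuous_expR.
- by rewrite -oppr0; apply: cvgN; exact: cvgr_expR.
- by move=> x _; exact: ex_derive.
- apply: cvgN; apply: cvg_at_right_filter.
  apply: continuous_comp; [exact: opp_continuous|exact: continuous_expR].
- move=> x _; have h : is_derive x (1 : R) (fun t : R => - expR (- t)) (expR (- x)).
    by apply: is_derive_eq; rewrite mulrN1 opprK.
  by rewrite derive1E (@derive_val _ _ _ _ _ _ _ h).
Qed.
End improper.

(** * The Gaussian integral in dimension n *)

Section gauss_rV.
Variable R : realType.
Local Notation leb := (@lebesgue_measure R).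

(** Tonelli's theorem, read through the recursive construction of the measure. *)
Lemma integral_rV_step (n : nat) (f : 'rV[R]_n.+1 -> \bar R) :
  measurable_fun setT f -> (forall x, 0 <= f x)%E ->
  (\int[lebesgue_rV R n.+1]_x f x =
   \int[leb]_y \int[lebesgue_rV R n]_z f (rV_cons (y, z)))%E.
Proof.
move=> mf f0.
have mc := @measurable_rV_cons R n.
have H := ge0_integral_pushforward mc (leb \x lebesgue_rV R n)%E (D := setT) (f := f)
  measurableT mf (fun x _ => f0 x).
rewrite preimage_setT in H.
transitivity (\int[(leb \x lebesgue_rV R n)%E]_x (f \o @rV_cons R n) x)%E.
  by rewrite -H.
rewrite fubini_tonelli1//; first exact: measurableT_comp.
by move=> x; exact: f0.
Qed.

Lemma dotv_rV_cons (n : nat) (y : R) (z : 'rV[R]_n) :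
  dotv (rV_cons (y, z)) (rV_cons (y, z)) = y ^+ 2 + dotv z z.
Proof.
rewrite /dotv big_ord_recl !mxE unlift_none/= -expr2; congr (_ + _).
by apply: eq_bigr => i _; rewrite !mxE liftK.
Qed.

Lemma measurable_gauss_rV (n : nat) :
  measurable_fun setT (fun x : 'rV[R]_n => expR (- dotv x x)).
Proof.
have m : measurable_fun setT (fun x : 'rV[R]_n => - dotv x x).
  by apply: measurable_funN; exact: (measurable_dotv (f := id) (g := id)).
exact: (measurableT_comp (@measurable_expR R) m).
Qed.

(** The Gaussian is a product over the coordinates. Its integral in closed form is what identifies
    the volume of the unit ball. *)
Lemma gauss_rV (n : nat) :
  (\int[lebesgue_rV R n]_x (expR (- dotv x x))%:E = (pi `^ (n%:R / 2))%:E)%E.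
Proof.
elim: n => [|n IH].
  rewrite mul0r powRr0 /= integral_dirac//.
    by rewrite diracE in_setT mul1e /dotv big_ord0 oppr0 expR0.
  by apply/measurable_EFinP; exact: measurable_gauss_rV.
rewrite integral_rV_step; last by move=> x; rewrite lee_fin expR_ge0.
  2: by apply/measurable_EFinP; exact: measurable_gauss_rV.
transitivity (\int[leb]_y ((expR (- y ^+ 2))%:E * (pi `^ (n%:R / 2))%:E))%E.
  apply: eq_integral => y _.
  under eq_integral => z _ do rewrite dotv_rV_cons opprD expRD EFinM.
  rewrite ge0_integralZl; last 4 first.
  - exact: measurableT.
  - by apply/measurable_EFinP; exact: measurable_gauss_rV.
  - by move=> z _; rewrite lee_fin expR_ge0.
  - by rewrite lee_fin expR_ge0.
  by rewrite IH.
rewrite (@ge0_integralZr _ _ _ leb setT measurableT (EFin \o @gauss_fun R)); last 3 first.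
- by apply/measurable_EFinP; exact: measurable_gauss_fun.
- by move=> z _; rewrite lee_fin expR_ge0.
- by rewrite lee_fin powR_ge0.
rewrite (integralT_gauss (R := R)) -EFinM -powR12_sqrt ?pi_ge0// -powRD; last first.
  by rewrite (gt_eqF (pi_gt0 _)) implybT.
by congr (_ `^ _)%:E; rewrite -natr1; lra.
Qed.
End gauss_rV.

(** * Volume of the unit ball and integrals of Riesz kernels *)

Section ball_volume.
Variables (R : realType) (N : nat).
Local Notation E := 'rV[R]_N.
Local Notation mu := (lebesgue_rV R N).
Local Notation leb := (@lebesgue_measure R).

(** Tonelli for a region of points and levels, with weight [g] on the levels; it serves both the
    Gaussian and the Riesz kernel. *)
Lemma integral_layer (A : set (E * measurableTypeR R)) (g : R -> R) :
  measurable A -> measurable_fun setT g -> (forall t, 0 <= g t) ->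
  (\int[mu]_x \int[leb]_t ((g t)%:E * (\1_A (x, t))%:E) =
   \int[leb]_t ((g t)%:E * mu [set x | A (x, t)]))%E.
Proof.
move=> mA mg g0.
pose h (z : E * measurableTypeR R) := ((g z.2)%:E * (\1_A z)%:E)%E.
have mh : measurable_fun setT h.
  apply: emeasurable_funM.
    by apply/measurable_EFinP; exact: (measurableT_comp mg).
  by apply/measurable_EFinP; exact: measurable_indic.
have h0 z : (0 <= h z)%E by rewrite mule_ge0// lee_fin.
rewrite (@fubini_tonelli _ _ _ _ R mu leb h)//.
apply: eq_integral => t _; rewrite /h/=.
have mp : measurable_fun setT (fun x : E => (x, t) : E * measurableTypeR R) by exact: measurable_fun_pair.
have mA' : measurable [set x | A (x, t)] by rewrite -[X in measurable X]setTI; exact: mp.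
rewrite (ge0_integralZl _ measurableT); last 3 first.
- by apply/measurable_EFinP; exact: (measurableT_comp (measurable_indic mA)).
- by move=> x _; rewrite lee_fin.
- by rewrite lee_fin.
congr (_ * _)%E.
rewrite (eq_integral (fun x => (\1_[set x | A (x, t)] x)%:E)); first by rewrite integral_indic// setIT.
move=> x _; rewrite !indicE.
suff -> : ((x, t) \in A) = (x \in [set x | A (x, t)]) by [].
by apply/idP/idP; rewrite !inE.
Qed.

Lemma integral_layer_cake (f : E -> R) (g : R -> R) :
  measurable_fun setT f -> measurable_fun setT g -> (forall t, 0 <= g t) ->
  (\int[mu]_x \int[leb]_(t in `]f x, +oo[%classic) (g t)%:E =
   \int[leb]_t ((g t)%:E * mu [set x | (f x < t)%R]))%E.
Proof.
move=> mf mg g0.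
have mA : measurable [set w : E * measurableTypeR R | f w.1 < w.2].
  rewrite -[X in measurable X]setTI.
  apply: (@measurable_fun_ltr _ _ _ setT (f \o fst) snd _ _ measurableT [set true]) => //.
  exact: measurableT_comp.
rewrite -(integral_layer mA mg g0).
apply: eq_integral => x _; rewrite integral_mkcond; apply: eq_integral => t _.
rewrite patchE indicE /=.
have -> : (t \in `]f x, +oo[%classic) = (f x < t).
  by apply/idP/idP; rewrite inE/= in_itv/= andbT.
have -> : ((x, t) \in [set w : E * measurableTypeR R | f w.1 < w.2]) = (f x < t).
  by apply/idP/idP; rewrite inE.
by case: ifP => _; rewrite ?mule1 ?mule0.
Qed.

(** With [exp (-|x|^2)] written as the integral of [exp (-t)] over [t > |x|^2], Tonelli turns the
    Gaussian integral into that of [exp (-t)] times the volume of the ball of radius [sqrt t], that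
    is, into the unit volume times [Gamma (1 + N/2)]. *)
Lemma ball_volE : inv_ball_volume R N * ball_vol R N = 1.
Proof.
have pN : 0 < pi `^ (N%:R / 2) :> R by apply: powR_gt0; exact: pi_gt0.
have mg : measurable_fun setT (fun t : R => expR (- t)).
  exact: (measurableT_comp (@measurable_expR R) (@oppr_measurable R setT)).
have mG : measurable_fun setT (fun t : R => t `^ (1 + N%:R / 2 - 1) * expR (- t)).
  by apply: measurable_funM => //; exact: measurable_powR.
have G0 t : 0 <= t `^ (1 + N%:R / 2 - 1) * expR (- t) :> R.
  by rewrite mulr_ge0 ?powR_ge0 ?expR_ge0.
have md : measurable_fun setT (fun x : E => dotv x x).
  exact: (measurable_dotv (f := id) (g := id)).
have key : ((pi `^ (N%:R / 2))%:E = (ball_vol R N)%:E *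
    \int[leb]_(t in `]0%R, +oo[) (t `^ (1 + N%:R / 2 - 1) * expR (- t))%:E)%E.
  rewrite -gauss_rV.
  transitivity (\int[mu]_x \int[leb]_(t in `](dotv x x), +oo[%classic) (expR (- t))%:E)%E.
    apply: eq_integral => x _; rewrite -integral_expRNy.
    rewrite integral_itv_obnd_cbnd//.
    by apply/measurable_EFinP; exact: measurable_funTS.
  rewrite integral_layer_cake//.
  rewrite -ge0_integralZl//; last 3 first.
  - by apply/measurable_EFinP; exact: measurable_funTS.
  - by move=> t _; rewrite lee_fin.
  - by rewrite lee_fin ball_vol_ge0.
  rewrite [RHS]integral_mkcond; apply: eq_integral => t _; rewrite patchE.
  have -> : (t \in `]0%R, +oo[%classic) = (0 < t).
    by apply/idP/idP; rewrite inE/= in_itv/= andbT.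
  case: ltP => t0.
    have -> : [set x : E | dotv x x < t] = eball 0 (t `^ 2^-1).
      apply/seteqP; split => x; rewrite /eball/= subr0 => h.
        by rewrite powR12_sqrt ?(ltW t0)// ltr_sqrt.
      by move: h; rewrite powR12_sqrt ?(ltW t0)// ltr_sqrt.
    rewrite mu_eball ?powR_gt0// -EFinM -EFinM -powR_mulrn ?powR_ge0// -powRrM.
    rewrite mulrC mulrAC mulrC; congr (_ * (_ `^ _ * _))%:E; lra.
  rewrite (_ : [set x | _] = set0) ?measure0 ?mule0//.
  apply/seteqP; split => // x /= h.
  by have := dotv_ge0 x; rewrite leNgt (lt_le_trans h t0).
rewrite /inv_ball_volume /Gamma /Rintegral mulrAC.
(* Neither positivity of the volume nor finiteness of the Gamma integral is known beforehand: both
   follow because their product is finite and nonzero. *)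
have [i0|i0] := eqVneq (ball_vol R N) 0.
  by move: key; rewrite i0 mul0e => -[] /eqP; rewrite gt_eqF.
have vpos : 0 < ball_vol R N by rewrite lt_neqAle eq_sym i0 ball_vol_ge0.
move: key; set I := (\int[leb]_(t in _) _)%E.
have I0 : (0 <= I)%E by apply: integral_ge0 => t _; rewrite lee_fin.
case: I I0 => [I I0| |//]; last by rewrite gt0_muley// ?lte_fin.
by rewrite -EFinM => -[E0]; rewrite /= [I * _]mulrC -E0 mulfV ?gt_eqF.
Qed.

Lemma ball_vol_gt0 : 0 < ball_vol R N.
Proof.
rewrite lt_neqAle ball_vol_ge0 andbT eq_sym; apply/eqP => e.
by have /eqP := ball_volE; rewrite e mulr0 eq_sym oner_eq0.
Qed.

Lemma inv_ball_volumeE : inv_ball_volume R N = (ball_vol R N)^-1.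
Proof. by rewrite -[RHS]mul1r -ball_volE mulfK// gt_eqF// ball_vol_gt0. Qed.

(** The kernel [|y|^-s] is at most 1 plus the length of the levels [t] between 1 and [|y|^-s]. By
    Tonelli, these levels are weighted by the measure of the set where [|y|^-s > t], which lies in
    the ball of radius [t^(-1/s)]. The case [s = 0], which occurs in dimension one, is treated apart
    since [1/s] is then meaningless. *)
Lemma integral_riesz_unit (s : R) : 0 <= s -> s < N%:R ->
  (\int[mu]_(y in eball 0 1) (enorm y `^ (- s))%:E <=
    (ball_vol R N * (N%:R / (N%:R - s)))%:E)%E.
Proof.
move=> s0 sN; have N0 : (0 : R) < N%:R by exact: le_lt_trans sN.
have mB : measurable (eball 0 1 : set E) := measurable_eball 0 1.
have mB1 : mu (eball 0 1) = (ball_vol R N)%:E.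
  by rewrite mu_eball// expr1n mul1r.
move: s0; rewrite le_eqVlt => /orP[/eqP <-|s0].
  rewrite subr0 mulfV ?gt_eqF// mulr1 -mB1.
  rewrite (eq_integral (cst 1%E)); last by move=> x _; rewrite oppr0 powRr0.
  by rewrite integral_cst// mul1e.
have me : measurable_fun setT (fun y : E => enorm y `^ (- s)).
  exact: (measurableT_comp (@measurable_powR R (- s)) (@measurable_enorm R N)).
pose A := [set w : E * measurableTypeR R | (enorm w.1 < 1) && ((1 < w.2) && (w.2 < enorm w.1 `^ (- s)))].
have mA : measurable A.
  rewrite -[X in measurable X]setTI.
  have m1 : measurable_fun setT (fun w : E * measurableTypeR R => enorm w.1 < 1).
    by apply: measurable_fun_ltr => //; exact: (measurableT_comp (@measurable_enorm R N)).
  have m2 : measurable_fun setT (fun w : E * measurableTypeR R => 1 < w.2).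
    by apply: measurable_fun_ltr.
  have m3 : measurable_fun setT (fun w : E * measurableTypeR R => w.2 < enorm w.1 `^ (- s)).
    by apply: measurable_fun_ltr => //; exact: (measurableT_comp me).
  have m4 := measurable_and m1 (measurable_and m2 m3).
  by apply: (m4 measurableT [set true]).
have inner0 x : (0 <= \int[leb]_t ((cst 1 t)%:E * (\1_A (x, t))%:E))%E.
  by apply: integral_ge0 => t _; rewrite mul1e lee_fin.
have mtr : measurable_fun setT (fun x : E => \int[leb]_t ((cst 1 t)%:E * (\1_A (x, t))%:E))%E.
  apply: (@measurable_fun_fubini_tonelli_F _ _ _ _ R leb (fun w : E * measurableTypeR R => (1%:E * (\1_A w)%:E)%E)).
    under eq_fun do rewrite mul1e.
    by apply/measurable_EFinP; exact: measurable_indic.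
  by move=> w; rewrite mul1e lee_fin.
apply: (@le_trans _ _ (\int[mu]_(y in eball 0 1) (1 + \int[leb]_t ((cst 1 t)%:E * (\1_A (y, t))%:E)))%E).
  apply: ge0_le_integral => //.
  - by move=> y _; rewrite lee_fin powR_ge0.
  - by apply/measurable_EFinP; exact: measurable_funTS.
  - by apply: emeasurable_funD => //; exact: measurable_funTS.
  - move=> y; rewrite /eball/= subr0 => y1.
    have [le1|gt1] := leP (enorm y `^ (- s)) 1.
      by apply: le_trans (leeDl _ (inner0 y)); rewrite lee_fin.
    have -> : (\int[leb]_t ((cst 1 t)%:E * (\1_A (y, t))%:E) = (enorm y `^ (- s) - 1)%:E)%E.
      under eq_integral => t _.
        rewrite mul1e (_ : \1_A (y, t) = \1_(`]1, (enorm y `^ (- s))[%classic) t); last first.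
          rewrite !indicE.
          suff -> : ((y, t) \in A) = (t \in `]1, (enorm y `^ (- s))[%classic) by [].
          by apply/idP/idP; rewrite !inE/= in_itv/= /A/= y1.
        over.
      rewrite integral_indic// setIT.
      by have := @lebesgue_measure_itv R `]1, (enorm y `^ (- s))[; rewrite /= lte_fin gt1.
    by rewrite -EFinD lee_fin addrC subrK.
rewrite ge0_integralD//; last by exact: measurable_funTS.
rewrite integral_cst// mul1e.
have : (\int[mu]_(y in eball 0 1) \int[leb]_t ((cst 1 t)%:E * (\1_A (y, t))%:E) <=
        (ball_vol R N * (s / (N%:R - s)))%:E)%E.
  apply: (@le_trans _ _ (\int[mu]_y \int[leb]_t ((cst 1 t)%:E * (\1_A (y, t))%:E))%E).
    by apply: ge0_subset_integral.
  rewrite integral_layer//.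
  have k1 : 1 < N%:R / s by rewrite ltr_pdivlMr// mul1r.
  have -> : (ball_vol R N * (s / (N%:R - s)))%:E =
      (\int[leb]_(t in `[1%R, +oo[) ((ball_vol R N)%:E * (t `^ (- (N%:R / s)))%:E))%E.
    rewrite ge0_integralZl; last 4 first.
    - exact: measurable_itv.
    - by apply/measurable_EFinP; apply: measurable_funTS; exact: measurable_powR.
    - by move=> t _; rewrite lee_fin powR_ge0.
    - by rewrite lee_fin ball_vol_ge0.
    rewrite integral_powRNy// powR1 -EFinM; congr (_ * _)%:E; field.
    by rewrite (gt_eqF s0) mulN1r subr_eq0 gt_eqF.
  have mb : measurable `[(1 : R), +oo[%classic by exact: measurable_itv.
  rewrite [leRHS]integral_mkcond; apply: ge0_le_integral => //.
  - by move=> t _; rewrite mul1e.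
  - under eq_fun do rewrite mul1e.
    have -> : (fun t => mu [set x | A (x, t)]) = mu \o ysection A.
      apply/funext => t /=; congr (mu _); apply/seteqP; split => x.
        by rewrite /ysection/= inE.
      by rewrite /ysection/= inE.
    exact: measurable_fun_ysection.
  - apply/(measurable_restrictT _ mb); apply: emeasurable_funM => //.
    by apply/measurable_EFinP; apply: measurable_funTS; exact: measurable_powR.
  - move=> t _; rewrite mul1e patchE.
    case: ifPn => [|]; rewrite ?notin_setE ?inE/= in_itv/= andbT => t1.
      have t0 : 0 < t by exact: lt_le_trans t1.
      have -> : ((ball_vol R N)%:E * (t `^ (- (N%:R / s)))%:E)%E = mu (eball 0 (t `^ (- s^-1))).
        rewrite mu_eball ?powR_gt0// -EFinM mulrC -powR_mulrn ?powR_ge0// -powRrM.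
        by congr (_ `^ _ * _)%:E; lra.
      apply: le_measure; rewrite ?inE; [|exact: measurable_eball|].
        rewrite -[X in measurable X]setTI.
        have mp : measurable_fun setT (fun x : E => (x, t) : E * measurableTypeR R).
          exact: measurable_fun_pair.
        exact: mp.
      move=> x /= /andP[x1 /andP[_ tx]]; rewrite /eball/= subr0.
      have x0 : 0 < enorm x.
        rewrite lt_neqAle enorm_ge0 andbT eq_sym; apply/eqP => x0; move: tx.
        by rewrite x0 powR0 ?oppr_eq0 ?gt_eqF// ltNge (ltW t0).
      rewrite -[ltLHS](@powRr1 _ (enorm x)) ?ltW//.
      have -> : (1 : R) = (- s) * (- s^-1) by rewrite mulrNN mulfV// gt_eqF.
      rewrite powRrM !powRN.
      have p1 : 0 < enorm x `^ s by exact: powR_gt0.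
      have p2 : 0 < t `^ s^-1 by exact: powR_gt0.
      have p3 : 0 < (enorm x `^ s)^-1 `^ s^-1 by apply: powR_gt0; rewrite invr_gt0.
      rewrite ltf_pV2 ?posrE//; apply: gt0_ltr_powR.
      - by rewrite invr_gt0.
      - by rewrite nnegrE ltW.
      - by rewrite nnegrE invr_ge0 ltW.
      - by rewrite -powRN.
    have -> : [set x : E | A (x, t)] = set0; last by rewrite measure0.
    by apply/seteqP; split => // x /= /andP[_ /andP[h _]]; apply: t1; exact: ltW.
move=> h; apply: (@le_trans _ _ ((ball_vol R N)%:E + (ball_vol R N * (s / (N%:R - s)))%:E)%E).
  by apply: leeD => //; rewrite -mB1.
rewrite -EFinD lee_fin le_eqVlt; apply/orP; left; apply/eqP; field.
by rewrite gt_eqF// subr_gt0.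
Qed.

Lemma integral_riesz (s r : R) : 0 < r -> 0 <= s -> s < N%:R ->
  (\int[mu]_(y in eball 0 r) (enorm y `^ (- s))%:E <=
    (ball_vol R N * (N%:R / (N%:R - s)) * r `^ (N%:R - s))%:E)%E.
Proof.
move=> r0 s0 sN.
have me : measurable_fun setT (fun y : E => enorm y `^ (- s)).
  exact: (measurableT_comp (@measurable_powR R (- s)) (@measurable_enorm R N)).
pose f (y : E) := ((\1_(eball 0 r : set E) y)%:E * (enorm y `^ (- s))%:E)%E.
have mf : measurable_fun setT f.
  apply: emeasurable_funM; apply/measurable_EFinP => //.
  by apply: measurable_indic; exact: measurable_eball.
have f0 y : (0 <= f y)%E by rewrite mule_ge0// lee_fin powR_ge0.
have mc (r' : R) : measurable (eball 0 r' : set E) by exact: measurable_eball.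
have fE (r' : R) : (\int[mu]_(y in eball 0 r') (enorm y `^ (- s))%:E =
    \int[mu]_y ((\1_(eball 0 r' : set E) y)%:E * (enorm y `^ (- s))%:E))%E.
  rewrite integral_mkcond; apply: eq_integral => y _; rewrite patchE indicE.
  by case: ifP; rewrite ?mul1e ?mul0e.
have := @ge0_integral_affine R N r 0 f (lt0r_neq0 r0) mf f0.
have -> : (\int[mu]_x f (r *: x + 0)%R = (r `^ (- s))%:E *
    \int[mu]_(y in eball 0 1) (enorm y `^ (- s))%:E)%E.
  rewrite fE -ge0_integralZl//; last 3 first.
  - apply: emeasurable_funM; apply/measurable_EFinP => //.
  - by move=> y _; rewrite mule_ge0// lee_fin powR_ge0.
  - by rewrite lee_fin powR_ge0.
  apply: eq_integral => x _; rewrite /f addr0 enormZ gtr0_norm// [RHS]muleCA.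
  congr (_ * _)%E.
    rewrite !indicE; suff -> : (r *: x \in eball 0 r) = (x \in eball 0 1) by [].
    by apply/idP/idP; rewrite !inE /eball/= !subr0 enormZ gtr0_norm// gtr_pMr.
  by rewrite -EFinM powRM ?enorm_ge0// ltW.
rewrite (fE r) gtr0_norm// => h; rewrite -[leLHS]/(\int[mu]_y f y)%E.
have -> : (\int[mu]_y f y = (r ^+ N)%:E * ((r `^ (- s))%:E *
    \int[mu]_(y in eball 0 1) (enorm y `^ (- s))%:E))%E.
  by rewrite h muleA -EFinM exprVn mulfV ?mul1e// expf_neq0 ?gt_eqF.
rewrite muleA -EFinM -powR_mulrn ?(ltW r0)// -powRD ?gt_eqF ?implybT//.
rewrite [X in (_ <= X%:E)%E]mulrC EFinM; apply: lee_wpmul2l; first by rewrite lee_fin powR_ge0.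
  exact: integral_riesz_unit.
by rewrite subr_gt0.
Qed.
End ball_volume.

(** * Test functions *)

Section flat_exp.
Variable R : realType.

(* the derivatives of [exp (- 1 / t)] are combinations of the following functions *)
Definition flat_exp (n : nat) (t : R) : R := if 0 < t then t^-1 ^+ n * expR (- t^-1) else 0.

Lemma flat_exp_ge0 n t : 0 <= flat_exp n t.
Proof.
rewrite /flat_exp; case: ltP => // t0.
by rewrite mulr_ge0 ?expR_ge0// exprn_ge0// invr_ge0 ltW.
Qed.

Lemma flat_exp_le0 n t : t <= 0 -> flat_exp n t = 0.
Proof. by rewrite /flat_exp ltNge => ->. Qed.

(** The exponential series bounds [exp (-1/t)] by [(n+2)! t^(n+2)] for [t > 0]. A quadratic bound is
    what makes the derivative at 0 vanish. *)
Lemma flat_exp_le_sqr n : exists2 K : R, 0 <= K & forall t, flat_exp n t <= K * t ^+ 2.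
Proof.
exists (n.+2`!%:R) => // t; rewrite /flat_exp; case: ltP => t0; last by rewrite mulr_ge0// sqr_ge0.
have k0 : (0 : R) < n.+2`!%:R by rewrite ltr0n fact_gt0.
have h : expR (- t^-1) <= n.+2`!%:R * t ^+ n.+2.
  have -> : n.+2`!%:R * t ^+ n.+2 = (t^-1 ^+ n.+2 / n.+2`!%:R)^-1.
    by rewrite invfM invrK exprVn invrK mulrC.
  rewrite expRN lef_pV2 ?posrE ?expR_gt0 ?divr_gt0 ?exprn_gt0 ?invr_gt0//.
  have ti : 0 <= t^-1 by rewrite invr_ge0 ltW.
  by apply: le_trans (expR_ge1Dxn n.+1 ti); rewrite lerDr.
apply: le_trans (ler_wpM2l _ h) _; first by rewrite exprn_ge0// invr_ge0 ltW.
rewrite mulrCA ler_pM2l// -[n.+2]addn2 exprD mulrA -exprMn mulVf ?gt_eqF//.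
by rewrite expr1n mul1r.
Qed.

(** The family is closed under differentiation up to linear combinations; smoothness of every order
    then follows by induction. *)
Lemma is_derive_flat_exp n (t : R) :
  is_derive t 1 (flat_exp n) (- n%:R * flat_exp n.+1 t + flat_exp n.+2 t).
Proof.
have [t0|t0|->] := ltgtP t 0.
- have -> : - n%:R * flat_exp n.+1 t + flat_exp n.+2 t = 0.
    by rewrite /flat_exp ltNge (ltW t0)/= mulr0 addr0.
  have h := @is_derive_cst R R R 0 t 1.
  apply: near_eq_is_derive h; near=> s; rewrite /cst /flat_exp; case: ltP => //= s0.
  have : s < 0 by near: s; exact: lt_nbhsl.
  by rewrite ltNge ltW.
- apply: (@near_eq_is_derive _ _ _ (fun s : R => s^-1 ^+ n * expR (- s^-1))).
    near=> s; rewrite /flat_exp; case: ltP => // s0.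
    have : 0 < s by near: s; exact: lt_nbhsr.
    by rewrite ltNge s0.
  have tn0 : t != 0 by rewrite gt_eqF.
  have dV : is_derive t (1 : R) (fun s : R => s^-1) (- t ^- 2).
    by apply: DeriveDef; [exact: derivableV|rewrite deriveV// derive_id [_ *: _]mulr1].
  have dE : is_derive t (1 : R) (fun s : R => expR (- s^-1)) (expR (- t^-1) * t ^- 2).
    by apply: is_derive_eq; rewrite opprK.
  have dX : is_derive t (1 : R) (fun s : R => s^-1 ^+ n) (n%:R * t^-1 ^+ n.-1 * (- t ^- 2)).
    have -> : (fun s : R => s^-1 ^+ n) = (fun s : R => s^-1) ^+ n.
      by apply/funext => s; rewrite exprfctE.
    exact: is_deriveX.
  have h := is_deriveM dX dE; apply: is_derive_eq.
  rewrite /flat_exp t0 /GRing.scale/=; case: n dX h => [|n] _ _ /=.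
    by rewrite !mul0r oppr0 !mul0r mulr0 addr0 add0r expr0 mul1r mulrC exprVn.
  rewrite -exprVn !exprS; move: (t^-1) (expR _) => z w; ring.
- have -> : - n%:R * flat_exp n.+1 0 + flat_exp n.+2 0 = 0 :> R.
    by rewrite /flat_exp ltxx mulr0 addr0.
  have [K K0 hK] := flat_exp_le_sqr n.
  have f0 : flat_exp n 0 = 0 by rewrite /flat_exp ltxx.
  have cv : (fun h : R => h^-1 *: ((flat_exp n \o shift 0) (h *: 1) - flat_exp n 0)) @ 0^' --> (0 : R).
    apply/cvgrPdist_le => e e0; near=> h.
    have h0 : h != 0 by near: h; exact: nbhs_dnbhs_neq.
    rewrite /= addr0 f0 subr0 sub0r normrN [h%:A]mulr1 normrM normrV ?unitfE//.
    rewrite ler_pdivrMl ?normr_gt0// ger0_norm ?flat_exp_ge0//.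
    apply: le_trans (hK h) _; rewrite -real_normK ?num_real// expr2 mulrA mulrC ler_wpM2l//.
    have hk : `|h| <= e / (K + 1).
      by near: h; apply: dnbhs0_le; rewrite divr_gt0// ltr_wpDl.
    rewrite ler_pdivlMr ?ltr_wpDl// in hk; apply: le_trans hk.
    by rewrite mulrC ler_wpM2l// lerDl.
  apply: DeriveDef; first by apply/cvg_ex; exists 0.
  exact: cvg_lim.
Unshelve. all: by end_near.
Qed.
End flat_exp.

Section lines.
Variables (R : realType) (V : normedModType R).

Lemma is_derive_line (f : V -> R) (x v : V) (d : R) :
  is_derive (0 : R) (1 : R) (fun h : R => f (h *: v + x)) d -> is_derive x v f d.
Proof.
move=> [h1 h2]; apply: DeriveDef; first exact/derivable1P.
rewrite -h2 /derive; set g1 := fun h => h^-1 *: _; set g2 := fun h => h^-1 *: _.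
suff -> : g1 = g2 by [].
by rewrite funeqE /g1 /g2 => h /=; rewrite addr0 scale0r add0r [_%:A]mulr1.
Qed.
End lines.

Section density.
Local Open Scope ereal_scope.
Context d (T : measurableType d) (R : realType) (m : {measure set T -> \bar R}).
Variable f : T -> \bar R.
Hypothesis mf : measurable_fun setT f.
Hypothesis f0 : forall x, 0 <= f x.

(** Measurability and sign of [f] are arguments of the set function, so that it carries its measure
    structure by itself. *)
Definition density of measurable_fun setT f & (forall x, 0 <= f x) := 
  fun A : set T => \int[m]_(x in A) f x.

Let density0 : density mf f0 set0 = 0.
Proof. by rewrite /density integral_set0. Qed.

Let density_ge0 A : 0 <= density mf f0 A.
Proof. by apply: integral_ge0 => x _; exact: f0. Qed.

Let density_sigma_additive : semi_sigma_additive (density mf f0).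
Proof.
move=> F mF tF mUF; rewrite /density ge0_integral_bigcup//; last exact: measurable_funTS.
by apply: is_cvg_ereal_nneg_natsum => n _; exact: density_ge0.
Qed.

HB.instance Definition _ := isMeasure.Build _ _ _ (density mf f0)
  density0 density_ge0 density_sigma_additive.

Definition density_measure : {measure set T -> \bar R} := density mf f0.
End density.

Section test_functions.
Variables (R : realType) (N : nat).
Local Notation E := 'rV[R]_N.
Local Notation mu := (lebesgue_rV R N).

(** An algebra of functions stable under partial derivatives: [Ck] follows for every [k] by
    induction, without formulas for the higher derivatives. *)
Inductive flat_alg : (E -> R) -> Prop :=
| flat_cst c : flat_alg (fun=> c)
| flat_base n i (al be : R) : flat_alg (fun x => flat_exp n (al * x ord0 i + be))
| flat_add f g : flat_alg f -> flat_alg g -> flat_alg (fun x => f x + g x)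
| flat_mul f g : flat_alg f -> flat_alg g -> flat_alg (fun x => f x * g x).

(** All directional derivatives are given, with linear dependence on the direction: bumps will be
    differentiated along arbitrary segments. *)
Lemma flat_alg_derive f : flat_alg f -> exists2 Df : 'I_N -> E -> R,
  (forall i, flat_alg (Df i)) &
  forall x v : E, is_derive x v f (\sum_i v ord0 i * Df i x).
Proof.
elim=> {f} [c|n i al be|f g _ [Df hf Ef] _ [Dg hg Eg]|f g sf [Df hf Ef] sg [Dg hg Eg]].
- exists (fun _ => fun=> 0) => [i|x v]; first exact: flat_cst.
  rewrite big1; last by move=> i _; rewrite mulr0.
  exact: is_derive_cst.
- exists (fun j x => if j == i then al * (- n%:R * flat_exp n.+1 (al * x ord0 i + be)
       + flat_exp n.+2 (al * x ord0 i + be)) else 0).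
    move=> j; case: (j == i); last exact: flat_cst.
    apply: flat_mul; first exact: flat_cst.
    apply: flat_add; last exact: flat_base.
    by apply: flat_mul; [exact: flat_cst|exact: flat_base].
  move=> x v; rewrite (bigD1 i)//= eqxx big1 ?addr0; last first.
    by move=> j /negbTE ->; rewrite mulr0.
  apply: is_derive_line.
  have -> : (fun h : R => flat_exp n (al * (h *: v + x) ord0 i + be)) =
      flat_exp n \o (fun h => h * (al * v ord0 i) + (al * x ord0 i + be)).
    by apply/funext => h /=; congr (flat_exp n _); rewrite !mxE; ring.
  have d1 : is_derive (0 : R) (1 : R) (fun h : R => h * (al * v ord0 i) + (al * x ord0 i + be))
      (al * v ord0 i).
    by apply: is_derive_eq; rewrite addr0 scaler0 add0r [_%:A]mulr1.
  have d2 := is_derive_flat_exp n (0 * (al * v ord0 i) + (al * x ord0 i + be)).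
  have := @is_derive1_comp R (flat_exp n) _ 0 _ _ d2 d1.
  rewrite mul0r add0r => h; apply: is_derive_eq.
  by ring.
- exists (fun i x => Df i x + Dg i x) => [i|x v]; first exact: flat_add.
  under eq_bigr do rewrite mulrDr.
  rewrite big_split/=; exact: is_deriveD (Ef x v) (Eg x v).
- exists (fun i x => f x * Dg i x + g x * Df i x) => [i|x v].
    by apply: flat_add; exact: flat_mul.
  have h := is_deriveM (Ef x v) (Eg x v).
  apply: is_derive_eq.
  rewrite !scaler_sumr -big_split/=; apply: eq_bigr => i _.
  by rewrite /GRing.scale/=; ring.
Qed.

Lemma continuous_flat_exp n : continuous (@flat_exp R n).
Proof.
move=> t; apply: differentiable_continuous; apply/derivable1_diffP.
by have [] := is_derive_flat_exp n t.
Qed.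

Lemma flat_alg_continuous f : flat_alg f -> continuous f.
Proof.
elim=> {f} [c|n i al be|f g _ cf _ cg|f g _ cf _ cg] x.
- exact: cst_continuous.
- apply: (@continuous_comp _ _ _ (fun x : E => al * x ord0 i + be) (flat_exp n)); last first.
    exact: continuous_flat_exp.
  apply: continuousD; last exact: cst_continuous.
  by apply: continuousM; [exact: cst_continuous|exact: continuous_coord].
- by apply: continuousD; [exact: cf|exact: cg].
- by apply: continuousM; [exact: cf|exact: cg].
Qed.

Lemma flat_alg_Ck k f : flat_alg f -> Ck k f.
Proof.
elim: k f => [|k IH] f sf /=; first exact: flat_alg_continuous.
have [Df hf Ef] := flat_alg_derive sf.
split; [exact: flat_alg_continuous|by move=> i x; have [] := Ef x (basis_vec i)|].
move=> i; rewrite (_ : partial i f = Df i); first exact: IH.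
apply/funext => x; rewrite /partial.
have [_ ->] := Ef x (basis_vec i).
rewrite (bigD1 i)//= big1 ?addr0 ?mxE ?eqxx ?mul1r// => j /negbTE ji.
by rewrite mxE eqxx ji mul0r.
Qed.

Lemma flat_alg_prod (I : Type) (s : seq I) (f : I -> E -> R) :
  (forall i, flat_alg (f i)) -> flat_alg (fun x => \prod_(i <- s) f i x).
Proof.
move=> sf; elim: s => [|i s IH].
  by under eq_fun do rewrite big_nil; exact: flat_cst.
by under eq_fun do rewrite big_cons; exact: flat_mul.
Qed.

(** Test functions with values in [0, 1] that tend to the indicator of the open box as [k] grows:
    integrals over boxes become limits of integrals against test functions. *)
Definition bump (a b : 'I_N -> R) (k : nat) (x : E) : R :=
  \prod_(i < N) (flat_exp 0 (k.+1%:R * x ord0 i + (- (k.+1%:R * a i))) *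
     flat_exp 0 (- k.+1%:R * x ord0 i + k.+1%:R * b i)).

Lemma bump_flat a b k : flat_alg (bump a b k).
Proof. by apply: flat_alg_prod => i; apply: flat_mul; exact: flat_base. Qed.

Lemma bump_ge0 a b k x : 0 <= bump a b k x.
Proof. by apply: prodr_ge0 => i _; rewrite mulr_ge0 ?flat_exp_ge0. Qed.

Lemma flat_exp0_le1 (t : R) : flat_exp 0 t <= 1.
Proof.
rewrite /flat_exp; case: ltP => t0; last exact: ler01.
by rewrite expr0 mul1r -expR0 ler_expR oppr_le0 invr_ge0 ltW.
Qed.

Lemma bump_le1 a b k x : bump a b k x <= 1.
Proof.
rewrite -[leRHS](@big1_eq R 1 *%R _ (index_enum 'I_N) xpredT); apply: ler_prod => i _.
by rewrite mulr_ge0 ?flat_exp_ge0//= -[leRHS]mulr1 ler_pM ?flat_exp_ge0 ?flat_exp0_le1.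
Qed.

Lemma bump_out a b k x : ~ obox a b x -> bump a b k x = 0.
Proof.
move=> /existsNP[i /negP]; rewrite negb_and -!leNgt => h.
rewrite /bump (bigD1 i)//=.
have k0 : (0 : R) < k.+1%:R by [].
case/orP: h => h.
  by rewrite flat_exp_le0 ?mul0r// -mulrBr pmulr_rle0// subr_le0.
by rewrite [X in _ * X * _]flat_exp_le0 ?mulr0 ?mul0r// mulNr addrC -mulrBr pmulr_rle0// subr_le0.
Qed.

Lemma cvg_prod1 (I : Type) (s : seq I) (u : I -> nat -> R) :
  (forall i, u i k @[k --> \oo] --> (1 : R)) ->
  (\prod_(i <- s) u i k) @[k --> \oo] --> (1 : R).
Proof.
move=> hu; elim: s => [|i s IH].
  by under eq_fun do rewrite big_nil; exact: cvg_cst.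
have h := cvgM (hu i) IH; rewrite mulr1 in h.
by under eq_fun do rewrite big_cons; exact: h.
Qed.

Lemma flat_exp0_cvg (c : R) : 0 < c -> flat_exp 0 (k.+1%:R * c) @[k --> \oo] --> (1 : R).
Proof.
move=> c0; apply/cvgrPdist_le => e e0.
have ec : 0 < e * c by rewrite mulr_gt0.
near=> k.
have k0 : (0 : R) < k.+1%:R * c by rewrite mulr_gt0.
rewrite /flat_exp k0 expr0 mul1r.
have h1 : expR (- (k.+1%:R * c)^-1) <= 1.
  by rewrite -[leRHS]expR0 ler_expR oppr_le0 invr_ge0 ltW.
rewrite ger0_norm ?subr_ge0//.
have h2 := expR_ge1Dx (- (k.+1%:R * c)^-1).
have h3 : (k.+1%:R * c)^-1 <= e.
  rewrite invfM -ler_pdivlMr ?invr_gt0// invrK.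
  by apply/ltW; near: k; exact: (near_infty_natSinv_lt (PosNum ec)).
move: h2 h3; move: (_^-1) (expR _) => y z; lra.
Unshelve. all: by end_near.
Qed.

Lemma bump_cvg a b x : obox a b x -> bump a b k x @[k --> \oo] --> (1 : R).
Proof.
move=> xab; apply: cvg_prod1 => i; have /andP[h1 h2] := xab i.
rewrite -[X in _ --> X]mulr1; apply: cvgM.
  by under eq_fun do rewrite -mulrBr; apply: flat_exp0_cvg; rewrite subr_gt0.
by under eq_fun do rewrite mulNr addrC -mulrBr; apply: flat_exp0_cvg; rewrite subr_gt0.
Qed.

Lemma bump_support a b k : compact (closure [set x | bump a b k x != 0]).
Proof.
have K : compact [set v : E | forall i, `[a i, b i]%classic (v ord0 i)].
  by apply: (@rV_compact R N (fun i => `[a i, b i]%classic)) => i; exact: segment_compact.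
apply: (subclosed_compact _ K); first exact: closed_closure.
have cK := compact_closed (@norm_hausdorff _ _) K.
rewrite [X in _ `<=` X]((closure_id _).1 cK).
apply: closure_subset => x /= /eqP xb i.
have : obox a b x by apply: contrapT => h; apply: xb; exact: bump_out.
by move=> /(_ i) /andP[h1 h2]; rewrite /= in_itv/= !ltW.
Qed.

Lemma bump_test a b k : test_function (bump a b k).
Proof. by split; [move=> n; apply: flat_alg_Ck; exact: bump_flat|exact: bump_support]. Qed.

Lemma measurable_bump a b k : measurable_fun setT (bump a b k).
Proof. by apply: continuous_measurable_rV; apply: flat_alg_continuous; exact: bump_flat. Qed.

(** Dominated convergence along the bumps, which vanish off the box and tend to 1 on it. *)
Lemma integral_obox0 (f : E -> R) a b : measurable_fun setT f ->
  mu.-integrable (obox a b) (EFin \o f) ->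
  (forall k, \int[mu]_x (f x * bump a b k x) = 0) ->
  (\int[mu]_(x in obox a b) (f x)%:E = 0)%E.
Proof.
move=> mf fi H; have mB := measurable_obox a b.
have mk k : measurable_fun setT (fun x => f x * bump a b k x).
  by apply: measurable_funM => //; exact: measurable_bump.
have m1 k : measurable_fun (obox a b) (fun x => (f x * bump a b k x)%:E).
  by apply/measurable_EFinP; exact: measurable_funTS.
have m2 : measurable_fun (obox a b) (EFin \o f).
  by apply/measurable_EFinP; exact: measurable_funTS.
have le1 x k : (`|(f x * bump a b k x)%:E| <= `|(f x)%:E|)%E.
  by rewrite /= lee_fin normrM [`|bump _ _ _ _|]ger0_norm ?bump_ge0// ler_piMr// bump_le1.
have E0 k : (\int[mu]_(x in obox a b) (f x * bump a b k x)%:E = 0)%E.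
  have ik : mu.-integrable (obox a b) (fun x => (f x * bump a b k x)%:E).
    by apply: le_integrable fi => // x _; exact: le1.
  have fk := integrable_fin_num mB ik.
  rewrite -(fineK fk); congr (_%:E); rewrite -[RHS](H k) /Rintegral; congr (fine _).
  rewrite integral_mkcond; apply: eq_integral => x _; rewrite patchE.
  by case: ifPn => //; rewrite notin_setE => /bump_out ->; rewrite mulr0.
have m3 : \forall x \ae mu, obox a b x -> (f x * bump a b k x)%:E @[k --> \oo] --> (f x)%:E.
  apply: aeW => x xB; apply: cvg_EFin; first by near=> k.
  by rewrite -[X in _ --> X]mulr1; apply: cvgMr; exact: bump_cvg.
have m4 : \forall x \ae mu, forall k, obox a b x -> (`|(f x * bump a b k x)%:E| <= `|(f x)%:E|)%E.
  by apply: aeW => x k _; exact: le1.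
have [_ _] := dominated_convergence mB m1 m2 m3 (integrable_abse fi) m4.
under eq_fun do rewrite E0.
by move=> h; rewrite -(cvg_lim _ h)// lim_cst.
Unshelve. all: by end_near.
Qed.

(** On a large box the positive and negative parts of [f] are densities of finite measures. These
    agree on all boxes, hence on all Borel sets, so [f] vanishes almost everywhere there. *)
Lemma fundamental_lemma (f : E -> R) : measurable_fun setT f ->
  (forall a b, mu.-integrable (obox a b) (EFin \o f)) ->
  (forall a b k, \int[mu]_x (f x * bump a b k x) = 0) ->
  {ae mu, forall x, f x = 0}.
Proof.
move=> mf fi H.
have key n : {ae mu, forall x, obox (fun=> - n%:R) (fun=> n%:R) x -> f x = 0}.
  pose Q : set E := obox (fun=> - n%:R) (fun=> n%:R).
  have mQ : measurable Q := measurable_obox _ _.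
  pose F := (EFin \o f) \_ Q.
  have iF : mu.-integrable setT F.
    by have /(integrable_mkcond _ mQ) := fi (fun=> - n%:R) (fun=> n%:R).
  have mF : measurable_fun setT F by case/integrableP: iF.
  have iFA A : measurable A -> mu.-integrable A F.
    by move=> mA; apply: integrableS iF.
  pose m1 := density_measure mu (measurable_funepos mF) (funepos_ge0 F).
  pose m2 := density_measure mu (measurable_funeneg mF) (funeneg_ge0 F).
  have fin1 A : measurable A -> (m1 A < +oo)%E.
    move=> mA; have /integrableP[_] := integrable_funepos mA (iFA A mA).
    by under eq_integral do rewrite gee0_abs ?funepos_ge0//.
  have fin2 A : measurable A -> (m2 A < +oo)%E.
    move=> mA; have /integrableP[_] := integrable_funeneg mA (iFA A mA).
    by under eq_integral do rewrite gee0_abs ?funeneg_ge0//.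
  have F0 a b : (\int[mu]_(x in obox a b) F x = 0)%E.
    rewrite /F -integral_mkcondr.
    have [c [d ->]] : oboxes (obox a b `&` Q).
      by apply: oboxes_setI; eexists; eexists.
    by apply: integral_obox0 => //.
  have mAll : forall A, measurable A -> m1 A = m2 A.
    apply: obox_measure_unique.
      move=> a b; have := F0 a b; rewrite integralE => /eqP.
      rewrite sube_eq; last 2 first.
      - by rewrite ge0_fin_numE ?measure_ge0//; [exact: fin1 (measurable_obox a b)|exact: measure_ge0 m1 _].
      - by [].
      by rewrite add0e => /eqP.
    by move=> a b; apply: fin1; exact: measurable_obox.
  have : ae_eq mu setT F (cst 0%E).
    apply: integral_ae_eq => // A _ mA.
    rewrite integral0 integralE; have := mAll A mA; rewrite /m1 /m2 /= /density => ->.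
    rewrite subee// ge0_fin_numE; first exact: fin2.
    exact: (measure_ge0 m2).
  by apply: filterS => x /(_ I) /=; rewrite /F patchE => + xQ; rewrite mem_set// => -[].
have := @ae_foralln _ _ _ mu (fun n x => obox (fun=> - n%:R) (fun=> n%:R) x -> f x = 0) key.
apply: filterS => x hx; have [n _ xn] : (\bigcup_n obox (fun=> - n%:R) (fun=> n%:R)) x by rewrite obox_cover.
exact: hx xn.
Qed.
End test_functions.

(** * Powers and p-integrable functions *)

Section power_inequalities.
Variable R : realType.
Implicit Types x y p : R.

Lemma powR_normD x y p : 0 < p -> `|x + y| `^ p <= 2 `^ p * (`|x| `^ p + `|y| `^ p).
Proof.
move=> p0; wlog xy : x y / `|x| <= `|y|.
  move=> H; have [xy|/ltW yx] := leP `|x| `|y|; first exact: H.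
  by rewrite addrC [X in _ * X]addrC; exact: H.
apply: (@le_trans _ _ ((2 * `|y|) `^ p)).
  apply: ge0_ler_powR; rewrite ?nnegrE ?(ltW p0) ?mulr_ge0//.
  by apply: le_trans (ler_normD _ _) _; lra.
by rewrite powRM// ler_pM2l ?powR_gt0// lerDr powR_ge0.
Qed.

Lemma ler_powR1 x p : 1 <= p -> 0 <= x -> x <= 1 + x `^ p.
Proof.
move=> p1 x0; have [x1|x1] := leP x 1; first by apply: le_trans x1 _; rewrite lerDl powR_ge0.
by apply: le_trans (le1r_powR (ltW x1) p1) _; rewrite lerDr.
Qed.

Lemma continuous_norm_powR p : 0 < p -> continuous (fun x : R => `|x| `^ p).
Proof.
move=> p0 x; have [->|x0] := eqVneq x 0.
  apply/cvgrPdist_le => e e0; near=> t.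
  rewrite normr0 powR0 ?gt_eqF// sub0r normrN ger0_norm ?powR_ge0//.
  have -> : e = (e `^ p^-1) `^ p by rewrite -powRrM mulVf ?gt_eqF// powRr1// ltW.
  apply: ge0_ler_powR; rewrite ?nnegrE ?powR_ge0 ?(ltW p0)//.
  near: t; apply/nbhs_ballP; exists (e `^ p^-1) => /=; first exact: powR_gt0.
  by move=> y; rewrite /ball/= sub0r normrN; exact: ltW.
apply: (@continuous_comp _ _ _ (fun t : R => `|t|) (fun t : R => t `^ p)); first exact: norm_continuous.
apply: differentiable_continuous; apply/derivable1_diffP.
by apply: derivable_powR; rewrite in_itv/= andbT normr_gt0.
Unshelve. all: by end_near.
Qed.
End power_inequalities.

Section Lp.
Context d (T : measurableType d) (R : realType) (m : {measure set T -> \bar R}).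
Implicit Types (f g : T -> R) (p : R).

Definition Lp p f := measurable_fun setT f /\ (\int[m]_x (`|f x| `^ p)%:E < +oo)%E.

Lemma measurable_powR_norm p f : measurable_fun setT f -> measurable_fun setT (fun x => `|f x| `^ p).
Proof.
move=> mf; apply: (measurableT_comp (measurable_powR p)).
exact: measurableT_comp.
Qed.

Let mpE p f : measurable_fun setT f -> measurable_fun setT (fun x => (`|f x| `^ p)%:E).
Proof. by move=> mf; apply/measurable_EFinP; exact: measurable_powR_norm. Qed.

Lemma Lnorm_powRE p f : ('N[m]_(p%:E)[EFin \o f] = (\int[m]_x (`|f x| `^ p)%:E) `^ p^-1)%E.
Proof. by rewrite unlock. Qed.

Lemma LfunP_Lp p f : 0 < p -> (f \in Lfun m p%:E) <-> Lp p f.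
Proof.
move=> p0; rewrite /Lp; split.
  rewrite inE => /andP[/[!inE]/= mf]; rewrite /finite_norm Lnorm_powRE => h; split => //.
  by apply: lty_poweRy h; rewrite invr_eq0 gt_eqF.
move=> [mf h]; rewrite inE; apply/andP; split; first by rewrite inE.
by rewrite inE/= /finite_norm Lnorm_powRE poweR_lty.
Qed.

Lemma hoelder_powR p f g : 1 < p -> measurable_fun setT f -> measurable_fun setT g ->
  (\int[m]_x (`|f x * g x|)%:E <=
   (\int[m]_x (`|f x| `^ p)%:E) `^ p^-1 *
   (\int[m]_x (`|g x| `^ (p / (p - 1)))%:E) `^ (p / (p - 1))^-1)%E.
Proof.
move=> p1 mf mg; have p0 : 0 < p by exact: lt_trans p1.
have h1 : 0 < p / (p - 1) by rewrite divr_gt0// subr_gt0.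
have h2 : p^-1 + (p / (p - 1))^-1 = 1.
  by rewrite invf_div -[X in X + _]mul1r -mulrDl addrC subrK mulfV ?gt_eqF.
by have := @hoelder _ _ _ m f g p (p / (p - 1)) mf mg p0 h1 h2;
  rewrite (Lnorm_powRE p) (Lnorm_powRE (p / (p - 1))) Lnorm1.
Qed.

Lemma Lp_integrable_powR p f : Lp p f -> m.-integrable setT (fun x => (`|f x| `^ p)%:E).
Proof.
move=> [mf fi]; apply/integrableP; split; first exact: mpE.
by under eq_integral do rewrite /= ger0_norm ?powR_ge0//.
Qed.

Lemma integral_powR_ge0 p f (A : set T) : (0 <= \int[m]_(x in A) (`|f x| `^ p)%:E)%E.
Proof. by apply: integral_ge0 => x _; rewrite lee_fin powR_ge0. Qed.

Lemma Lp_integrableM p f g : 1 < p -> Lp p f -> Lp (p / (p - 1)) g ->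
  m.-integrable setT (fun x => (f x * g x)%:E).
Proof.
move=> p1 [mf fi] [mg gi]; apply/integrableP; split.
  by apply/measurable_EFinP; exact: measurable_funM.
apply: le_lt_trans (hoelder_powR p1 mf mg) _.
have h (x : \bar R) r : (0 <= x)%E -> (x < +oo)%E -> (x `^ r \is a fin_num)%E.
  by move=> x0 x1; apply: fin_num_poweR; rewrite ge0_fin_numE.
by rewrite ltey_eq (fin_numM (h _ _ _ fi) (h _ _ _ gi))// integral_powR_ge0.
Qed.

Lemma Lp_fineK p f : Lp p f -> (\int[m]_x (`|f x| `^ p)%:E = (\int[m]_x (`|f x| `^ p))%:E)%E.
Proof. by move=> [mf fi]; rewrite fineK// ge0_fin_numE ?integral_powR_ge0. Qed.

Lemma Rintegral_powR_ge0 p f : 0 <= \int[m]_x (`|f x| `^ p).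
Proof. by apply: fine_ge0; exact: integral_powR_ge0. Qed.

Lemma Lp_hoelder p f g : 1 < p -> Lp p f -> Lp (p / (p - 1)) g ->
  `|\int[m]_x (f x * g x)| <= (\int[m]_x (`|f x| `^ p)) `^ p^-1 *
    (\int[m]_x (`|g x| `^ (p / (p - 1)))) `^ (p / (p - 1))^-1.
Proof.
move=> p1 fp gp; have i := Lp_integrableM p1 fp gp.
apply: le_trans (le_normr_Rintegral measurableT i) _.
rewrite -lee_fin fineK; last first.
  by apply: integrable_fin_num => //; exact: integrable_abse i.
apply: le_trans (hoelder_powR p1 fp.1 gp.1) _.
by rewrite (Lp_fineK fp) (Lp_fineK gp) !poweR_EFin -EFinM.
Qed.

Lemma Lp_integrable_on p f (B : set T) : 1 <= p -> measurable B -> (m B < +oo)%E ->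
  Lp p f -> m.-integrable B (EFin \o f).
Proof.
move=> p1 mB Bf fp; have mf := fp.1.
have i1 : m.-integrable B (fun x => (1 + `|f x| `^ p)%:E).
  apply: (@eq_integrable _ _ _ m _ mB (cst 1%E \+ (fun x => (`|f x| `^ p)%:E))%E) => //.
  apply: integrableD => //.
    apply/integrableP; split => //; under eq_integral do rewrite abse1.
    by rewrite integral_cst// mul1e.
  by apply: integrableS (Lp_integrable_powR fp).
apply: le_integrable i1 => //; first by apply/measurable_EFinP; exact: measurable_funTS.
move=> x _ /=; rewrite lee_fin [leRHS]ger0_norm ?addr_ge0 ?powR_ge0//.
exact: ler_powR1.
Qed.

Lemma LpD p f g : 0 < p -> Lp p f -> Lp p g -> Lp p (fun x => f x + g x).
Proof.
move=> p0 fp gp; have [mf mg] := (fp.1, gp.1).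
split; first exact: measurable_funD.
apply: (@le_lt_trans _ _ (\int[m]_x (2 `^ p * (`|f x| `^ p + `|g x| `^ p))%:E)%E).
  apply: ge0_le_integral => //.
  - by apply: mpE; exact: measurable_funD.
  - apply/measurable_EFinP; apply: measurable_funM => //.
    by apply: measurable_funD; exact: measurable_powR_norm.
  - by move=> x _; rewrite lee_fin powR_normD.
under eq_integral do rewrite EFinM.
rewrite (ge0_integralZl _ measurableT); last 3 first.
- by apply/measurable_EFinP; apply: measurable_funD; exact: measurable_powR_norm.
- by move=> x _; rewrite lee_fin addr_ge0 ?powR_ge0.
- by rewrite lee_fin powR_ge0.
under eq_integral do rewrite EFinD.
rewrite (ge0_integralD _ measurableT); last 4 first.
- by move=> x _; rewrite lee_fin powR_ge0.
- exact: mpE.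
- by move=> x _; rewrite lee_fin powR_ge0.
- exact: mpE.
by rewrite (Lp_fineK fp) (Lp_fineK gp) -EFinD -EFinM ltry.
Qed.

Lemma LpZ p f (t : R) : Lp p f -> Lp p (fun x => t * f x).
Proof.
move=> [mf fi]; split; first exact: measurable_funM.
under eq_integral do rewrite normrM powRM// EFinM.
rewrite (ge0_integralZl _ measurableT); last 3 first.
- exact: mpE.
- by move=> x _; rewrite lee_fin powR_ge0.
- by rewrite lee_fin powR_ge0.
by rewrite (Lp_fineK (conj mf fi)) -EFinM ltry.
Qed.

Lemma LpN p f : Lp p f -> Lp p (fun x => - f x).
Proof.
by move=> fp; have := LpZ (-1) fp; under eq_fun do rewrite mulN1r.
Qed.

Lemma LpB p f g : 0 < p -> Lp p f -> Lp p g -> Lp p (fun x => f x - g x).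
Proof. by move=> p0 fp gp; exact: (LpD p0 fp (LpN gp)). Qed.

Lemma Lp0 p : 0 < p -> Lp p (fun=> 0).
Proof.
move=> p0; split => //.
by under eq_integral do rewrite normr0 powR0 ?gt_eqF//; rewrite integral0.
Qed.

Lemma Lp_le p f g (C : R) : 0 < p -> measurable_fun setT g -> (forall x, `|g x| <= C * `|f x|) -> 0 <= C ->
  Lp p f -> Lp p g.
Proof.
move=> p0 mg H C0 fp; have [mf fi] := LpZ C fp; split; first exact: mg.
apply: le_lt_trans fi; apply: ge0_le_integral => //.
- exact: mpE.
- exact: mpE.
- move=> x _; rewrite lee_fin; apply: ge0_ler_powR; rewrite ?nnegrE ?(ltW p0)//.
  by rewrite normrM (ger0_norm C0).
Qed.
End Lp.

Section limits.
Context d (T : measurableType d) (R : realType) (m : {measure set T -> \bar R}).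

Lemma cauchy_seq_cvg (u : nat -> R) :
  (forall e : R, 0 < e -> exists K, forall i, (K <= i)%N -> `|u i - u K| <= e) -> cvgn u.
Proof.
move=> H; apply/cauchy_cvgP/cauchy_exP => e /= e0.
have [K HK] := H _ (divr_gt0 e0 (ltr0n R 2)).
exists (u K); exists K => // i /= Ki; rewrite /ball/= distrC.
by apply: le_lt_trans (HK i Ki) _; rewrite ltr_pdivrMr// ltr_pMr// ltr1n.
Qed.

Lemma fatou_cvg (h : nat -> T -> R) (g : T -> R) (c : \bar R) :
  (forall n, measurable_fun setT (h n)) -> (forall n x, 0 <= h n x) ->
  (forall x, h n x @[n --> \oo] --> g x) ->
  (forall n, (\int[m]_x (h n x)%:E <= c)%E) -> (\int[m]_x (g x)%:E <= c)%E.
Proof.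
move=> mh h0 hg hc.
have := @fatou _ _ _ m setT measurableT (fun n x => (h n x)%:E).
have E x : limn_einf (fun n => (h n x)%:E) = (g x)%:E.
  rewrite limn_einf_lim; apply/cvg_lim => //; apply: cvg_einfs.
  by apply: cvg_EFin (hg x); near=> n.
under eq_integral do rewrite E.
move=> H; apply: le_trans (H _ _) _.
- by move=> n; exact/measurable_EFinP.
- by move=> n x _; rewrite lee_fin.
rewrite limn_einf_lim; apply: lime_le; first exact: is_cvg_einfs.
apply: nearW => n; apply: le_trans (hc n).
by apply: ereal_inf_lbound; exists n => /=.
Unshelve. all: by end_near.
Qed.
End limits.

(** * Completeness of L^p *)

Section Lp_complete.
Context d (T : measurableType d) (R : realType) (m : {measure set T -> \bar R}).
Variable p : R.
Hypothesis p1 : 1 < p.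
Let p0 : 0 < p. Proof. exact: lt_trans p1. Qed.
Variable f : nat -> T -> R.
Hypothesis fp : forall n, Lp m p (f n).
Hypothesis f_cauchy : forall e : R, 0 < e -> exists K, forall i j, (K <= i)%N -> (K <= j)%N ->
  \int[m]_x (`|f i x - f j x| `^ p) <= e.

(** The rate [1 / (2 * 2^p)] is chosen so that, after multiplication by the weights [(2^p)^k] used
    below, the terms still decay like [2^-k]. *)
Let fast_subseq : exists s : nat -> nat, (forall k, (s k < s k.+1)%N) /\
  forall k i j, (s k <= i)%N -> (s k <= j)%N ->
    \int[m]_x (`|f i x - f j x| `^ p) <= (2 `^ p *+ 2)^-1 ^+ k.
Proof.
have c0 k : 0 < (2 `^ p *+ 2)^-1 ^+ k :> R.
  by rewrite exprn_gt0// invr_gt0 pmulrn_lgt0// powR_gt0.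
have /choice[K HK] := fun k => f_cauchy (c0 k).
pose s := fix s k := if k is k'.+1 then maxn (s k').+1 (K k) else K 0%N.
have sK k : (K k <= s k)%N by case: k => [|k] //=; rewrite leq_maxr.
exists s; split => [k|k i j ki kj]; first by rewrite /= leq_maxl.
by apply: HK; [exact: leq_trans (sK k) ki|exact: leq_trans (sK k) kj].
Qed.

Lemma Lp_complete : exists2 g, Lp m p g & forall e : R, 0 < e -> exists K, forall n, (K <= n)%N ->
  \int[m]_x (`|g x - f n x| `^ p) <= e.
Proof.
have [s [s_mono s_fast]] := fast_subseq.
have mf n : measurable_fun setT (f n) := (fp n).1.
pose D k x := f (s k.+1) x - f (s k) x.
have DP k : Lp m p (D k) by exact: (LpB p0 (fp _) (fp _)).
pose h k x := ((2 `^ p) ^+ k * `|D k x| `^ p)%:E.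
have mh k : measurable_fun setT (h k).
  apply/measurable_EFinP; apply: measurable_funM => //; apply: measurable_powR_norm.
  exact: (DP k).1.
have h0 k x : (0 <= h k x)%E by rewrite lee_fin mulr_ge0 ?powR_ge0// exprn_ge0// powR_ge0.
have ih k : (\int[m]_x h k x <= (2^-1 ^+ k)%:E)%E.
  rewrite /h; under eq_integral do rewrite EFinM.
  rewrite (ge0_integralZl _ measurableT); last 3 first.
  - by apply/measurable_EFinP; apply: measurable_powR_norm; exact: (DP k).1.
  - by move=> x _; rewrite lee_fin powR_ge0.
  - by rewrite lee_fin exprn_ge0// powR_ge0.
  rewrite Lp_fineK// -EFinM lee_fin.
  have := s_fast k (s k) (s k.+1) (leqnn _) (ltnW (s_mono k)).
  under eq_Rintegral do rewrite distrC.
  move/(ler_wpM2l (exprn_ge0 k (powR_ge0 2 p))) => /le_trans; apply.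
  have p2 : 0 < 2 `^ p :> R by exact: powR_gt0.
  by rewrite -exprMn; have -> : 2 `^ p / (2 `^ p *+ 2) = 2^-1 :> R by field; rewrite gt_eqF.
(* [S] is integrable, hence finite almost everywhere. Where it is finite, the weights give
   [|D k x| <= C * 2^-k] and the subsequence converges. *)
pose S x := (\sum_(k <oo) h k x)%E.
have iS : (\int[m]_x S x < +oo)%E.
  rewrite integral_nneseries//.
  apply: le_lt_trans (_ : _ <= \sum_(k <oo) ((2^-1 ^+ k)%:E : \bar R))%E _.
    by apply: lee_nneseries => [k _ _|k _]; [exact: integral_ge0|exact: ih].
  apply: (@le_lt_trans _ _ 2%:E); last by rewrite ltry.
  apply: lime_le; first by apply: is_cvg_nneseries => k _ _; rewrite lee_fin exprn_ge0.
  apply: nearW => n; rewrite sumEFin lee_fin.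
  have -> : \sum_(0 <= k < n) (2^-1 : R) ^+ k = 2 - 2 * 2^-1 ^+ n.
    elim: n => [|n IH]; first by rewrite big_nil expr0; lra.
    by rewrite big_nat_recr//= IH exprS; lra.
  by rewrite gerBl mulr_ge0// exprn_ge0.
have mS : measurable_fun setT S by apply: ge0_emeasurable_sum.
have S0 x : (0 <= S x)%E by apply: nneseries_ge0.
have aeS : {ae m, forall x, (S x < +oo)%E}.
  have iS' : m.-integrable setT S.
    by apply/integrableP; split => //; under eq_integral do rewrite gee0_abs//.
  have := integrable_ae measurableT iS'.
  by apply: filterS => x /(_ I); rewrite ge0_fin_numE.
have aecv : {ae m, forall x, cvgn (fun k => f (s k) x)}.
  apply: filterS aeS => x Sx.
  have [C C0 HC] : exists2 C : R, 0 <= C & forall k, `|D k x| <= C * 2^-1 ^+ k.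
    exists (fine (S x) `^ p^-1); first exact: powR_ge0.
    move=> k; have hk : (h k x <= S x)%E.
      apply: le_trans (nneseries_lim_ge k.+1 _) => //.
      by rewrite big_nat_recr//= leeDr// sume_ge0.
    have {}hk : (2 ^+ k * `|D k x|) `^ p <= fine (S x).
      rewrite -lee_fin fineK ?ge0_fin_numE//; apply: le_trans hk.
      by rewrite lee_fin powRM ?exprn_ge0// -powR_mulrn// powRAC powR_mulrn ?powR_ge0.
    have : 2 ^+ k * `|D k x| <= fine (S x) `^ p^-1.
      have e : 2 ^+ k * `|D k x| = ((2 ^+ k * `|D k x|) `^ p) `^ p^-1.
        by rewrite -powRrM mulfV ?gt_eqF// powRr1// mulr_ge0// exprn_ge0.
      by rewrite e; apply: ge0_ler_powR; rewrite ?nnegrE ?powR_ge0 ?invr_ge0 ?(ltW p0)// fine_ge0.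
    by rewrite exprVn ler_pdivlMr ?exprn_gt0// mulrC.
  have tele i k : (k <= i)%N -> `|f (s i) x - f (s k) x| <= 2 * C * (2^-1 ^+ k - 2^-1 ^+ i).
    elim: i => [|i IH]; first by rewrite leqn0 => /eqP ->; rewrite !subrr normr0 mulr0.
    rewrite leq_eqVlt => /orP[/eqP ->|]; first by rewrite !subrr normr0 mulr0.
    rewrite ltnS => /IH {}IH.
    have -> : f (s i.+1) x - f (s k) x = D i x + (f (s i) x - f (s k) x).
      by rewrite /D addrA subrK.
    apply: le_trans (ler_normD _ _) _; have := HC i; rewrite exprS; lra.
  apply: cauchy_seq_cvg => e e0.
  have C1 : 0 < 2 * C + 1 by lra.
  have [K] := ltr_add_invr (divr_gt0 e0 C1).
  rewrite add0r => HK; exists K => i Ki; apply: le_trans (tele _ _ Ki) _.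
  have hK : (2^-1 : R) ^+ K <= K.+1%:R^-1.
    rewrite exprVn lef_pV2 ?posrE ?exprn_gt0// -natrX ler_nat.
    exact: ltn_expl.
  have h1 : (2^-1 : R) ^+ K - 2^-1 ^+ i <= e / (2 * C + 1).
    by apply: le_trans (ltW HK); apply: le_trans hK; rewrite gerBl exprn_ge0.
  apply: le_trans (ler_wpM2l _ h1) _; first by rewrite mulr_ge0.
  by rewrite mulrCA ger_pMr// ler_pdivrMr; lra.
have [A [mA A0 HA]] := aecv.
(* Set to 0 on the exceptional null set, so that the limit exists everywhere and is measurable. *)
pose f' k x : R := f (s k) x * \1_(~` A) x.
have mf' k : measurable_fun setT (f' k).
  by apply: measurable_funM => //; apply: measurable_indic; exact: measurableC.
have cvf' x : cvgn (fun k => f' k x).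
  rewrite /f' indicE; have [xA|xA] := pselect (A x).
    by rewrite memNset//=; under eq_fun do rewrite mulr0; exact: is_cvg_cst.
  rewrite mem_set//=; under eq_fun do rewrite mulr1.
  by apply: contrapT => ncv; apply: xA; exact: HA.
pose g x := limn (fun k => f' k x).
have gP x : f' k x @[k --> \oo] --> g x by exact: cvf'.
have mg : measurable_fun setT g by apply: (measurable_fun_cvg mf') => x _; exact: gP.
have s_le k i : (k <= i)%N -> (s k <= s i)%N.
  elim: i => [|i IH]; first by rewrite leqn0 => /eqP ->.
  by rewrite leq_eqVlt => /orP[/eqP -> //|/IH hi]; exact: leq_trans hi (ltnW (s_mono i)).
(* Fatou's lemma along the subsequence turns the Cauchy estimate into a bound on the distance to the
   limit. *)
have key j k0 : (s k0 <= j)%N ->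
    (\int[m]_x (`|g x - f j x| `^ p)%:E <= ((2 `^ p *+ 2)^-1 ^+ k0)%:E)%E.
  move=> kj; apply: (@fatou_cvg _ _ _ m (fun n x => `|f' (n + k0)%N x - f j x| `^ p)).
  - by move=> n; apply: measurable_powR_norm; exact: measurable_funB.
  - by move=> n x; exact: powR_ge0.
  - move=> x; have h1 : f' (n + k0)%N x @[n --> \oo] --> g x.
      by have := gP x; rewrite -(cvg_shiftn k0).
    have h2 : (f' (n + k0)%N x - f j x) @[n --> \oo] --> g x - f j x.
      by apply: cvgB => //; exact: cvg_cst.
    exact: (cvg_comp _ _ h2 (@continuous_norm_powR R p p0 _)).
  - move=> n.
    have -> : (\int[m]_x (`|f' (n + k0)%N x - f j x| `^ p)%:E = \int[m]_x (`|f (s (n + k0)%N) x - f j x| `^ p)%:E)%E.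
      apply: ge0_ae_eq_integral => //.
      + by apply/measurable_EFinP; apply: measurable_powR_norm; exact: measurable_funB.
      + by apply/measurable_EFinP; apply: measurable_powR_norm; exact: measurable_funB.
      + exists A; split => // x /= hx; apply: contrapT => xA; apply: hx => _.
        by rewrite /f' indicE mem_set//= mulr1.
    rewrite (Lp_fineK (LpB p0 (fp (s (n + k0)%N)) (fp j))) lee_fin.
    by apply: s_fast => //; apply: s_le; rewrite leq_addl.
have gfp j k0 : (s k0 <= j)%N -> Lp m p (fun x => g x - f j x).
  by move=> kj; split; [exact: measurable_funB|exact: le_lt_trans (key j k0 kj) (ltry _)].
exists g.
  have -> : g = fun x => (g x - f (s 0%N) x) + f (s 0%N) x by apply/funext => x; rewrite subrK.
  exact: (LpD p0 (gfp (s 0%N) 0%N (leqnn _)) (fp _)).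
move=> e e0.
have [k0] := ltr_add_invr e0; rewrite add0r => Hk.
exists (s k0) => j kj; have := key j k0 kj; rewrite (Lp_fineK (gfp j k0 kj)) lee_fin.
move/le_trans; apply; apply: le_trans (ltW Hk).
have p2 : 1 <= 2 `^ p :> R.
  by rewrite -[leLHS](powRr0 (2 : R)); apply: ler_powR; [rewrite ler1n|exact: ltW].
have : (2 `^ p *+ 2)^-1 ^+ k0 <= (2^-1 : R) ^+ k0.
  apply: lerXn2r; rewrite ?nnegrE ?invr_ge0 ?mulrn_wge0 ?powR_ge0//.
  by rewrite lef_pV2 ?posrE ?pmulrn_lgt0 ?powR_gt0// -[(2 `^ p) *+ 2]mulr_natr ler_peMl// -[leLHS](powRr0 2) ler_powR ?ler1n// ltW.
move/le_trans; apply; rewrite exprVn lef_pV2 ?posrE ?exprn_gt0// -natrX ler_nat.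
exact: ltn_expl.
Qed.
End Lp_complete.

(** * Weak gradients along segments *)

Section test_function_facts.
Variables (R : realType) (N : nat).
Local Notation E := 'rV[R]_N.
Local Notation mu := (lebesgue_rV R N).

(** The compact support lies in a box. Off the support [phi] vanishes in a neighbourhood, so its
    partial derivatives vanish there as well. *)
Lemma test_function_bound (phi : E -> R) : test_function phi -> exists a b (M : R),
  [/\ 0 <= M, forall x, `|phi x| <= M, forall i x, `|partial i phi x| <= M &
      forall x, ~ obox a b x -> phi x = 0 /\ forall i, partial i phi x = 0].
Proof.
move=> [Cphi cS]; set S := closure _ in cS.
have [M0 [M0r HM0]] := compact_bounded cS.
pose r := `|M0| + 1.
have Sr x : S x -> forall i, `|x ord0 i| <= r.
  move=> Sx i; have : `|x| <= r by apply: HM0 => //; rewrite /r (le_lt_trans (ler_norm _))// ltrDl.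
  apply: le_trans; rewrite [leRHS]mx_normrE.
  exact: (le_bigmax _ (fun ij : 'I_1 * 'I_N => `|x ij.1 ij.2|) (ord0, i)).
have bnd (f : E -> R) : continuous f -> exists2 M : R, 0 <= M & forall x, S x -> `|f x| <= M.
  move=> cf; have [M [Mr HM]] := compact_bounded (continuous_compact (continuous_subspaceT cf) cS).
  exists (`|M| + 1); first by rewrite addr_ge0.
  move=> x Sx; apply: HM; last by exists x.
  by rewrite (le_lt_trans (ler_norm _))// ltrDl.
have out x : ~ S x -> phi x = 0 /\ forall i, partial i phi x = 0.
  move=> Sx; have oS : open (~` S) by apply: closed_openC; exact: closed_closure.
  have nS : \forall y \near x, phi y = 0.
    have := open_nbhs_nbhs (conj oS Sx); apply: filterS => y Sy.
    apply: contrapT => py; apply: Sy; apply: subset_closure; exact/eqP.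
  split; first exact: nbhs_singleton nS.
  move=> i; have h := @is_derive_cst R E R 0 x (basis_vec i).
  have : is_derive x (basis_vec i) phi 0.
    by apply: near_eq_is_derive h; apply: filterS nS => y ->.
  by case.
have c0 : continuous phi := Cphi 0%N.
have ci i : continuous (partial i phi) by have [_ _ /(_ i)] := Cphi 1%N.
have [Mf Mf0 HMf] := bnd _ c0.
have /choice[Mi HMi] : forall i, exists M : R, 0 <= M /\ forall x, S x -> `|partial i phi x| <= M.
  by move=> i; have [M ? ?] := bnd _ (ci i); exists M.
exists (fun=> - (r + 1)), (fun=> r + 1), (Mf + \sum_i Mi i).
have sM : 0 <= \sum_i Mi i by apply: sumr_ge0 => i _; have [] := HMi i.
split.
- by rewrite addr_ge0.
- move=> x; have [Sx|Sx] := pselect (S x).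
    by apply: le_trans (HMf _ Sx) _; rewrite lerDl.
  by have [-> _] := out x Sx; rewrite normr0 addr_ge0.
- move=> i x; have [Sx|Sx] := pselect (S x).
    have [_ /(_ x Sx)/le_trans] := HMi i; apply; rewrite (bigD1 i)//= addrCA lerDl.
    by rewrite addr_ge0// sumr_ge0// => j _; have [] := HMi j.
  by have [_ ->] := out x Sx; rewrite normr0 addr_ge0.
- move=> x hx; apply: out => Sx; apply: hx => i; rewrite -ltr_norml.
  by apply: le_lt_trans (Sr x Sx i) _; rewrite ltrDl.
Qed.

Lemma test_function_continuous (phi : E -> R) : test_function phi -> continuous phi.
Proof. by move=> [/(_ 0%N)]. Qed.

Lemma partial_continuous (phi : E -> R) i : test_function phi -> continuous (partial i phi).
Proof. by move=> [/(_ 1%N)[_ _ /(_ i)]]. Qed.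

Lemma measurable_test (phi : E -> R) : test_function phi -> measurable_fun setT phi.
Proof. by move=> t; apply: continuous_measurable_rV; exact: test_function_continuous. Qed.

Lemma measurable_partial (phi : E -> R) i : test_function phi -> measurable_fun setT (partial i phi).
Proof. by move=> t; apply: continuous_measurable_rV; exact: partial_continuous. Qed.

Lemma flat_alg_is_derive (f : E -> R) x v : flat_alg f ->
  is_derive x v f (\sum_i v ord0 i * partial i f x).
Proof.
move=> /flat_alg_derive[Df hf Ef]; have := Ef x v.
suff -> : \sum_i v ord0 i * Df i x = \sum_i v ord0 i * partial i f x by [].
apply: eq_bigr => i _; congr (_ * _).
have [_] := Ef x (basis_vec i); rewrite -/(partial i f x) => ->.
rewrite (bigD1 i)//= big1 ?addr0 ?mxE ?eqxx ?mul1r// => j /negbTE ji.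
by rewrite mxE eqxx ji mul0r.
Qed.

Lemma partial_shift (f : E -> R) i c x : partial i (fun y => f (y + c)) x = partial i f (x + c).
Proof.
rewrite /partial /derive; set g1 := fun h => h^-1 *: _; set g2 := fun h => h^-1 *: _.
suff -> : g1 = g2 by [].
by apply/funext => h; rewrite /g1 /g2 /= addrA.
Qed.

Lemma bump_shift (a b : 'I_N -> R) k (c x : E) :
  bump a b k (x + c) = bump (fun i => a i - c ord0 i) (fun i => b i - c ord0 i) k x.
Proof.
by apply: eq_bigr => i _; congr (flat_exp 0 _ * flat_exp 0 _); rewrite mxE; ring.
Qed.

Lemma measurable_segment (z : E) :
  measurable_fun setT (fun xs : E * measurableTypeR R => xs.1 + xs.2 *: z).
Proof.
apply: measurable_fun_rV => i; under eq_fun do rewrite !mxE.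
apply: measurable_funD; first exact: (measurableT_comp (@measurable_coord R N i)).
by apply: measurable_funM => //; exact: measurable_snd.
Qed.
End test_function_facts.

(** * Fubini's theorem over the unit interval *)

Section fubini01.
Variables (R : realType) (N : nat).
Local Notation E := 'rV[R]_N.
Local Notation mu := (lebesgue_rV R N).
Local Notation leb := (@lebesgue_measure R).
Local Notation I01 := (`[(0 : R), (1 : R)]%classic).

Let mI : measurable (I01 : set R). Proof. exact: measurable_itv. Qed.

Lemma measurable_int01 (H : E * measurableTypeR R -> R) : measurable_fun setT H ->
  measurable_fun setT (fun x => \int[leb]_(s in I01) H (x, s)).
Proof.
move=> mH; pose F := fun w : E * measurableTypeR R => ((H w * \1_I01 w.2)%:E).
have mF : measurable_fun setT F.
  apply/measurable_EFinP; apply: measurable_funM => //.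
  exact: (measurableT_comp (measurable_indic mI)).
have e x : \int[leb]_(s in I01) H (x, s) =
  fine ((\int[leb]_s F^\+ (x, s)) - (\int[leb]_s F^\- (x, s)))%E.
  rewrite /Rintegral integral_mkcond integralE; congr (fine (_ - _)%E);
  apply: eq_integral => s _; rewrite ?funeposE ?funenegE /F patchE indicE;
  by case: ifP; rewrite ?mulr1 ?mulr0.
under eq_fun do rewrite e.
apply: measurableT_comp; first by [].
apply: emeasurable_funB.
  have := @measurable_fun_fubini_tonelli_F _ _ _ _ R leb (F^\+)%E (measurable_funepos mF).
  by apply => w; exact: funepos_ge0.
have := @measurable_fun_fubini_tonelli_F _ _ _ _ R leb (F^\-)%E (measurable_funeneg mF).
by apply => w; exact: funeneg_ge0.
Qed.

(** A bound on the slices uniform in [s] gives integrability on the product, as the interval has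
    length one. *)
Lemma Rfubini01 (H : E * measurableTypeR R -> R) (C : R) : measurable_fun setT H ->
  (forall s, 0 <= s -> s <= 1 -> (\int[mu]_x `|H (x, s)|%:E <= C%:E)%E) ->
  [/\ mu.-integrable setT (fun x => (\int[leb]_(s in I01) H (x, s))%:E),
  \int[mu]_x \int[leb]_(s in I01) H (x, s) = \int[leb]_(s in I01) \int[mu]_x H (x, s) &
  leb.-integrable I01 (fun s => (\int[mu]_x H (x, s))%:E)].
Proof.
move=> mH HC; pose F := fun w : E * measurableTypeR R => ((H w * \1_I01 w.2)%:E).
have C0 : 0 <= C.
  rewrite -lee_fin; apply: le_trans (HC 0 (lexx _) ler01).
  by apply: integral_ge0 => x _; rewrite lee_fin.
have mF : measurable_fun setT F.
  apply/measurable_EFinP; apply: measurable_funM => //.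
  exact: (measurableT_comp (measurable_indic mI)).
have Fs s x : F (x, s) = if s \in I01 then (H (x, s))%:E else 0%E.
  by rewrite /F /= indicE; case: (s \in I01); rewrite ?mulr1 ?mulr0.
have iF : (mu \x leb)%E.-integrable setT F.
  apply/(integrable21ltyP _ _ mF).
  apply: (@le_lt_trans _ _ (\int[leb]_s (C * \1_I01 s)%:E)%E).
    apply: ge0_le_integral => //.
    - by move=> s _; apply: integral_ge0.
    - apply: (@measurable_fun_fubini_tonelli_G _ _ _ _ R mu (fun w => `|F w|%E)).
        exact: (measurableT_comp (@abse_measurable R setT) mF).
      by move=> w; exact: abse_ge0.
    - by apply/measurable_EFinP; apply: measurable_funM => //; exact: measurable_indic.
    - move=> s _; under eq_integral do rewrite Fs.
      rewrite indicE; case: (boolP (s \in I01)) => [|_].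
        rewrite inE/= in_itv/= => /andP[s0 s1]; rewrite mulr1; exact: HC.
      by rewrite mulr0; under eq_integral do rewrite abse0; rewrite integral0.
  under eq_integral do rewrite EFinM.
  rewrite (ge0_integralZl _ measurableT); last 3 first.
  - by apply/measurable_EFinP; exact: measurable_indic.
  - by move=> s _; rewrite lee_fin.
  - by rewrite lee_fin.
  rewrite integral_indic// setIT.
  rewrite [X in (_ * X)%E](_ : _ = 1%E); last first.
    by have := @lebesgue_measure_itv R `[0, 1]; rewrite /= lte_fin ltr01 oppr0 adde0.
  by rewrite mule1 ltry.
have inner1 x : (\int[leb]_s F (x, s) = \int[leb]_(s in I01) (H (x, s))%:E)%E.
  rewrite [RHS]integral_mkcond; apply: eq_integral => s _; rewrite patchE Fs.
  by case: ifP.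
have i1 := integrable_fubini_F iF.
have e1 : ae_eq mu setT (fun x => (\int[leb]_(s in I01) H (x, s))%:E) (fun x => \int[leb]_s F (x, s))%E.
  have := integrable_ae measurableT i1.
  by apply: filterS => x /(_ I) h _; rewrite inner1 /Rintegral fineK// -inner1.
have m1 : measurable_fun setT (fun x => (\int[leb]_(s in I01) H (x, s))%:E).
  by apply/measurable_EFinP; exact: measurable_int01.
have GE s : (fubini_G mu F s = ((fun s => (\int[mu]_x H (x, s))%:E) \_ I01) s)%E.
  rewrite /fubini_G patchE; under eq_integral do rewrite Fs.
  case: ifPn => [|_]; last by rewrite integral0.
  rewrite inE/= in_itv/= => /andP[s0 s1]; rewrite /Rintegral fineK//.
  apply: integrable_fin_num => //; apply/integrableP; split; last exact: le_lt_trans (HC s s0 s1) (ltry _).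
  by apply/measurable_EFinP; exact: (measurableT_comp mH (measurable_pair2 _)).
have [mi1 _] := integrableP _ _ _ i1; split.
- have [_ bi1] := integrableP _ _ _ i1; apply/integrableP; split=> //.
  rewrite (@ge0_ae_eq_integral _ _ _ mu setT _ (fun x => `|\int[leb]_s F (x, s)|)%E)//.
  + exact: (measurableT_comp (@abse_measurable R setT) m1).
  + exact: (measurableT_comp (@abse_measurable R setT) mi1).
  + by apply: filterS e1 => x h /h ->.
- rewrite {1}/Rintegral (@ae_eq_integral _ _ _ mu setT _ _ measurableT m1 mi1 e1).
  rewrite (Fubini iF) [RHS]/Rintegral integral_mkcond; congr (fine _).
  by apply: eq_integral => s _; exact: GE.
- have mG : measurable_fun I01 (fun s => (\int[mu]_x H (x, s))%:E).
    apply: (@eq_measurable_fun _ _ _ _ I01 (fubini_G mu F)).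
      by move=> s sI; rewrite GE patchE sI.
    exact: measurable_funTS (measurable_fubini_G iF).
  apply/integrableP; split => //.
  have lI : (leb I01 < +oo)%E by rewrite lebesgue_measure_itv /= lte_fin ltr01 EFinN sube0 ltry.
  apply: (@le_lt_trans _ _ (\int[leb]_(s in I01) C%:E)%E); last first.
    have := @integral_cst _ _ _ leb I01 mI C%:E => /= ->.
    by rewrite lte_mul_pinfty// lee_fin.
  apply: ge0_le_integral => //.
  + exact: (measurableT_comp (@abse_measurable R setT) mG).
  + move=> s; rewrite /= in_itv/= => /andP[s0 s1].
    apply: le_trans (HC s s0 s1); rewrite /Rintegral.
    rewrite -[X in (X <= _)%E]/(`|(fine (\int[mu]_x (H (x, s))%:E))%:E|%E) fineK; last first.
      apply: integrable_fin_num => //; apply/integrableP; split; last exact: le_lt_trans (HC s s0 s1) (ltry _).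
      by apply/measurable_EFinP; exact: (measurableT_comp mH (measurable_pair2 _)).
    apply: le_abse_integral => //.
    by apply/measurable_EFinP; exact: (measurableT_comp mH (measurable_pair2 _)).
Qed.
End fubini01.

Section Rintegral_extra.
Context d (T : measurableType d) (R : realType) (m : {measure set T -> \bar R}).

Lemma bounded_integrable (f : T -> R) (C : R) : measurable_fun setT f ->
  (\int[m]_x `|f x|%:E <= C%:E)%E -> m.-integrable setT (EFin \o f).
Proof.
move=> mf fC; apply/integrableP; split; first exact/measurable_EFinP.
exact: le_lt_trans fC (ltry _).
Qed.

Lemma integrableRZ (D : set T) (f : T -> R) (k : R) : measurable D ->
  m.-integrable D (EFin \o f) -> m.-integrable D (EFin \o fun x => k * f x).
Proof. by move=> mD fi; apply: eq_integrable (integrableZl mD k fi). Qed.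

Lemma integrableRD (D : set T) (f g : T -> R) : measurable D ->
  m.-integrable D (EFin \o f) -> m.-integrable D (EFin \o g) ->
  m.-integrable D (EFin \o fun x => f x + g x).
Proof. by move=> mD fi gi; apply: eq_integrable (integrableD mD fi gi). Qed.

Lemma integrableRB (D : set T) (f g : T -> R) : measurable D ->
  m.-integrable D (EFin \o f) -> m.-integrable D (EFin \o g) ->
  m.-integrable D (EFin \o fun x => f x - g x).
Proof. by move=> mD fi gi; apply: eq_integrable (integrableB mD fi gi). Qed.

(* No integrability is needed: [fine] sends the infinite values to 0 on both sides. *)
Lemma Rintegral_ge0Mr (D : set T) (f : T -> R) (k : R) : measurable D ->
  measurable_fun setT f -> 0 <= k ->
  \int[m]_(x in D) (f x * k) = \int[m]_(x in D) f x * k.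
Proof.
move=> mD /measurable_EFinP mf k0; rewrite /Rintegral.
have mp : measurable_fun D (EFin \o f)^\+%E by exact: measurable_funepos (measurable_funTS mf).
have mn : measurable_fun D (EFin \o f)^\-%E by exact: measurable_funeneg (measurable_funTS mf).
rewrite (_ : (fun x => (f x * k)%:E) = (fun x => k%:E * (EFin \o f) x)%E); last first.
  by apply/funext => x; rewrite /= -EFinM mulrC.
rewrite integralE ge0_funeposM// ge0_funenegM// [in RHS]integralE.
rewrite (ge0_integralZl_EFin _ mD _ mp k0)//.
rewrite (ge0_integralZl_EFin _ mD _ mn k0)//.
set A := integral _ _ _; set B := integral _ _ _.
have A0 : (0 <= A)%E by apply: integral_ge0.
have B0 : (0 <= B)%E by apply: integral_ge0.
move: A B A0 B0; have [->|kn] := eqVneq k 0; first by move=> A B _ _; rewrite !mul0e sube0 mulr0.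
have kp : (0 < k%:E)%E by rewrite lte_fin lt_def kn.
case=> [a||] [b||] _ _ //=; rewrite ?gt0_muley ?gt0_mulNy// ?mul0r//.
by rewrite -mulrBr mulrC.
Qed.

Lemma Rintegral_opp (D : set T) (f : T -> R) : measurable D -> measurable_fun setT f ->
  \int[m]_(x in D) - f x = - \int[m]_(x in D) f x.
Proof.
move=> mD mf; rewrite /Rintegral.
have -> : (fun x => (- f x)%:E) = (\- (EFin \o f))%E by apply/funext => x.
rewrite integralE funeposN funenegN [in RHS]integralE.
have A0 : (0 <= \int[m]_(x in D) ((EFin \o f)^\+)%E x)%E by apply: integral_ge0.
have B0 : (0 <= \int[m]_(x in D) ((EFin \o f)^\-)%E x)%E by apply: integral_ge0.
move: A0 B0; move: (integral _ _ _) (integral _ _ _) => A B.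
by case: A B => [a||] [b||] //= _ _; rewrite ?oppr0// opprB.
Qed.

Lemma Rintegral_mulr (D : set T) (f : T -> R) (k : R) : measurable D ->
  measurable_fun setT f ->
  \int[m]_(x in D) (f x * k) = \int[m]_(x in D) f x * k.
Proof.
move=> mD mf; have [k0|/ltW k0] := leP 0 k; first exact: Rintegral_ge0Mr.
rewrite -[k in RHS]opprK mulrN -Rintegral_ge0Mr ?oppr_ge0// -Rintegral_opp//.
  by apply: eq_Rintegral => x _; rewrite mulrN opprK.
exact: measurable_funM.
Qed.

Lemma integrable_indicM (f : T -> R) (D : set T) : measurable D ->
  m.-integrable setT (EFin \o fun x => f x * \1_D x) -> m.-integrable D (EFin \o f).
Proof.
move=> mD h; apply/(integrable_mkcond _ mD); rewrite restrict_EFin patch_indic.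
exact: h.
Qed.

Let sum_aux (I : Type) (s : seq I) (f : I -> T -> R) (D : set T) : measurable D ->
  (forall i, m.-integrable D (EFin \o f i)) ->
  m.-integrable D (EFin \o fun x => \sum_(i <- s) f i x) /\
  \int[m]_(x in D) (\sum_(i <- s) f i x) = \sum_(i <- s) \int[m]_(x in D) f i x.
Proof.
move=> mD fi; elim: s => [|i s [IH1 IH2]].
  split.
    by apply: eq_integrable (@integrable0 _ _ R m D) => // x _ /=; rewrite big_nil.
  by under eq_Rintegral do rewrite big_nil; rewrite big_nil Rintegral_cst// mul0r.
split.
  by apply: eq_integrable (integrableD mD (fi i) IH1) => // x _ /=; rewrite big_cons EFinD.
by under eq_Rintegral do rewrite big_cons; rewrite big_cons RintegralD// IH2.
Qed.

Lemma integrable_sumR (I : finType) (f : I -> T -> R) (D : set T) : measurable D ->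
  (forall i, m.-integrable D (EFin \o f i)) -> m.-integrable D (EFin \o fun x => \sum_i f i x).
Proof. by move=> mD /(sum_aux (index_enum I) mD)[]. Qed.

Lemma Rintegral_sum (I : finType) (f : I -> T -> R) (D : set T) : measurable D ->
  (forall i, m.-integrable D (EFin \o f i)) ->
  \int[m]_(x in D) (\sum_i f i x) = \sum_i \int[m]_(x in D) f i x.
Proof. by move=> mD /(sum_aux (index_enum I) mD)[]. Qed.

Lemma Lp_sum (I : finType) (f : I -> T -> R) (p : R) : 0 < p ->
  (forall i, Lp m p (f i)) -> Lp m p (fun x => \sum_i f i x).
Proof.
move=> p0 fi; elim: (index_enum I) => [|i s IH].
  by under eq_fun do rewrite big_nil; exact: Lp0.
by under eq_fun do rewrite big_cons; exact: LpD.
Qed.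
End Rintegral_extra.

Section segment.
Variables (R : realType) (N : nat).
Local Notation E := 'rV[R]_N.
Local Notation mu := (lebesgue_rV R N).
Local Notation leb := (@lebesgue_measure R).
Variable p : R.
Hypothesis p1 : 1 < p.
Let p0 : 0 < p. Proof. exact: lt_trans p1. Qed.
Local Notation I01 := (`[(0 : R), (1 : R)]%classic).

Lemma Lp_shift (w : E -> R) c : Lp mu p w -> Lp mu p (fun x => w (x + c)).
Proof.
move=> [mw wi]; split; first by apply: (measurableT_comp mw); exact: measurable_shift.
rewrite (ge0_integral_shift c (f := fun x => (`|w x| `^ p)%:E))//.
by apply/measurable_EFinP; exact: measurable_powR_norm.
Qed.

(** The constant does not depend on the shift [c]: [|w|] is at most [1 + |w|^p], and the integral of
    [|w|^p] is invariant under translation. *)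
Lemma Lp_test_bound (w psi : E -> R) (M : R) a b : 0 <= M -> Lp mu p w ->
  measurable_fun setT psi -> (forall x, `|psi x| <= M) ->
  (forall x, ~ obox a b x -> psi x = 0) ->
  exists C : R, forall c, (\int[mu]_x `|w (x + c) * psi x|%:E <= C%:E)%E.
Proof.
move=> M0 wp mpsi psiM psi0; have mB := measurable_obox a b.
exists (M * (fine (mu (obox a b)) + \int[mu]_x (`|w x| `^ p))) => c.
have [mw wi] := Lp_shift c wp; have mp := measurable_powR_norm p mw.
have m1 : measurable_fun setT (fun x : E => (\1_(obox a b) x + `|w (x + c)| `^ p)%:E).
  by apply/measurable_EFinP; apply: measurable_funD => //; exact: measurable_indic.
apply: (@le_trans _ _ (\int[mu]_x (M%:E * (\1_(obox a b) x + `|w (x + c)| `^ p)%:E))%E).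
  apply: ge0_le_integral => //.
  - by apply/measurable_EFinP; apply: measurableT_comp => //; exact: measurable_funM.
  - by apply: measurable_funeM; exact: m1.
  - move=> x _; rewrite -EFinM lee_fin indicE.
    case: (boolP (x \in obox a b)) => xB /=; last first.
      by rewrite notin_setE in xB; rewrite psi0// mulr0 normr0 add0r mulr_ge0 ?powR_ge0.
    rewrite normrM mulrC ler_pM//; exact: ler_powR1 (ltW p1) (normr_ge0 _).
rewrite (ge0_integralZl _ measurableT); last 3 first.
- exact: m1.
- by move=> x _; rewrite lee_fin addr_ge0 ?powR_ge0.
- by rewrite lee_fin.
rewrite EFinM lee_wpmul2l ?lee_fin//.
under eq_integral do rewrite EFinD.
rewrite (ge0_integralD _ measurableT); last 4 first.
- by move=> x _; rewrite lee_fin.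
- by apply/measurable_EFinP; exact: measurable_indic.
- by move=> x _; rewrite lee_fin powR_ge0.
- exact/measurable_EFinP.
rewrite integral_indic// setIT (ge0_integral_shift c (f := fun x => (`|w x| `^ p)%:E)); last 2 first.
- by apply/measurable_EFinP; apply: measurable_powR_norm; case: wp.
- by move=> x; rewrite lee_fin powR_ge0.
have fB : mu (obox a b) \is a fin_num by rewrite ge0_fin_numE ?measure_ge0 ?mu_obox_lty.
by rewrite (Lp_fineK wp) EFinD (fineK fB).
Qed.

Lemma Lp_test_integrable (w psi : E -> R) (M : R) a b c : 0 <= M -> Lp mu p w ->
  measurable_fun setT psi -> (forall x, `|psi x| <= M) ->
  (forall x, ~ obox a b x -> psi x = 0) ->
  mu.-integrable setT (EFin \o fun x => w (x + c) * psi x).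
Proof.
move=> M0 wp mpsi psiM psi0; have [C HC] := Lp_test_bound M0 wp mpsi psiM psi0.
apply: bounded_integrable (HC c); apply: measurable_funM => //; exact: (Lp_shift c wp).1.
Qed.

Lemma Lp_test_integrable0 (w psi : E -> R) (M : R) a b : 0 <= M -> Lp mu p w ->
  measurable_fun setT psi -> (forall x, `|psi x| <= M) ->
  (forall x, ~ obox a b x -> psi x = 0) ->
  mu.-integrable setT (EFin \o fun x => w x * psi x).
Proof.
move=> M0 wp mpsi psiM psi0.
by apply: eq_integrable (Lp_test_integrable 0 M0 wp mpsi psiM psi0) => // x _ /=; rewrite addr0.
Qed.

Lemma is_derive_along (f : E -> R) (y v : E) (s d : R) :
  is_derive (y + s *: v) v f d -> is_derive s 1 (fun t : R => f (y + t *: v)) d.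
Proof.
have e : (fun h : R => h^-1 *: (f (y + (h *: 1 + s) *: v) - f (y + s *: v))) =
         (fun h : R => h^-1 *: (f (h *: v + (y + s *: v)) - f (y + s *: v))).
  apply/funext => h; congr (_ *: (f _ - _)).
  by rewrite scalerDl /GRing.scale/= mulr1 addrCA.
by move=> [h1 h2]; split; [rewrite /derivable -e in h1|rewrite /derive -e in h2].
Qed.

Lemma Lp_dotv (Du : E -> E) (z : E) : (forall i, Lp mu p (fun x => Du x ord0 i)) ->
  Lp mu p (fun x => dotv (Du x) z).
Proof.
move=> DuP; apply: (Lp_sum p0) => i.
by under eq_fun do rewrite mulrC; exact: LpZ.
Qed.

Lemma weak_gradient_Lp (u : E -> R) (Du : E -> E) : weak_gradient p u Du ->
  forall i, Lp mu p (fun x => Du x ord0 i).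
Proof. by move=> [h _] i; apply/LfunP_Lp. Qed.

Let mI : measurable (I01 : set R). Proof. exact: measurable_itv. Qed.

Definition seg (w : E -> R) (z x : E) : R := \int[leb]_(s in I01) w (x + s *: z).

Lemma seg_fubini (w psi : E -> R) (M : R) a b z : 0 <= M -> Lp mu p w ->
  measurable_fun setT psi -> (forall x, `|psi x| <= M) ->
  (forall x, ~ obox a b x -> psi x = 0) ->
  [/\ mu.-integrable setT (EFin \o fun x => seg w z x * psi x),
  \int[mu]_x (seg w z x * psi x) = \int[leb]_(s in I01) \int[mu]_x (w (x + s *: z) * psi x) &
  leb.-integrable I01 (EFin \o fun s => \int[mu]_x (w (x + s *: z) * psi x))].
Proof.
move=> M0 wp mpsi psiM psi0; have [C HC] := Lp_test_bound M0 wp mpsi psiM psi0.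
have mw := wp.1.
have mws : measurable_fun setT (fun xs : E * measurableTypeR R => w (xs.1 + xs.2 *: z)).
  exact: (measurableT_comp mw (measurable_segment z)).
have mH : measurable_fun setT (fun xs : E * measurableTypeR R => w (xs.1 + xs.2 *: z) * psi xs.1).
  by apply: measurable_funM => //; exact: (measurableT_comp mpsi measurable_fst).
have [h1 h2 h3] := @Rfubini01 R N _ C mH (fun s _ _ => HC (s *: z)).
have E1 x : \int[leb]_(s in I01) (w (x + s *: z) * psi x) = seg w z x * psi x.
  by rewrite Rintegral_mulr//; exact: (measurableT_comp mws (measurable_pair1 _)).
split; last exact: h3.
  apply: eq_integrable h1 => // x _ /=; congr (_%:E); exact: E1.
by rewrite -h2; apply: eq_Rintegral => x _; rewrite -E1.
Qed.

Lemma measurable_seg (w : E -> R) z : measurable_fun setT w -> measurable_fun setT (seg w z).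
Proof.
move=> mw; apply: (@measurable_int01 R N (fun xs => w (xs.1 + xs.2 *: z))).
exact: (measurableT_comp mw (measurable_segment z)).
Qed.

(** A shifted bump is again a bump, hence a test function; the defining identity is summed over the
    coordinates of [z]. *)
Lemma weak_gradient_bump (u : E -> R) (Du : E -> E) (z c : E) (a b : 'I_N -> R) k :
  Lp mu p u -> weak_gradient p u Du ->
  \int[mu]_y (dotv (Du y) z * bump a b k (y + c)) =
  \int[mu]_y (u y * - \sum_i z ord0 i * partial i (bump a b k) (y + c)).
Proof.
move=> up uD; have DuP := weak_gradient_Lp uD; have [_ wg] := uD.
set phi := bump a b k.
have [a2 [b2 es]] : exists a2 b2, (fun y => phi (y + c)) = bump a2 b2 k.
  by do 2?eexists; apply/funext => y; exact: bump_shift.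
have ts : test_function (fun y : E => phi (y + c)) by rewrite es; exact: bump_test.
have [as' [bs' [M' [M'0 phisM dphisM phis0]]]] := test_function_bound ts.
have ps i : partial i (fun y : E => phi (y + c)) = fun y => partial i phi (y + c).
  by apply/funext => y; exact: partial_shift.
have is1 i := Lp_test_integrable0 M'0 (DuP i) (measurable_test ts) phisM (fun x h => (phis0 x h).1).
have is2 i : mu.-integrable setT (EFin \o fun y => u y * partial i phi (y + c)).
  have := Lp_test_integrable0 M'0 up (measurable_partial i ts) (dphisM i) (fun x h => (phis0 x h).2 i).
  by rewrite ps.
have wgi i : \int[mu]_y (u y * partial i phi (y + c)) = - \int[mu]_y (Du y ord0 i * phi (y + c)).
  by rewrite -(wg _ ts i) ps.
pose A i y := Du y ord0 i * phi (y + c); pose B i y := u y * partial i phi (y + c).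
have -> : (fun y => dotv (Du y) z * phi (y + c)) = fun y => \sum_i z ord0 i * A i y.
  by apply/funext => y; rewrite /dotv mulr_suml; apply: eq_bigr => i _; rewrite /A; ring.
have -> : (fun y => u y * - \sum_i z ord0 i * partial i phi (y + c)) =
    fun y => \sum_i - z ord0 i * B i y.
  by apply/funext => y; rewrite -sumrN mulr_sumr; apply: eq_bigr => i _; rewrite /B; ring.
rewrite !Rintegral_sum//; last 2 first.
- by move=> i; apply: integrableRZ => //; exact: is2.
- by move=> i; apply: integrableRZ => //; exact: is1.
apply: eq_bigr => i _; rewrite !RintegralZl//; last 2 first.
- exact: is2.
- exact: is1.
by rewrite (wgi i) mulrNN.
Qed.

(** The difference of the two sides is tested against bumps. Translations are moved onto the bump,
    the weak gradient is traded for a derivative of the bump, and Fubini leaves, for each fixed [y],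
    the fundamental theorem of calculus for the smooth function [s -> phi (y - s z)]. *)
Lemma segment_formula (u : E -> R) (Du : E -> E) z : Lp mu p u -> weak_gradient p u Du ->
  {ae mu, forall x : E, u (x + z) - u x = seg (fun y => dotv (Du y) z) z x}.
Proof.
move=> up uD; have DuP := weak_gradient_Lp uD.
pose w y := dotv (Du y) z; have wp : Lp mu p w := Lp_dotv z DuP.
suff : {ae mu, forall x : E, u (x + z) - u x - seg w z x = 0}.
  by apply: filterS => x /eqP; rewrite subr_eq0 => /eqP.
have muz : measurable_fun setT (fun x : E => u (x + z)) by exact: (Lp_shift z up).1.
apply: fundamental_lemma.
- by do 2?apply: measurable_funB => //; [exact: up.1|exact: measurable_seg wp.1].
- move=> a b; have mB := measurable_obox a b.
  pose psi : E -> R := \1_(obox a b).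
  have mpsi : measurable_fun setT psi by exact: measurable_indic.
  have psi1 x : `|psi x| <= 1 by rewrite /psi indicE; case: (_ \in _); rewrite ?normr1 ?normr0.
  have psiN x : ~ obox a b x -> psi x = 0 by move=> xB; rewrite /psi indicE memNset.
  apply: integrable_indicM => //.
  have [h _ _] := seg_fubini z ler01 wp mpsi psi1 psiN.
  have h1 := Lp_test_integrable z ler01 up mpsi psi1 psiN.
  have h2 := Lp_test_integrable0 ler01 up mpsi psi1 psiN.
  apply: eq_integrable (integrableB _ (integrableB _ h1 h2) h) => // x _ /=.
  by rewrite -!EFinB -!mulrBl.
move=> a b k; set phi := bump a b k.
have tphi : test_function phi := bump_test a b k.
have [a' [b' [M [M0 phiM dphiM phi0]]]] := test_function_bound tphi.
have mphi := measurable_test tphi.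
pose D y := \sum_i z ord0 i * partial i phi y.
have cD : continuous D.
  by apply: continuous_sum_rV => i y; apply: (@cvgM _ _ (nbhs y)); [exact: cvg_cst|exact: partial_continuous].
have mD : measurable_fun setT D.
  by apply: measurable_sum => i; apply: measurable_funM => //; exact: measurable_partial.
pose Mz := \sum_i `|z ord0 i| * M.
have Mz0 : 0 <= Mz by apply: sumr_ge0 => i _; rewrite mulr_ge0.
have DM y : `|D y| <= Mz.
  apply: le_trans (ler_norm_sum _ _ _) _; apply: ler_sum => i _.
  by rewrite normrM ler_wpM2l.
have D0 y : ~ obox a' b' y -> D y = 0.
  by move=> /phi0[_ h]; rewrite /D big1// => i _; rewrite h mulr0.
have phi00 y : ~ obox a' b' y -> phi y = 0 by move=> /phi0[].
have [i3 e3 _] := @seg_fubini w phi M a' b' z M0 wp mphi phiM phi00.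
have i1 := Lp_test_integrable z M0 up mphi phiM phi00.
have i2 := Lp_test_integrable0 M0 up mphi phiM phi00.
have i12 : mu.-integrable setT (EFin \o fun x => u (x + z) * phi x - u x * phi x).
  by apply: eq_integrable (integrableB _ i1 i2) => // x _ /=; rewrite EFinB.
under eq_Rintegral do rewrite !mulrBl.
rewrite RintegralB//.
rewrite RintegralB// e3.
have mDs s : measurable_fun setT (fun y : E => D (y - s *: z)).
  by apply: (measurableT_comp mD); exact: measurable_shift.
have key s : \int[mu]_x (w (x + s *: z) * phi x) = \int[mu]_y (u y * - D (y - s *: z)).
  rewrite -(Rintegral_shift (- (s *: z)) (f := fun x => w (x + s *: z) * phi x)); last first.
    by apply: measurable_funM => //; exact: (Lp_shift _ wp).1.
  under eq_Rintegral do rewrite subrK.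
  exact: weak_gradient_bump.
under [X in _ - X]eq_Rintegral do rewrite key.
have [C HC] := Lp_test_bound Mz0 up mD DM D0.
pose H (ys : E * measurableTypeR R) := u ys.1 * - D (ys.1 - ys.2 *: z).
have mH : measurable_fun setT H.
  apply: measurable_funM; first exact: (measurableT_comp up.1 measurable_fst).
  apply: measurableT_comp => //; apply: (measurableT_comp mD).
  by have := measurable_segment (- z); under eq_fun do rewrite scalerN.
have mHs s : measurable_fun setT (fun x => H (x, s)).
  exact: (measurableT_comp mH (measurable_pair2 s)).
have mHn s : measurable_fun setT (fun x => `|H (x, s)|%:E).
  by apply/measurable_EFinP; exact: (measurableT_comp (@normr_measurable R setT) (mHs s)).
have HH s : 0 <= s -> s <= 1 -> (\int[mu]_x `|H (x, s)|%:E <= C%:E)%E.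
  move=> _ _; rewrite -(ge0_integral_shift (s *: z) (f := fun x => `|H (x, s)|%:E)); last 2 first.
  - exact: mHn.
  - by move=> x; rewrite lee_fin.
  by under eq_integral do rewrite /H /= addrK mulrN normrN; exact: HC.
have [_ e4 _] := Rfubini01 mH HH.
rewrite /H/= in e4; rewrite -e4.
have FTC y : \int[leb]_(s in I01) (u y * - D (y - s *: z)) = u y * phi (y - z) - u y * phi y.
  pose F (s : R) : R := u y * phi (y + s *: - z).
  have dF (s : R) : is_derive s (1 : R) F (u y * - D (y - s *: z)).
    apply: is_deriveZ; apply: is_derive_along.
    have := flat_alg_is_derive (y + s *: - z) (- z) (bump_flat a b k).
    congr (is_derive _ _ _ _); rewrite /D -sumrN scalerN.
    by apply: eq_bigr => i _; rewrite mxE mulNr.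
  rewrite /Rintegral (continuous_FTC2 ltr01 (F := F)).
  - by rewrite /F scale1r scale0r addr0.
  - apply: continuous_subspaceT => s; apply: (@cvgM _ _ (nbhs s)); first exact: cvg_cst.
    apply: (@cvgN _ _ _ (nbhs s)); apply: (@continuous_comp _ _ _ (fun s : R => y - s *: z) D); last exact: cD.
    by apply: (@cvgB _ _ _ (nbhs s)); [exact: cvg_cst|apply: cvgZr_tmp; exact: cvg_id].
  - have cF : continuous F by move=> s; apply: differentiable_continuous; apply/derivable1_diffP; case: (dF s).
    split => [s _|  |]; first by case: (dF s).
    + by apply: cvg_at_right_filter; exact: cF.
    + by apply: cvg_at_left_filter; exact: cF.
  - by move=> s _; rewrite derive1E; case: (dF s).
under [X in _ - X]eq_Rintegral do rewrite FTC.
have i4 : mu.-integrable setT (EFin \o fun y => u y * phi (y - z)).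
  apply: eq_integrable (integrable_shift (- z) i1) => // y _ /=.
  by rewrite subrK.
rewrite RintegralB//.
rewrite -(Rintegral_shift (- z) (f := fun x => u (x + z) * phi x)); last exact: measurable_funM.
by under eq_Rintegral do rewrite subrK; rewrite subrr.
Qed.
End segment.

(** * Morrey's inequality *)

Section morrey_kernel.
Variables (R : realType) (N : nat).
Local Notation E := 'rV[R]_N.
Local Notation mu := (lebesgue_rV R N).
Local Notation leb := (@lebesgue_measure R).
Local Notation J := (`](0 : R), (1 : R)]%classic).
Variables (F : E -> R) (rho : R).
Hypotheses (mF : measurable_fun setT F) (F0 : forall x, 0 <= F x) (rho0 : 0 < rho) (N0 : (0 < N)%N).
Let B : set E := eball 0 rho.
Let mB : measurable B. Proof. exact: measurable_eball. Qed.
Let mJ : measurable (J : set R). Proof. exact: measurable_itv. Qed.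

Let in_B (y : E) : (y \in B) = (enorm y < rho).
Proof. by apply/idP/idP; rewrite inE /B /eball/= subr0. Qed.

Let Ipos (y : E) : 0 <= \1_B y :> R. Proof. by []. Qed.

Let mFseg x : measurable_fun setT (fun zs : E * measurableTypeR R => F (x + zs.2 *: zs.1)).
Proof.
apply: (measurableT_comp mF); apply: measurable_fun_rV => i; under eq_fun do rewrite !mxE.
apply: measurable_funD => //; apply: measurable_funM; first exact: measurable_snd.
exact: (measurableT_comp (@measurable_coord R N i) measurable_fst).
Qed.

Let mIB : measurable_fun setT (\1_B : E -> R). Proof. exact: measurable_indic. Qed.

(** The integrand after the substitution [y = s z]: one factor [1/s] comes from the norm of [z], and
    [N] more from the Jacobian. *)
Let f x (s : R) (y : E) : R :=
  F (x + y) * enorm y * s `^ (- (N.+1)%:R) * \1_B (s `^ (-1) *: y).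

Let f_ge0 x s y : 0 <= f x s y.
Proof. by rewrite /f !mulr_ge0 ?powR_ge0 ?enorm_ge0. Qed.

Let mFx x : measurable_fun setT (fun y : E => F (x + y)).
Proof.
apply: (measurableT_comp mF).
by have := @measurable_shift R N x; under eq_fun do rewrite addrC.
Qed.

Let mf x : measurable_fun setT (fun ys : E * measurableTypeR R => f x ys.2 ys.1).
Proof.
apply: measurable_funM; [apply: measurable_funM; [apply: measurable_funM|]|].
- exact: (measurableT_comp (mFx x) measurable_fst).
- exact: (measurableT_comp (@measurable_enorm R N) measurable_fst).
- exact: (measurableT_comp (@measurable_powR R _) measurable_snd).
- apply: (measurableT_comp mIB); apply: measurable_fun_rV => i; under eq_fun do rewrite !mxE.
  apply: measurable_funM; first exact: (measurableT_comp (@measurable_powR R _) measurable_snd).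
  exact: (measurableT_comp (@measurable_coord R N i) measurable_fst).
Qed.

Let mfs x s : measurable_fun setT (f x s : E -> R).
Proof. exact: (measurableT_comp (mf x) (measurable_pair2 s)). Qed.

Let scaling x s : 0 < s ->
  (\int[mu]_z (F (x + s *: z)%R * enorm z * \1_B z)%:E = \int[mu]_y (f x s y)%:E)%E.
Proof.
move=> s0; have sn0 : s != 0 by rewrite gt_eqF.
have sN0 : 0 <= s ^+ N by rewrite exprn_ge0 ?ltW.
have mfE : measurable_fun setT (fun y => (f x s y)%:E) by apply/measurable_EFinP; exact: mfs.
transitivity ((s ^+ N)%:E * \int[mu]_z ((fun y => (f x s y)%:E) (s *: z + 0)%R))%E; last first.
  rewrite (ge0_integral_affine 0 sn0 mfE) ?gtr0_norm// ?muleA; last by move=> y; rewrite lee_fin.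
  by rewrite -EFinM -exprMn mulfV// expr1n mul1e.
rewrite -(ge0_integralZl _ measurableT); last 3 first.
- by apply: (measurableT_comp mfE); exact: measurable_affine.
- by move=> z _; rewrite lee_fin.
- by rewrite lee_fin.
apply: eq_integral => z _; rewrite -EFinM; congr (_%:E).
rewrite /f addr0 enormZ gtr0_norm// scalerA.
have -> : s `^ (-1) * s = 1 by rewrite powRN powRr1 ?ltW// mulVf.
rewrite scale1r.
rewrite powRN powR_mulrn ?ltW// exprS.
by field; rewrite expf_neq0.
Qed.

(** For fixed [y] only [s > |y| / rho] contributes. The integral is then extended from [s <= 1] to
    infinity, where it has the closed form [(|y| / rho)^-N / N]. *)
Let radial x y : (\int[leb]_(s in J) (f x s y)%:E <=
  (rho ^+ N / N%:R)%:E * (F (x + y) * enorm y `^ (1 - N%:R) * \1_B y)%:E)%E.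
Proof.
have [->|y0] := eqVneq y 0.
  have -> : (\int[leb]_(s in J) (f x s 0%R)%:E = 0)%E.
    by apply: integral0_eq => s _; rewrite /f enorm0 mulr0 !mul0r.
  rewrite -EFinM lee_fin; apply: mulr_ge0; first by rewrite divr_ge0// exprn_ge0// ltW.
  by apply: mulr_ge0 => //; apply: mulr_ge0 => //; exact: powR_ge0.
have ny : 0 < enorm y.
  by rewrite lt_neqAle (enorm_ge0 y) andbT eq_sym; apply: contra y0 => /eqP /enorm_eq0 ->.
have a0 : 0 < enorm y / rho by rewrite divr_gt0.
have k1 : 1 < N.+1%:R :> R by rewrite ltr1n ltnS.
pose A := F (x + y) * enorm y * \1_B y.
have A0 : 0 <= A by rewrite !mulr_ge0 ?enorm_ge0.
have mh : measurable_fun setT (fun s : R => (s `^ (- N.+1%:R))%:E).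
  by apply/measurable_EFinP; exact: measurable_powR.
apply: (@le_trans _ _ (\int[leb]_(s in `[(enorm y / rho)%R, +oo[) (A * s `^ (- N.+1%:R))%:E)%E).
  rewrite integral_mkcond [leRHS]integral_mkcond; apply: ge0_le_integral => //.
  - by move=> s _; rewrite patchE; case: ifP => // _; rewrite lee_fin.
  - apply/(measurable_restrictT _ mJ); apply/measurable_EFinP; apply: measurable_funTS.
    exact: (measurableT_comp (mf x) (measurable_pair1 y)).
  - apply/(measurable_restrictT _ (measurable_itv _)); apply: measurable_funTS.
    by apply/measurable_EFinP; apply: measurable_funM => //; exact: measurable_powR.
  move=> s _; rewrite !patchE; case: ifPn => [|_]; last first.
    by case: ifP => // _; rewrite lee_fin mulr_ge0 ?powR_ge0.
  rewrite inE/= in_itv/= => /andP[s0 s1].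
  have eB : (s `^ (-1) *: y \in B) = (enorm y < s * rho).
    by rewrite in_B enormZ gtr0_norm ?powR_gt0// powRN powRr1 ?ltW// ltr_pdivrMl.
  have [ys|ys] := ltP (enorm y) (s * rho); last first.
    rewrite /f indicE eB ltNge ys mulr0.
    by case: ifP => // _; rewrite lee_fin mulr_ge0 ?powR_ge0.
  have sJ : s \in `[(enorm y / rho)%R, +oo[%classic.
    by rewrite inE/= in_itv/= andbT ler_pdivrMr// ltW.
  rewrite sJ lee_fin /A /f !indicE eB ys in_B.
  have -> : enorm y < rho by apply: lt_le_trans ys _; rewrite ler_piMl// ltW.
  by rewrite !mulr1.
under eq_integral do rewrite EFinM.
have mJ2 : measurable (`[(enorm y / rho)%R, +oo[%classic : set R) by exact: measurable_itv.
rewrite ge0_integralZl; last 4 first.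
- exact: mJ2.
- exact: measurable_funTS.
- by move=> s _; rewrite lee_fin powR_ge0.
- by rewrite lee_fin.
rewrite integral_powRNy// -!EFinM lee_fin le_eqVlt; apply/orP; left; apply/eqP.
have -> : 1 - N.+1%:R = - N%:R :> R by rewrite -natr1; lra.
have -> : N.+1%:R - 1 = N%:R :> R by rewrite -natr1 addrK.
have -> : enorm y `^ (1 - N%:R) = enorm y / enorm y ^+ N.
  rewrite powRD; last by rewrite (gt_eqF ny) implybT.
  by rewrite powRN powRr1 ?powR_mulrn ?ltW.
rewrite /A powRN powR_mulrn; last exact: ltW.
rewrite expr_div_n; field.
by rewrite pnatr_eq0 -lt0n N0 !expf_neq0 ?gt_eqF.
Qed.

(** Averaging over all segments issued from [x] produces the Riesz kernel [|y|^(1-N)]: scaling and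
    Tonelli take the place of polar coordinates. *)
Lemma morrey_kernel x :
  (\int[mu]_z \int[leb]_(s in J) (F (x + s *: z)%R * enorm z * \1_B z)%:E <=
   (rho ^+ N / N%:R)%:E * \int[mu]_y (F (x + y)%R * enorm y `^ (1 - N%:R) * \1_B y)%:E)%E.
Proof.
have mJ1 : measurable_fun setT (fun zs : E * measurableTypeR R => \1_J zs.2 : R).
  exact: (measurableT_comp (measurable_indic mJ) measurable_snd).
have addJ (g : R -> R) : (\int[leb]_(s in J) (g s)%:E = \int[leb]_s (g s * \1_J s)%:E)%E.
  rewrite integral_mkcond; apply: eq_integral => s _; rewrite patchE indicE.
  by case: ifP; rewrite ?mulr1 ?mulr0.
under eq_integral do rewrite addJ.
rewrite (@fubini_tonelli _ _ _ _ _ mu leb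
  (fun zs => (F (x + zs.2 *: zs.1) * enorm zs.1 * \1_B zs.1 * \1_J zs.2)%:E)); last 2 first.
- apply/measurable_EFinP; apply: measurable_funM => //; apply: measurable_funM.
    apply: measurable_funM; first exact: mFseg.
    exact: (measurableT_comp (@measurable_enorm R N) measurable_fst).
  exact: (measurableT_comp mIB measurable_fst).
- by move=> zs; rewrite lee_fin !mulr_ge0 ?enorm_ge0.
have -> : (\int[leb]_s \int[mu]_z (F (x + s *: z)%R * enorm z * \1_B z * \1_J s)%:E =
           \int[leb]_s \int[mu]_y (f x s y * \1_J s)%:E)%E.
  apply: eq_integral => s _; rewrite indicE; case: (boolP (s \in J)) => [|_]; last first.
    by rewrite !integral0_eq// => z _; rewrite mulr0.
  rewrite inE/= in_itv/= => /andP[s0 _].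
  under [LHS]eq_integral do rewrite mulr1.
  by under [RHS]eq_integral do rewrite mulr1; exact: scaling.
rewrite -(@fubini_tonelli _ _ _ _ _ mu leb (fun ys => (f x ys.2 ys.1 * \1_J ys.2)%:E)); last 2 first.
- by apply/measurable_EFinP; apply: measurable_funM => //; exact: mf.
- by move=> ys; rewrite lee_fin mulr_ge0.
have mr : measurable_fun setT (fun y => (F (x + y) * enorm y `^ (1 - N%:R) * \1_B y)%:E).
  apply/measurable_EFinP; apply: measurable_funM => //; apply: measurable_funM; first exact: mFx.
  exact: (measurableT_comp (@measurable_powR R _) (@measurable_enorm R N)).
rewrite -(ge0_integralZl _ measurableT); last 3 first.
- exact: mr.
- by move=> y _; rewrite lee_fin !mulr_ge0 ?powR_ge0.
- by rewrite lee_fin divr_ge0// exprn_ge0// ltW.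
apply: ge0_le_integral => //.
- by move=> y _; apply: integral_ge0 => s _; rewrite lee_fin mulr_ge0.
- apply: (@measurable_fun_fubini_tonelli_F _ _ _ _ R leb (fun ys => (f x ys.2 ys.1 * \1_J ys.2)%:E)).
    by apply/measurable_EFinP; apply: measurable_funM => //; exact: mf.
  by move=> ys; rewrite lee_fin mulr_ge0.
- by apply: measurable_funeM; exact: mr.
by move=> y _; rewrite /= -addJ; exact: radial.
Qed.
End morrey_kernel.

Section ae_swap.
Context d1 d2 (T1 : measurableType d1) (T2 : measurableType d2) (R : realType).
Variables (m1 : {sigma_finite_measure set T1 -> \bar R}) (m2 : {sigma_finite_measure set T2 -> \bar R}).

(** The null set off which the segment formula holds depends on the increment; Tonelli, applied to
    the indicator of the failure set, exchanges the two quantifiers. *)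
Lemma ae_swap (Q : set (T1 * T2)) : measurable Q ->
  (forall y, {ae m1, forall x, Q (x, y)}) -> {ae m1, forall x, {ae m2, forall y, Q (x, y)}}.
Proof.
move=> mQ HQ; pose f (w : T1 * T2) : \bar R := (\1_(~` Q) w)%:E.
have mf : measurable_fun setT f by apply/measurable_EFinP; apply: measurable_indic; exact: measurableC.
have f0 w : (0 <= f w)%E by rewrite lee_fin.
have fT w : f w = 0%E -> Q w.
  rewrite /f indicE => -[]; case: (boolP (w \in ~` Q)) => /= [_ /eqP|]; first by rewrite oner_eq0.
  by rewrite notin_setE /= => /contrapT.
have fQ w : Q w -> f w = 0%E by move=> Qw; rewrite /f indicE memNset//=; exact.
have ftt := @fubini_tonelli _ _ _ _ _ m1 m2 f mf f0.
have z2 : (\int[m2]_y \int[m1]_x f (x, y) = 0)%E.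
  apply: integral0_eq => y _.
  rewrite (@ge0_ae_eq_integral _ _ _ m1 setT _ (cst 0%E)) ?integral0//.
  - exact: (measurableT_comp mf (measurable_pair2 y)).
  - by apply: filterS (HQ y) => x /fQ.
have mF := @measurable_fun_fubini_tonelli_F _ _ _ _ _ m2 f mf f0.
have zF : ae_eq m1 setT (fubini_F m2 f) (cst 0%E).
  apply/ae_eq_integral_abs => //; under eq_integral do rewrite gee0_abs ?integral_ge0//.
  by rewrite -z2 -ftt.
apply: filterS zF => x /(_ I) zx.
have mfx : measurable_fun setT (fun y => f (x, y)) by exact: (measurableT_comp mf (measurable_pair1 x)).
have : ae_eq m2 setT (fun y => f (x, y)) (cst 0%E).
  by apply/ae_eq_integral_abs => //; under eq_integral do rewrite gee0_abs//; exact: zx.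
by apply: filterS => y /(_ I); exact: fT.
Qed.
End ae_swap.

Section morrey.
Variables (R : realType) (N : nat).
Local Notation E := 'rV[R]_N.
Local Notation mu := (lebesgue_rV R N).
Local Notation leb := (@lebesgue_measure R).
Local Notation J := (`](0 : R), (1 : R)]%classic).
Variable p : R.
Hypotheses (N0 : (0 < N)%N) (Np : N%:R < p).
Let N1 : 1 <= N%:R :> R. Proof. by rewrite ler1n. Qed.
Let p1 : 1 < p. Proof. exact: le_lt_trans Np. Qed.
Let p0 : 0 < p. Proof. exact: lt_trans p1. Qed.
Let mJ : measurable (J : set R). Proof. exact: measurable_itv. Qed.

Lemma enorm_le_sum (x : E) : enorm x <= \sum_i `|x ord0 i|.
Proof.
have S0 : 0 <= \sum_i `|x ord0 i| by apply: sumr_ge0.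
rewrite -ler_sqr ?nnegrE ?enorm_ge0// enorm_sqr expr2 [leRHS]mulr_suml.
apply: ler_sum => i _; apply: le_trans (ler_norm _) _; rewrite normrM ler_wpM2l//.
by rewrite (bigD1 i)//= lerDl sumr_ge0.
Qed.

Lemma Lp_enorm (Du : E -> E) : (forall i, Lp mu p (fun x => Du x ord0 i)) ->
  Lp mu p (fun x => enorm (Du x)).
Proof.
move=> DuP.
have mDu : measurable_fun setT Du by apply: measurable_fun_rV => i; exact: (DuP i).1.
apply: (@Lp_le _ _ _ _ p (fun x => \sum_i `|Du x ord0 i|) _ 1) => //.
- exact: (measurableT_comp (@measurable_enorm R N) mDu).
- move=> x; rewrite mul1r !ger0_norm ?enorm_ge0 ?sumr_ge0//; exact: enorm_le_sum.
- apply: (Lp_sum p0) => i; have [m1 m2] := DuP i; split.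
    exact: (measurableT_comp (@normr_measurable R setT) m1).
  by under eq_integral do rewrite normr_id.
Qed.

Definition Lp_norm (f : E -> R) : R := (\int[mu]_x (`|f x| `^ p)) `^ p^-1.

Lemma Lp_norm_ge0 f : 0 <= Lp_norm f. Proof. exact: powR_ge0. Qed.

(** The constant in the bound of the mean of [|u (x + z) - u x|] over [|z| < rho]: times
    [rho^(1-N/p)] and the L^p norm of the gradient. It results from Hoelder's inequality with the
    kernel [|y|^(1-N)], divided by the volume of the ball. *)
Definition morrey_cst : R :=
  (ball_vol R N * N%:R) `^ (- p^-1) * ((p - 1) / (p - N%:R)) `^ ((p - 1) / p).

Lemma morrey_cst_gt0 : 0 < morrey_cst.
Proof.
apply: mulr_gt0; apply: powR_gt0; first by rewrite mulr_gt0 ?ball_vol_gt0 ?ltr0n.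
by rewrite divr_gt0// subr_gt0.
Qed.

Let theta : R := (p - 1) / p.
(** Minus the exponent obtained when the kernel [|y|^(1-N)] is raised to the conjugate exponent of
    [p]; [s < N], which makes it integrable near 0, amounts to [N < p]. *)
Let s : R := (N%:R - 1) * p / (p - 1).

Let pm1 : 0 < p - 1. Proof. by rewrite subr_gt0. Qed.
Let pN : 0 < p - N%:R. Proof. by rewrite subr_gt0. Qed.

Let s_ge0 : 0 <= s. Proof. by rewrite /s divr_ge0 ?(ltW pm1)// mulr_ge0 ?(ltW p0)// subr_ge0. Qed.

Let Ns : N%:R - s = (p - N%:R) / (p - 1).
Proof. by rewrite /s; field; rewrite gt_eqF. Qed.

Let s_lt : s < N%:R. Proof. by rewrite -subr_gt0 Ns divr_gt0. Qed.

Lemma morrey_mean (F : E -> R) (rho : R) x : 0 < rho -> Lp mu p F -> (forall x, 0 <= F x) ->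
  (\int[mu]_z \int[leb]_(t in J) (F (x + t *: z)%R * enorm z * \1_(eball 0 rho) z)%:E <=
  (rho ^+ N * ball_vol R N * (morrey_cst * rho `^ (1 - N%:R / p)) * Lp_norm F)%:E)%E.
Proof.
move=> rho0 Fp F0; have mF := Fp.1.
apply: le_trans (morrey_kernel mF F0 rho0 N0 x) _.
pose g (y : E) : R := enorm y `^ (1 - N%:R) * \1_(eball 0 rho) y.
have mB : measurable (eball 0 rho : set E) by exact: measurable_eball.
have mg : measurable_fun setT g.
  apply: measurable_funM; last exact: measurable_indic.
  exact: (measurableT_comp (@measurable_powR R _) (@measurable_enorm R N)).
have Fxp : Lp mu p (fun y => F (x + y)).
  by have := Lp_shift x Fp; under eq_fun do rewrite addrC.
have gE : (\int[mu]_y (`|g y| `^ (p / (p - 1)))%:E =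
   \int[mu]_(y in eball 0 rho) (enorm y `^ (- s))%:E)%E.
  rewrite [RHS]integral_mkcond; apply: eq_integral => y _; rewrite patchE /g indicE.
  case: ifP => _ /=; last by rewrite mulr0 normr0 powR0// mulf_neq0// ?invr_eq0 ?gt_eqF.
  rewrite mulr1 ger0_norm ?powR_ge0// -powRrM; congr ((_ `^ _)%:E).
  by rewrite /s; field; rewrite gt_eqF.
have gI : (\int[mu]_y (`|g y| `^ (p / (p - 1)))%:E <=
   (ball_vol R N * (N%:R / (N%:R - s)) * rho `^ (N%:R - s))%:E)%E.
  by rewrite gE; exact: integral_riesz.
have H := hoelder_powR mu p1 Fxp.1 mg.
have -> : (\int[mu]_y (F (x + y)%R * enorm y `^ (1 - N%:R) * \1_(eball 0 rho) y)%:E =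
  \int[mu]_x0 (`|F (x + x0)%R * g x0|)%:E)%E.
  apply: eq_integral => y _; congr (_%:E); rewrite ger0_norm /g ?mulrA//.
  by rewrite !mulr_ge0 ?powR_ge0.
have c0 : 0 <= rho ^+ N / N%:R by rewrite divr_ge0// exprn_ge0// ltW.
apply: le_trans (lee_wpmul2l _ H) _; first by rewrite lee_fin.
set A := poweR _ _; set B := poweR _ _.
have A_ : A = (Lp_norm F)%:E.
  rewrite /A; have -> : (\int[mu]_x0 (`|F (x + x0)%R| `^ p)%:E = \int[mu]_y (`|F y| `^ p)%:E)%E.
    rewrite -[RHS](ge0_integral_shift x); last 2 first.
    - by apply/measurable_EFinP; exact: measurable_powR_norm.
    - by move=> y; rewrite lee_fin powR_ge0.
    by apply: eq_integral => y _; rewrite addrC.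
  by rewrite Lp_fineK// poweR_EFin.
pose b := (ball_vol R N * (N%:R / (N%:R - s)) * rho `^ (N%:R - s)) `^ theta.
have B_ : (B <= b%:E)%E.
  rewrite /B /b -poweR_EFin invf_div -/theta; apply: gt0_ler_poweR => //.
  - by rewrite divr_ge0// ltW.
  - by rewrite in_itv/= leey andbT; apply: integral_ge0 => y _; rewrite lee_fin powR_ge0.
  - rewrite in_itv/= leey andbT lee_fin mulr_ge0 ?powR_ge0// mulr_ge0 ?ball_vol_ge0//.
    by rewrite divr_ge0// subr_ge0 ltW.
rewrite A_; apply: (@le_trans _ _ ((rho ^+ N / N%:R)%:E * ((Lp_norm F)%:E * b%:E))%E).
  by rewrite lee_wpmul2l ?lee_fin// lee_wpmul2l ?lee_fin ?Lp_norm_ge0.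
rewrite -!EFinM lee_fin le_eqVlt; apply/orP; left; apply/eqP.
have w0 := ball_vol_gt0 R N; have n0 : 0 < N%:R :> R by exact: lt_le_trans N1.
have bE : b = ball_vol R N * N%:R * (ball_vol R N * N%:R) `^ (- p^-1) *
    ((p - 1) / (p - N%:R)) `^ theta * rho `^ (1 - N%:R / p).
  rewrite /b Ns; set K := (p - 1) / (p - N%:R).
  have -> : ball_vol R N * (N%:R / ((p - N%:R) / (p - 1))) = ball_vol R N * N%:R * K.
    by rewrite /K; field; rewrite !gt_eqF.
  have K0 : 0 <= K by rewrite divr_ge0// ltW.
  have w1 : 0 <= ball_vol R N * N%:R by rewrite mulr_ge0// ltW.
  rewrite (powRM _ (mulr_ge0 w1 K0) (powR_ge0 _ _)) (powRM _ w1 K0) -powRrM.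
  congr (_ * _ * _ `^ _).
    rewrite -[X in _ = X * _]powRr1// -powRD; last by rewrite mulf_neq0 ?implybT ?gt_eqF.
    by congr (_ `^ _); rewrite /theta; field; rewrite gt_eqF.
  by rewrite /theta; field; rewrite !gt_eqF.
rewrite bE /morrey_cst -/theta; field; by rewrite gt_eqF.
Qed.
End morrey.

Section morrey_estimates.
Variables (R : realType) (N : nat).
Local Notation E := 'rV[R]_N.
Local Notation mu := (lebesgue_rV R N).
Local Notation leb := (@lebesgue_measure R).
Local Notation J := (`](0 : R), (1 : R)]%classic).
Variable p : R.
Hypotheses (N0 : (0 < N)%N) (Np : N%:R < p).
Let N1 : 1 <= N%:R :> R. Proof. by rewrite ler1n. Qed.
Let p1 : 1 < p. Proof. exact: le_lt_trans Np. Qed.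
Let p0 : 0 < p. Proof. exact: lt_trans p1. Qed.
Let mJ : measurable (J : set R). Proof. exact: measurable_itv. Qed.
Variables (u : E -> R) (Du : E -> E).
Hypotheses (up : Lp mu p u) (uD : weak_gradient p u Du).
Let F x := enorm (Du x).
Let Fp : Lp mu p F. Proof. by apply: (Lp_enorm N0 Np); exact: (weak_gradient_Lp p1 uD). Qed.
Let F0 x : 0 <= F x. Proof. exact: enorm_ge0. Qed.

Let P (w : E * E) : \bar R := (\int[leb]_(t in J) (F (w.1 + t *: w.2)%R * enorm w.2)%:E)%E.

Let mK : measurable_fun setT (fun wt : (E * E) * measurableTypeR R => F (wt.1.1 + wt.2 *: wt.1.2) * enorm wt.1.2).
Proof.
have m2 : measurable_fun setT (fun wt : (E * E) * measurableTypeR R => wt.1.2).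
  exact: (measurableT_comp measurable_snd measurable_fst).
apply: measurable_funM; last exact: (measurableT_comp (@measurable_enorm R N) m2).
apply: (measurableT_comp Fp.1); apply: measurable_fun_rV => i; under eq_fun do rewrite !mxE.
apply: measurable_funD.
  apply: (measurableT_comp (@measurable_coord R N i)).
  exact: (measurableT_comp measurable_fst measurable_fst).
apply: measurable_funM; first exact: measurable_snd.
exact: (measurableT_comp (@measurable_coord R N i) m2).
Qed.

Let mP : measurable_fun setT P.
Proof.
pose f (wt : (E * E) * measurableTypeR R) := ((F (wt.1.1 + wt.2 *: wt.1.2) * enorm wt.1.2) * \1_J wt.2)%:E.
have mf : measurable_fun setT f.
  apply/measurable_EFinP; apply: measurable_funM; first exact: mK.
  exact: (measurableT_comp (measurable_indic mJ) measurable_snd).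
have f0 w : (0 <= f w)%E by rewrite lee_fin mulr_ge0// mulr_ge0// enorm_ge0.
have := @measurable_fun_fubini_tonelli_F _ _ _ _ R leb f mf f0.
apply: eq_measurable_fun => w _; rewrite /P [RHS]integral_mkcond; apply: eq_integral => t _.
by rewrite patchE /f /= indicE; case: ifP => _; rewrite ?mulr1 ?mulr0.
Qed.

Let mQ : measurable [set w : E * E | (`|u (w.1 + w.2) - u w.1|%:E <= P w)%E].
Proof.
have mu12 : measurable_fun setT (fun w : E * E => u (w.1 + w.2)).
  apply: (measurableT_comp up.1); apply: measurable_fun_rV => i; under eq_fun do rewrite !mxE.
  by apply: measurable_funD; apply: (measurableT_comp (@measurable_coord R N i)).
rewrite -[X in measurable X]setTI; apply: measurable_lee => //.
apply/measurable_EFinP; apply: (measurableT_comp (@normr_measurable R setT)).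
by apply: measurable_funB => //; exact: (measurableT_comp up.1).
Qed.

Let segment_le z : {ae mu, forall x, (`|u (x + z) - u x|%:E <= P (x, z))%E}.
Proof.
have := segment_formula p1 z up uD; apply: filterS => x ->.
have mD : measurable_fun setT (fun t : R => dotv (Du (x + t *: z)) z).
  have mDz : measurable_fun setT (fun y => dotv (Du y) z) := (Lp_dotv p1 z (weak_gradient_Lp p1 uD)).1.
  exact: (measurableT_comp (measurableT_comp mDz (measurable_segment z)) (measurable_pair1 x)).
have mDJ : measurable_fun J (fun t => (dotv (Du (x + t *: z)) z)%:E).
  by apply/measurable_EFinP; exact: measurable_funTS.
rewrite /seg /Rintegral -integral_itv_obnd_cbnd//.
set X := integral _ _ _.
apply: (@le_trans _ _ `|X|%E); first by case: X => [r||] //=; rewrite normr0 leey.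
apply: le_trans (@le_abse_integral _ _ R leb J _ mJ mDJ) _.
apply: ge0_le_integral => //.
- apply: (measurableT_comp (@abse_measurable R setT)).
  by apply/measurable_EFinP; exact: measurable_funTS.
- apply/measurable_EFinP; apply: measurable_funTS.
  exact: (measurableT_comp mK (measurable_pair1 (x, z))).
- by move=> t _; rewrite /= lee_fin; exact: dotv_le.
Qed.

Lemma mean_osc (rho : R) : 0 < rho -> {ae mu, forall x,
  (\int[mu]_(z in eball 0 rho) `|u (x + z) - u x|%:E <=
   (rho ^+ N * ball_vol R N * (morrey_cst N p * rho `^ (1 - N%:R / p)) * Lp_norm p F)%:E)%E}.
Proof.
move=> rho0; have := @ae_swap _ _ _ _ R mu mu _ mQ segment_le; apply: filterS => x Hx.
apply: le_trans (morrey_mean N0 Np x rho0 Fp F0).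
have mB : measurable (eball 0 rho : set E) by exact: measurable_eball.
have mux : measurable_fun setT (fun z => u (x + z)).
  by have := (Lp_shift x up).1; under eq_fun do rewrite addrC.
rewrite integral_mkcond; apply: ae_ge0_le_integral => //.
- by move=> z _; rewrite patchE; case: ifP => // _; rewrite lee_fin.
- apply/(measurable_restrictT _ mB); apply: measurable_funTS; apply/measurable_EFinP.
  by apply: (measurableT_comp (@normr_measurable R setT)); exact: measurable_funB.
- by move=> z _; apply: integral_ge0 => t _; rewrite lee_fin mulr_ge0// mulr_ge0// enorm_ge0.
- pose f (zt : E * measurableTypeR R) := ((F (x + zt.2 *: zt.1) * enorm zt.1 * \1_(eball 0 rho) zt.1) * \1_J zt.2)%:E.
  have mf : measurable_fun setT f.
    apply/measurable_EFinP; apply: measurable_funM; last first.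
      exact: (measurableT_comp (measurable_indic mJ) measurable_snd).
    apply: measurable_funM; last exact: (measurableT_comp (measurable_indic mB) measurable_fst).
    have mx : measurable_fun setT (fun zt : E * measurableTypeR R => ((x, zt.1), zt.2)).
      by apply: measurable_fun_pair => //; apply: measurable_fun_pair.
    exact: (measurableT_comp mK mx).
  have f0 w : (0 <= f w)%E by rewrite lee_fin !mulr_ge0// enorm_ge0.
  have := @measurable_fun_fubini_tonelli_F _ _ _ _ R leb f mf f0.
  apply: eq_measurable_fun => w _; rewrite [RHS]integral_mkcond; apply: eq_integral => t _.
  by rewrite patchE /f /= [\1_J t]indicE; case: ifP => _; rewrite ?mulr1 ?mulr0.
apply: filterS Hx => z /= Hz _; rewrite patchE indicE; case: ifPn => _; last first.
  by apply: integral_ge0 => t _; rewrite lee_fin mulr_ge0// mulr_ge0// enorm_ge0.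
by under eq_integral do rewrite mulr1; exact: Hz.
Qed.
End morrey_estimates.

(** * Pointwise values against means over balls *)

Section ball_means.
Variables (R : realType) (N : nat).
Local Notation E := 'rV[R]_N.
Local Notation mu := (lebesgue_rV R N).
Variable p : R.
Hypotheses (N0 : (0 < N)%N) (Np : N%:R < p).
Let N1 : 1 <= N%:R :> R. Proof. by rewrite ler1n. Qed.
Let p1 : 1 < p. Proof. exact: le_lt_trans Np. Qed.
Let p0 : 0 < p. Proof. exact: lt_trans p1. Qed.

Lemma Lp_integrable_ball (u : E -> R) (y : E) (rho : R) : Lp mu p u ->
  mu.-integrable (eball y rho) (EFin \o u).
Proof.
move=> up; apply: (Lp_integrable_on (ltW p1) _ (mu_eball_lty _ _) up).
exact: measurable_eball.
Qed.

(** The ball of centre [y] need only lie in the ball of radius [r] around [x]: means around other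
    points than [x] are what the grid argument and the Hoelder estimate use. *)
Lemma ball_osc (u : E -> R) (x y : E) (r rho c : R) : Lp mu p u -> 0 < rho ->
  enorm (y - x) + rho <= r ->
  (\int[mu]_(z in eball 0 r) `|u (x + z) - u x|%:E <= c%:E)%E ->
  `|u x * (rho ^+ N * ball_vol R N) - \int[mu]_(w in eball y rho) u w| <= c.
Proof.
move=> up rho0 yr H; set D : set E := eball (y - x) rho.
have mD : measurable D by exact: measurable_eball.
have mB : measurable (eball y rho : set E) by exact: measurable_eball.
have uxp : Lp mu p (fun z => u (x + z)).
  by have := Lp_shift x up; under eq_fun do rewrite addrC.
have eD z : (x + z \in eball y rho) = (z \in D).
  by rewrite /D /eball; apply/idP/idP; rewrite !inE /= opprB addrA [z + x]addrC.
have -> : \int[mu]_(w in eball y rho) u w = \int[mu]_(z in D) u (x + z).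
  rewrite Rintegral_mkcond [RHS]Rintegral_mkcond -[LHS](Rintegral_shift x); last first.
    by apply/(measurable_restrictT _ mB); apply: measurable_funTS; exact: up.1.
  by apply: eq_Rintegral => z _; rewrite addrC !patchE eD.
have -> : u x * (rho ^+ N * ball_vol R N) = \int[mu]_(z in D) u x.
  rewrite Rintegral_cst//; congr (_ * _).
  by rewrite -[LHS]/(fine (rho ^+ N * ball_vol R N)%:E) -(mu_eball (y - x) rho0).
have i1 : mu.-integrable D (EFin \o fun z => u (x + z)) by exact: Lp_integrable_ball.
have i2 : mu.-integrable D (EFin \o cst (u x)).
  apply/integrableP; split; first by apply/measurable_EFinP; exact: measurable_cst.
  have := @integral_cst _ _ _ mu D mD `|u x|%:E => /= ->.
  by rewrite lte_mul_pinfty// ?lee_fin// mu_eball_lty.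
rewrite -RintegralB//; apply: le_trans (le_normr_Rintegral mD (integrableRB mD i2 i1)) _.
rewrite -lee_fin /Rintegral fineK; last first.
  apply: integrable_fin_num => //.
  exact: (integrable_norm (integrableRB mD i2 i1)).
apply: le_trans H; under eq_integral do rewrite distrC.
apply: ge0_subset_integral => //; first exact: measurable_eball.
- apply/measurable_EFinP; apply: measurable_funTS; apply: (measurableT_comp (@normr_measurable R setT)).
  by apply: measurable_funB => //; exact: uxp.1.
- move=> z; rewrite /D /eball /= subr0 => zD.
  have := enormD (z - (y - x)) (y - x); rewrite subrK => h.
  by apply: le_lt_trans h _; apply: lt_le_trans yr; rewrite addrC ltrD2l.
Qed.

Lemma ball_hoelder (u : E -> R) (y : E) (rho : R) : Lp mu p u -> 0 < rho ->
  `|\int[mu]_(w in eball y rho) u w| <= Lp_norm p u * (rho ^+ N * ball_vol R N) `^ (1 - p^-1).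
Proof.
move=> up rho0; have mB : measurable (eball y rho : set E) by exact: measurable_eball.
have pq : p / (p - 1) != 0 by rewrite mulf_neq0 ?invr_eq0 ?subr_eq0 ?gt_eqF.
have e : (\int[mu]_x (`|\1_(eball y rho) x| `^ (p / (p - 1)))%:E = (rho ^+ N * ball_vol R N)%:E :> \bar R)%E.
  rewrite -(mu_eball y rho0) -[X in mu X]setIT -integral_indic//; apply: eq_integral => x _.
  by rewrite indicE; case: (_ \in _) => /=; rewrite ?normr1 ?powR1// normr0 powR0.
have Ip : Lp mu (p / (p - 1)) (\1_(eball y rho) : E -> R).
  by split; [exact: measurable_indic|rewrite e ltry].
have := Lp_hoelder p1 up Ip; rewrite /Lp_norm [X in _ <= _ * X `^ _](_ : _ = rho ^+ N * ball_vol R N); last first.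
  by rewrite /Rintegral e.
have -> : (p / (p - 1))^-1 = 1 - p^-1 by field; rewrite gt_eqF// gt_eqF// subr_gt0.
congr (`|_| <= _); rewrite [RHS]Rintegral_mkcond; apply: eq_Rintegral => x _.
by rewrite patchE indicE; case: (_ \in _); rewrite ?mulr1 ?mulr0.
Qed.

Variables (u : E -> R) (Du : E -> E).
Hypotheses (up : Lp mu p u) (uD : weak_gradient p u Du).
Let M := Lp_norm p (fun x => enorm (Du x)).

(** The value is compared with the mean over a ball, and the mean with the L^p norm. The radius is
    kept free; it is chosen in [energy_sup]. *)
Lemma morrey_sup (rho : R) : 0 < rho -> {ae mu, forall x, `|u x| <=
  morrey_cst N p * rho `^ (1 - N%:R / p) * M + (rho ^+ N * ball_vol R N) `^ (- p^-1) * Lp_norm p u}.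
Proof.
move=> rho0; have := mean_osc N0 Np up uD rho0; apply: filterS => x Hx.
have yr : enorm (x - x) + rho <= rho by rewrite subrr enorm0 add0r.
have h1 := ball_osc up rho0 yr Hx; have h2 := ball_hoelder x up rho0.
set V := rho ^+ N * ball_vol R N in h1 h2 *.
have V0 : 0 < V by rewrite mulr_gt0 ?exprn_gt0// ball_vol_gt0.
have eV : V `^ (1 - p^-1) = V * V `^ (- p^-1).
  by rewrite powRD ?(gt_eqF V0) ?implybT// powRr1// ltW.
rewrite eV in h2; rewrite -/M -[V * _ * M]mulrA in h1.
move: h1 h2; set Z := Rintegral _ _ _; set A := _ * M; set B := V `^ _; set L := Lp_norm _ _.
move=> h1 h2; rewrite -(ler_pM2r V0) -[X in _ * X <= _](ger0_norm (ltW V0)) -normrM.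
have := ler_normD (u x * V - Z) Z; rewrite subrK.
move: h1 h2; move: (`|_|) (`|_|) (`|_|) => a b c; nra.
Qed.

(** The ball around [y] sits in the ball of radius [2 * rho] around [x], and [2 ^ N] is the ratio of
    the volumes. The null set does not depend on [y]. *)
Lemma morrey_ball_mean (rho : R) : 0 < rho -> {ae mu, forall x, forall y, enorm (y - x) < rho ->
  `|u x - (rho ^+ N * ball_vol R N)^-1 * \int[mu]_(w in eball y rho) u w| <=
  2 ^+ N * (morrey_cst N p * (2 * rho) `^ (1 - N%:R / p)) * M}.
Proof.
move=> rho0; have r2 : 0 < 2 * rho by lra.
have := mean_osc N0 Np up uD r2; apply: filterS => x Hx y xy.
have yr : enorm (y - x) + rho <= 2 * rho by lra.
have := ball_osc up rho0 yr Hx; rewrite -/M exprMn.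
set V := rho ^+ N * ball_vol R N.
have V0 : 0 < V by rewrite mulr_gt0 ?exprn_gt0// ball_vol_gt0.
set Z := Rintegral _ _ _; set A := morrey_cst N p * _.
have -> : 2 ^+ N * rho ^+ N * ball_vol R N * A * M = 2 ^+ N * A * M * V by rewrite /V; ring.
move=> h; rewrite -(ler_pM2r V0) -[X in _ * X <= _](ger0_norm (ltW V0)) -normrM mulrBl.
by have -> : V^-1 * Z * V = Z by rewrite mulrC mulrA mulfV ?mul1r// gt_eqF.
Qed.

(** Both values are compared with the same mean, over the ball of radius [2 * enorm z] around [x],
    whose centre is near enough to [x] and to [x + z]. The factor 4 comes from doubling this radius
    once more. *)
Lemma morrey_hoelder (z : E) : {ae mu, forall x, `|u (x + z) - u x| <=
  (2 ^+ N * morrey_cst N p * 4 `^ (1 - N%:R / p) * 2) * enorm z `^ (1 - N%:R / p) * M}.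
Proof.
have [->|z0] := eqVneq z 0.
  apply: aeW => x; rewrite addr0 subrr normr0 mulr_ge0 ?Lp_norm_ge0//.
  by rewrite !mulr_ge0 ?powR_ge0 ?exprn_ge0 ?(ltW (morrey_cst_gt0 N0 Np)).
have ez : 0 < enorm z.
  by rewrite lt_neqAle (enorm_ge0 z) andbT eq_sym; apply: contra z0 => /eqP /enorm_eq0 ->.
have r2 : 0 < 2 * enorm z by lra.
have H1 := morrey_ball_mean r2; have H2 := negligible_shift z H1.
move: H1 H2; apply: filterS2 => x /(_ x) h1 /(_ x) h2.
have {}h1 := h1 _; have {}h2 := h2 _.
have k1 : enorm (x - x) < 2 * enorm z by rewrite subrr enorm0.
have k2 : enorm (x - (x + z)) < 2 * enorm z by rewrite opprD addrA subrr add0r enormN; lra.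
move: (h1 k1) (h2 k2); have -> : 2 * (2 * enorm z) = 4 * enorm z by ring.
rewrite powRM ?enorm_ge0//; set A := 2 ^+ N * _ * M; move=> {}h1 {}h2.
have -> : 2 ^+ N * morrey_cst N p * 4 `^ (1 - N%:R / p) * 2 * enorm z `^ (1 - N%:R / p) * M = A + A.
  by rewrite /A; ring.
move: h1 h2; set Z := _ * Rintegral _ _ _ => h1 h2.
have -> : u (x + z) - u x = (u (x + z) - Z) - (u x - Z) by ring.
by apply: le_trans (ler_normB _ _) _; rewrite lerD.
Qed.
End ball_means.

(** * Compactness *)

Lemma powR_small (R : realType) (c alpha e : R) : 0 <= c -> 0 < alpha -> 0 < e ->
  exists2 d : R, 0 < d & c * d `^ alpha <= e.
Proof.
move=> c0 a0 e0; have c1 : 0 < c + 1 by lra.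
exists ((e / (c + 1)) `^ alpha^-1); first by rewrite powR_gt0// divr_gt0.
rewrite -powRrM mulVf ?gt_eqF// powRr1 ?divr_ge0 ?(ltW e0) ?(ltW c1)//.
by rewrite mulrCA ger_pMr// ler_pdivrMr//; lra.
Qed.

(** Every row converges along one ultrafilter finer than the filter at infinity, by compactness of
    intervals; [phi n] is then picked in a set of the ultrafilter that controls the rows up to [n].
    This replaces nested subsequences. *)
Lemma bounded_diagonal (R : realType) (a : nat -> nat -> R) (B : nat -> R) :
  (forall k n, `|a k n| <= B k) ->
  exists phi l, (forall n, (n <= phi n)%N) /\
    forall n k, (k <= n)%N -> `|a k (phi n) - l k| < n.+1%:R^-1.
Proof.
move=> aB; have [U [UU oU]] := @ultraFilterLemma nat \oo _.
have /choice[l lP] : forall k, exists l : R, a k @ U --> l.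
  move=> k; have K : compact `[- B k, B k]%classic by exact: segment_compact.
  have UK : (a k @ U) `[- B k, B k]%classic.
    apply: (@filterS _ U _ setT); last exact: filterT.
    by move=> n _; rewrite /= in_itv/= -ler_norml; exact: aB.
  have [l [_ ll]] := K (a k @ U) _ UK.
  exists l => O Ol; have [//|UO] := in_ultra_setVsetC (a k @^-1` O) UU.
  by have [y [yO]] := ll (~` O) O UO Ol.
have /choice[phi phiP] : forall n, exists m, (n <= m)%N /\
    forall k, (k <= n)%N -> `|a k m - l k| < n.+1%:R^-1.
  move=> n; have n0 : 0 < n.+1%:R^-1 :> R by [].
  have Hk k : U [set m | `|a k m - l k| < n.+1%:R^-1].
    by have /cvgrPdist_lt/(_ _ n0) := lP k; apply: filterS => m /=; rewrite distrC.
  have Hn j : U [set m | forall k, (k < j)%N -> `|a k m - l k| < n.+1%:R^-1].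
    elim: j => [|j IH]; first by apply: filterS filterT.
    apply: filterS2 IH (Hk j) => m h1 h2 k; rewrite ltnS leq_eqVlt => /predU1P[->//|]; exact: h1.
  have Hm : U [set m | (n <= m)%N] by apply: oU; exists n.
  have [m [h1 h2]] := @filter_ex _ U _ _ (filterI (Hn n.+1) Hm).
  by exists m; split => // k kn; exact: h1.
by exists phi, l; split => n; [have [] := phiP n|have [_] := phiP n].
Qed.

Section compactness.
Variables (R : realType) (N : nat).
Local Notation E := 'rV[R]_N.
Local Notation mu := (lebesgue_rV R N).
Variable p : R.
Hypotheses (N0 : (0 < N)%N) (Np : N%:R < p).
Let N1 : 1 <= N%:R :> R. Proof. by rewrite ler1n. Qed.
Let p1 : 1 < p. Proof. exact: le_lt_trans Np. Qed.
Let p0 : 0 < p. Proof. exact: lt_trans p1. Qed.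
Variables (u : nat -> E -> R) (Du : nat -> E -> E) (C : R).
Hypotheses (up : forall n, Lp mu p (u n)) (uD : forall n, weak_gradient p (u n) (Du n)).
Hypotheses (uC : forall n, Lp_norm p (u n) <= C)
  (DuC : forall n, Lp_norm p (fun x => enorm (Du n x)) <= C).

Lemma grid_dense (x : E) (rho : R) : 0 < rho -> exists g, enorm (grid_pt R g - x) < rho.
Proof.
move=> rho0; have n0 : 0 < N%:R :> R by exact: lt_le_trans N1.
have [m] := ltr_add_invr (divr_gt0 rho0 n0); rewrite add0r ltr_pdivlMr// => Hm.
have [z hz] := grid_near m x; exists (m, z).
apply: le_lt_trans (enorm_le_sum _) _.
apply: (@le_lt_trans _ _ (\sum_(i < N) m.+1%:R^-1)).
  apply: ler_sum => i _; have /andP[h1 h2] := hz i.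
  by rewrite mxE [X in _ + X]mxE distrC ger0_norm// ltW.
by rewrite sumr_const card_ord -[X in X < _]mulr_natr.
Qed.

(* By [morrey_hoelder] the values of [u n] are controlled by its means over small balls
   centred at grid points, and countably many means converge along a diagonal. *)
Lemma ae_subsequence : exists2 phi : nat -> nat, (forall n, (n <= phi n)%N) &
  {ae mu, forall x, cvgn (fun n => u (phi n) x)}.
Proof.
have C0 : 0 <= C by apply: le_trans (uC 0%N); exact: Lp_norm_ge0.
pose rad (k : nat) : R := k.+1%:R^-1.
have rad0 k : 0 < rad k by rewrite /rad.
pose V k := rad k ^+ N * ball_vol R N.
have V0 k : 0 < V k by rewrite mulr_gt0 ?exprn_gt0// ball_vol_gt0.
pose K := (nat * (nat * {ffun 'I_N -> int}))%type.
pose A (kg : K) n := (V kg.1)^-1 * \int[mu]_(w in eball (grid_pt R kg.2) (rad kg.1)) u n w.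
pose B (kg : K) := (V kg.1)^-1 * (C * V kg.1 `^ (1 - p^-1)).
have AB kg n : `|A kg n| <= B kg.
  rewrite normrM ger0_norm ?invr_ge0 ?(ltW (V0 _))// ler_wpM2l ?invr_ge0 ?(ltW (V0 _))//.
  apply: le_trans (ball_hoelder N0 Np _ (up n) (rad0 kg.1)) _.
  by rewrite ler_wpM2r// powR_ge0.
(* Pairs of a scale and a grid point are coded by natural numbers; an integer that codes no pair
   gives the zero row. *)
pose a m n := if @unpickle K m is Some kg then A kg n else 0.
pose b m := if @unpickle K m is Some kg then B kg else 0.
have ab m n : `|a m n| <= b m by rewrite /a /b; case: unpickle => // ; rewrite normr0.
have [phi [l [phi_ge phi_cvg]]] := bounded_diagonal ab.
exists phi => //.
have H : {ae mu, forall x, forall n k, forall y, enorm (y - x) < rad k ->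
  `|u n x - (V k)^-1 * \int[mu]_(w in eball y (rad k)) u n w| <=
  2 ^+ N * (morrey_cst N p * (2 * rad k) `^ (1 - N%:R / p)) * C}.
  apply: ae_foralln => n; apply: ae_foralln => k.
  have := morrey_ball_mean N0 Np (up n) (uD n) (rad0 k); apply: filterS => x Hx y /Hx h.
  apply: le_trans h _; rewrite ler_wpM2l// mulr_ge0 ?exprn_ge0// mulr_ge0 ?powR_ge0//.
  exact/ltW/morrey_cst_gt0.
apply: filterS H => x Hx; apply: cauchy_seq_cvg => e e0.
pose alpha := 1 - N%:R / p.
have alpha0 : 0 < alpha by rewrite subr_gt0 ltr_pdivrMr// mul1r.
pose c := 2 ^+ N * morrey_cst N p * C * 2 `^ alpha.
have c0 : 0 <= c.
  by rewrite mulr_ge0 ?powR_ge0// mulr_ge0// mulr_ge0 ?exprn_ge0// ltW// morrey_cst_gt0.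
have e3 : 0 < e / 3 by lra.
have [d d0 Hd] := powR_small c0 alpha0 e3.
have [k] := ltr_add_invr d0; rewrite add0r -/(rad k) => kd.
have [g Hg] := grid_dense x (rad0 k).
have osc n : `|u n x - A (k, g) n| <= e / 3.
  apply: le_trans (Hx n k _ Hg) _; apply: le_trans Hd.
  rewrite -/alpha powRM ?(ltW (rad0 k))//.
  have -> : 2 ^+ N * (morrey_cst N p * (2 `^ alpha * rad k `^ alpha)) * C = c * rad k `^ alpha.
    by rewrite /c; ring.
  by rewrite ler_wpM2l// ge0_ler_powR ?nnegrE ?(ltW (rad0 k)) ?(ltW alpha0) ?(ltW d0)// ltW.
pose m := pickle ((k, g) : K).
have am n : a m n = A (k, g) n by rewrite /a /m pickleK.
have e6 : 0 < e / 6 by lra.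
have [j] := ltr_add_invr e6; rewrite add0r => Hj.
exists (maxn j m) => i ij.
have cl n : (maxn j m <= n)%N -> `|A (k, g) (phi n) - l m| <= e / 6.
  rewrite geq_max => /andP[jn mn]; rewrite -am; apply: le_trans (ltW (phi_cvg n m mn)) _.
  by apply: le_trans (ltW Hj); rewrite lef_pV2 ?posrE// ler_nat.
move: (osc (phi i)) (osc (phi (maxn j m))) (cl i ij) (cl _ (leqnn _)).
rewrite !ler_norml => /andP[h1 h2] /andP[h3 h4] /andP[h5 h6] /andP[h7 h8].
by apply/andP; split; lra.
Qed.
End compactness.

(** * Difference quotients and the chain rule *)

Section Rintegral_estimates.
Context d (T : measurableType d) (R : realType) (m : {measure set T -> \bar R}).

Lemma ae_bound_integrable (f g : T -> R) : measurable_fun setT f ->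
  m.-integrable setT (EFin \o g) -> {ae m, forall x, `|f x| <= g x} ->
  m.-integrable setT (EFin \o f).
Proof.
move=> mf /integrableP[mg ig] fg; apply/integrableP; split; first exact/measurable_EFinP.
apply: le_lt_trans ig; apply: ae_ge0_le_integral => //.
- by apply/measurable_EFinP; exact: (measurableT_comp (@normr_measurable R setT) mf).
- exact: (measurableT_comp (@abse_measurable R setT) mg).
- by apply: filterS fg => x h _; rewrite lee_fin; apply: le_trans h (ler_norm _).
Qed.

Lemma ae_eq_Rintegral (f g : T -> R) : measurable_fun setT f -> measurable_fun setT g ->
  {ae m, forall x, f x = g x} -> \int[m]_x f x = \int[m]_x g x.
Proof.
move=> mf mg fg; rewrite /Rintegral; congr fine.
apply: (@ae_eq_integral _ _ _ m setT) => //; [exact/measurable_EFinP|exact/measurable_EFinP|].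
by apply: filterS fg => x /= -> _.
Qed.

Lemma ae_bound_Rintegral (f g : T -> R) : measurable_fun setT f ->
  m.-integrable setT (EFin \o g) -> {ae m, forall x, `|f x| <= g x} ->
  `|\int[m]_x f x| <= \int[m]_x g x.
Proof.
move=> mf ig fg; have jf := ae_bound_integrable mf ig fg.
have mg : measurable_fun setT g by case/integrableP: ig => /measurable_EFinP.
have -> : \int[m]_x g x = \int[m]_x `|g x|.
  apply: ae_eq_Rintegral => //; first exact: (measurableT_comp (@normr_measurable R setT) mg).
  by apply: filterS fg => x h; rewrite ger0_norm//; exact: le_trans h.
apply: le_trans (le_normr_Rintegral measurableT jf) _.
have jn := integrable_norm jf; have jg := integrable_norm ig.
rewrite -lee_fin /Rintegral !fineK; [|exact: integrable_fin_num jg|exact: integrable_fin_num jn].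
apply: ae_ge0_le_integral => //.
- by case/integrableP: jn.
- by case/integrableP: jg.
- by apply: filterS fg => x h _; rewrite lee_fin; apply: le_trans h (ler_norm _).
Qed.

Lemma Rintegral_dct (f : nat -> T -> R) (l g : T -> R) :
  (forall n, measurable_fun setT (f n)) -> measurable_fun setT l ->
  m.-integrable setT (EFin \o g) ->
  {ae m, forall x, f n x @[n --> \oo] --> l x} ->
  {ae m, forall x n, `|f n x| <= g x} ->
  \int[m]_x f n x @[n --> \oo] --> \int[m]_x l x.
Proof.
move=> mf ml ig fl fg.
have m1 n : measurable_fun setT (EFin \o f n) by exact/measurable_EFinP.
have m2 : measurable_fun setT (EFin \o l) by exact/measurable_EFinP.
have c1 : {ae m, forall x, setT x -> (EFin \o f n) x @[n --> \oo] --> (EFin \o l) x}.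
  by apply: filterS fl => x h _; apply: cvg_EFin h; near=> n.
have c2 : {ae m, forall x n, setT x -> (`|(EFin \o f n) x| <= (EFin \o g) x)%E}.
  by apply: filterS fg => x h n _; rewrite /= lee_fin.
have [il _ H] := dominated_convergence measurableT m1 m2 c1 ig c2.
by apply: fine_cvg; rewrite fineK; [exact: H|exact: integrable_fin_num].
Unshelve. all: by end_near.
Qed.

Lemma Lp_ae_le (p C : R) (f g : T -> R) : 0 < p -> measurable_fun setT g -> 0 <= C ->
  {ae m, forall x, `|g x| <= C * `|f x|} -> Lp m p f -> Lp m p g.
Proof.
move=> p0 mg C0 gf fp; split => //.
have [m1 i1] : Lp m p (fun x => C * f x) by exact: LpZ.
apply: le_lt_trans i1; apply: ae_ge0_le_integral => //.
- by apply/measurable_EFinP; exact: measurable_powR_norm.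
- by apply/measurable_EFinP; exact: measurable_powR_norm.
- apply: filterS gf => x h _; rewrite lee_fin ge0_ler_powR ?nnegrE ?(ltW p0)//.
  by rewrite normrM (ger0_norm C0).
Qed.
End Rintegral_estimates.

Section difference_quotients.
Variables (R : realType) (N : nat).
Local Notation E := 'rV[R]_N.
Local Notation mu := (lebesgue_rV R N).
Local Notation tau n := (n.+1%:R^-1 : R).

Lemma test_is_derive (phi : E -> R) i (x : E) (s : R) : test_function phi ->
  is_derive s 1 (fun t : R => phi (x + t *: basis_vec i)) (partial i phi (x + s *: basis_vec i)).
Proof.
move=> [/(_ 1%N)[_ hd _] _]; apply: is_derive_along.
by split; [exact: hd|].
Qed.

Lemma test_lipschitz (phi : E -> R) (M : R) i (x : E) (s t : R) : test_function phi ->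
  (forall y, `|partial i phi y| <= M) ->
  `|phi (x + t *: basis_vec i) - phi (x + s *: basis_vec i)| <= M * `|t - s|.
Proof.
move=> tp HM; wlog st : s t / s <= t.
  by move=> H; have [st|/ltW st] := leP s t; [exact: H|rewrite distrC [`|t - s|]distrC; exact: H].
have D y := test_is_derive i x y tp.
have cF : {within `[s, t], continuous (fun y : R => phi (x + y *: basis_vec i))}.
  apply: continuous_subspaceT => y; apply: differentiable_continuous; apply/derivable1_diffP.
  by case: (D y).
have [c _ ->] := MVT_segment st (fun y _ => D y) cF.
by rewrite normrM ler_wpM2r.
Qed.

Lemma tau_cvg0 : (fun n => tau n) @ \oo --> (0 : R).
Proof. exact: cvg_harmonic. Qed.

Lemma test_quotient_cvg (phi : E -> R) i (x : E) : test_function phi ->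
  (tau n)^-1 * (phi (x - tau n *: basis_vec i) - phi x) @[n --> \oo] --> - partial i phi x.
Proof.
move=> [/(_ 1%N)[_ hd _] _]; have Hl := hd i x.
have h0 : - tau n @[n --> \oo] --> (0 : R)^'.
  have c : - tau n @[n --> \oo] --> (0 : R) by rewrite -oppr0; apply: cvgN; exact: tau_cvg0.
  move=> A hA; have H : \forall n \near \oo, - tau n != 0 -> A (- tau n) := c _ hA.
  apply: (@filterS _ \oo _ (fun n => - tau n != 0 -> A (- tau n))) H => n; apply.
  by rewrite oppr_eq0 invr_neq0.
have : (- tau n)^-1 *: (phi (- tau n *: basis_vec i + x) - phi x) @[n --> \oo] --> partial i phi x.
  exact: cvg_comp h0 Hl.
have -> : (fun n => (tau n)^-1 * (phi (x - tau n *: basis_vec i) - phi x)) =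
    (fun n => - ((- tau n)^-1 *: (phi (- tau n *: basis_vec i + x) - phi x))).
  by apply/funext => n; rewrite invrN !scaleNr opprK [- _ + x]addrC.
exact: cvgN.
Qed.

(** The difference quotient is moved from [u] onto [phi], where it converges boundedly to a partial
    derivative. It remains to find the limit of the quotients of [u] against test functions, which
    is done for compositions and for the tent. *)
Lemma weak_gradient_dq (p : R) (u : E -> R) (D : E -> E) : 1 < p -> Lp mu p u ->
  (forall i, Lp mu p (fun x => D x ord0 i)) ->
  (forall i phi, test_function phi ->
    \int[mu]_x ((tau n)^-1 * (u (x + tau n *: basis_vec i) - u x) * phi x) @[n --> \oo] -->
    \int[mu]_x (D x ord0 i * phi x)) ->
  weak_gradient p u D.
Proof.
move=> p1 up Dp H; have p0 : 0 < p by exact: lt_trans p1.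
split=> [i|phi tphi i]; first exact/LfunP_Lp.
have [a [b [M [M0 phiM dphiM phi0]]]] := test_function_bound tphi.
have mphi := measurable_test tphi.
pose e := basis_vec i : E.
pose f n x := u x * ((tau n)^-1 * (phi (x - tau n *: e) - phi x)).
have mf n : measurable_fun setT (f n).
  apply: measurable_funM; first exact: up.1.
  apply: measurable_funM => //; apply: measurable_funB => //.
  by apply: (measurableT_comp mphi); exact: measurable_shift.
have intf n : \int[mu]_x f n x = \int[mu]_x ((tau n)^-1 * (u (x + tau n *: e) - u x) * phi x).
  have i1 := Lp_test_integrable p1 (tau n *: e) M0 up mphi phiM (fun x h => (phi0 x h).1).
  have i2 := Lp_test_integrable0 p1 M0 up mphi phiM (fun x h => (phi0 x h).1).
  have i4 : mu.-integrable setT (EFin \o fun y => u y * phi (y - tau n *: e)).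
    apply: eq_integrable (integrable_shift (- (tau n *: e)) i1) => // y _ /=.
    by rewrite subrK.
  transitivity ((tau n)^-1 * (\int[mu]_x (u x * phi (x - tau n *: e)) - \int[mu]_x (u x * phi x))).
    rewrite -RintegralB// -RintegralZl//; last exact: integrableRB.
    by apply: eq_Rintegral => x _; rewrite /f; ring.
  rewrite -(Rintegral_shift (tau n *: e) (f := fun x => u x * phi (x - tau n *: e))); last first.
    apply: measurable_funM; first exact: up.1.
    by apply: (measurableT_comp mphi); exact: measurable_shift.
  under eq_Rintegral do rewrite addrK.
  rewrite -RintegralB// -RintegralZl//; last exact: integrableRB.
  by apply: eq_Rintegral => x _; ring.
(* Steps are at most 1, so the supports of all shifted test functions lie in the box enlarged by
   1. *)
pose a' j := a j - 1; pose b' j := b j + 1.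
pose g x := M * `|u x * \1_(obox a' b') x|.
have ig : mu.-integrable setT (EFin \o g).
  apply: integrableRZ => //; apply: integrable_norm.
  apply: (@Lp_test_integrable0 _ _ p p1 u (\1_(obox a' b')) 1 a' b') => //.
  - by apply: measurable_indic; exact: measurable_obox.
  - by move=> x; rewrite indicE; case: (_ \in _); rewrite ?normr1 ?normr0.
  - by move=> x xB; rewrite indicE memNset.
have c1 : {ae mu, forall x, f n x @[n --> \oo] --> u x * - partial i phi x}.
  by apply: aeW => x; apply: cvgMr; exact: test_quotient_cvg.
have c2 : {ae mu, forall x n, `|f n x| <= g x}.
  apply: aeW => x n; rewrite /g /f !normrM indicE; case: (boolP (x \in _)) => xB.
    rewrite normr1 mulr1 [M * _]mulrC ler_wpM2l// ger0_norm ?invr_ge0 ?invr_ge0//.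
    rewrite mulrC ler_pdivrMr ?invr_gt0//.
    have := test_lipschitz x 0 (- tau n) tphi (dphiM i).
    by rewrite scale0r addr0 scaleNr subr0 normrN (ger0_norm (_ : 0 <= tau n))// invr_ge0.
  rewrite notin_setE in xB.
  have t1 : tau n <= 1 by rewrite invf_le1// ler1n.
  have t0 : 0 <= tau n by rewrite invr_ge0.
  rewrite (phi0 x _).1; last first.
    by move=> h; apply: xB => j; have /andP[h1 h2] := h j; rewrite /a' /b'; apply/andP; split; lra.
  rewrite (phi0 (x - tau n *: e) _).1; last first.
    move=> h; apply: xB => j; have /andP[] := h j; rewrite /a' /b' !mxE.
    move: t1 t0; move: (tau n) => t t1 t0; case: (_ && _); rewrite ?mulr1 ?mulr0 => h1 h2;
    by apply/andP; split; lra.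
  by rewrite subrr normr0 !mulr0.
have ml : measurable_fun setT (fun x => u x * - partial i phi x).
  apply: measurable_funM; first exact: up.1.
  by apply: measurableT_comp => //; exact: measurable_partial.
have := Rintegral_dct mf ml ig c1 c2; under eq_fun do rewrite intf.
move=> h1; have h2 := H i phi tphi; have := cvg_unique (@norm_hausdorff _ R) h1 h2 => <-.
rewrite -Rintegral_opp//.
  by apply: eq_Rintegral => x _; rewrite mulrN opprK.
Qed.
End difference_quotients.

Section chain_rule.
Variables (R : realType) (N : nat).
Local Notation E := 'rV[R]_N.
Local Notation mu := (lebesgue_rV R N).
Local Notation leb := (@lebesgue_measure R).
Local Notation I01 := (`[(0 : R), (1 : R)]%classic).
Local Notation tau n := (n.+1%:R^-1 : R).
Variable p : R.
Hypotheses (N0 : (0 < N)%N) (Np : N%:R < p).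
Let N1 : 1 <= N%:R :> R. Proof. by rewrite ler1n. Qed.
Let p1 : 1 < p. Proof. exact: le_lt_trans Np. Qed.
Let p0 : 0 < p. Proof. exact: lt_trans p1. Qed.
Let mI : measurable (I01 : set R). Proof. exact: measurable_itv. Qed.
Let alpha : R := 1 - N%:R / p.
Let alpha0 : 0 < alpha. Proof. by rewrite subr_gt0 ltr_pdivrMr// mul1r. Qed.
Let alpha1 : alpha <= 1. Proof. by rewrite gerBl divr_ge0// ltW. Qed.

(* As [Rintegral_mulr], this holds without integrability. *)
Lemma le_norm_Rintegral d (T : measurableType d) (m : {measure set T -> \bar R}) (D : set T)
  (f : T -> R) : measurable D -> measurable_fun setT f ->
  `|\int[m]_(x in D) f x| <= \int[m]_(x in D) `|f x|.
Proof.
move=> mD /measurable_EFinP mf; rewrite /Rintegral.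
have mp : measurable_fun D (EFin \o f)^\+%E by exact: measurable_funepos (measurable_funTS mf).
have mn : measurable_fun D (EFin \o f)^\-%E by exact: measurable_funeneg (measurable_funTS mf).
have -> : (\int[m]_(x in D) `|f x|%:E = \int[m]_(x in D) ((EFin \o f)^\+ x + (EFin \o f)^\- x))%E.
  apply: eq_integral => x _; rewrite funeposE funenegE /= -!EFin_max -EFinD.
  congr (_%:E); case: (leP 0 (f x)) => fx.
    by rewrite (max_idPr _) ?oppr_le0// addr0 ger0_norm.
  by rewrite (max_idPl _) ?oppr_ge0 ?(ltW fx)// add0r ltr0_norm.
rewrite ge0_integralD// integralE.
have A0 : (0 <= \int[m]_(x in D) ((EFin \o f)^\+)%E x)%E by apply: integral_ge0.
have B0 : (0 <= \int[m]_(x in D) ((EFin \o f)^\-)%E x)%E by apply: integral_ge0.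
move: A0 B0; move: (integral _ _ _) (integral _ _ _) => A B.
case: A B => [a||] [b||] //=; rewrite ?lee_fin ?normr0// => a0 b0.
by rewrite ler_norml; apply/andP; split; lra.
Qed.

Lemma Rintegral_bound d (T : measurableType d) (m : {measure set T -> \bar R})
  (f : T -> R) (c : R) : measurable_fun setT f ->
  (\int[m]_x `|f x|%:E <= c%:E)%E -> `|\int[m]_x f x| <= c.
Proof.
move=> mf fc; apply: le_trans (le_norm_Rintegral m measurableT mf) _.
have i0 : (0 <= \int[m]_x `|f x|%:E)%E by apply: integral_ge0 => x _; rewrite lee_fin.
by rewrite -lee_fin /Rintegral fineK// ge0_fin_numE//; exact: le_lt_trans fc (ltry _).
Qed.

Lemma Rintegral_I01_close (f : R -> R) (a c : R) : leb.-integrable I01 (EFin \o f) ->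
  (forall s, 0 <= s -> s <= 1 -> `|f s - a| <= c) -> `|\int[leb]_(s in I01) f s - a| <= c.
Proof.
move=> fi fc; have l1 : fine (leb I01) = 1.
  by rewrite lebesgue_measure_itv /= lte_fin ltr01 EFinN sube0.
have ic b : leb.-integrable I01 (EFin \o cst b).
  by apply: continuous_compact_integrable; [exact: segment_compact|exact: continuous_subspaceT (@cst_continuous _ _ _)].
have cE b : \int[leb]_(s in I01) b = b.
  by rewrite (@Rintegral_cst _ _ _ leb I01 mI b) l1 mulr1.
have mI' : measurable (I01 : set (measurableTypeR R)) by exact: measurable_itv.
have ib := @integrableRB _ _ _ leb I01 f (cst a) mI' fi (ic a).
rewrite -{1}(cE a) -(@RintegralB _ _ _ leb I01 f (fun=> a) mI' fi (ic a)).
apply: le_trans (le_normr_Rintegral mI' ib) _; rewrite -[leRHS]cE.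
apply: le_Rintegral; [exact: mI'|exact: (integrable_norm ib)|exact: ic|].
by move=> s; rewrite /= in_itv/= => /andP[s0 s1]; exact: fc.
Qed.

Lemma basis_enorm (t : R) i : enorm (t *: basis_vec i : E) = `|t|.
Proof.
rewrite enormZ -[RHS]mulr1; congr (_ * _).
rewrite /enorm -[RHS]sqrtr1; congr Num.sqrt.
rewrite /dotv (bigD1 i)//= big1 ?addr0 => [|j /negbTE ji]; rewrite !mxE eqxx ?eqxx ?mulr1//.
by rewrite ji mulr0.
Qed.

Lemma dotv_basis (x : E) i : dotv x (basis_vec i) = x ord0 i.
Proof.
rewrite /dotv (bigD1 i)//= big1 ?addr0 => [|j /negbTE ji]; rewrite mxE eqxx ?eqxx ?mulr1//.
by rewrite ji mulr0.
Qed.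

Lemma cvg_tau_powR (v : nat -> R) (l c : R) : 0 <= c ->
  (forall n, `|v n - l| <= c * (tau n) `^ alpha) -> v n @[n --> \oo] --> l.
Proof.
move=> c0 H; apply/cvgrPdist_le => e e0.
have [d d0 Hd] := powR_small c0 alpha0 e0.
have [k] := ltr_add_invr d0; rewrite add0r => kd.
exists k => // n /= kn; rewrite distrC; apply: le_trans (H n) _; apply: le_trans Hd.
rewrite ler_wpM2l// ge0_ler_powR ?nnegrE ?invr_ge0 ?(ltW alpha0) ?(ltW d0)//.
by apply: le_trans (ltW kd); rewrite lef_pV2 ?posrE// ler_nat.
Qed.

Variables (u : E -> R) (Du : E -> E) (B L : R) (T T' : R -> R).
Hypotheses (up : Lp mu p u) (uD : weak_gradient p u Du).
Hypotheses (uB : forall x, `|u x| <= B) (L0 : 0 <= L).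
Hypotheses (T00 : T 0 = 0) (T'00 : T' 0 = 0).
Hypotheses (mT : measurable_fun setT T) (mT' : measurable_fun setT T').
(** Together with [T2] this says that [T] is of class C^{1,1} with derivative [T']. The intended
    case is [min(t, 0)^2]. *)
Hypothesis T1 : forall a b, `|T b - T a - T' a * (b - a)| <= L * (b - a) ^+ 2.
Hypothesis T2 : forall a b, `|T' b - T' a| <= L * `|b - a|.
Let B0 : 0 <= B. Proof. by apply: le_trans (uB 0). Qed.
Let DuP := weak_gradient_Lp p1 uD.

Let Tu_le x : `|T (u x)| <= (L * B) * `|u x|.
Proof.
have := T1 0 (u x); rewrite T00 T'00 mul0r !subr0 => /le_trans; apply.
by rewrite -mulrA ler_wpM2l// -[u x ^+ 2]ger0_norm ?sqr_ge0// normrX expr2 ler_wpM2r.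
Qed.

Let T'u_le x : `|T' (u x)| <= L * B.
Proof.
have := T2 0 (u x); rewrite T'00 !subr0 => /le_trans; apply.
by rewrite ler_wpM2l.
Qed.

Let mTu : measurable_fun setT (T \o u). Proof. exact: (measurableT_comp mT up.1). Qed.
Let mT'u : measurable_fun setT (T' \o u). Proof. exact: (measurableT_comp mT' up.1). Qed.

Lemma Lp_chain : Lp mu p (T \o u).
Proof. exact: (Lp_le p0 mTu Tu_le (mulr_ge0 L0 B0) up). Qed.

Lemma Lp_chain_gradient i : Lp mu p (fun x => (T' (u x) *: Du x) ord0 i).
Proof.
apply: (@Lp_le _ _ _ _ p (fun x => Du x ord0 i) _ (L * B)) => //.
- under eq_fun do rewrite mxE; apply: measurable_funM => //; exact: (DuP i).1.
- by move=> x; rewrite mxE normrM ler_wpM2r.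
- by rewrite mulr_ge0.
Qed.

Section direction.
Variables (i : 'I_N) (phi : E -> R).
Hypothesis tphi : test_function phi.
Let e : E := basis_vec i.
Let w y := Du y ord0 i.
Let wp : Lp mu p w := DuP i.
Let psi x := T' (u x) * phi x.
Let M := Lp_norm p (fun x => enorm (Du x)).
Let Ch := (2 ^+ N * morrey_cst N p * 4 `^ (1 - N%:R / p) * 2) * M.
Let Ch0 : 0 <= Ch.
Proof.
rewrite mulr_ge0 ?Lp_norm_ge0// mulr_ge0// mulr_ge0 ?powR_ge0// mulr_ge0 ?exprn_ge0//.
exact/ltW/morrey_cst_gt0.
Qed.

Let hoelder_e t : {ae mu, forall x, `|u (x + t *: e) - u x| <= Ch * `|t| `^ alpha}.
Proof.
have := morrey_hoelder N0 Np up uD (t *: e); apply: filterS => x.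
by rewrite basis_enorm -/alpha -/M /Ch; congr (_ <= _); ring.
Qed.

Let seg_e t : {ae mu, forall x, u (x + t *: e) - u x = t * seg w (t *: e) x}.
Proof.
have := segment_formula p1 (t *: e) up uD; apply: filterS => x ->.
rewrite mulrC -Rintegral_mulr//; last first.
  exact: (measurableT_comp (measurableT_comp wp.1 (measurable_segment (t *: e))) (measurable_pair1 x)).
by apply: eq_Rintegral => s _; rewrite dotvZr dotv_basis mulrC.
Qed.

(* The Taylor remainder of [T] is at most [L (u (x + t e) - u x)^2]; one factor is
   [O(t^alpha)] by Morrey and the other one is [t] times a segment mean of [Du]. *)
Lemma chain_direction :
  \int[mu]_x ((tau n)^-1 * (T (u (x + tau n *: e)) - T (u x)) * phi x) @[n --> \oo] -->
  \int[mu]_x (T' (u x) * w x * phi x).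
Proof.
have [a [b [K [K0 phiK dphiK phi0]]]] := test_function_bound tphi.
have mphi := measurable_test tphi.
have phi00 x : ~ obox a b x -> phi x = 0 by move=> /phi0[].
have t0 n : 0 < tau n by rewrite invr_gt0.
have t1 n : tau n <= 1 by rewrite invf_le1// ler1n.
have mw := wp.1.
pose wn x := `|w x|.
have wnp : Lp mu p wn.
  apply: (@Lp_le _ _ _ _ p w _ 1) => //; last by move=> x; rewrite normr_id mul1r.
  exact: (measurableT_comp (@normr_measurable R setT) mw).
pose phin x := `|phi x|.
have mphin : measurable_fun setT phin by exact: (measurableT_comp (@normr_measurable R setT) mphi).
have phinK x : `|phin x| <= K by rewrite normr_id.
have phin0 x : ~ obox a b x -> phin x = 0 by move=> /phi00; rewrite /phin => ->; rewrite normr0.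
have [C0 HC0] := Lp_test_bound p1 K0 wnp mphin phinK phin0.
have C00 : 0 <= C0 by rewrite -lee_fin; apply: le_trans (HC0 0); apply: integral_ge0 => x _; rewrite lee_fin.
have mpsi : measurable_fun setT psi by apply: measurable_funM.
have psiK x : `|psi x| <= L * B * K by rewrite normrM ler_pM.
have psi0 x : ~ obox a b x -> psi x = 0 by move=> /phi00; rewrite /psi => ->; rewrite mulr0.
have LBK0 : 0 <= L * B * K by rewrite !mulr_ge0.
have segn n : \int[mu]_x (`|seg w (tau n *: e) x * phi x|) <= C0.
  have [j1 j2 j3] := seg_fubini p1 (tau n *: e) K0 wnp mphin phinK phin0.
  apply: (@le_trans _ _ (\int[mu]_x (seg wn (tau n *: e) x * phin x))).
    have [k1 _ _] := seg_fubini p1 (tau n *: e) K0 wp mphi phiK phi00.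
    apply: le_Rintegral => //; first exact: (integrable_norm k1).
    move=> x _; rewrite normrM ler_wpM2r//; apply: le_norm_Rintegral => //.
    exact: (measurableT_comp (measurableT_comp mw (measurable_segment (tau n *: e))) (measurable_pair1 x)).
  rewrite j2; apply: le_trans (ler_norm _) _; rewrite -[X in `|X|]subr0.
  apply: Rintegral_I01_close j3 _ => s _ _; rewrite subr0; apply: Rintegral_bound; last exact: HC0.
  apply: measurable_funM => //; exact: (Lp_shift (s *: (tau n *: e)) wnp).1.
pose a' j := a j - 1; pose b' j := b j + 1.
have mB' : measurable (obox a' b') by exact: measurable_obox.
have iB' : mu.-integrable setT (EFin \o fun x => `|w x| * \1_(obox a' b') x).
  apply: (@Lp_test_integrable0 _ _ p p1 wn (\1_(obox a' b')) 1 a' b') => //.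
  - by move=> x; rewrite indicE; case: (_ \in _); rewrite ?normr1 ?normr0.
  - by move=> x xB; rewrite indicE memNset.
pose C1 := \int[mu]_x (`|w x| * \1_(obox a' b') x).
have C10 : 0 <= C1 by apply: Rintegral_ge0 => x _; rewrite mulr_ge0.
pose h n := Ch * tau n `^ alpha.
(* Continuity under translation with a rate: the shift is moved from [w], which is only in L^p, onto
   the factor [T' (u) * phi], which is Hoelder continuous of exponent [alpha] by Morrey's
   estimate. *)
have A_close n s : 0 <= s -> s <= 1 -> `|\int[mu]_x (w (x + s *: (tau n *: e)) * psi x) - \int[mu]_x (w x * psi x)| <=
   (L * K * Ch + L * B * K) * tau n `^ alpha * C1.
  move=> s0 s1; set z := s *: _.
  have ez : z = (s * tau n) *: e by rewrite /z scalerA.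
  have st0 : 0 <= s * tau n by rewrite mulr_ge0 ?(ltW (t0 n)).
  have st1 : s * tau n <= tau n by rewrite ler_piMl ?(ltW (t0 n)).
  have tta : tau n <= tau n `^ alpha.
    by rewrite -[leLHS]powRr1 ?(ltW (t0 n))//; rewrite ger_powR// t0 t1.
  have sta : (s * tau n) `^ alpha <= tau n `^ alpha.
    by rewrite ge0_ler_powR ?nnegrE ?(ltW alpha0) ?(ltW (t0 n)).
  have i1 := Lp_test_integrable p1 z LBK0 wp mpsi psiK psi0.
  have i2 := Lp_test_integrable0 p1 LBK0 wp mpsi psiK psi0.
  have i3 : mu.-integrable setT (EFin \o fun x => w x * psi (x - z)).
    by apply: eq_integrable (integrable_shift (- z) i1) => // x _ /=; rewrite subrK.
  rewrite -(Rintegral_shift (- z) (f := fun x => w (x + z) * psi x)); last first.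
    by apply: measurable_funM => //; exact: (Lp_shift z wp).1.
  under [X in X - _]eq_Rintegral do rewrite subrK.
  rewrite -RintegralB// -[leRHS](RintegralZl _ measurableT iB').
  apply: ae_bound_Rintegral.
  - apply: measurable_funB; apply: measurable_funM => //.
    exact: (measurableT_comp mpsi (measurable_shift _)).
  - exact: integrableRZ.
  have := hoelder_e (- (s * tau n)); rewrite normrN (ger0_norm st0) scaleNr -ez.
  apply: filterS => x Hx; rewrite -mulrBr normrM [leRHS]mulrCA indicE.
  apply: ler_wpM2l => //; case: (boolP (x \in _)) => xB.
    rewrite mulr1 /psi.
    have -> : T' (u (x - z)) * phi (x - z) - T' (u x) * phi x =
      (T' (u (x - z)) - T' (u x)) * phi (x - z) + T' (u x) * (phi (x - z) - phi x) by ring.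
    apply: le_trans (ler_normD _ _) _; rewrite !normrM mulrDl; apply: lerD.
      have -> : L * K * Ch * tau n `^ alpha = L * (Ch * tau n `^ alpha) * K by ring.
      apply: ler_pM => //.
      apply: le_trans (T2 _ _) _; rewrite ler_wpM2l//; apply: le_trans Hx _.
      by rewrite ler_wpM2l.
    rewrite -mulrA; apply: ler_pM => //.
    have := test_lipschitz x 0 (- (s * tau n)) tphi (dphiK i).
    rewrite scale0r addr0 scaleNr -/e -ez subr0 normrN (ger0_norm st0) => /le_trans; apply.
    by rewrite ler_wpM2l//; apply: le_trans st1 _.
  rewrite notin_setE in xB; rewrite mulr0.
  rewrite (psi0 x); last first.
    by move=> hx; apply: xB => j; have /andP[h1 h2] := hx j; rewrite /a' /b'; apply/andP; split; lra.
  rewrite (psi0 (x - z)) ?subrr ?normr0//.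
  move=> hx; apply: xB => j; have := hx j; rewrite /a' /b' mxE [X in _ + X]mxE.
  have : `|z ord0 j| <= 1.
    apply: le_trans (coord_le_enorm z j) _; rewrite ez basis_enorm ger0_norm//.
    exact: le_trans st1 (t1 n).
  rewrite ler_norml; move: (z ord0 j) (x ord0 j) (a j) (b j) => r1 r2 r3 r4.
  by move=> /andP[q1 q2] /andP[q3 q4]; apply/andP; split; lra.
apply: (@cvg_tau_powR _ _ (L * Ch * C0 + (L * K * Ch + L * B * K) * C1)).
  have a1 : 0 <= L * Ch * C0 by rewrite mulr_ge0// mulr_ge0.
  have a2 : 0 <= L * K * Ch + L * B * K by rewrite addr_ge0// mulr_ge0// mulr_ge0.
  exact: addr_ge0 a1 (mulr_ge0 a2 C10).
move=> n; have [k1 k2 k3] := seg_fubini p1 (tau n *: e) LBK0 wp mpsi psiK psi0.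
pose v x := (tau n)^-1 * (T (u (x + tau n *: e)) - T (u x)) * phi x.
have mv : measurable_fun setT v.
  apply: measurable_funM => //; apply: measurable_funM => //; apply: measurable_funB => //.
  exact: (measurableT_comp mTu (measurable_shift _)).
have [k4 _ _] := seg_fubini p1 (tau n *: e) K0 wp mphi phiK phi00.
pose S x := seg w (tau n *: e) x.
have mS : measurable_fun setT S by exact: measurable_seg mw.
have vS : {ae mu, forall x, `|v x - S x * psi x| <= L * h n * `|S x * phi x|}.
  have H1 := seg_e (tau n); have H2 := hoelder_e (tau n).
  move: H1 H2; apply: filterS2 => x; rewrite -/(S x) (ger0_norm (ltW (t0 n))) -/(h n) => e1 e2.
  have tn : tau n != 0 by rewrite gt_eqF.
  have := T1 (u x) (u (x + tau n *: e)); rewrite e1 in e2 *.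
  set dT := T _ - T _ => hT.
  have -> : v x - S x * psi x = (tau n)^-1 * (dT - T' (u x) * (tau n * S x)) * phi x.
    by rewrite /v /psi -/dT; move: tn; move: (tau n) => t tn; field.
  rewrite normrM [X in X * _]normrM [`|S x * _|]normrM [leRHS]mulrA; apply: ler_wpM2r => //.
  have -> : `|(tau n)^-1| = (tau n)^-1 by rewrite ger0_norm// invr_ge0 ltW.
  rewrite mulrC ler_pdivrMr//; apply: le_trans hT _.
  have -> : (tau n * S x) ^+ 2 = `|tau n * S x| * (tau n * `|S x|).
    by rewrite normrM (ger0_norm (ltW (t0 n))) -expr2 !exprMn real_normK ?num_real.
  have -> : L * h n * `|S x| * tau n = L * (h n * (tau n * `|S x|)) by ring.
  by rewrite ler_wpM2l// ler_wpM2r// mulr_ge0// ltW.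
have mvS : measurable_fun setT (fun x => v x - S x * psi x).
  by apply: measurable_funB => //; apply: measurable_funM.
have iSn : mu.-integrable setT (EFin \o fun x => L * h n * `|S x * phi x|).
  by apply: integrableRZ => //; exact: (integrable_norm k4).
have ivS := ae_bound_integrable mvS iSn vS.
have iv : mu.-integrable setT (EFin \o v).
  by apply: eq_integrable (integrableRD measurableT ivS k1) => // x _ /=; rewrite subrK.
have hv : `|\int[mu]_x v x - \int[mu]_x (S x * psi x)| <= L * Ch * C0 * tau n `^ alpha.
  rewrite -RintegralB//; apply: le_trans (ae_bound_Rintegral mvS iSn vS) _.
  rewrite RintegralZl//; last exact: (integrable_norm k4).
  have -> : L * Ch * C0 * tau n `^ alpha = L * h n * C0 by rewrite /h; ring.
  by rewrite ler_wpM2l ?segn// mulr_ge0// mulr_ge0 ?powR_ge0.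
have hA := Rintegral_I01_close k3 (A_close n); rewrite -k2 in hA.
have -> : \int[mu]_x (T' (u x) * w x * phi x) = \int[mu]_x (w x * psi x).
  by apply: eq_Rintegral => x _; rewrite /psi; ring.
rewrite -/v mulrDl [X in _ <= _ + X](_ : _ = (L * K * Ch + L * B * K) * tau n `^ alpha * C1); last by ring.
apply: le_trans (lerD hv hA); rewrite -/S.
apply: le_trans (ler_normD _ _); rewrite addrA subrK//.
Qed.
End direction.

Lemma weak_gradient_chain : weak_gradient p (T \o u) (fun x => T' (u x) *: Du x).
Proof.
apply: (weak_gradient_dq p1 Lp_chain Lp_chain_gradient) => i phi tphi.
under [X in _ --> X]eq_Rintegral do rewrite mxE.
exact: chain_direction.
Qed.
End chain_rule.

(** * The tent function *)

Section tent.
Variables (R : realType) (N : nat).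
Local Notation E := 'rV[R]_N.
Local Notation mu := (lebesgue_rV R N).
Local Notation tau n := (n.+1%:R^-1 : R).
Hypothesis N0 : (0 < N)%N.

(** A sphere lies in shells of arbitrarily small volume. The slope of the tent jumps across two
    spheres, which have to be negligible. *)
Lemma sphere_null (c : E) (r : R) : 0 < r -> {ae mu, forall x, enorm (x - c) <> r}.
Proof.
move=> r0; pose S := [set x : E | enorm (x - c) = r].
have mS : measurable S.
  have -> : S = (fun x => enorm (x - c)) @^-1` [set r] by [].
  rewrite -[X in measurable X]setTI.
  exact: (measurableT_comp (@measurable_enorm R N) (@measurable_shift R N (- c))).
have S0 : mu S = 0%E.
  apply/eqP; rewrite -measure_le0; apply/lee_addgt0Pr => e e0; rewrite add0e.
  have w0 := ball_vol_gt0 R N.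
  have : (r + t) ^+ N * ball_vol R N @[t --> (0 : R)] --> (r + 0) ^+ N * ball_vol R N.
    apply: cvgMl; apply: (@continuous_comp _ _ _ (fun t : R => r + t) (fun t : R => t ^+ N)).
      by apply: cvgD; [exact: cvg_cst|exact: cvg_id].
    exact: exprn_continuous.
  move=> /cvgrPdist_le/(_ e e0)[d /= d0 /(_ (d / 2))].
  have d2 : 0 < d / 2 by rewrite divr_gt0.
  rewrite /ball_/= sub0r normrN (gtr0_norm d2) ltr_pdivrMr// ltr_pMr// ltr1n => /(_ isT).
  rewrite addr0 distrC => Hd.
  have rd : 0 < r + d / 2 by rewrite addr_gt0.
  have mB r' : measurable (eball c r' : set E) by exact: measurable_eball.
  apply: (@le_trans _ _ (mu (eball c (r + d / 2) `\` eball c r))).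
    apply: le_measure; rewrite ?inE//; first exact: measurableD.
    by move=> x /= xS; rewrite /eball /= xS; split; [rewrite ltrDl|rewrite ltxx].
  rewrite measureD//; last exact: mu_eball_lty.
  rewrite setIidr; last by move=> x; rewrite /eball/= => h; apply: lt_trans h _; rewrite ltrDl.
  rewrite [leLHS](_ : _ = (((r + d / 2) ^+ N * ball_vol R N)%:E - (r ^+ N * ball_vol R N)%:E)%E); last first.
    by rewrite -(mu_eball c rd) -(mu_eball c r0).
  rewrite -EFinB lee_fin.
  by apply: le_trans Hd; exact: ler_norm.
by exists S; split => // x /= /contrapT.
Qed.

Variables (p : R) (x0 : E) (r d : R).
Hypotheses (p1 : 1 < p) (r0 : 0 < r) (d0 : 0 < d).
Let p0 : 0 < p. Proof. exact: lt_trans p1. Qed.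

Definition tent (x : E) : R := d * Num.min 1 (Num.max 0 (2 - 2 / r * enorm (x - x0))).

Definition tent_grad (x : E) : E :=
  if r / 2 < enorm (x - x0) < r then (- (2 * d / r) / enorm (x - x0)) *: (x - x0) else 0.

Lemma tent_ge0 x : 0 <= tent x.
Proof. by rewrite /tent mulr_ge0 ?(ltW d0)// le_min ler01 le_max lexx. Qed.

Lemma tent_le x : tent x <= d.
Proof. by rewrite ger_pMr// ge_min lexx. Qed.

Let r2 : 0 < 2 / r. Proof. by rewrite divr_gt0. Qed.

Lemma tent_in x : enorm (x - x0) <= r / 2 -> tent x = d.
Proof.
move=> h; have h1 : 2 / r * enorm (x - x0) <= 1.
  by apply: le_trans (ler_wpM2l (ltW r2) h) _; rewrite mulrA divfK ?gt_eqF// divff.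
rewrite /tent (min_idPl _) ?mulr1// le_max; apply/orP; right; lra.
Qed.

Lemma tent_out x : r <= enorm (x - x0) -> tent x = 0.
Proof.
move=> h; have h1 : 2 <= 2 / r * enorm (x - x0).
  by apply: le_trans (ler_wpM2l (ltW r2) h); rewrite divfK ?gt_eqF.
rewrite /tent (max_idPl _); last lra.
by rewrite (min_idPr _) ?mulr0.
Qed.

Lemma tent_mid x : r / 2 <= enorm (x - x0) -> enorm (x - x0) <= r ->
  tent x = d * (2 - 2 / r * enorm (x - x0)).
Proof.
move=> h1 h2; have k1 : 1 <= 2 / r * enorm (x - x0).
  by apply: le_trans (ler_wpM2l (ltW r2) h1); rewrite mulrA divfK ?gt_eqF// divff.
have k2 : 2 / r * enorm (x - x0) <= 2.
  by apply: le_trans (ler_wpM2l (ltW r2) h2) _; rewrite divfK ?gt_eqF.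
by rewrite /tent (max_idPr _) ?(min_idPr _)//; lra.
Qed.

Lemma tent_lipschitz x y : `|tent x - tent y| <= 2 * d / r * enorm (x - y).
Proof.
have L (a b : R) : `|Num.min 1 (Num.max 0 a) - Num.min 1 (Num.max 0 b)| <= `|a - b|.
  have H (a' b' : R) : Num.min 1 (Num.max 0 a') - Num.min 1 (Num.max 0 b') <= `|a' - b'|.
    have n1 := ler_norm (a' - b'); have n2 := normr_ge0 (a' - b').
    by rewrite /Num.min /Num.max; repeat case: ifPn; rewrite -?leNgt; lra.
  by rewrite ler_norml H andbT lerNl opprB distrC H.
rewrite /tent -mulrBr normrM (gtr0_norm d0).
have -> : 2 * d / r * enorm (x - y) = d * (2 / r * enorm (x - y)) by ring.
rewrite ler_wpM2l ?(ltW d0)//; apply: le_trans (L _ _) _.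
have -> : 2 - 2 / r * enorm (x - x0) - (2 - 2 / r * enorm (y - x0)) =
  2 / r * (enorm (y - x0) - enorm (x - x0)) by ring.
rewrite normrM (gtr0_norm r2) ler_wpM2l ?(ltW r2)// distrC.
by apply: le_trans (enormB _ _) _; rewrite opprB addrA subrK.
Qed.

Let mdist : measurable_fun setT (fun x : E => enorm (x - x0)).
Proof. exact: (measurableT_comp (@measurable_enorm R N) (@measurable_shift R N (- x0))). Qed.

Lemma measurable_tent : measurable_fun setT tent.
Proof.
apply: measurable_funM => //; apply: measurable_minr => //; apply: measurable_maxr => //.
by apply: measurable_funB => //; exact: measurable_funM.
Qed.

Lemma tent_grad_norm x :
  enorm (tent_grad x) = 2 * d / r * \1_[set y : E | r / 2 < enorm (y - x0) < r] x.
Proof.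
rewrite /tent_grad indicE; case: ifPn => h; last by rewrite memNset ?enorm0 ?mulr0//; exact/negP.
rewrite mem_set//= mulr1 enormZ; have /andP[h1 _] := h.
have n0 : 0 < enorm (x - x0) by apply: lt_trans h1; rewrite divr_gt0.
have c0 : 0 < 2 * d / r by rewrite divr_gt0// mulr_gt0.
by rewrite normrM normrN (gtr0_norm c0) gtr0_norm ?invr_gt0// divfK// gt_eqF.
Qed.

Let A := [set y : E | r / 2 < enorm (y - x0) < r].
Let mA : measurable A.
Proof.
have -> : A = (fun x => enorm (x - x0)) @^-1` `]r / 2, r[%classic.
  by apply/seteqP; split => y /=; rewrite in_itv.
by rewrite -[X in measurable X]setTI; exact: mdist.
Qed.

Lemma measurable_tent_grad i : measurable_fun setT (fun x => tent_grad x ord0 i).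
Proof.
have -> : (fun x => tent_grad x ord0 i) =
  (fun x => - (2 * d / r) * \1_A x * enorm (x - x0) `^ (-1) * (x - x0) ord0 i).
  apply/funext => x; rewrite /tent_grad indicE; case: ifPn => h.
    by rewrite mem_set//= mulr1 mxE powRN powRr1// enorm_ge0.
  by rewrite memNset ?mxE ?mulr0 ?mul0r//; exact/negP.
apply: measurable_funM; last exact: (measurableT_comp (@measurable_coord R N i) (@measurable_shift R N (- x0))).
apply: measurable_funM; first by apply: measurable_funM => //; exact: measurable_indic.
exact: (measurableT_comp (@measurable_powR R _) mdist).
Qed.

Let ballI_Lp (c : E) (s : R) : Lp mu p (\1_(eball c s) : E -> R).
Proof.
split; first by apply: measurable_indic; exact: measurable_eball.
rewrite (_ : \int[mu]_x _ = mu (eball c s))%E ?mu_eball_lty//.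
rewrite -[in RHS](setIT (eball c s)) -integral_indic//; last exact: measurable_eball.
by apply: eq_integral => x _; rewrite indicE; case: (_ \in _); rewrite ?normr1 ?powR1// normr0 powR0// gt_eqF.
Qed.

Lemma Lp_tent : Lp mu p tent.
Proof.
apply: (Lp_le p0 measurable_tent _ (ltW d0) (ballI_Lp x0 r)) => x.
rewrite indicE; case: (boolP (x \in _)) => xB.
  by rewrite normr1 mulr1 ger0_norm ?tent_ge0 ?tent_le.
by rewrite notin_setE /eball/= in xB; rewrite tent_out ?normr0 ?mulr0// leNgt; exact/negP.
Qed.

Lemma Lp_tent_grad i : Lp mu p (fun x => tent_grad x ord0 i).
Proof.
have c0 : 0 <= 2 * d / r by rewrite divr_ge0 ?mulr_ge0 ?ltW.
apply: (Lp_le p0 (measurable_tent_grad i) _ c0 (ballI_Lp x0 r)) => x.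
apply: le_trans (coord_le_enorm _ _) _; rewrite tent_grad_norm ler_wpM2l//.
rewrite -/A [\1_A x]indicE; case: (boolP (x \in A)) => xA; last exact: normr_ge0.
have xB : x \in eball x0 r by move: xA; rewrite !inE /A /eball/= => /andP[].
by rewrite indicE xB normr1.
Qed.

(** On the sloping part, the increment of the norm is written as [(|y + t e|^2 - |y|^2) / (|y + t e|
    + |y|)], with numerator [t (2 y_i + t)]. Elsewhere off the two spheres the tent is locally
    constant. *)
Lemma tent_quotient i x : enorm (x - x0) <> r / 2 -> enorm (x - x0) <> r ->
  (tau n)^-1 * (tent (x + tau n *: basis_vec i) - tent x) @[n --> \oo] --> tent_grad x ord0 i.
Proof.
move=> /eqP h1 /eqP h2; set y := x - x0; pose nr n := enorm (y + tau n *: basis_vec i).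
have nrE n : enorm (x + tau n *: basis_vec i - x0) = nr n by rewrite /nr /y addrAC.
have cn : nr n @[n --> \oo] --> enorm y.
  have : y + tau n *: basis_vec i @[n --> \oo] --> y.
    rewrite -[X in _ --> X]addr0; apply: cvgD; first exact: cvg_cst.
    by rewrite -[X in _ --> X](scale0r (basis_vec i)); apply: cvgZr_tmp; exact: tau_cvg0.
  move=> h; exact: (cvg_comp _ _ h (@continuous_enorm R N y)).
have near_ne (c : R) : enorm y < c -> \forall n \near \oo, nr n < c.
  by move=> yc; exact: (cvgr_lt _ cn).
have near_gt (c : R) : c < enorm y -> \forall n \near \oo, c < nr n.
  by move=> yc; exact: (cvgr_gt _ cn).
have cst0 : {near \oo, (fun n => (tau n)^-1 * (tent (x + tau n *: basis_vec i) - tent x)) =1 cst 0} ->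
    (tau n)^-1 * (tent (x + tau n *: basis_vec i) - tent x) @[n --> \oo] --> (0 : R).
  move=> h; apply: (@cvg_trans _ (cst (0 : R) @ \oo)); last exact: cvg_cst.
  by apply: near_eq_cvg; apply: filterS h => n /= ->.
rewrite /tent_grad -/y; case: ifPn => [/andP[a1 a2]|]; last first.
  rewrite negb_and -!leNgt => hy; rewrite mxE; apply: cst0.
  case/orP: hy => hy.
    have {}hy : enorm y < r / 2 by rewrite lt_neqAle h1.
    apply: filterS (near_ne _ hy) => n hn.
    by rewrite !tent_in ?subrr ?mulr0 ?nrE ?ltW.
  have {}hy : r < enorm y by rewrite lt_neqAle eq_sym h2.
  apply: filterS (near_gt _ hy) => n hn.
  by rewrite !tent_out ?subrr ?mulr0 ?nrE ?ltW.
have ny : 0 < enorm y by apply: lt_trans a1; rewrite divr_gt0.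
have lim : - (2 * d / r) * ((2 * y ord0 i + tau n) / (nr n + enorm y)) @[n --> \oo] -->
    - (2 * d / r) * ((2 * y ord0 i + 0) / (enorm y + enorm y)).
  apply: cvgMr; apply: cvgM; first by apply: cvgD; [exact: cvg_cst|exact: tau_cvg0].
  apply: cvgV; first by rewrite gt_eqF// addr_gt0.
  by apply: cvgD => //; exact: cvg_cst.
have -> : (- (2 * d / r) / enorm y *: y) ord0 i =
    - (2 * d / r) * ((2 * y ord0 i + 0) / (enorm y + enorm y)).
  by rewrite mxE; field; rewrite !gt_eqF// addr_gt0.
apply: cvg_trans lim; apply: near_eq_cvg.
apply: filterS2 (near_gt _ a1) (near_ne _ a2) => n b1 b2.
rewrite !tent_mid ?nrE ?ltW// -/y.
have e2 : nr n ^+ 2 = enorm y ^+ 2 + tau n * (2 * y ord0 i + tau n).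
  have q3 : dotv (basis_vec i) (basis_vec i : E) = 1.
    by rewrite -enorm_sqr -[basis_vec i]scale1r basis_enorm normr1 expr1n.
  rewrite /nr; move: (y) => z.
  have q1 := dotv_basis z i; have q2 : dotv (basis_vec i) z = z ord0 i by rewrite dotvC.
  by rewrite !enorm_sqr dotvDl !dotvDr !dotvZl !dotvZr q1 q2 q3; ring.
have t0 : tau n != 0 by rewrite invr_neq0.
have s0 : nr n + enorm y != 0 by rewrite gt_eqF// addr_gt0// (lt_trans _ b1)// divr_gt0.
have -> : 2 * y ord0 i + tau n = (tau n)^-1 * (nr n - enorm y) * (nr n + enorm y).
  have -> : (tau n)^-1 * (nr n - enorm y) * (nr n + enorm y) = (tau n)^-1 * (nr n ^+ 2 - enorm y ^+ 2) by ring.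
  by rewrite e2 [_ + _ * _]addrC addrK mulKf.
by rewrite mulfK//; move: t0; move: (tau n) => t t0; field; rewrite t0 gt_eqF.
Qed.

Lemma weak_gradient_tent : weak_gradient p tent tent_grad.
Proof.
apply: (weak_gradient_dq p1 Lp_tent Lp_tent_grad) => i phi tphi.
have [a [b [M [M0 phiM dphiM phi0]]]] := test_function_bound tphi.
have mphi := measurable_test tphi.
have iphi : mu.-integrable setT (EFin \o phi).
  have mB := measurable_obox a b.
  have iB : mu.-integrable setT (EFin \o (\1_(obox a b) : E -> R)).
    apply: (@bounded_integrable _ _ _ _ _ (fine (mu (obox a b)))); first exact: measurable_indic.
    rewrite fineK ?ge0_fin_numE ?mu_obox_lty// -[X in mu X]setIT -integral_indic//.
    by under eq_integral do rewrite ger0_norm//.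
  apply: (ae_bound_integrable mphi (integrableRZ M measurableT iB)).
  apply: aeW => x; rewrite indicE; case: (boolP (x \in _)) => xB; first by rewrite mulr1.
  by rewrite notin_setE in xB; rewrite (phi0 x xB).1 normr0 mulr0.
apply: (@Rintegral_dct _ _ _ mu _ _ (fun x => 2 * d / r * `|phi x|)).
- move=> n; apply: measurable_funM => //; apply: measurable_funM => //; apply: measurable_funB.
    exact: (measurableT_comp measurable_tent (measurable_shift _)).
  exact: measurable_tent.
- by apply: measurable_funM => //; exact: measurable_tent_grad.
- by apply: integrableRZ => //; exact: (integrable_norm iphi).
- have r20 : 0 < r / 2 by rewrite divr_gt0.
  have H1 := sphere_null x0 r20; have H2 := sphere_null x0 r0.
  by move: H1 H2; apply: filterS2 => x h1 h2; apply: cvgMl; exact: tent_quotient.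
- apply: aeW => x n; rewrite normrM ler_wpM2r// normrM.
  rewrite ger0_norm ?invr_ge0 ?invr_ge0// mulrC ler_pdivrMr ?invr_gt0//.
  apply: le_trans (tent_lipschitz _ _) _.
  by rewrite [x + _]addrC addrK basis_enorm ger0_norm ?invr_ge0.
Qed.
End tent.

(** * The energy space *)

Section power_convexity.
Variable R : realType.
Implicit Types (x y p : R).

Lemma powR_convex p x y t : 1 <= p -> 0 <= x -> 0 <= y -> 0 <= t -> t <= 1 ->
  ((1 - t) * x + t * y) `^ p <= (1 - t) * x `^ p + t * y `^ p.
Proof.
move=> p1 x0 y0 t0 t1.
have := @convex_powR R p p1 (Itv01 t0 t1) y x.
rewrite !inE/= !in_itv/= !andbT => /(_ y0 x0); rewrite !convRE /=.
by move=> h; rewrite addrC [leRHS]addrC; exact: h.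
Qed.

(** The mean value theorem on both halves of the interval; the derivative [p t^(p-1)] is strictly
    increasing as [p > 1]. *)
Lemma powR_strict_midpoint p x y : 1 < p -> 0 <= x -> x < y ->
  ((x + y) / 2) `^ p < (x `^ p + y `^ p) / 2.
Proof.
move=> p1 x0 xy; have p0 : 0 < p by exact: lt_trans p1.
pose f (t : R) : R := `|t| `^ p.
have cf : continuous f := continuous_norm_powR p0.
have df (t : R) : 0 < t -> is_derive t 1 f (p * t `^ (p - 1)).
  move=> t0; apply: near_eq_is_derive (is_derive1_powR p t0).
  near=> s; rewrite /f gtr0_norm//; near: s; exact: lt_nbhsr.
have cw (a b : R) : {within `[a, b], continuous f} by exact: continuous_subspaceT.
set m := (x + y) / 2.
have xm : x < m by rewrite /m; lra.
have my : m < y by rewrite /m; lra.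
have [|c1 c1i E1] := @MVT R f (fun t => p * t `^ (p - 1)) x m xm _ (cw _ _).
  by move=> t; rewrite in_itv/= => /andP[xt _]; apply: df; exact: le_lt_trans xt.
have [|c2 c2i E2] := @MVT R f (fun t => p * t `^ (p - 1)) m y my _ (cw _ _).
  by move=> t; rewrite in_itv/= => /andP[xt _]; apply: df; apply: lt_trans xt; exact: le_lt_trans xm.
move: c1i c2i; rewrite !in_itv/= => /andP[h1 h2] /andP[h3 h4].
have c12 : c1 `^ (p - 1) < c2 `^ (p - 1).
  apply: gt0_ltr_powR; rewrite ?subr_gt0 ?nnegrE//; [|apply: ltW|exact: lt_trans h3].
    exact: le_trans (ltW h1).
  by apply: le_lt_trans (lt_trans xm h3).
have m0 : 0 <= m by exact: le_trans (ltW xm).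
have y0 : 0 <= y by exact: le_trans (ltW xy).
move: E1 E2; rewrite /f !ger0_norm// => E1 E2.
have e1 : m - x = (y - x) / 2 by rewrite /m; lra.
have e2 : y - m = (y - x) / 2 by rewrite /m; lra.
rewrite e1 in E1; rewrite e2 in E2.
have yx : 0 < (y - x) / 2 by lra.
have : p * c1 `^ (p - 1) * ((y - x) / 2) < p * c2 `^ (p - 1) * ((y - x) / 2).
  by rewrite ltr_pM2r// ltr_pM2l.
by rewrite -E1 -E2; lra.
Unshelve. all: by end_near.
Qed.
End power_convexity.

Section uniform_convexity.
Variables (R : realType) (n : nat) (p : R).
Hypothesis p1 : 1 < p.
Let p0 : 0 < p. Proof. exact: lt_trans p1. Qed.
Local Notation E := 'rV[R]_n.
Implicit Types x y : E.

Lemma enorm_powR_convex x y (t : R) : 0 <= t -> t <= 1 ->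
  enorm ((1 - t) *: x + t *: y) `^ p <= (1 - t) * enorm x `^ p + t * enorm y `^ p.
Proof.
move=> t0 t1; have t1' : 0 <= 1 - t by rewrite subr_ge0.
apply: le_trans (powR_convex (ltW p1) (enorm_ge0 x) (enorm_ge0 y) t0 t1).
apply: ge0_ler_powR; rewrite ?nnegrE ?(ltW p0) ?enorm_ge0 ?addr_ge0 ?mulr_ge0 ?enorm_ge0//.
by apply: le_trans (enormD _ _) _; rewrite !enormZ !ger0_norm.
Qed.

Definition conv_gap x y : R :=
  (enorm x `^ p + enorm y `^ p) / 2 - enorm (2^-1 *: (x + y)) `^ p.

Lemma conv_gap_ge0 x y : 0 <= conv_gap x y.
Proof.
have h2 : 0 <= 2^-1 :> R by [].
have h3 : 2^-1 <= 1 :> R by lra.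
have := enorm_powR_convex x y h2 h3.
have -> : 1 - 2^-1 = 2^-1 :> R by lra.
by rewrite -scalerDr /conv_gap; lra.
Qed.

Lemma conv_gapC x y : conv_gap x y = conv_gap y x.
Proof. by rewrite /conv_gap [y + x]addrC [enorm y `^ p + _]addrC. Qed.

(** A zero gap forces equality in the convexity of the power, hence equal norms for [x], [y] and
    their midpoint; the parallelogram identity then gives [x = y]. *)
Lemma conv_gap_gt0 x y : x != y -> 0 < conv_gap x y.
Proof.
move=> xy; rewrite lt_neqAle conv_gap_ge0 andbT eq_sym; apply: contra xy => /eqP g0.
wlog st : x y g0 / enorm x <= enorm y.
  move=> H; have [st|/ltW ts] := leP (enorm x) (enorm y); first exact: H.
  by rewrite eq_sym; apply: (H y x) ts; rewrite conv_gapC.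
have z0 : 0 <= enorm (2^-1 *: (x + y)) := enorm_ge0 _.
have zst : enorm (2^-1 *: (x + y)) <= (enorm x + enorm y) / 2.
  rewrite enormZ ger0_norm// mulrC ler_pM2r//; exact: enormD.
have s0 : 0 <= enorm x := enorm_ge0 _; have t0 : 0 <= enorm y := enorm_ge0 _.
have m0 : 0 <= (enorm x + enorm y) / 2 by rewrite divr_ge0// addr_ge0.
have zp : enorm (2^-1 *: (x + y)) `^ p <= ((enorm x + enorm y) / 2) `^ p.
  by apply: ge0_ler_powR; rewrite ?nnegrE ?(ltW p0).
move: g0; rewrite /conv_gap => g0.
move: st; rewrite le_eqVlt => /predU1P[st|st]; last first.
  by have := powR_strict_midpoint p1 s0 st; lra.
have zs : enorm (2^-1 *: (x + y)) = enorm x.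
  apply: (@powR_injective _ p) => //; rewrite ?nnegrE//.
  by move: g0; rewrite -st; lra.
have para : enorm (x - y) ^+ 2 = 2 * enorm x ^+ 2 + 2 * enorm y ^+ 2 - 4 * enorm (2^-1 *: (x + y)) ^+ 2.
  rewrite !enorm_sqr -[- y]scaleN1r !(dotvZl, dotvZr, dotvDl, dotvDr) (dotvC y x).
  by move: (dotv x x) (dotv y y) (dotv x y) => A B C; field.
move: para; rewrite zs -st => para.
have : enorm (x - y) ^+ 2 = 0 by rewrite para; lra.
by move=> /eqP; rewrite sqrf_eq0 => /eqP/enorm_eq0/eqP; rewrite subr_eq0.
Qed.

(* By homogeneity it suffices to argue on the compact unit sphere of [E * E], where
   [conv_gap] vanishes on the diagonal only. *)
Lemma uniform_convexity (e : R) : 0 < e -> exists2 C : R, 0 < C & forall x y,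
  enorm (x - y) `^ p <= e * (enorm x `^ p + enorm y `^ p) + C * conv_gap x y.
Proof.
move=> e0.
pose F (z : E * E) := conv_gap z.1 z.2.
pose S (z : E * E) := enorm z.1 `^ p + enorm z.2 `^ p.
pose D (z : E * E) := enorm (z.1 - z.2) `^ p.
have cpow (g : E * E -> E) : continuous g -> continuous (fun z => enorm (g z) `^ p).
  move=> cg z; have cn : continuous (fun t : R => `|t| `^ p) := continuous_norm_powR p0.
  have -> : (fun z => enorm (g z) `^ p) = (fun z => `|enorm (g z)| `^ p).
    by apply/funext => w; rewrite ger0_norm// enorm_ge0.
  apply: (@continuous_comp _ _ _ (fun z => enorm (g z)) (fun t : R => `|t| `^ p)); last exact: cn.
  by apply: (@continuous_comp _ _ _ g (@enorm R n)); [exact: cg|exact: continuous_enorm].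
have c1 : continuous (fun z : E * E => enorm z.1 `^ p) by apply: cpow => z; exact: cvg_fst.
have c2 : continuous (fun z : E * E => enorm z.2 `^ p) by apply: cpow => z; exact: cvg_snd.
have cS : continuous S by move=> z; apply: cvgD; [exact: c1|exact: c2].
have cD : continuous D by apply: cpow => z; apply: cvgB; [exact: cvg_fst|exact: cvg_snd].
have cF : continuous F.
  move=> z; apply: cvgB; first by apply: cvgMl; exact: cS.
  apply: cpow => w; apply: cvgZl_tmp; apply: cvgD; [exact: cvg_fst|exact: cvg_snd].
(* On this compact part of the sphere the gap is bounded below by some [c > 0]; on the rest of the
   sphere the first term of the bound suffices. *)
pose K := [set z | S z = 1] `&` [set z | e <= D z].
have cK : compact K.
  pose box := [set v : E | forall i, `[-1, 1]%classic (v ord0 i)].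
  have cbox : compact box.
    by apply: (@rV_compact R n (fun=> `[-1, 1]%classic)) => i; exact: segment_compact.
  apply: (subclosed_compact _ (compact_setX cbox cbox)).
    apply: closedI.
      by apply: (closed_comp (f := S) (D := [set 1])) => // z _; exact: cS.
    by apply: (closed_comp (f := D) (D := [set t | e <= t])) => //.
  have small (v : E) : enorm v `^ p <= 1 -> box v.
    move=> v1 i; rewrite /= in_itv/= -ler_norml; apply: le_trans (coord_le_enorm v i) _.
    rewrite leNgt; apply/negP => v2; move: v1; rewrite leNgt => /negP; apply.
    have e1 : 1 = 1 `^ p :> R by rewrite powR1.
    rewrite [ltLHS]e1; apply: gt0_ltr_powR; rewrite ?nnegrE ?enorm_ge0//.
  move=> [x y] [/= Sz _]; rewrite /S /= in Sz.
  by split; apply: small; rewrite -Sz ?lerDl ?lerDr powR_ge0.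
have [c c0 Hc] : exists2 c : R, 0 < c & forall z, K z -> c <= F z.
  have cFK : closed (F @` K).
    apply: compact_closed; first exact: norm_hausdorff.
    by apply: continuous_compact => //; exact: continuous_subspaceT.
  have n0 : (~` (F @` K)) 0.
    move=> [[x y] [_ /= De] F0]; have [xy|xy] := eqVneq x y.
      by move: De; rewrite /D /= xy subrr enorm0 powR0 ?gt_eqF// leNgt e0.
    by have := conv_gap_gt0 xy; rewrite -/(F (x, y)) F0 ltxx.
  have := open_nbhs_nbhs (conj (closed_openC cFK) n0).
  move=> /nbhs_ballP[c /= c0 Hc]; exists c => // z Kz; rewrite leNgt; apply/negP => Fc.
  apply: (Hc (F z)); last by exists z.
  by rewrite /ball/= sub0r normrN ger0_norm//; exact: conv_gap_ge0.
exists (2 `^ p * 2 / c); first by rewrite divr_gt0// mulr_gt0// powR_gt0.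
move=> x y; set s := enorm x `^ p + enorm y `^ p.
have s0 : 0 <= s by rewrite addr_ge0// powR_ge0.
have DS : enorm (x - y) `^ p <= 2 `^ p * s.
  have := powR_normD (enorm x) (enorm y) p0; rewrite !(ger0_norm (enorm_ge0 _)).
  apply: le_trans; apply: ge0_ler_powR; rewrite ?nnegrE ?(ltW p0) ?enorm_ge0//.
  by apply: le_trans (ler_norm _); apply: le_trans (enormD _ _) _; rewrite enormN.
have [s00|sn0] := eqVneq s 0.
  apply: le_trans DS _; rewrite s00 !mulr0 add0r mulr_ge0 ?conv_gap_ge0//.
  by rewrite divr_ge0 ?(ltW c0)// mulr_ge0// powR_ge0.
have {sn0 s0} s0 : 0 < s by rewrite lt_neqAle eq_sym sn0.
pose l := s `^ (- p^-1).
have l0 : 0 < l by rewrite powR_gt0.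
have lp : l `^ p = s^-1.
  by rewrite /l -powRrM mulNr mulVf ?gt_eqF// powRN powRr1// ltW.
have hom x' : enorm (l *: x') `^ p = s^-1 * enorm x' `^ p.
  by rewrite enormZ gtr0_norm// powRM ?enorm_ge0 ?ltW// lp.
have FZ : F (l *: x, l *: y) = s^-1 * conv_gap x y.
  have e1 : 2^-1 *: (l *: x + l *: y) = l *: (2^-1 *: (x + y)).
    by rewrite -scalerDr !scalerA mulrC.
  by rewrite /F /conv_gap /= e1 !hom; ring.
have SZ : S (l *: x, l *: y) = 1 by rewrite /S /= !hom -mulrDr mulVf// gt_eqF.
have DZ : D (l *: x, l *: y) = s^-1 * enorm (x - y) `^ p by rewrite /D /= -scalerBr hom.
have g0 := conv_gap_ge0 x y.
have [le|] := leP e (D (l *: x, l *: y)).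
  have := Hc (l *: x, l *: y) (conj SZ le); rewrite FZ mulrC ler_pdivlMr// => h.
  apply: le_trans DS _.
  have -> : 2 `^ p * 2 / c * conv_gap x y = 2 `^ p * (2 * conv_gap x y / c) by ring.
  have q1 : 0 < 2 `^ p :> R by rewrite powR_gt0.
  have q2 : s <= conv_gap x y / c by rewrite ler_pdivlMr// mulrC.
  have q3 : 0 <= e * s by rewrite mulr_ge0 ?ltW.
  have q4 : 2 `^ p * s <= 2 `^ p * (conv_gap x y / c) by rewrite ler_pM2l.
  have q5 : 0 <= 2 `^ p * (conv_gap x y / c) by rewrite mulr_ge0 ?(ltW q1)// divr_ge0 ?(ltW c0).
  have -> : 2 * conv_gap x y / c = conv_gap x y / c + conv_gap x y / c by ring.
  apply: le_trans q4 _; rewrite [2 `^ p * (_ + _)]mulrDr -[leLHS]add0r.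
  by apply: lerD; [exact: q3|rewrite lerDl].
rewrite DZ mulrC ltr_pdivrMr// => /ltW h; apply: le_trans h _.
rewrite lerDl mulr_ge0// divr_ge0 ?mulr_ge0 ?powR_ge0 ?ltW//.
Qed.
End uniform_convexity.

Section energy.
Variables (R : realType) (N : nat).
Local Notation E := 'rV[R]_N.
Local Notation mu := (lebesgue_rV R N).
Variable p : R.
Hypotheses (N0 : (0 < N)%N) (Np : N%:R < p).
Let N1 : 1 <= N%:R :> R. Proof. by rewrite ler1n. Qed.
Let p1 : 1 < p. Proof. exact: le_lt_trans Np. Qed.
Let p0 : 0 < p. Proof. exact: lt_trans p1. Qed.

(** A function carried together with a gradient: linear operations are exact on pairs, whereas the
    gradient selected by [grad] is linear only almost everywhere. *)
Definition sobolev_pair : lmodType R := ((E -> R^o) * (E -> E))%type.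
Local Notation V := sobolev_pair.
Implicit Types u v w : V.

Definition in_W1p v : Prop := Lp mu p v.1 /\ weak_gradient p v.1 v.2.

Lemma in_W1p_grad v : in_W1p v -> forall i, Lp mu p (fun x => v.2 x ord0 i).
Proof. by move=> [_ vD]; exact: (weak_gradient_Lp p1 vD). Qed.

Lemma in_W1p_measurable_grad v : in_W1p v -> measurable_fun setT v.2.
Proof. by move=> Wv; apply: measurable_fun_rV => i; exact: (in_W1p_grad Wv i).1. Qed.

Lemma in_W1p0 : in_W1p 0.
Proof.
split; first exact: Lp0.
split=> [i|phi tphi i].
  apply/LfunP_Lp => //; rewrite (_ : (fun _ => _) = fun=> 0); first exact: Lp0.
  by apply/funext => x; rewrite mxE.
under eq_Rintegral do rewrite mul0r.
under [X in - X]eq_Rintegral do rewrite mxE mul0r.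
by rewrite Rintegral_cst// mul0r oppr0.
Qed.

Lemma in_W1pL (t : R) u v : in_W1p u -> in_W1p v -> in_W1p (t *: u + v).
Proof.
move=> Wu Wv; have up := Wu.1; have vp := Wv.1.
have Dup := in_W1p_grad Wu; have Dvp := in_W1p_grad Wv.
split; first exact: (LpD p0 (LpZ t up) vp).
have eD i : (fun x => (t *: u + v).2 x ord0 i) = fun x => t * u.2 x ord0 i + v.2 x ord0 i.
  by apply/funext => x; rewrite /= !mxE.
split=> [i|phi tphi i].
  by apply/(LfunP_Lp _ _ p0); rewrite eD; exact: (LpD p0 (LpZ t (Dup i)) (Dvp i)).
have [a [b [M [M0 phiM dphiM phi0]]]] := test_function_bound tphi.
have mphi := measurable_test tphi; have mdphi := measurable_partial i tphi.
have z0 x (h : ~ obox a b x) := (phi0 x h).1; have z1 x (h : ~ obox a b x) := (phi0 x h).2 i.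
have i1 := Lp_test_integrable0 p1 M0 up mdphi (dphiM i) z1.
have i2 := Lp_test_integrable0 p1 M0 vp mdphi (dphiM i) z1.
have i3 := Lp_test_integrable0 p1 M0 (Dup i) mphi phiM z0.
have i4 := Lp_test_integrable0 p1 M0 (Dvp i) mphi phiM z0.
transitivity (t * \int[mu]_x (u.1 x * partial i phi x) + \int[mu]_x (v.1 x * partial i phi x)).
  rewrite -RintegralZl// -RintegralD//; last exact: integrableRZ.
  by apply: eq_Rintegral => x _; rewrite mulrA -mulrDl.
rewrite (Wu.2.2 phi tphi i) (Wv.2.2 phi tphi i) mulrN -opprD; congr (- _).
rewrite -RintegralZl// -RintegralD//; last exact: integrableRZ.
apply: eq_Rintegral => x _; have -> := congr1 (fun f => f x) (eD i).
by rewrite mulrA -mulrDl.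
Qed.

Lemma in_W1pZ (t : R) v : in_W1p v -> in_W1p (t *: v).
Proof. by move=> Wv; rewrite -[_ *: _]addr0; apply: in_W1pL => //; exact: in_W1p0. Qed.

Lemma in_W1pD u v : in_W1p u -> in_W1p v -> in_W1p (u + v).
Proof. by move=> Wu Wv; rewrite -[u]scale1r; exact: in_W1pL. Qed.

Lemma in_W1pB u v : in_W1p u -> in_W1p v -> in_W1p (u - v).
Proof. by move=> Wu Wv; rewrite addrC -scaleN1r; exact: in_W1pL. Qed.

Lemma in_W1p_enorm v : in_W1p v -> Lp mu p (fun x => enorm (v.2 x)).
Proof. by move=> Wv; apply: (Lp_enorm N0 Np) => i; exact: in_W1p_grad. Qed.

Lemma in_W1p_integrable_grad v : in_W1p v ->
  mu.-integrable setT (EFin \o fun x => enorm (v.2 x) `^ p).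
Proof.
move=> /in_W1p_enorm/Lp_integrable_powR; apply: eq_integrable => // x _ /=.
by rewrite ger0_norm// enorm_ge0.
Qed.

Variables (a : E -> R) (alo ahi : R).
(** The bounds hold everywhere; an essentially bounded potential is modified on a null set
    beforehand. *)
Hypotheses (ma : measurable_fun setT a) (alo0 : 0 < alo)
  (a_alo : forall x, alo <= a x) (a_ahi : forall x, a x <= ahi).
Let a0 x : 0 <= a x. Proof. exact: le_trans (ltW alo0) (a_alo x). Qed.

Lemma in_W1p_integrable_pot v : in_W1p v ->
  mu.-integrable setT (EFin \o fun x => a x * `|v.1 x| `^ p).
Proof.
move=> [vp _]; apply: (ae_bound_integrable (g := fun x => ahi * `|v.1 x| `^ p)).
- by apply: measurable_funM => //; apply: measurable_powR_norm; exact: vp.1.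
- by apply: integrableRZ => //; exact: Lp_integrable_powR.
- by apply: aeW => x; rewrite ger0_norm ?mulr_ge0 ?powR_ge0// ler_wpM2r ?powR_ge0.
Qed.

Definition energy v : R :=
  \int[mu]_x (enorm (v.2 x) `^ p) + \int[mu]_x (a x * `|v.1 x| `^ p).

Lemma energy_ge0 v : 0 <= energy v.
Proof.
by rewrite addr_ge0// Rintegral_ge0// => x _; rewrite ?mulr_ge0 ?powR_ge0.
Qed.

Lemma energyZ (t : R) v : in_W1p v -> energy (t *: v) = `|t| `^ p * energy v.
Proof.
move=> Wv; rewrite mulrDr -RintegralZl//; last exact: in_W1p_integrable_grad.
rewrite -RintegralZl//; last exact: in_W1p_integrable_pot.
congr (_ + _); apply: eq_Rintegral => x _.
  by rewrite /= enormZ powRM ?enorm_ge0.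
have -> : (t *: v).1 x = t * v.1 x by [].
by rewrite normrM powRM ?normr_ge0//; ring.
Qed.

Lemma energy_pot v : in_W1p v -> \int[mu]_x (`|v.1 x| `^ p) <= alo^-1 * energy v.
Proof.
move=> Wv; have ip := Lp_integrable_powR Wv.1; have iA := in_W1p_integrable_pot Wv.
rewrite ler_pdivlMl//; apply: (@le_trans _ _ (\int[mu]_x (a x * `|v.1 x| `^ p))).
  rewrite -RintegralZl//; apply: le_Rintegral => //; first exact: integrableRZ.
  by move=> x _; rewrite ler_wpM2r ?powR_ge0.
by rewrite lerDr Rintegral_ge0// => x _; exact: powR_ge0.
Qed.

Lemma energy_grad v : \int[mu]_x (enorm (v.2 x) `^ p) <= energy v.
Proof. by rewrite lerDl Rintegral_ge0// => x _; rewrite mulr_ge0 ?powR_ge0. Qed.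

Lemma enorm_scalar (t : R) : enorm (const_mx t : 'rV[R]_1) = `|t|.
Proof. by rewrite /enorm /dotv big_ord1 !mxE -expr2 sqrtr_sqr. Qed.

(** Scalars seen as vectors of dimension one, so that the vector inequalities also serve the
    potential part of the energy. *)
Let row1 (t : R) : 'rV[R]_1 := const_mx t.

Let row1L (s t x y : R) : s *: row1 x + t *: row1 y = row1 (s * x + t * y).
Proof. by apply/rowP => k; rewrite !mxE. Qed.

Let row1B (x y : R) : row1 x - row1 y = row1 (x - y).
Proof. by apply/rowP => k; rewrite !mxE. Qed.

Let row1mid (x y : R) : 2^-1 *: (row1 x + row1 y) = row1 (2^-1 * (x + y)).
Proof. by apply/rowP => k; rewrite !mxE. Qed.

Let mid (f g h : E -> R) : mu.-integrable setT (EFin \o f) -> mu.-integrable setT (EFin \o g) ->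
  mu.-integrable setT (EFin \o h) ->
  mu.-integrable setT (EFin \o fun x => 2^-1 * (f x + g x) - h x) /\
  \int[mu]_x (2^-1 * (f x + g x) - h x) = 2^-1 * (\int[mu]_x f x + \int[mu]_x g x) - \int[mu]_x h x.
Proof.
move=> jf jg jh; have jfg := integrableRD measurableT jf jg.
have jz := integrableRZ 2^-1 measurableT jfg; split; first exact: integrableRB.
by rewrite RintegralB// RintegralZl// RintegralD.
Qed.

Lemma energy_cvx u v (t : R) : in_W1p u -> in_W1p v -> 0 <= t -> t <= 1 ->
  energy ((1 - t) *: u + t *: v) <= (1 - t) * energy u + t * energy v.
Proof.
move=> Wu Wv t0 t1; have Wuv : in_W1p ((1 - t) *: u + t *: v).
  by apply: in_W1pL => //; exact: in_W1pZ.
have iu := in_W1p_integrable_grad Wu; have iv := in_W1p_integrable_grad Wv.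
have ju := in_W1p_integrable_pot Wu; have jv := in_W1p_integrable_pot Wv.
rewrite /energy !mulrDr addrACA; apply: lerD; rewrite -!RintegralZl// -RintegralD//;
  try exact: integrableRZ; apply: le_Rintegral => //; try by apply: integrableRD => //; exact: integrableRZ.
- exact: in_W1p_integrable_grad.
- by move=> x _; exact: enorm_powR_convex.
- exact: in_W1p_integrable_pot.
- move=> x _; have := enorm_powR_convex p1 (row1 (u.1 x)) (row1 (v.1 x)) t0 t1.
  rewrite row1L !enorm_scalar => h.
  have -> : (1 - t) * (a x * `|u.1 x| `^ p) + t * (a x * `|v.1 x| `^ p) =
    a x * ((1 - t) * `|u.1 x| `^ p + t * `|v.1 x| `^ p) by ring.
  by rewrite ler_wpM2l.
Qed.

Definition energy_gap u v := (energy u + energy v) / 2 - energy (2^-1 *: (u + v)).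

(** The pointwise inequality is integrated in dimension [N] for the gradients and in dimension one,
    with weight [a], for the values. The constant [C1 + C2] serves both because each integrated gap
    is nonnegative. *)
Lemma energy_ucvx (e : R) : 0 < e -> exists2 C : R, 0 < C & forall u v,
  in_W1p u -> in_W1p v -> energy (u - v) <= e * (energy u + energy v) + C * energy_gap u v.
Proof.
move=> e0; have [C1 C10 H1] := @uniform_convexity R N p p1 e e0.
have [C2 C20 H2] := @uniform_convexity R 1 p p1 e e0.
exists (C1 + C2); first exact: addr_gt0.
move=> u v Wu Wv; set z := 2^-1 *: (u + v).
have Wz : in_W1p z by apply: in_W1pZ; exact: in_W1pD.
have Wd := in_W1pB Wu Wv.
have iu := in_W1p_integrable_grad Wu; have iv := in_W1p_integrable_grad Wv.
have iz := in_W1p_integrable_grad Wz.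
have ju := in_W1p_integrable_pot Wu; have jv := in_W1p_integrable_pot Wv.
have jz := in_W1p_integrable_pot Wz.
have id := in_W1p_integrable_grad Wd; have jd := in_W1p_integrable_pot Wd.
pose su x := row1 (u.1 x); pose sv x := row1 (v.1 x).
pose G1 x := conv_gap p (u.2 x) (v.2 x); pose G2 x := a x * conv_gap p (su x) (sv x).
have E1 x : G1 x = 2^-1 * (enorm (u.2 x) `^ p + enorm (v.2 x) `^ p) - enorm (z.2 x) `^ p.
  by rewrite /G1 /conv_gap mulrC.
have E2 x : G2 x = 2^-1 * (a x * `|u.1 x| `^ p + a x * `|v.1 x| `^ p) - a x * `|z.1 x| `^ p.
  rewrite /G2 /conv_gap /su /sv row1mid !enorm_scalar.
  have -> : z.1 x = 2^-1 * (u.1 x + v.1 x) by [].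
  ring.
have G1f : G1 = fun x => 2^-1 * (enorm (u.2 x) `^ p + enorm (v.2 x) `^ p) - enorm (z.2 x) `^ p.
  by apply/funext.
have G2f : G2 = fun x => 2^-1 * (a x * `|u.1 x| `^ p + a x * `|v.1 x| `^ p) - a x * `|z.1 x| `^ p.
  by apply/funext.
have [iG1 eG1] := mid iu iv iz; have [iG2 eG2] := mid ju jv jz.
rewrite -G1f in iG1 eG1; rewrite -G2f in iG2 eG2.
have D1 : \int[mu]_x (enorm ((u - v).2 x) `^ p) <=
    e * (\int[mu]_x (enorm (u.2 x) `^ p) + \int[mu]_x (enorm (v.2 x) `^ p)) + C1 * \int[mu]_x G1 x.
  rewrite -RintegralD// -!RintegralZl//; last exact: integrableRD.
  have k1 := integrableRZ e measurableT (integrableRD measurableT iu iv).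
  have k2 := integrableRZ C1 measurableT iG1.
  rewrite -RintegralD//; apply: le_Rintegral => //; first exact: integrableRD.
  by move=> x _; exact: H1.
have D2 : \int[mu]_x (a x * `|(u - v).1 x| `^ p) <=
    e * (\int[mu]_x (a x * `|u.1 x| `^ p) + \int[mu]_x (a x * `|v.1 x| `^ p)) + C2 * \int[mu]_x G2 x.
  rewrite -RintegralD// -!RintegralZl//; last exact: integrableRD.
  have k1 := integrableRZ e measurableT (integrableRD measurableT ju jv).
  have k2 := integrableRZ C2 measurableT iG2.
  rewrite -RintegralD//; apply: le_Rintegral => //; first exact: integrableRD.
  move=> x _; have := ler_wpM2l (a0 x) (H2 (su x) (sv x)).
  rewrite /su /sv row1B !enorm_scalar => h; apply: le_trans h _.
  by rewrite /G2 /su /sv le_eqVlt; apply/orP; left; apply/eqP; ring.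
have G10 : 0 <= \int[mu]_x G1 x by apply: Rintegral_ge0 => x _; exact: (conv_gap_ge0 p1).
have G20 : 0 <= \int[mu]_x G2 x.
  by apply: Rintegral_ge0 => x _; rewrite mulr_ge0//; exact: (conv_gap_ge0 p1).
have gapE : energy_gap u v = \int[mu]_x G1 x + \int[mu]_x G2 x.
  rewrite eG1 eG2 /energy_gap /energy -/z.
  do 6!move: (Rintegral _ _ _) => ?; ring.
rewrite gapE /energy.
move: (\int[mu]_x G1 x) (\int[mu]_x G2 x) G10 G20 D1 D2 => I1 I2 I10 I20.
do 6!move: (Rintegral _ _ _) => ?; move=> D1 D2.
have h1 : 0 <= C1 * I2 by rewrite mulr_ge0 ?(ltW C10).
have h2 : 0 <= C2 * I1 by rewrite mulr_ge0 ?(ltW C20).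
apply: le_trans (lerD D1 D2) _.
by rewrite -subr_ge0 [leRHS](_ : _ = C1 * I2 + C2 * I1); [exact: addr_ge0|ring].
Qed.
End energy.

Section energy_space.
Variables (R : realType) (N : nat).
Local Notation E := 'rV[R]_N.
Local Notation mu := (lebesgue_rV R N).
Variable p : R.
Hypotheses (N0 : (0 < N)%N) (Np : N%:R < p).
Let N1 : 1 <= N%:R :> R. Proof. by rewrite ler1n. Qed.
Let p1 : 1 < p. Proof. exact: le_lt_trans Np. Qed.
Let p0 : 0 < p. Proof. exact: lt_trans p1. Qed.
Let n0 : 0 < N%:R :> R. Proof. by rewrite ltr0n. Qed.
Local Notation V := (sobolev_pair R N).
Variables (a : E -> R) (alo ahi : R).
Hypotheses (ma : measurable_fun setT a) (alo0 : 0 < alo)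
  (a_alo : forall x, alo <= a x) (a_ahi : forall x, a x <= ahi).
Let ahi0 : 0 < ahi. Proof. exact: lt_le_trans alo0 (le_trans (a_alo 0) (a_ahi 0)). Qed.
Let a0 x : 0 <= a x. Proof. exact: le_trans (ltW alo0) (a_alo x). Qed.

Lemma test_Lp (psi : E -> R) (M s : R) a' b' : 0 < s -> measurable_fun setT psi ->
  (forall x, `|psi x| <= M) -> (forall x, ~ obox a' b' x -> psi x = 0) -> Lp mu s psi.
Proof.
move=> s0 mpsi psiM psi0; have mB := measurable_obox a' b'.
have M0 : 0 <= M by apply: le_trans (psiM 0).
apply: (@Lp_le _ _ _ _ s (\1_(obox a' b')) _ M) => //.
  move=> x; rewrite indicE; case: (boolP (x \in _)) => xB; first by rewrite normr1 mulr1.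
  by rewrite notin_setE in xB; rewrite psi0// normr0 mulr_ge0.
split; first exact: measurable_indic.
rewrite (_ : \int[mu]_x _ = mu (obox a' b'))%E ?mu_obox_lty//.
rewrite -[in RHS](setIT (obox a' b')) -integral_indic//.
by apply: eq_integral => x _; rewrite indicE; case: (_ \in _); rewrite ?normr1 ?powR1// normr0 powR0// gt_eqF.
Qed.

Lemma Lp_cvg_Rintegral (f : nat -> E -> R) (g psi : E -> R) : (forall n, Lp mu p (f n)) ->
  Lp mu p g -> Lp mu (p / (p - 1)) psi ->
  (forall e : R, 0 < e -> exists K, forall n, (K <= n)%N -> \int[mu]_x (`|g x - f n x| `^ p) <= e) ->
  \int[mu]_x (f n x * psi x) @[n --> \oo] --> \int[mu]_x (g x * psi x).
Proof.
move=> fp gp hp H; set S := (\int[mu]_x (`|psi x| `^ (p / (p - 1)))) `^ (p / (p - 1))^-1.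
have S0 : 0 <= S by exact: powR_ge0.
apply/cvgrPdist_le => e e0.
have ip : 0 < p^-1 by rewrite invr_gt0.
have [d d0 Hd] := powR_small S0 ip e0.
have [K HK] := H d d0; exists K => // n /= Kn.
have i1 := Lp_integrableM p1 gp hp; have i2 := Lp_integrableM p1 (fp n) hp.
have dp := LpB p0 gp (fp n).
rewrite -RintegralB//; under eq_Rintegral do rewrite -mulrBl.
apply: le_trans (Lp_hoelder p1 dp hp) _; rewrite -/S mulrC; apply: le_trans Hd.
by rewrite ler_wpM2l// ge0_ler_powR ?nnegrE ?(ltW ip) ?(ltW d0) ?Rintegral_powR_ge0// HK.
Qed.

(** The norm is at most [N] times the largest coordinate; this crude constant is enough for a
    convergence statement. *)
Lemma enorm_powR_sum (x : E) : enorm x `^ p <= N%:R `^ p * \sum_i `|x ord0 i| `^ p.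
Proof.
have [i0 _ Hi] : exists2 i0 : 'I_N, true & forall j, `|x ord0 j| <= `|x ord0 i0|.
  have [i _ Hi] := @Order.TotalTheory.arg_maxP _ R 'I_N (Ordinal N0) xpredT (fun i => `|x ord0 i|) isT.
  by exists i => // j; exact: Hi.
apply: (@le_trans _ _ ((N%:R * `|x ord0 i0|) `^ p)).
  apply: ge0_ler_powR; rewrite ?nnegrE ?(ltW p0) ?enorm_ge0 ?mulr_ge0//.
  apply: le_trans (enorm_le_sum _) _.
  apply: le_trans (ler_sum _ (fun i _ => Hi i)) _.
  by rewrite sumr_const card_ord mulr_natl.
rewrite powRM// ler_wpM2l ?powR_ge0// (bigD1 i0)//= lerDl sumr_ge0//.
Qed.

(** Values and gradient components converge separately in L^p. The weak gradient identity passes to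
    the limit since test functions and their partial derivatives lie in the dual space. *)
Lemma energy_complete (s : nat -> V) : (forall n, in_W1p p (s n)) ->
  (forall e : R, 0 < e -> exists K, forall m n, (K <= m)%N -> (K <= n)%N ->
     energy p a (s m - s n) <= e) ->
  exists2 u, in_W1p p u & forall e : R, 0 < e -> exists K, forall n, (K <= n)%N ->
     energy p a (u - s n) <= e.
Proof.
move=> Ws sC; have iWB m n := in_W1pB N0 Np (Ws m) (Ws n).
have [g gp Hg] : exists2 g, Lp mu p g & forall e : R, 0 < e -> exists K, forall n, (K <= n)%N ->
    \int[mu]_x (`|g x - (s n).1 x| `^ p) <= e.
  apply: (Lp_complete p1 (fun n => (Ws n).1)) => e e0.
  have [K HK] := sC _ (mulr_gt0 alo0 e0); exists K => i j Ki Kj.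
  apply: le_trans (energy_pot ma alo0 a_alo a_ahi (iWB i j)) _.
  by rewrite ler_pdivrMl// HK.
have /choice[D HD] : forall i : 'I_N, exists d : E -> R, Lp mu p d /\
    forall e : R, 0 < e -> exists K, forall n, (K <= n)%N ->
    \int[mu]_x (`|d x - (s n).2 x ord0 i| `^ p) <= e.
  move=> i.
  have [d dp Hd] : exists2 d, Lp mu p d & forall e : R, 0 < e -> exists K, forall n, (K <= n)%N ->
      \int[mu]_x (`|d x - (s n).2 x ord0 i| `^ p) <= e; last by exists d.
  apply: (Lp_complete p1 (fun n => in_W1p_grad N0 Np (Ws n) i)) => e e0.
  have [K HK] := sC e e0; exists K => m n Km Kn.
  apply: le_trans (HK m n Km Kn); apply: le_trans (energy_grad p alo0 a_alo (s m - s n)).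
  apply: le_Rintegral => //.
  - exact: (Lp_integrable_powR (LpB p0 (in_W1p_grad N0 Np (Ws m) i) (in_W1p_grad N0 Np (Ws n) i))).
  - exact: in_W1p_integrable_grad.
  move=> x _; apply: ge0_ler_powR; rewrite ?nnegrE ?(ltW p0) ?enorm_ge0//.
  by have := coord_le_enorm ((s m - s n).2 x) i; rewrite !mxE.
pose u : V := (g, fun x => \row_i D i x).
have uD i : (fun x => u.2 x ord0 i) = D i by apply/funext => x; rewrite mxE.
have Wu : in_W1p p u.
  split => //; split=> [i|phi tphi i].
    by apply/(LfunP_Lp _ _ p0); rewrite uD; exact: (HD i).1.
  have [a' [b' [M [M0 phiM dphiM phi0]]]] := test_function_bound tphi.
  have q0 : 0 < p / (p - 1) by rewrite divr_gt0// subr_gt0.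
  have h1 := test_Lp q0 (measurable_test tphi) phiM (fun x h => (phi0 x h).1).
  have h2 := test_Lp q0 (measurable_partial i tphi) (dphiM i) (fun x h => (phi0 x h).2 i).
  have c1 := Lp_cvg_Rintegral (fun n => (Ws n).1) gp h2 Hg.
  have c2 := Lp_cvg_Rintegral (fun n => in_W1p_grad N0 Np (Ws n) i) (HD i).1 h1 (HD i).2.
  have e n : \int[mu]_x ((s n).1 x * partial i phi x) = - \int[mu]_x ((s n).2 x ord0 i * phi x).
    exact: (Ws n).2.2.
  move: c1; under eq_fun do rewrite e; move=> c1.
  have := cvg_unique (@norm_hausdorff _ R) c1 (cvgN c2) => ->.
  by congr (- _); apply: eq_Rintegral => x _; rewrite mxE.
exists u => // e e0.
pose e1 := e / 2 / ahi; pose e2 := e / 2 / (N%:R `^ p * N%:R).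
have c0 : 0 < N%:R `^ p * N%:R :> R by rewrite mulr_gt0 ?powR_gt0.
have e10 : 0 < e1 by rewrite divr_gt0 ?divr_gt0.
have e20 : 0 < e2 by rewrite divr_gt0 ?divr_gt0.
have [K1 HK1] := Hg e1 e10.
have /choice[K2 HK2] := fun i => (HD i).2 e2 e20.
exists (maxn K1 (\max_i K2 i)) => n; rewrite geq_max => /andP[n1 /bigmax_leqP n2].
have Wd := in_W1pB N0 Np Wu (Ws n).
have -> : e = N%:R `^ p * (N%:R * e2) + ahi * e1.
  rewrite /e1 /e2; have q : N%:R `^ p != 0 :> R by rewrite gt_eqF// powR_gt0.
  by move: q; move: (N%:R `^ p) => c q; field; rewrite q !gt_eqF.
have ipi i : mu.-integrable setT (EFin \o fun x => `|D i x - (s n).2 x ord0 i| `^ p).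
  exact: (Lp_integrable_powR (LpB p0 (HD i).1 (in_W1p_grad N0 Np (Ws n) i))).
apply: lerD.
  apply: (@le_trans _ _ (\int[mu]_x (N%:R `^ p * \sum_i `|D i x - (s n).2 x ord0 i| `^ p))).
    apply: le_Rintegral => //; first exact: in_W1p_integrable_grad.
      by apply: integrableRZ => //; exact: integrable_sumR.
    move=> x _; apply: le_trans (enorm_powR_sum _) _; rewrite ler_wpM2l ?powR_ge0//.
    by apply: ler_sum => i _; rewrite /= !mxE.
  rewrite RintegralZl//; last exact: integrable_sumR.
  rewrite ler_wpM2l ?powR_ge0// Rintegral_sum//.
  apply: le_trans (ler_sum _ (fun i _ => HK2 i n (n2 i isT))) _.
  by rewrite sumr_const card_ord mulr_natl.
apply: (@le_trans _ _ (\int[mu]_x (ahi * `|g x - (s n).1 x| `^ p))).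
  have jd := Lp_integrable_powR (LpB p0 gp (Ws n).1).
  apply: le_Rintegral => //; first exact: (in_W1p_integrable_pot ma alo0 a_alo a_ahi Wd).
    exact: integrableRZ.
  by move=> x _; rewrite ler_wpM2r ?powR_ge0.
rewrite RintegralZl//; last exact: (Lp_integrable_powR (LpB p0 gp (Ws n).1)).
by rewrite ler_wpM2l ?(ltW ahi0)// HK1.
Qed.
End energy_space.

(** * The embedding and the first variation *)

Lemma powR_expR (R : realType) (x y : R) : 0 < x -> x `^ y = expR (y * ln x).
Proof. by move=> x0; rewrite /powR gt_eqF. Qed.

Lemma powR_invK (R : realType) (p x : R) : p != 0 -> 0 <= x -> (x `^ p^-1) `^ p = x.
Proof. by move=> p0 x0; rewrite -powRrM mulVf// powRr1. Qed.

(** Convexity of the power at the midpoint; this is where the factor [2^((p-1)/p)] of [k_a] comes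
    from. *)
Lemma norm_sum_powR (R : realType) (p x y : R) : 1 < p -> 0 <= x -> 0 <= y ->
  x + y <= 2 `^ ((p - 1) / p) * (x `^ p + y `^ p) `^ p^-1.
Proof.
move=> p1 x0 y0; have p0 : 0 < p by exact: lt_trans p1.
have h := @powR_convex R p x y 2^-1 (ltW p1) x0 y0 (ltac:(lra)) (ltac:(lra)).
have e1 : (1 - 2^-1) * x + 2^-1 * y = (x + y) / 2 by lra.
have e2 : (1 - 2^-1) * x `^ p + 2^-1 * y `^ p = (x `^ p + y `^ p) / 2 by lra.
rewrite e1 e2 in h.
have s0 : 0 <= x `^ p + y `^ p by rewrite addr_ge0 ?powR_ge0.
have xy0 : 0 <= (x + y) / 2 by rewrite divr_ge0 ?addr_ge0.
have : (x + y) / 2 <= ((x `^ p + y `^ p) / 2) `^ p^-1.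
  have -> : (x + y) / 2 = (((x + y) / 2) `^ p) `^ p^-1.
    by rewrite -powRrM mulfV ?gt_eqF// powRr1.
  by apply: ge0_ler_powR; rewrite ?nnegrE ?invr_ge0 ?powR_ge0 ?(ltW p0)// divr_ge0.
rewrite ler_pdivrMr// => /le_trans; apply; rewrite powRM// ?invr_ge0// mulrC mulrA mulrAC.
rewrite ler_wpM2r ?powR_ge0// le_eqVlt; apply/orP; left; apply/eqP.
rewrite !powR_expR// ?invr_gt0// lnV ?posrE//.
rewrite -[X in X * _](@lnK R 2) ?posrE// -expRD; congr expR.
by field; rewrite gt_eqF.
Qed.

Section morrey_energy.
Variables (R : realType) (N : nat).
Local Notation E := 'rV[R]_N.
Local Notation mu := (lebesgue_rV R N).
Variable p : R.
Hypotheses (N0 : (0 < N)%N) (Np : N%:R < p).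
Let N1 : 1 <= N%:R :> R. Proof. by rewrite ler1n. Qed.
Let p1 : 1 < p. Proof. exact: le_lt_trans Np. Qed.
Let p0 : 0 < p. Proof. exact: lt_trans p1. Qed.
Let n0 : 0 < N%:R :> R. Proof. by rewrite ltr0n. Qed.
Local Notation V := (sobolev_pair R N).
Variables (a : E -> R) (alo ahi : R).
Hypotheses (ma : measurable_fun setT a) (alo0 : 0 < alo)
  (a_alo : forall x, alo <= a x) (a_ahi : forall x, a x <= ahi).

(** This is [k_a] with [alo] in place of the essential infimum of the potential. *)
Definition embedding_cst : R :=
  (1 / alo) `^ ((p - N%:R) / p ^+ 2) * 2 `^ ((p - 1) / p)
  * inv_ball_volume R N `^ (1 / p) * (1 / N%:R `^ (N%:R / p ^+ 2))
  * ((p - 1) / (p - N%:R)) `^ (N%:R * (p - 1) / p ^+ 2).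

Lemma embedding_cst_gt0 : 0 < embedding_cst.
Proof.
have w0 := ball_vol_gt0 R N.
rewrite /embedding_cst inv_ball_volumeE.
have h1 : 0 < 1 / alo by rewrite divr_gt0.
have h2 : 0 < (2 : R) by [].
have h3 : 0 < (ball_vol R N)^-1 by rewrite invr_gt0.
have h4 : 0 < 1 / N%:R `^ (N%:R / p ^+ 2) by rewrite divr_gt0 ?powR_gt0.
have h5 : 0 < (p - 1) / (p - N%:R) by rewrite divr_gt0 ?subr_gt0.
exact: (mulr_gt0 (mulr_gt0 (mulr_gt0 (mulr_gt0 (powR_gt0 _ h1) (powR_gt0 _ h2)) (powR_gt0 _ h3)) h4) (powR_gt0 _ h5)).
Qed.

(* The radius balances the two terms of [morrey_sup]. *)
Lemma energy_sup (v : V) : in_W1p p v ->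
  {ae mu, forall x, `|v.1 x| <= embedding_cst * energy p a v `^ p^-1}.
Proof.
move=> Wv; have w0 := ball_vol_gt0 R N.
have kap0 : 0 < (p - 1) / (p - N%:R) by rewrite divr_gt0 ?subr_gt0.
(* All constants are products of powers of positive numbers, so the identities between them are
   checked on logarithms; [r] is the logarithm of the radius. *)
pose A := ln alo; pose n := ln (N%:R : R); pose kap := ln ((p - 1) / (p - N%:R)).
pose om := ln (ball_vol R N); pose th := (p - 1) / p.
pose r := - A / p + n / p - th * kap; pose rho := expR r.
have rho0 : 0 < rho by exact: expR_gt0.
pose M := Lp_norm p (fun x => enorm (v.2 x)); pose L := Lp_norm p v.1.
have M0 : 0 <= M by exact: Lp_norm_ge0.
have L0 : 0 <= L by exact: Lp_norm_ge0.
pose X := expR (- om / p - N%:R * r / p).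
have b2 : (rho ^+ N * ball_vol R N) `^ (- p^-1) = X.
  rewrite powR_expR ?mulr_gt0 ?exprn_gt0// lnM ?posrE ?exprn_gt0// lnXn// expRK -/om.
  by congr expR; rewrite mulr_natl; ring.
have b1 : morrey_cst N p * rho `^ (1 - N%:R / p) = X * expR (- A / p).
  rewrite /morrey_cst (powR_expR _ (mulr_gt0 w0 n0)) (powR_expR _ kap0) (powR_expR _ rho0).
  rewrite (lnM w0 n0) expRK -/om -/n -/kap -!expRD; congr expR.
  by rewrite /r /th; field; rewrite gt_eqF.
have := morrey_sup N0 Np Wv.1 Wv.2 rho0; rewrite b1 b2 -/M -/L; apply: filterS => x Hx.
apply: le_trans Hx _.
(* At this radius the coefficients of [L] and [M] are in the ratio [alo^(1/p)], so that the p-th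
   powers of the two terms in brackets add up to at most the energy. *)
have -> : X * expR (- A / p) * M + X * L = X * expR (- A / p) * (M + expR (A / p) * L).
  rewrite mulrDr; congr (_ + _); rewrite -mulrA [expR (- A / p) * _]mulrA -expRD.
  by rewrite mulNr addNr expR0 mul1r.
have kE : embedding_cst = X * expR (- A / p) * 2 `^ th.
  rewrite /embedding_cst inv_ball_volumeE !div1r.
  rewrite !powR_expR ?invr_gt0 ?powR_gt0// !lnV ?posrE// -/om -/A -/n -/kap -expRN -!expRD.
  by congr expR; rewrite /r /th; field; rewrite gt_eqF.
have eL0 : 0 <= expR (A / p) * L by rewrite mulr_ge0 ?expR_ge0.
rewrite kE -[leRHS]mulrA; apply: ler_wpM2l; first by rewrite mulr_ge0 ?expR_ge0.
apply: le_trans (norm_sum_powR p1 M0 eL0) _; rewrite ler_wpM2l ?powR_ge0//.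
have sp0 : 0 <= M `^ p + (expR (A / p) * L) `^ p by rewrite addr_ge0 ?powR_ge0.
suff key : M `^ p + (expR (A / p) * L) `^ p <= energy p a v.
  apply: ge0_ler_powR key; rewrite ?nnegrE//; first by rewrite invr_ge0 ltW.
  exact: (energy_ge0 p alo0 a_alo).
have pn0 : p != 0 by rewrite gt_eqF.
have Mp : M `^ p = \int[mu]_x (enorm (v.2 x) `^ p).
  rewrite [LHS](powR_invK pn0 (Rintegral_powR_ge0 _ _ _)).
  by apply: eq_Rintegral => x' _; rewrite ger0_norm// enorm_ge0.
have Lpp : L `^ p = \int[mu]_x (`|v.1 x| `^ p).
  exact: (powR_invK pn0 (Rintegral_powR_ge0 _ _ _)).
have Ap : expR (A / p) `^ p = alo.
  rewrite powR_expR ?expR_gt0// expRK mulrC divfK ?gt_eqF// lnK ?posrE//.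
move: Mp Lpp => Mp Lpp; clearbody M L.
rewrite (powRM p (expR_ge0 (A / p)) L0) Ap {}Mp {}Lpp /energy lerD2l.
have jp := Lp_integrable_powR Wv.1.
rewrite -RintegralZl//; apply: le_Rintegral => //; first exact: integrableRZ.
  exact: (in_W1p_integrable_pot ma alo0 a_alo a_ahi Wv).
by move=> x' _; rewrite ler_wpM2r ?powR_ge0.
Qed.
End morrey_energy.

(** * Derivative of the p-th power of the norm *)

Section first_variation.
Variables (R : realType) (n : nat) (p : R).
Hypothesis p1 : 1 < p.
Let p0 : 0 < p. Proof. exact: lt_trans p1. Qed.
Local Notation E := 'rV[R]_n.
Local Notation tau n := (n.+1%:R^-1 : R).
Implicit Types x y : E.

Lemma is_derive_tau (f : R -> R) (d : R) : is_derive (0 : R) (1 : R) f d ->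
  (tau k)^-1 * (f (tau k) - f 0) @[k --> \oo] --> d.
Proof.
move=> [h1 h2].
have h0 : tau k @[k --> \oo] --> (0 : R)^'.
  move=> A hA; have H : \forall k \near \oo, tau k != 0 -> A (tau k) := @tau_cvg0 R _ hA.
  apply: (@filterS _ \oo _ (fun k => tau k != 0 -> A (tau k))) H => k; apply.
  by rewrite invr_neq0.
have := cvg_comp _ _ h0 h1; rewrite -/(derive f 0 1) h2.
suff -> : (fun k => (tau k)^-1 * (f (tau k) - f 0)) =
  (fun h : R => h^-1 *: (f (h *: 1 + 0) - f 0)) \o (fun k => tau k) by [].
by apply/funext => k; rewrite /= addr0 /GRing.scale/= mulr1.
Qed.

Definition pform x y : R := enorm x `^ (p - 2) * dotv x y.

(** Away from 0, [|x + t y|^p] is the power [p/2] of a quadratic polynomial in [t], positive near 0.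
    At [x = 0] the quotient is [t^(p-1) |y|^p], which tends to 0 as [p > 1]; this covers [p < 2],
    where the exponent [p - 2] is negative. *)
Lemma pform_quotient_cvg x y :
  (tau k)^-1 * (enorm (x + tau k *: y) `^ p - enorm x `^ p) @[k --> \oo] --> p * pform x y.
Proof.
pose D (t : R) := dotv x x + 2 * dotv x y * t + dotv y y * t ^+ 2.
have DE (t : R) : enorm (x + t *: y) ^+ 2 = D t.
  rewrite enorm_sqr !(dotvDl, dotvDr, dotvZl, dotvZr) [dotv y x]dotvC /D.
  by move: (dotv x x) (dotv x y) (dotv y y) => A B C; ring.
have powE (z : E) : enorm z `^ p = (enorm z ^+ 2) `^ (p / 2).
  by rewrite -powR_mulrn ?enorm_ge0// -powRrM mulrCA divff ?mulr1.
have [->|x0] := eqVneq x 0.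
  rewrite /pform; have -> : dotv (0 : E) y = 0 by rewrite /dotv big1// => i _; rewrite mxE mul0r.
  rewrite mulr0 mulr0; under eq_fun do rewrite add0r enorm0 powR0 ?gt_eqF// subr0 enormZ powRM ?enorm_ge0//.
  have pm1 : 0 < p - 1 by rewrite subr_gt0.
  apply/cvgrPdist_le => e e0.
  have [d d0 Hd] := powR_small (powR_ge0 (enorm y) p) pm1 e0.
  have [k] := ltr_add_invr d0; rewrite add0r => kd.
  exists k => // m /= km; rewrite sub0r normrN; apply: le_trans Hd.
  have t0 : 0 < tau m by rewrite invr_gt0.
  have td : tau m <= d by apply: le_trans (ltW kd); rewrite lef_pV2 ?posrE// ler_nat.
  rewrite (gtr0_norm t0) ger0_norm; last by rewrite !mulr_ge0 ?powR_ge0 ?invr_ge0// ltW.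
  have -> : (tau m)^-1 * (tau m `^ p * enorm y `^ p) = enorm y `^ p * tau m `^ (p - 1).
    rewrite powRD; last by rewrite (gt_eqF t0) implybT.
    by rewrite powRN powRr1 ?(ltW t0)//; ring.
  by rewrite ler_wpM2l ?powR_ge0// ge0_ler_powR ?nnegrE ?(ltW pm1) ?(ltW t0) ?(ltW d0).
have nx : 0 < dotv x x.
  by rewrite -enorm_sqr exprn_gt0// lt_neqAle (enorm_ge0 x) andbT eq_sym; apply: contra x0 => /eqP /enorm_eq0 ->.
have dD : is_derive (0 : R) (1 : R) D (2 * dotv x y).
  have c : (fun h : R => h^-1 *: (D (h *: 1 + 0) - D 0)) @ 0^' --> 2 * dotv x y.
    have cc : (fun h : R => 2 * dotv x y + dotv y y * h) @ (0 : R) --> 2 * dotv x y.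
      rewrite -[X in _ --> X]addr0 -[X in _ + X](mulr0 (dotv y y)).
      by apply: cvgD; [exact: cvg_cst|apply: cvgMr; exact: cvg_id].
    apply: (@cvg_trans _ ((fun h : R => 2 * dotv x y + dotv y y * h) @ 0^')); last first.
      by apply: cvg_trans cc; apply: cvg_app; exact: cvg_within.
    apply: near_eq_cvg; near=> h.
    have h0 : h != 0 by near: h; exact: nbhs_dnbhs_neq.
    rewrite addr0 /D /GRing.scale/= !mulr1 expr0n/= !mulr0 !addr0.
    by move: h0; move: (dotv x x) (dotv x y) (dotv y y) => A B C h0; field.
  by split; [apply/cvg_ex; exists (2 * dotv x y)|exact: cvg_lim c].
have D0 : D 0 = dotv x x by rewrite /D mulr0 expr0n/= mulr0 !addr0.
have dF : is_derive (0 : R) (1 : R) ((fun s => s `^ (p / 2)) \o D) (p * pform x y).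
  have h : 0 < D 0 by rewrite D0.
  have := is_derive1_comp (is_derive1_powR (p / 2) h) dD.
  congr (is_derive _ _ _ _); rewrite /pform D0 -enorm_sqr.
  rewrite -(powR_mulrn 2 (enorm_ge0 x)) -powRrM.
  have -> : 2 * (p / 2 - 1) = p - 2 :> R by field.
  by field.
have := is_derive_tau dF.
suff -> : (fun k => (tau k)^-1 * (((fun s => s `^ (p / 2)) \o D) (tau k) - ((fun s => s `^ (p / 2)) \o D) 0)) =
  (fun k => (tau k)^-1 * (enorm (x + tau k *: y) `^ p - enorm x `^ p)) by [].
by apply/funext => k; rewrite /= -!DE scale0r addr0 -!powE.
Unshelve. all: by end_near.
Qed.

(* Convexity along the segment from [x - y] to [x + y]. *)
Lemma pform_quotient_bound x y k :
  `|(tau k)^-1 * (enorm (x + tau k *: y) `^ p - enorm x `^ p)| <=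
  enorm (x + y) `^ p + enorm (x - y) `^ p + 2 * enorm x `^ p.
Proof.
have t0 : 0 < tau k by rewrite invr_gt0.
have t1 : tau k <= 1 by rewrite invf_le1// ler1n.
have t1' : 0 <= 1 - tau k by rewrite subr_ge0.
have h1 := enorm_powR_convex p1 x (x + y) (ltW t0) t1.
have e1 : (1 - tau k) *: x + tau k *: (x + y) = x + tau k *: y.
  by rewrite scalerBl scale1r scalerDr addrA subrK.
rewrite e1 in h1.
(* With this weight [x] is the barycentre of [x + tau k *: y] and [x - y]; convexity there bounds
   the quotient from below. *)
pose s := tau k / (1 + tau k).
have s0 : 0 <= s by rewrite divr_ge0 ?addr_ge0 ?(ltW t0).
have s1 : s <= 1 by rewrite ler_pdivrMr ?addr_gt0// mul1r lerDr.
have h2 := enorm_powR_convex p1 (x + tau k *: y) (x - y) s0 s1.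
have e2 : (1 - s) *: (x + tau k *: y) + s *: (x - y) = x.
  have q : 1 + tau k != 0 by rewrite gt_eqF// addr_gt0.
  have c1 : (1 - s) + s = 1 by rewrite subrK.
  have c2 : (1 - s) * tau k - s = 0 by rewrite /s; move: q; move: (tau k) => t q; field.
  rewrite scalerDr scalerBr addrACA -scalerDl c1 scale1r scalerA -scalerBl c2 scale0r addr0//.
rewrite e2 in h2.
move: (powR_ge0 (enorm (x + y)) p) (powR_ge0 (enorm (x - y)) p) (powR_ge0 (enorm x) p) => A0 B0 C0.
have h3 : (1 + tau k) * enorm x `^ p <= enorm (x + tau k *: y) `^ p + tau k * enorm (x - y) `^ p.
  have q : 0 < 1 + tau k by rewrite addr_gt0.
  have := ler_wpM2l (ltW q) h2; congr (_ <= _); rewrite /s.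
  by move: q; move: (tau k) (enorm _ `^ p) (enorm (x - y) `^ p) => t A B q; field; rewrite gt_eqF.
move: h1 h3 A0 B0 C0; move: (enorm (x + y) `^ p) (enorm (x - y) `^ p) (enorm x `^ p) (enorm _ `^ p).
move: t0; move: (tau k) => t t0 A B C Z h1 h3 A0 B0 C0.
have qA : 0 <= t * A by rewrite mulr_ge0 ?(ltW t0).
have qB : 0 <= t * B by rewrite mulr_ge0 ?(ltW t0).
have qC : 0 <= t * C by rewrite mulr_ge0 ?(ltW t0).
rewrite ler_norml; apply/andP; split.
  rewrite [leRHS]mulrC ler_pdivlMr// -subr_ge0.
  rewrite [leRHS](_ : _ = (Z + t * B - (1 + t) * C) + (t * A + 3 * (t * C))); last by ring.
  by rewrite addr_ge0 ?subr_ge0// addr_ge0// mulr_ge0.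
rewrite [leLHS]mulrC ler_pdivrMr// -subr_ge0.
rewrite [leRHS](_ : _ = ((1 - t) * C + t * A - Z) + (t * B + 3 * (t * C))); last by ring.
by rewrite addr_ge0 ?subr_ge0// addr_ge0// mulr_ge0.
Qed.
End first_variation.

Section energy_variation.
Variables (R : realType) (N : nat).
Local Notation E := 'rV[R]_N.
Local Notation mu := (lebesgue_rV R N).
Local Notation tau n := (n.+1%:R^-1 : R).
Variable p : R.
Hypotheses (N0 : (0 < N)%N) (Np : N%:R < p).
Let N1 : 1 <= N%:R :> R. Proof. by rewrite ler1n. Qed.
Let p1 : 1 < p. Proof. exact: le_lt_trans Np. Qed.
Let p0 : 0 < p. Proof. exact: lt_trans p1. Qed.
Local Notation V := (sobolev_pair R N).

Lemma weak_gradient_unique (u : E -> R) (D1 D2 : E -> E) :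
  weak_gradient p u D1 -> weak_gradient p u D2 -> {ae mu, forall x, D1 x = D2 x}.
Proof.
move=> h1 h2; have d1 := weak_gradient_Lp p1 h1; have d2 := weak_gradient_Lp p1 h2.
suff H i : {ae mu, forall x, D1 x ord0 i - D2 x ord0 i = 0}.
  have : {ae mu, forall x i, D1 x ord0 i - D2 x ord0 i = 0} by exact: filter_forall.
  by apply: filterS => x Hx; apply/rowP => i; apply/eqP; rewrite -subr_eq0 Hx.
have d12 := LpB p0 (d1 i) (d2 i).
apply: fundamental_lemma; first exact: d12.1.
  by move=> a b; apply: (Lp_integrable_on (ltW p1) (measurable_obox _ _) (mu_obox_lty _ _) d12).
move=> a b k; have tb := bump_test a b k.
have [a' [b' [M [M0 phiM dphiM phi0]]]] := test_function_bound tb.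
have mb := measurable_test tb.
have i1 := Lp_test_integrable0 p1 M0 (d1 i) mb phiM (fun x h => (phi0 x h).1).
have i2 := Lp_test_integrable0 p1 M0 (d2 i) mb phiM (fun x h => (phi0 x h).1).
under eq_Rintegral do rewrite mulrBl.
rewrite RintegralB//; have e1 := h1.2 _ tb i; have e2 := h2.2 _ tb i.
by apply/eqP; rewrite subr_eq0 -eqr_opp -e1 -e2.
Qed.

Variables (a : E -> R) (alo ahi : R).
Hypotheses (ma : measurable_fun setT a) (alo0 : 0 < alo)
  (a_alo : forall x, alo <= a x) (a_ahi : forall x, a x <= ahi).
Let a0 x : 0 <= a x. Proof. exact: le_trans (ltW alo0) (a_alo x). Qed.
Let row1 (t : R) : 'rV[R]_1 := const_mx t.

Let row1L (x t y : R) : row1 x + t *: row1 y = row1 (x + t * y).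
Proof. by apply/rowP => k; rewrite !mxE. Qed.

Let dot1 (x y : R) : dotv (row1 x) (row1 y) = x * y.
Proof. by rewrite /dotv big_ord1 !mxE. Qed.

Lemma scalar_quotient_cvg (x y : R) :
  (tau k)^-1 * (`|x + tau k * y| `^ p - `|x| `^ p) @[k --> \oo] --> p * (`|x| `^ (p - 2) * x * y).
Proof.
have := @pform_quotient_cvg R 1 p p1 (row1 x) (row1 y); rewrite /pform dot1 enorm_scalar.
have -> : `|x| `^ (p - 2) * (x * y) = `|x| `^ (p - 2) * x * y by rewrite mulrA.
suff -> : (fun k => (tau k)^-1 * (enorm (row1 x + tau k *: row1 y) `^ p - `|x| `^ p)) =
  (fun k => (tau k)^-1 * (`|x + tau k * y| `^ p - `|x| `^ p)) by [].
by apply/funext => k; rewrite row1L enorm_scalar.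
Qed.

Lemma scalar_quotient_bound (x y : R) k :
  `|(tau k)^-1 * (`|x + tau k * y| `^ p - `|x| `^ p)| <=
  `|x + y| `^ p + `|x - y| `^ p + 2 * `|x| `^ p.
Proof.
have := pform_quotient_bound p1 (row1 x) (row1 y) k; rewrite row1L !enorm_scalar.
have -> : row1 x + row1 y = row1 (x + y) by rewrite -[row1 y]scale1r row1L mul1r.
have -> : row1 x - row1 y = row1 (x - y) by rewrite -scaleN1r row1L mulN1r.
by rewrite !enorm_scalar.
Qed.

(** Limits of difference quotients inherit the convexity bound; this is how both parts of the energy
    form are shown to be integrable. *)
Lemma quotient_limit_bound (f : nat -> R) (l c : R) : f n @[n --> \oo] --> p * l ->
  (forall n, `|f n| <= c) -> `|l| <= p^-1 * c.
Proof.
move=> fl fc; rewrite ler_pdivlMl// -[X in X * _](gtr0_norm p0) -normrM.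
apply: (@cvgr_to_le _ \oo _ _ (fun n => `|f n|)); first exact: cvg_norm.
by apply: nearW => n; exact: fc.
Qed.

Definition energy_form (w z : V) : R :=
  \int[mu]_x pform p (w.2 x) (z.2 x) +
  \int[mu]_x (a x * `|w.1 x| `^ (p - 2) * w.1 x * z.1 x).

Section pair.
Variables (w z : V).
Hypotheses (Ww : in_W1p p w) (Wz : in_W1p p z).
Let Wp := in_W1pD N0 Np Ww Wz.
Let Wm := in_W1pB N0 Np Ww Wz.
Let g1 x := enorm (w.2 x + z.2 x) `^ p + enorm (w.2 x - z.2 x) `^ p + 2 * enorm (w.2 x) `^ p.
Let g2 x := a x * (`|w.1 x + z.1 x| `^ p + `|w.1 x - z.1 x| `^ p + 2 * `|w.1 x| `^ p).

Let ig1 : mu.-integrable setT (EFin \o g1).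
Proof.
have h1 := in_W1p_integrable_grad N0 Np Wp; have h2 := in_W1p_integrable_grad N0 Np Wm.
have h3 := integrableRZ 2 measurableT (in_W1p_integrable_grad N0 Np Ww).
exact: (integrableRD measurableT (integrableRD measurableT h1 h2) h3).
Qed.

Let ig2 : mu.-integrable setT (EFin \o g2).
Proof.
have h1 := in_W1p_integrable_pot ma alo0 a_alo a_ahi Wp.
have h2 := in_W1p_integrable_pot ma alo0 a_alo a_ahi Wm.
have h3 := integrableRZ 2 measurableT (in_W1p_integrable_pot ma alo0 a_alo a_ahi Ww).
have := integrableRD measurableT (integrableRD measurableT h1 h2) h3.
apply: eq_integrable => // x _; congr (_%:E); rewrite /g2.
have -> : (w + z).1 x = w.1 x + z.1 x by [].
have -> : (w - z).1 x = w.1 x - z.1 x by [].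
by ring.
Qed.

Let mw1 : measurable_fun setT w.1 := Ww.1.1.
Let mz1 : measurable_fun setT z.1 := Wz.1.1.
Let mw2 := in_W1p_measurable_grad N0 Np Ww.
Let mz2 := in_W1p_measurable_grad N0 Np Wz.

Let mform1 : measurable_fun setT (fun x => pform p (w.2 x) (z.2 x)).
Proof.
apply: measurable_funM; last exact: measurable_dotv.
apply: (measurableT_comp (@measurable_powR R _)).
exact: (measurableT_comp (@measurable_enorm R N) mw2).
Qed.

Let mform2 : measurable_fun setT (fun x => a x * `|w.1 x| `^ (p - 2) * w.1 x * z.1 x).
Proof.
apply: measurable_funM => //; apply: measurable_funM => //; apply: measurable_funM => //.
exact: measurable_powR_norm.
Qed.

Lemma energy_form_integrable1 : mu.-integrable setT (EFin \o fun x => pform p (w.2 x) (z.2 x)).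
Proof.
apply: (ae_bound_integrable mform1 (integrableRZ p^-1 measurableT ig1)); apply: aeW => x.
by apply: (quotient_limit_bound (@pform_quotient_cvg R N p p1 (w.2 x) (z.2 x))) => n; exact: pform_quotient_bound.
Qed.

Lemma energy_form_integrable2 :
  mu.-integrable setT (EFin \o fun x => a x * `|w.1 x| `^ (p - 2) * w.1 x * z.1 x).
Proof.
apply: (ae_bound_integrable mform2 (integrableRZ p^-1 measurableT ig2)); apply: aeW => x.
rewrite -!mulrA normrM (ger0_norm (a0 x)) /g2 [leRHS]mulrCA ler_wpM2l//.
rewrite mulrA.
by apply: (quotient_limit_bound (@scalar_quotient_cvg (w.1 x) (z.1 x))) => n; exact: scalar_quotient_bound.
Qed.

(** Dominated convergence, the dominating function being the one that convexity gives for the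
    quotients. *)
Lemma energy_quotient_cvg :
  (tau n)^-1 * (energy p a (w + tau n *: z) - energy p a w) @[n --> \oo] --> p * energy_form w z.
Proof.
have Wt n : in_W1p p (w + tau n *: z).
  by apply: (in_W1pD N0 Np Ww); exact: (in_W1pZ N0 Np).
have i1 n := in_W1p_integrable_grad N0 Np (Wt n).
have i2 n := in_W1p_integrable_pot ma alo0 a_alo a_ahi (Wt n).
have j1 := in_W1p_integrable_grad N0 Np Ww.
have j2 := in_W1p_integrable_pot ma alo0 a_alo a_ahi Ww.
pose f1 n x := (tau n)^-1 * (enorm (w.2 x + tau n *: z.2 x) `^ p - enorm (w.2 x) `^ p).
pose f2 n x := (tau n)^-1 * (a x * `|(w + tau n *: z).1 x| `^ p - a x * `|w.1 x| `^ p).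
have if1 n : mu.-integrable setT (EFin \o f1 n).
  exact: (integrableRZ _ measurableT (integrableRB measurableT (i1 n) j1)).
have if2 n : mu.-integrable setT (EFin \o f2 n).
  exact: (integrableRZ _ measurableT (integrableRB measurableT (i2 n) j2)).
have mf1 n : measurable_fun setT (f1 n) by have /integrableP[/measurable_EFinP] := if1 n.
have mf2 n : measurable_fun setT (f2 n) by have /integrableP[/measurable_EFinP] := if2 n.
have c1 : \int[mu]_x f1 n x @[n --> \oo] --> \int[mu]_x (p * pform p (w.2 x) (z.2 x)).
  apply: (Rintegral_dct mf1 _ ig1); first exact: measurable_funM.
  - by apply: aeW => x; exact: pform_quotient_cvg.
  - by apply: aeW => x n; exact: pform_quotient_bound.
have f2E n x : f2 n x = a x * ((tau n)^-1 * (`|w.1 x + tau n * z.1 x| `^ p - `|w.1 x| `^ p)).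
  have e : (w + tau n *: z).1 x = w.1 x + tau n * z.1 x by [].
  by rewrite /f2 e -mulrBr mulrCA.
have c2 : \int[mu]_x f2 n x @[n --> \oo] -->
    \int[mu]_x (p * (a x * `|w.1 x| `^ (p - 2) * w.1 x * z.1 x)).
  apply: (Rintegral_dct mf2 _ ig2); first exact: measurable_funM.
  - apply: aeW => x; have -> : p * (a x * `|w.1 x| `^ (p - 2) * w.1 x * z.1 x) =
      a x * (p * (`|w.1 x| `^ (p - 2) * w.1 x * z.1 x)) by ring.
    under eq_fun do rewrite f2E.
    by apply: cvgMr; exact: scalar_quotient_cvg.
  - apply: aeW => x n; rewrite f2E normrM (ger0_norm (a0 x)) ler_wpM2l//.
    exact: scalar_quotient_bound.
have -> : p * energy_form w z = \int[mu]_x (p * pform p (w.2 x) (z.2 x)) +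
    \int[mu]_x (p * (a x * `|w.1 x| `^ (p - 2) * w.1 x * z.1 x)).
  rewrite /energy_form mulrDr RintegralZl//; last exact: energy_form_integrable1.
  by rewrite RintegralZl//; exact: energy_form_integrable2.
have -> : (fun n => (tau n)^-1 * (energy p a (w + tau n *: z) - energy p a w)) =
    (fun n => \int[mu]_x f1 n x + \int[mu]_x f2 n x).
  apply/funext => n.
  rewrite (RintegralZl _ measurableT (integrableRB measurableT (i1 n) j1)).
  rewrite (RintegralZl _ measurableT (integrableRB measurableT (i2 n) j2)).
  rewrite (RintegralB measurableT (i1 n) j1) (RintegralB measurableT (i2 n) j2).
  rewrite /energy -mulrDr; congr (_ * _).
  by rewrite opprD addrACA.
exact: cvgD.
Qed.
End pair.

Lemma energy_formN (w z : V) : in_W1p p w -> in_W1p p z ->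
  energy_form w (- z) = - energy_form w z.
Proof.
move=> Ww Wz.
have e1 : \int[mu]_x pform p (w.2 x) ((- z).2 x) = - \int[mu]_x pform p (w.2 x) (z.2 x).
  rewrite -Rintegral_opp//; last first.
    by have /integrableP[/measurable_EFinP] := energy_form_integrable1 Ww Wz.
  by apply: eq_Rintegral => x _; rewrite /pform -mulrN; congr (_ * _); rewrite dotvC /= dotvNl dotvC.
have e2 : \int[mu]_x (a x * `|w.1 x| `^ (p - 2) * w.1 x * (- z).1 x) =
    - \int[mu]_x (a x * `|w.1 x| `^ (p - 2) * w.1 x * z.1 x).
  rewrite -Rintegral_opp//; last first.
    by have /integrableP[/measurable_EFinP] := energy_form_integrable2 Ww Wz.
  by apply: eq_Rintegral => x _; rewrite -mulrN.
have H (A B C D : R) : A = - C -> B = - D -> A + B = - (C + D) by move=> -> ->; rewrite opprD.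
exact: (H _ _ _ _ e1 e2).
Qed.

(** Positive steps from the minimizer give [l z <= energy_form w z]; both sides are odd in [z],
    which turns the inequality into an equality. *)
Lemma critical_energy_form (w : V) (l : V -> R) : in_W1p p w ->
  (forall (t : R) u v, in_W1p p u -> in_W1p p v -> l (t *: u + v) = t * l u + l v) ->
  (forall v, in_W1p p v -> energy p a w / p - l w <= energy p a v / p - l v) ->
  forall z, in_W1p p z -> energy_form w z = l z.
Proof.
move=> Ww lL crit.
have half z : in_W1p p z -> l z <= energy_form w z.
  move=> Wz; rewrite -(ler_pM2l p0).
  apply: (@cvgr_to_ge _ \oo _ _ _ _ _ (energy_quotient_cvg Ww Wz)).
  apply: nearW => n; have t0 : 0 < tau n by rewrite invr_gt0.
  have Wt : in_W1p p (tau n *: z + w) by exact: (in_W1pL N0 Np).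
  have := crit _ Wt; rewrite lL// [tau n *: z + w]addrC.
  rewrite -subr_ge0 => h; rewrite -(pmulr_rge0 _ p0) in h.
  rewrite [leRHS]mulrC ler_pdivlMr//; move: h.
  have pV : p * p^-1 = 1 by rewrite divff// gt_eqF.
  move: (energy p a (w + _)) (energy p a w) (l z) (l w) => B A x y.
  have -> : p * (B / p - (tau n * x + y) - (A / p - y)) = (p * p^-1) * (B - A) - tau n * (p * x) by ring.
  by rewrite pV mul1r [_ * (p * x)]mulrC; rewrite subr_ge0.
move=> z Wz; apply/eqP; rewrite eq_le half// andbT.
have WN : in_W1p p (- z) by rewrite -scaleN1r; exact: (in_W1pZ N0 Np).
have := half _ WN; rewrite energy_formN//.
have -> : l (- z) = - l z.
  have l0 : l 0 = 0 by have := lL 1 0 0 (in_W1p0 N0 Np) (in_W1p0 N0 Np); rewrite scale1r addr0 mul1r => h; lra.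
  by have := lL (-1) z 0 Wz (in_W1p0 N0 Np); rewrite scaleN1r addr0 l0 => ->; lra.
by rewrite lerN2.
Qed.
End energy_variation.

(** * The reaction term *)

Section reaction.
Variables (R : realType) (N : nat).
Local Notation E := 'rV[R]_N.
Local Notation mu := (lebesgue_rV R N).
Variable p : R.
Hypotheses (N0 : (0 < N)%N) (Np : N%:R < p).
Let N1 : 1 <= N%:R :> R. Proof. by rewrite ler1n. Qed.
Let p1 : 1 < p. Proof. exact: le_lt_trans Np. Qed.
Let p0 : 0 < p. Proof. exact: lt_trans p1. Qed.
Local Notation V := (sobolev_pair R N).
Variables (a : E -> R) (alo ahi : R).
Hypotheses (ma : measurable_fun setT a) (alo0 : 0 < alo)
  (a_alo : forall x, alo <= a x) (a_ahi : forall x, a x <= ahi).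
Variables (h : E -> R) (lam Gm : R) (gt Gt : R -> R).
Hypotheses (ih : mu.-integrable setT (EFin \o h)) (h0 : forall x, 0 <= h x).
Hypotheses (lam0 : 0 < lam) (gt_bnd : forall t, `|gt t| <= Gm).
Hypothesis gt_uc : forall e : R, 0 < e -> exists2 dl : R, 0 < dl &
  forall s t, `|s - t| <= dl -> `|gt s - gt t| <= e.
Hypothesis Gt_diff : forall e : R, 0 < e -> exists2 dl : R, 0 < dl &
  forall t s, `|s| <= dl -> `|Gt (t + s) - Gt t - gt t * s| <= e * `|s|.
Hypotheses (cgt : continuous gt) (cGt : continuous Gt).
Hypothesis Gt_lip : forall t, `|Gt t| <= Gm * `|t|.

Local Notation K := (embedding_cst N p alo).
Local Notation nm w := (energy p a w `^ p^-1).
Let K0 : 0 < K. Proof. exact: embedding_cst_gt0. Qed.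
Let Gm0 : 0 <= Gm. Proof. exact: le_trans (gt_bnd 0). Qed.
Let mh : measurable_fun setT h. Proof. by have /integrableP[/measurable_EFinP] := ih. Qed.
Let mgt : measurable_fun setT gt. Proof. exact: continuous_measurable_fun. Qed.
Let mGt : measurable_fun setT Gt. Proof. exact: continuous_measurable_fun. Qed.
Let H := \int[mu]_x h x.
Let H0 : 0 <= H. Proof. by apply: Rintegral_ge0. Qed.
Let H1 : 0 < H + 1. Proof. exact: ltr_wpDl. Qed.

Lemma weight_integrable (f : E -> R) (C : R) : measurable_fun setT f ->
  {ae mu, forall x, `|f x| <= C} -> mu.-integrable setT (EFin \o fun x => h x * f x).
Proof.
move=> mf fC; apply: (ae_bound_integrable (measurable_funM mh mf) (integrableRZ C measurableT ih)).
by apply: filterS fC => x fx; rewrite normrM (ger0_norm (h0 x)) mulrC ler_wpM2r.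
Qed.

Lemma weight_bound (f : E -> R) (C : R) : measurable_fun setT f ->
  {ae mu, forall x, `|f x| <= C} -> `|\int[mu]_x (h x * f x)| <= C * H.
Proof.
move=> mf fC.
have -> : C * H = \int[mu]_x (C * h x) by rewrite (RintegralZl C measurableT ih).
apply: (ae_bound_Rintegral (measurable_funM mh mf) (integrableRZ C measurableT ih)).
by apply: filterS fC => x fx; rewrite normrM (ger0_norm (h0 x)) mulrC ler_wpM2r.
Qed.

Definition reaction_form (u w : V) : R := lam * \int[mu]_x (h x * (gt (u.1 x) * w.1 x)).
Definition reaction_potential (u : V) : R := lam * \int[mu]_x (h x * Gt (u.1 x)).

Let sup (w : V) : in_W1p p w -> {ae mu, forall x, `|w.1 x| <= K * nm w}.
Proof. by move=> Ww; exact: (energy_sup N0 Np ma alo0 a_alo a_ahi Ww). Qed.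

Let nm_ge0 (w : V) : 0 <= nm w. Proof. exact: powR_ge0. Qed.

Let formb (f : R -> R) (B : R) (u w : V) : measurable_fun setT f -> (forall t, `|f t| <= B) ->
  in_W1p p u -> in_W1p p w -> {ae mu, forall x, `|f (u.1 x) * w.1 x| <= B * (K * nm w)}.
Proof.
move=> mf fB Wu Ww; apply: filterS (sup Ww) => x wx.
by rewrite normrM ler_pM.
Qed.

Let mform (u w : V) : in_W1p p u -> in_W1p p w -> measurable_fun setT (fun x => gt (u.1 x) * w.1 x).
Proof.
move=> Wu Ww; apply: measurable_funM; last exact: Ww.1.1.
exact: (measurableT_comp mgt Wu.1.1).
Qed.

Lemma reaction_form_integrable (u w : V) : in_W1p p u -> in_W1p p w ->
  mu.-integrable setT (EFin \o fun x => h x * (gt (u.1 x) * w.1 x)).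
Proof. by move=> Wu Ww; apply: (weight_integrable (mform Wu Ww) (formb mgt gt_bnd Wu Ww)). Qed.

Lemma reaction_potential_integrable (u : V) : in_W1p p u ->
  mu.-integrable setT (EFin \o fun x => h x * Gt (u.1 x)).
Proof.
move=> Wu; apply: (@weight_integrable _ (Gm * (K * nm u))).
  exact: (measurableT_comp mGt Wu.1.1).
by apply: filterS (sup Wu) => x ux; apply: (le_trans (Gt_lip _)); rewrite ler_wpM2l.
Qed.

Lemma reaction_formL (u : V) (t : R) (v w : V) : in_W1p p u -> in_W1p p v -> in_W1p p w ->
  reaction_form u (t *: v + w) = t * reaction_form u v + reaction_form u w.
Proof.
move=> Wu Wv Ww; rewrite /reaction_form mulrCA -mulrDr; congr (_ * _).
have iv := reaction_form_integrable Wu Wv; have iw := reaction_form_integrable Wu Ww.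
rewrite -(RintegralZl t measurableT iv) -(RintegralD measurableT (integrableRZ t measurableT iv) iw).
apply: eq_Rintegral => x _.
have -> : (t *: v + w).1 x = t * v.1 x + w.1 x by [].
by ring.
Qed.

Lemma reaction_form_bnd (u w : V) : in_W1p p u -> in_W1p p w ->
  `|reaction_form u w| <= lam * Gm * K * H * nm w.
Proof.
move=> Wu Ww; rewrite /reaction_form normrM (gtr0_norm lam0).
have := weight_bound (mform Wu Ww) (formb mgt gt_bnd Wu Ww).
rewrite -(ler_pM2l lam0) => h1; apply: (le_trans h1).
by rewrite le_eqVlt; apply/orP; left; apply/eqP; ring.
Qed.

(** By the embedding, small energy means small sup norm, so the scalar moduli of [gt] and [Gt] can
    be applied pointwise. *)
Let sup_small (dl : R) : 0 < dl -> exists2 e : R, 0 < e &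
  forall w, in_W1p p w -> energy p a w <= e -> {ae mu, forall x, `|w.1 x| <= dl}.
Proof.
move=> dl0; exists ((dl / K) `^ p); first by rewrite powR_gt0// divr_gt0.
move=> w Ww we; apply: filterS (sup Ww) => x wx; apply: (le_trans wx).
rewrite mulrC -ler_pdivlMr//.
have -> : dl / K = ((dl / K) `^ p) `^ p^-1.
  by rewrite -powRrM divff ?powRr1// ?gt_eqF// divr_ge0// ltW.
have pV : 0 <= p^-1 by rewrite invr_ge0 ltW.
by apply: (ge0_ler_powR pV _ _ we); rewrite nnegrE ?powR_ge0//; exact: (energy_ge0 p alo0 a_alo w).
Qed.

(** The scalar tolerance that corresponds to a tolerance [e] in the dual norm; [H + 1] avoids a
    division by a vanishing [H]. *)
Let epsd (e : R) : 0 < e -> 0 < e / (lam * K * (H + 1)).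
Proof. by move=> e0; apply: divr_gt0 => //; apply: mulr_gt0 => //; exact: mulr_gt0. Qed.

Let epsE (e x : R) : 0 < e -> 0 <= x -> lam * (e / (lam * K * (H + 1)) * (K * x) * H) <= e * x.
Proof.
move=> e0 x0.
have -> : lam * (e / (lam * K * (H + 1)) * (K * x) * H) = e * x * (H / (H + 1)).
  by field; rewrite !gt_eqF.
by apply: ler_piMr; [exact: mulr_ge0 (ltW e0) x0|rewrite ler_pdivrMr// mul1r lerDl].
Qed.

Let form_diff (e : R) (u u' w : V) : in_W1p p u -> in_W1p p u' -> in_W1p p w ->
  {ae mu, forall x, `|gt (u.1 x) - gt (u'.1 x)| <= e} ->
  `|reaction_form u w - reaction_form u' w| <= lam * (e * (K * nm w) * H).
Proof.
move=> Wu Wu' Ww he; rewrite /reaction_form -mulrBr normrM (gtr0_norm lam0) ler_pM2l//.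
rewrite -(RintegralB measurableT (reaction_form_integrable Wu Ww) (reaction_form_integrable Wu' Ww)).
have -> : \int[mu]_x (h x * (gt (u.1 x) * w.1 x) - h x * (gt (u'.1 x) * w.1 x)) =
    \int[mu]_x (h x * (gt (u.1 x) * w.1 x - gt (u'.1 x) * w.1 x)).
  by apply: eq_Rintegral => x _; rewrite mulrBr.
apply: weight_bound; first exact: (measurable_funB (mform Wu Ww) (mform Wu' Ww)).
apply: filterS2 he (sup Ww) => x h1 h2.
by rewrite -mulrBl normrM ler_pM.
Qed.

Lemma reaction_form_ucont (e : R) : 0 < e -> exists2 dl : R, 0 < dl &
  forall u u' w, in_W1p p u -> in_W1p p u' -> in_W1p p w -> energy p a (u - u') <= dl ->
    `|reaction_form u w - reaction_form u' w| <= e * nm w.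
Proof.
move=> e0; have [d1 d10 Hd1] := gt_uc (epsd e0).
have [d2 d20 Hd2] := sup_small d10; exists d2 => // u u' w Wu Wu' Ww uu'.
apply: (le_trans _ (epsE e0 (nm_ge0 w))); apply: form_diff => //.
by apply: filterS (Hd2 _ (in_W1pB N0 Np Wu Wu') uu') => x; exact: Hd1.
Qed.

Lemma reaction_potential_diff (e : R) : 0 < e -> exists2 dl : R, 0 < dl &
  forall u w, in_W1p p u -> in_W1p p w -> energy p a w <= dl ->
    `|reaction_potential (u + w) - reaction_potential u - reaction_form u w| <= e * nm w.
Proof.
move=> e0; have [d1 d10 Hd1] := Gt_diff (epsd e0).
have [d2 d20 Hd2] := sup_small d10; exists d2 => // u w Wu Ww we.
apply: (le_trans _ (epsE e0 (nm_ge0 w))).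
have i1 := reaction_potential_integrable (in_W1pD N0 Np Wu Ww).
have i2 := reaction_potential_integrable Wu; have i3 := reaction_form_integrable Wu Ww.
rewrite /reaction_potential /reaction_form -!mulrBr normrM (gtr0_norm lam0) ler_pM2l//.
rewrite -(RintegralB measurableT i1 i2) -(RintegralB measurableT (integrableRB measurableT i1 i2) i3).
have -> : \int[mu]_x (h x * Gt ((u + w).1 x) - h x * Gt (u.1 x) - h x * (gt (u.1 x) * w.1 x)) =
    \int[mu]_x (h x * (Gt (u.1 x + w.1 x) - Gt (u.1 x) - gt (u.1 x) * w.1 x)).
  by apply: eq_Rintegral => x _; rewrite !mulrBr.
apply: weight_bound.
  apply: measurable_funB; last exact: mform.
  apply: measurable_funB; last exact: (measurableT_comp mGt Wu.1.1).
  exact: (measurableT_comp mGt (measurable_funD Wu.1.1 Ww.1.1)).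
apply: filterS2 (Hd2 _ Ww we) (sup Ww) => x h1 h2.
apply: (le_trans (Hd1 _ _ h1)); rewrite ler_wpM2l//; exact: ltW (epsd e0).
Qed.

(** [Gt (u)] is bounded by [C] from above only, so its positive part is integrated instead. *)
Lemma reaction_potential_le (u : V) (C : R) : in_W1p p u -> {ae mu, forall x, Gt (u.1 x) <= C} ->
  0 <= C -> reaction_potential u <= lam * (C * H).
Proof.
move=> Wu uC C0; rewrite /reaction_potential ler_pM2l//.
have i1 := reaction_potential_integrable Wu.
have -> : C * H = \int[mu]_x (C * h x) by rewrite (RintegralZl C measurableT ih).
have mG : measurable_fun setT (fun x => Num.max 0 (Gt (u.1 x))).
  by apply: measurable_maxr => //; exact: (measurableT_comp mGt Wu.1.1).
have i2 : mu.-integrable setT (EFin \o fun x => h x * Num.max 0 (Gt (u.1 x))).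
  apply: (@weight_integrable _ C mG); apply: filterS uC => x ux.
  by rewrite ger0_norm ?le_max ?lexx// ge_max C0.
apply: (@le_trans _ _ (\int[mu]_x (h x * Num.max 0 (Gt (u.1 x))))).
  apply: le_Rintegral => // x _; rewrite ler_wpM2l// le_max lexx orbT//.
have := @weight_bound _ C mG; rewrite (RintegralZl C measurableT ih) => /(_ _)/(le_trans (ler_norm _)); apply.
by apply: filterS uC => x ux; rewrite ger0_norm ?le_max ?lexx// ge_max C0.
Qed.

(** A subsequence converges almost everywhere to some [l], so the integral of
    [h |gt (u_n) - gt (l)|] tends to 0, with dominating function [2 Gm h]. The embedding factors the
    sup norm of [w] out, which makes the estimate uniform in [w]. *)
Lemma reaction_form_compact (s : nat -> V) (B : R) : (forall n, in_W1p p (s n)) ->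
  (forall n, energy p a (s n) <= B) ->
  exists2 phi : nat -> nat, (forall n, (n <= phi n)%N) &
  forall e : R, 0 < e -> exists k, forall i j, (k <= i)%N -> (k <= j)%N ->
    forall w, in_W1p p w ->
      `|reaction_form (s (phi i)) w - reaction_form (s (phi j)) w| <= e * nm w.
Proof.
move=> Ws sB.
have B0 : 0 <= B by apply: le_trans (sB 0%N); exact: (energy_ge0 p alo0 a_alo).
have c1 n : Lp_norm p (s n).1 <= (alo^-1 * B) `^ p^-1 + B `^ p^-1.
  rewrite -[leLHS]addr0; apply: lerD; last exact: powR_ge0.
  apply: ge0_ler_powR; rewrite ?nnegrE ?invr_ge0 ?(ltW p0)//; first exact: Rintegral_powR_ge0.
    by rewrite mulr_ge0// invr_ge0 ltW.
  apply: (le_trans (energy_pot ma alo0 a_alo a_ahi (Ws n))).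
  by rewrite ler_wpM2l// invr_ge0 ltW.
have c2 n : Lp_norm p (fun x => enorm ((s n).2 x)) <= (alo^-1 * B) `^ p^-1 + B `^ p^-1.
  rewrite -[leLHS]add0r; apply: lerD; first exact: powR_ge0.
  apply: ge0_ler_powR; rewrite ?nnegrE ?invr_ge0 ?(ltW p0)//; first exact: Rintegral_powR_ge0.
  apply: le_trans (sB n); apply: le_trans (energy_grad p alo0 a_alo (s n)).
  by rewrite le_eqVlt; apply/orP; left; apply/eqP; apply: eq_Rintegral => x _; rewrite ger0_norm// sqrtr_ge0.
have [phi phi_ge cv] := ae_subsequence N0 Np (fun n => (Ws n).1) (fun n => (Ws n).2) c1 c2.
exists phi => //.
have [A [mA A0 AP]] := cv.
have mnA : measurable (~` A) by exact: measurableC.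
pose v n x := (s (phi n)).1 x * \1_(~` A) x.
have mv n : measurable_fun setT (v n).
  by apply: measurable_funM; [exact: (Ws _).1.1|exact: measurable_indic].
have vc x : cvgn (fun n => v n x).
  have [Ax|nAx] := pselect (A x).
    rewrite /v indicE memNset; last by move=> /(_ Ax).
    under eq_fun do rewrite mulr0; exact: is_cvg_cst.
  rewrite /v indicE mem_set//; under eq_fun do rewrite mulr1.
  by apply: contrapT => hc; exact: nAx (AP x hc).
pose l x := limn (fun n => v n x).
have ml : measurable_fun setT l.
  by apply: (measurable_fun_cvg mv) => x _; exact: vc.
have aeA : {ae mu, forall x, ~ A x} by exists A; split => // x /= /contrapT.
have cI : (fun n => \int[mu]_x (h x * `|gt ((s (phi n)).1 x) - gt (l x)|)) @ \oo --> (0 : R).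
  have -> : (0 : R) = \int[mu]_x (h x * 0).
    by under eq_Rintegral do rewrite mulr0; rewrite Rintegral_cst// mul0r.
  have md n : measurable_fun setT (fun x => `|gt ((s (phi n)).1 x) - gt (l x)|).
    apply: measurableT_comp => //; apply: measurable_funB; last exact: (measurableT_comp mgt ml).
    exact: (measurableT_comp mgt (Ws _).1.1).
  apply: (Rintegral_dct (g := fun x => (2 * Gm) * h x)).
  - by move=> n; exact: (measurable_funM mh (md n)).
  - exact: measurable_funM.
  - exact: (integrableRZ _ measurableT ih).
  - apply: filterS aeA => x nAx; apply: cvgMr.
    have e n : (s (phi n)).1 x = v n x by rewrite /v indicE mem_set// mulr1.
    under eq_fun do rewrite e.
    have h1 : gt (v n x) @[n --> \oo] --> gt (l x).
      by apply: continuous_cvg; [exact: cgt|exact: vc].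
    have h2 : gt (v n x) - gt (l x) @[n --> \oo] --> (0 : R).
      by rewrite -(subrr (gt (l x))); apply: cvgB h1 _; exact: cvg_cst.
    rewrite -(@normr0 R R); exact: (cvg_norm h2).
  - apply: aeW => x n; rewrite normrM (ger0_norm (h0 x)) normr_id mulrC ler_wpM2r//.
    by apply: (le_trans (ler_normB _ _)); have := lerD (gt_bnd ((s (phi n)).1 x)) (gt_bnd (l x)); rewrite mulr_natl mulr2n.
move=> e e0; pose e' := e / (2 * lam * K).
have e'0 : 0 < e' by apply: divr_gt0 => //; apply: mulr_gt0 => //; exact: mulr_gt0.
have /cvgrPdist_le/(_ _ e'0) [k _ hk] := cI.
exists k => i j ki kj w Ww.
have I (n : nat) : mu.-integrable setT (EFin \o fun x => h x * `|gt ((s (phi n)).1 x) - gt (l x)|).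
  apply: (@weight_integrable _ (2 * Gm)).
    apply: measurableT_comp => //; apply: measurable_funB; last exact: (measurableT_comp mgt ml).
    exact: (measurableT_comp mgt (Ws _).1.1).
  apply: aeW => x; rewrite normr_id.
  by apply: (le_trans (ler_normB _ _)); have := lerD (gt_bnd ((s (phi n)).1 x)) (gt_bnd (l x)); rewrite mulr_natl mulr2n.
have Ile (n : nat) : (k <= n)%N -> \int[mu]_x (h x * `|gt ((s (phi n)).1 x) - gt (l x)|) <= e'.
  by move=> kn; have := hk n kn; rewrite sub0r normrN => /(le_trans (ler_norm _)).
rewrite /reaction_form -mulrBr normrM (gtr0_norm lam0).
have iu n := reaction_form_integrable (Ws (phi n)) Ww.
rewrite -(RintegralB measurableT (iu i) (iu j)).
pose g x := (K * nm w) * (h x * `|gt ((s (phi i)).1 x) - gt (l x)| +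
   h x * `|gt ((s (phi j)).1 x) - gt (l x)|).
have ig : mu.-integrable setT (EFin \o g).
  exact: (integrableRZ _ measurableT (integrableRD measurableT (I i) (I j))).
have bd : `|\int[mu]_x (h x * (gt ((s (phi i)).1 x) * w.1 x) - h x * (gt ((s (phi j)).1 x) * w.1 x))| <=
    \int[mu]_x g x.
  apply: (ae_bound_Rintegral _ ig).
    by have /integrableP[/measurable_EFinP] := integrableRB measurableT (iu i) (iu j).
  apply: filterS (sup Ww) => x wx.
  rewrite -mulrBr -mulrBl !normrM (ger0_norm (h0 x)) /g -mulrDr [leRHS]mulrCA.
  rewrite ler_wpM2l// mulrC ler_pM//.
  have -> : gt ((s (phi i)).1 x) - gt ((s (phi j)).1 x) =
    (gt ((s (phi i)).1 x) - gt (l x)) - (gt ((s (phi j)).1 x) - gt (l x)) by ring.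
  exact: ler_normB.
have gE : \int[mu]_x g x = (K * nm w) * (\int[mu]_x (h x * `|gt ((s (phi i)).1 x) - gt (l x)|) +
   \int[mu]_x (h x * `|gt ((s (phi j)).1 x) - gt (l x)|)).
  rewrite (RintegralZl _ measurableT (integrableRD measurableT (I i) (I j))).
  by rewrite (RintegralD measurableT (I i) (I j)).
rewrite gE in bd.
have := lerD (Ile _ ki) (Ile _ kj) => le2.
have Kn : 0 <= K * nm w by rewrite mulr_ge0 ?powR_ge0// ltW.
have le3 := le_trans bd (ler_wpM2l Kn le2).
apply: (le_trans (ler_wpM2l (ltW lam0) le3)).
rewrite le_eqVlt; apply/orP; left; apply/eqP; rewrite /e'.
by field; rewrite !gt_eqF.
Qed.
End reaction.

Lemma Rintegral_le0_ae d (T : measurableType d) (R : realType) (m : {measure set T -> \bar R})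
    (f : T -> R) : m.-integrable setT (EFin \o f) -> (forall x, 0 <= f x) ->
  \int[m]_x f x <= 0 -> {ae m, forall x, f x = 0}.
Proof.
move=> jf f0 le0.
have fE : (\int[m]_x (f x)%:E = (\int[m]_x f x)%:E)%E.
  by rewrite /Rintegral fineK//; exact: integrable_fin_num.
have I0 : (\int[m]_x `|(f x)%:E| = 0)%E.
  transitivity (\int[m]_x (f x)%:E)%E; first by apply: eq_integral => x _; rewrite gee0_abs ?lee_fin.
  rewrite fE; congr (_%:E); apply/eqP; rewrite eq_le le0/=.
  by apply: Rintegral_ge0 => x _; exact: f0.
have /integrableP[mf _] := jf.
have /(ae_eq_integral_abs m measurableT mf) := I0.
by apply: filterS => x /(_ I)/= [].
Qed.

(** * Nonnegativity of critical points *)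

Section nonnegative_critical.
Variables (R : realType) (N : nat).
Local Notation E := 'rV[R]_N.
Local Notation mu := (lebesgue_rV R N).
Variable p : R.
Hypotheses (N0 : (0 < N)%N) (Np : N%:R < p).
Let N1 : 1 <= N%:R :> R. Proof. by rewrite ler1n. Qed.
Let p1 : 1 < p. Proof. exact: le_lt_trans Np. Qed.
Let p0 : 0 < p. Proof. exact: lt_trans p1. Qed.
Local Notation V := (sobolev_pair R N).

Lemma weak_gradient_ae_eq (u v : E -> R) (D : E -> E) :
  measurable_fun setT u -> measurable_fun setT v -> {ae mu, forall x, u x = v x} ->
  weak_gradient p u D -> weak_gradient p v D.
Proof.
move=> mU mV uv [D1 D2]; split => // phi tphi i; rewrite -D2//.
have mp := measurable_partial i tphi.
apply: ae_eq_Rintegral; [exact: measurable_funM|exact: measurable_funM|].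
by apply: filterS uv => x ->.
Qed.

Variables (a : E -> R) (alo ahi : R).
Hypotheses (ma : measurable_fun setT a) (alo0 : 0 < alo)
  (a_alo : forall x, alo <= a x) (a_ahi : forall x, a x <= ahi).
Let a0 x : 0 < a x. Proof. exact: lt_le_trans alo0 (a_alo x). Qed.

(** The square makes the test function C^{1,1}, as the chain rule requires; [min(t, 0)] itself is
    not differentiable at 0. *)
Let neg2 (t : R) : R := Num.min t 0 ^+ 2.
Let dneg2 (t : R) : R := 2 * Num.min t 0.

Let cmin : continuous (fun t : R => Num.min t 0).
Proof. by move=> t; apply: continuous_min; [exact: cvg_id|exact: cvg_cst]. Qed.

Let neg2T1 s t : `|neg2 t - neg2 s - dneg2 s * (t - s)| <= 2 * (t - s) ^+ 2.
Proof.
rewrite /neg2 /dneg2; case: (leP t 0) => ht; case: (leP s 0) => hs.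
- have -> : t ^+ 2 - s ^+ 2 - 2 * s * (t - s) = (t - s) ^+ 2 by ring.
  by rewrite ger0_norm ?sqr_ge0//; have := sqr_ge0 (t - s); lra.
- rewrite expr0n/= mulr0 mul0r !subr0 ger0_norm ?sqr_ge0//.
  have h1 : 0 <= s * (s - 2 * t) by rewrite mulr_ge0// ?(ltW hs)//; lra.
  have := sqr_ge0 (t - s); nra.
- rewrite expr0n/= sub0r.
  have h : 0 <= (- s) * t by rewrite mulr_ge0 ?(ltW ht)//; lra.
  have h2 := sqr_ge0 s; have h3 := sqr_ge0 t.
  by rewrite ler_norml; apply/andP; split; nra.
- by rewrite expr0n/= !mulr0 mul0r !subr0 normr0 mulr_ge0// sqr_ge0.
Qed.

Let neg2T2 s t : `|dneg2 t - dneg2 s| <= 2 * `|t - s|.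
Proof.
rewrite /dneg2 -mulrBr normrM (ger0_norm (ler0n _ 2)) ler_pM2l//.
case: (leP t 0) => ht; case: (leP s 0) => hs //; rewrite ?subr0 ?sub0r ?normr0//.
- rewrite ler0_norm// ler0_norm; lra.
- rewrite normrN ler0_norm// ger0_norm; lra.
Qed.

(* The test function is [min(w, 0)^2]; it makes both parts of the energy form nonpositive. *)
Lemma nonnegative_critical (w : V) (B : R) : in_W1p p w -> {ae mu, forall x, `|w.1 x| <= B} ->
  (forall z, in_W1p p z -> (forall x, 0 <= z.1 x) -> 0 <= energy_form p a w z) ->
  {ae mu, forall x, 0 <= w.1 x}.
Proof.
move=> Ww wB pos.
(* The chain rule asks for a bound that holds everywhere, so [w] is first modified on a null set. *)
pose u x := Num.max (- B) (Num.min B (w.1 x)).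
have mU : measurable_fun setT u.
  by apply: measurable_maxr => //; apply: measurable_minr => //; exact: Ww.1.1.
have uw : {ae mu, forall x, w.1 x = u x}.
  apply: filterS wB => x; rewrite ler_norml => /andP[h1 h2].
  by rewrite /u (min_idPr h2) (max_idPr h1).
have [B0|Bn] := leP 0 B; last first.
  apply: filterS wB => x /(le_trans (normr_ge0 _)) h; exfalso; move: h; rewrite leNgt => /negP; exact.
have uB x : `|u x| <= B.
  by rewrite ler_norml /u le_max lexx/= ge_max ge_min lexx/= andbT; lra.
have up : Lp mu p u.
  apply: (Lp_ae_le p0 mU ler01 _ Ww.1); apply: filterS uw => x <-; by rewrite mul1r.
have uD : weak_gradient p u w.2 by exact: (weak_gradient_ae_eq Ww.1.1 mU uw Ww.2).
have mmin : measurable_fun setT (fun t : R => Num.min t 0) by exact: continuous_measurable_fun.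
have mT : measurable_fun setT neg2 by apply: measurable_funX.
have mT' : measurable_fun setT dneg2 by exact: measurable_funM.
have T0 : neg2 0 = 0 by rewrite /neg2 minxx expr0n.
have T'0 : dneg2 0 = 0 by rewrite /dneg2 minxx mulr0.
pose z : V := (neg2 \o u, fun x => dneg2 (u x) *: w.2 x).
have Wz : in_W1p p z.
  split.
    exact: (Lp_chain N0 Np up uB (ler0n _ 2) T0 T'0 mT neg2T1).
  exact: (weak_gradient_chain N0 Np up uD uB (ler0n _ 2) T0 T'0 mT mT' neg2T1 neg2T2).
have z0 x : 0 <= z.1 x by rewrite sqr_ge0.
have := pos _ Wz z0; rewrite /energy_form.
have i1 := energy_form_integrable1 N0 Np Ww Wz.
have i2 := energy_form_integrable2 N0 Np ma alo0 a_alo a_ahi Ww Wz.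
have l1 : \int[mu]_x pform p (w.2 x) (z.2 x) <= 0.
  rewrite -oppr_ge0 -(Rintegral_opp _ measurableT); last by have /integrableP[/measurable_EFinP] := i1.
  apply: Rintegral_ge0 => x _; rewrite oppr_ge0 /pform mulr_ge0_le0 ?powR_ge0//= dotvC dotvZl.
  by rewrite mulr_le0_ge0 ?dotv_ge0// /dneg2 pmulr_rle0// ge_min lexx orbT.
pose f x := - (a x * `|u x| `^ (p - 2) * u x * neg2 (u x)).
have f0 x : 0 <= f x.
  rewrite oppr_ge0 /neg2; case: (leP (u x) 0) => h; last by rewrite expr0n mulr0.
  apply: mulr_le0_ge0; last exact: sqr_ge0.
  by apply: mulr_ge0_le0 => //; apply: mulr_ge0; [exact: ltW|exact: powR_ge0].
have m2 : measurable_fun setT (fun x => a x * `|w.1 x| `^ (p - 2) * w.1 x * z.1 x).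
  by have /integrableP[/measurable_EFinP] := i2.
have mf : measurable_fun setT f.
  apply: measurable_funN; apply: measurable_funM; last exact: (measurableT_comp mT mU).
  apply: measurable_funM => //; apply: measurable_funM => //; exact: measurable_powR_norm.
have fE : {ae mu, forall x, f x = - (a x * `|w.1 x| `^ (p - 2) * w.1 x * z.1 x)}.
  by apply: filterS uw => x ->.
have mN : measurable_fun setT (fun x => - (a x * `|w.1 x| `^ (p - 2) * w.1 x * z.1 x)).
  exact: measurable_funN.
have jf : mu.-integrable setT (EFin \o f).
  have i2N : mu.-integrable setT (EFin \o fun x => `|a x * `|w.1 x| `^ (p - 2) * w.1 x * z.1 x|).
    exact: (integrable_norm i2).
  apply: (ae_bound_integrable mf i2N).
  by apply: filterS fE => x ->; rewrite normrN.
move=> h.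
have /(Rintegral_le0_ae jf f0) : \int[mu]_x f x <= 0.
  have -> : \int[mu]_x f x = - \int[mu]_x (a x * `|w.1 x| `^ (p - 2) * w.1 x * z.1 x).
    by rewrite (ae_eq_Rintegral mf mN fE) (Rintegral_opp _ measurableT m2).
  by rewrite oppr_le0; apply: (le_trans h); rewrite -[leRHS]add0r lerD2r.
apply: filterS2 uw => x ->; case: (leP 0 (u x)) => // h0 fx0; exfalso; move: fx0.
have un : u x != 0 by rewrite lt_eqF.
apply/eqP; rewrite /f oppr_eq0 /neg2 (min_idPl (ltW h0)).
have e2 : u x ^+ 2 != 0 by rewrite sqrf_eq0.
have ep : `|u x| `^ (p - 2) != 0 by rewrite powR_eq0 normr_eq0 (negbTE un).
apply: mulf_neq0 => //; apply: mulf_neq0 => //; apply: mulf_neq0 => //.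
by rewrite gt_eqF.
Qed.
End nonnegative_critical.

(** * Truncation of the nonlinearity *)

Section clamp.
Variable R : realType.
Implicit Types (f : R -> R) (A B s t e : R).

Definition clamp A B t : R := Num.max A (Num.min B t).

Lemma clamp_itv A B t : A <= B -> A <= clamp A B t <= B.
Proof. by move=> AB; rewrite /clamp le_max lexx/= ge_max AB ge_min lexx. Qed.

Lemma clamp_id A B t : A <= t -> t <= B -> clamp A B t = t.
Proof. by move=> At tB; rewrite /clamp (min_idPr tB) (max_idPr At). Qed.

Lemma clamp_dist A B s t : `|clamp A B s - clamp A B t| <= `|s - t|.
Proof.
rewrite /clamp ler_norml; have := ler_norm (s - t); have := ler_norm (t - s); rewrite distrC => h1 h2.
by case: (leP B s) => h3; case: (leP B t) => h4; [case: (leP A B)|case: (leP A B); case: (leP A t)|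
  case: (leP A B); case: (leP A s)|case: (leP A s); case: (leP A t)]; lra.
Qed.

Lemma continuous_clamp A B : continuous (clamp A B).
Proof.
move=> t; apply: (@continuous_max R R (fun=> A)); first exact: cvg_cst.
by apply: (@continuous_min R R (fun=> B)); [exact: cvg_cst|exact: cvg_id].
Qed.

(** By contradiction: clamped counterexamples stay in a compact interval, [bounded_diagonal]
    extracts a limit, and [f] would be discontinuous there. *)
Lemma clamp_uniform_continuous f A B e : continuous f -> A <= B -> 0 < e ->
  exists2 dl : R, 0 < dl &
  forall s t, `|s - t| <= dl -> `|f (clamp A B s) - f (clamp A B t)| <= e.
Proof.
move=> cf AB e0; apply: contrapT => H.
have /choice[s sP] : forall n, exists s : R * R, `|s.1 - s.2| <= n.+1%:R^-1 /\
    e < `|f (clamp A B s.1) - f (clamp A B s.2)|.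
  move=> n; apply: contrapT => Hn; apply: H; exists n.+1%:R^-1 => // s t st.
  by rewrite leNgt; apply/negP => h; apply: Hn; exists (s, t).
have cb (k n : nat) : `|clamp A B (s n).1| <= `|A| + `|B|.
  have /andP[] := clamp_itv (s n).1 AB; move: (clamp A B _) => x h1 h2.
  have := ler_norm B; have := ler_norm (- A); rewrite normrN ler_norml.
  by have := normr_ge0 A; have := normr_ge0 B => *; apply/andP; split; lra.
have [phi [l [phin lP]]] := bounded_diagonal cb.
have /cvgrPdist_lt/(_ _ (divr_gt0 e0 (ltr0Sn R 1))) := cf (l 0%N).
move=> /nbhs_ballP[d /= d0 hd].
have d20 : 0 < d / 2 by rewrite divr_gt0.
have [n] := ltr_add_invr d20; rewrite add0r => nd.
have h1 := lP n 0%N isT; have [h2 h3] := sP (phi n).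
have h4 := le_trans (clamp_dist A B _ _) h2.
have h5 : (phi n).+1%:R^-1 <= n.+1%:R^-1 :> R by rewrite lef_pV2 ?posrE// ler_nat ltnS.
have n1 : `|f (l 0%N) - f (clamp A B (s (phi n)).1)| < e / 2.
  by apply: hd; rewrite /ball/= distrC; apply: (lt_trans h1); move: nd d0; move: (_^-1) => v; lra.
have n2 : `|f (l 0%N) - f (clamp A B (s (phi n)).2)| < e / 2.
  apply: hd; rewrite /ball/= -(subrK (clamp A B (s (phi n)).1) (l 0%N)) -addrA.
  apply: (le_lt_trans (ler_normD _ _)); rewrite distrC.
  move: h1 h4 h5 nd; move: `|_| `|_| (_^-1) (_^-1) => x y v w; lra.
have := ler_normB (f (l 0%N) - f (clamp A B (s (phi n)).2)) (f (l 0%N) - f (clamp A B (s (phi n)).1)).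
have -> : f (l 0%N) - f (clamp A B (s (phi n)).2) - (f (l 0%N) - f (clamp A B (s (phi n)).1)) =
  f (clamp A B (s (phi n)).1) - f (clamp A B (s (phi n)).2) by ring.
lra.
Qed.

Lemma clamp_bounded f A B : continuous f -> A <= B -> exists M, forall t, `|f (clamp A B t)| <= M.
Proof.
move=> cf AB; have cf' : {within `[A, B], continuous (fun t => `|f t|)}.
  by apply: continuous_subspaceT => x; apply: cvg_norm; exact: cf.
have [c _ hc] := EVT_max AB cf'.
by exists `|f c| => t; apply: hc; rewrite in_itv/=; exact: clamp_itv.
Qed.
End clamp.

(** * Primitives of continuous functions *)

Section primitive_theory.
Variable R : realType.
Implicit Types (f g : R -> R) (a b s t : R).
Local Notation leb := (@lebesgue_measure R).

Lemma itv_integrable f a b : continuous f -> leb.-integrable `[a, b] (EFin \o f).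
Proof.
move=> cf; apply: continuous_compact_integrable; first exact: segment_compact.
exact: continuous_subspaceT.
Qed.

Lemma eq_primitive f g t : 0 <= t -> (forall s, 0 <= s -> s <= t -> f s = g s) ->
  primitive f t = primitive g t.
Proof.
move=> t0 fg; rewrite /primitive t0; apply: eq_Rintegral => s.
by rewrite inE/= in_itv/= => /andP[]; exact: fg.
Qed.

Lemma primitive0 f : primitive f 0 = 0.
Proof. by rewrite /primitive lexx set_itv1 Rintegral_set1. Qed.

Let splitB f a b c : continuous f -> a <= b -> b <= c ->
  \int[leb]_(x in `[a, c]) f x - \int[leb]_(x in `[a, b]) f x = \int[leb]_(x in `[b, c]) f x.
Proof.
move=> cf ab bc; rewrite (@Rintegral_itvB R f (BLeft a) (BRight c) b) ?bnd_simp//.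
  apply: Rintegral_itv_obnd_cbnd; apply: (integrableS _ _ _ (itv_integrable b c cf)) => //.
  by apply: subset_itvr; rewrite bnd_simp.
exact: itv_integrable.
Qed.

Lemma primitiveB f a b : continuous f -> a <= b ->
  primitive f b - primitive f a = \int[leb]_(x in `[a, b]) f x.
Proof.
move=> cf ab; rewrite /primitive; case: (leP 0 a) => a0.
  by rewrite (le_trans a0 ab) splitB.
case: (leP 0 b) => b0; rewrite opprK.
  by rewrite -(splitB cf (ltW a0) b0) subrK.
by rewrite addrC; apply/eqP; rewrite subr_eq addrC -subr_eq splitB// ltW.
Qed.

Lemma primitive_bounds f a b (lo hi : R) : continuous f -> a <= b ->
  (forall s, a <= s -> s <= b -> lo <= f s <= hi) ->
  lo * (b - a) <= primitive f b - primitive f a <= hi * (b - a).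
Proof.
move=> cf ab fb; rewrite primitiveB//.
have ci (k : R) : k * (b - a) = \int[leb]_(x in `[a, b]) k.
  have e : leb `[a, b]%classic = (b - a)%:E by rewrite lebesgue_measure_itv/= lte_fin; case: ltP => // ba;
    rewrite (le_anti (introT andP (conj ab ba))) subrr.
  by rewrite Rintegral_cst// [X in fine X]e.
rewrite !ci; apply/andP; split; apply: le_Rintegral => //; try exact: itv_integrable.
- by apply: itv_integrable => x; exact: cvg_cst.
- by move=> x; rewrite /= in_itv/= => /andP[h1 h2]; have /andP[] := fb _ h1 h2.
- by apply: itv_integrable => x; exact: cvg_cst.
- by move=> x; rewrite /= in_itv/= => /andP[h1 h2]; have /andP[] := fb _ h1 h2.
Qed.

Lemma primitive_lip f (C : R) a b : continuous f -> (forall t, `|f t| <= C) ->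
  `|primitive f b - primitive f a| <= C * `|b - a|.
Proof.
move=> cf fC; wlog ab : a b / a <= b => [H|].
  by case: (leP a b) => [|/ltW]/H//; rewrite distrC [`|a - b|]distrC.
rewrite (ger0_norm (_ : 0 <= b - a)) ?subr_ge0// ler_norml -mulNr.
by apply: primitive_bounds => // s _ _; rewrite -ler_norml.
Qed.

Lemma continuous_primitive f (C : R) : continuous f -> (forall t, `|f t| <= C) ->
  continuous (primitive f).
Proof.
move=> cf fC x; have C0 : 0 < C + 1 by have := le_trans (normr_ge0 _) (fC 0); lra.
apply/cvgrPdist_le => e e0; near=> y.
apply: (le_trans (primitive_lip y x cf fC)).
apply: (@le_trans _ _ ((C + 1) * `|x - y|)); first by rewrite ler_wpM2r// lerDl.
rewrite mulrC -ler_pdivlMr//.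
by near: y; apply: cvgr_dist_le; [exact: cvg_id|exact: divr_gt0].
Unshelve. all: by end_near. Qed.

(** A uniform modulus of continuity of [f] gives a first-order expansion of its primitive that is
    uniform in the base point. *)
Lemma primitive_diff f : continuous f ->
  (forall e : R, 0 < e -> exists2 dl : R, 0 < dl &
    forall s t, `|s - t| <= dl -> `|f s - f t| <= e) ->
  forall e : R, 0 < e -> exists2 dl : R, 0 < dl &
    forall t s, `|s| <= dl -> `|primitive f (t + s) - primitive f t - f t * s| <= e * `|s|.
Proof.
move=> cf uf e e0; have [dl dl0 H] := uf _ e0; exists dl => // t s sd.
have bd x : `|x - t| <= `|s| -> f t - e <= f x <= f t + e.
  move=> xt; have := H x t (le_trans xt sd); rewrite ler_norml => /andP[h1 h2].
  by apply/andP; split; lra.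
case: (leP 0 s) => s0.
  have ts : t <= t + s by lra.
  have := @primitive_bounds f _ _ (f t - e) (f t + e) cf ts _.
  rewrite addrAC subrr add0r; case/(_ _)/andP.
    move=> x h1 h2; apply: bd; rewrite !ger0_norm//; lra.
  by move: (primitive _ _ - _) => P h1 h2; rewrite ler_norml (ger0_norm s0); apply/andP; split; lra.
have ts : t + s <= t by lra.
have := @primitive_bounds f _ _ (f t - e) (f t + e) cf ts _.
have -> : t - (t + s) = - s by ring.
case/(_ _)/andP.
  move=> x h1 h2; apply: bd; rewrite ler0_norm ?ltr0_norm//; lra.
rewrite -[primitive f (t + s) - _]opprB.
by move: (primitive _ _ - _) => P h1 h2; rewrite ler_norml (ltr0_norm s0); apply/andP; split; lra.
Qed.
End primitive_theory.

Section truncation.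
Variables (R : realType) (g : R -> R) (c dl : R).
Hypotheses (cg : continuous g) (g0 : forall t, 0 <= t -> 0 <= g t).
Hypotheses (c0 : 0 < c) (dl0 : 0 < dl).

(* The cutoff after [c] keeps the primitive within [g c * dl] of [primitive g c]. *)
Definition trunc (t : R) : R := g (clamp 0 c t) * clamp 0 1 (1 - (t - c) / dl).

Lemma continuous_trunc : continuous trunc.
Proof.
move=> t; apply: cvgM.
  by apply: (@continuous_comp _ _ _ (clamp 0 c) g); [exact: continuous_clamp|exact: cg].
apply: (@continuous_comp _ _ _ (fun t => 1 - (t - c) / dl) (clamp 0 1)); last exact: continuous_clamp.
apply: cvgB; first exact: cvg_cst.
by apply: cvgMl; apply: cvgB; [exact: cvg_id|exact: cvg_cst].
Qed.

Lemma trunc_ge0 t : 0 <= trunc t.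
Proof.
have /andP[h1 _] := clamp_itv t (ltW c0); have /andP[h2 _] := @clamp_itv R 0 1 (1 - (t - c) / dl) ler01.
by rewrite mulr_ge0// g0.
Qed.

Lemma trunc_id t : 0 <= t -> t <= c -> trunc t = g t.
Proof.
move=> t0 tc; rewrite /trunc clamp_id//.
have h : 1 <= 1 - (t - c) / dl by rewrite lerBrDr gerDl pmulr_lle0 ?invr_gt0// subr_le0.
by rewrite /clamp (min_idPl h) (max_idPr ler01) mulr1.
Qed.

Let trunc_le t : c <= t -> trunc t <= g c.
Proof.
move=> ct; rewrite /trunc; have /andP[h1 h2] := @clamp_itv R 0 1 (1 - (t - c) / dl) ler01.
rewrite {1}/clamp (min_idPl ct) (max_idPr (ltW c0)) ler_piMr// g0// ltW//.
Qed.

Let trunc_out t : c + dl <= t -> trunc t = 0.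
Proof.
move=> ct; have h : 1 - (t - c) / dl <= 0 by rewrite subr_le0 ler_pdivlMr// mul1r; lra.
by rewrite /trunc {2}/clamp (min_idPr (le_trans h ler01)) (max_idPl h) mulr0.
Qed.

(** On negative arguments [trunc] is the constant [g 0]. It is thus nonnegative on the whole line,
    which yields the sign condition in [nonnegative_critical]. *)
Let trunc_neg t : t <= 0 -> trunc t = trunc 0.
Proof.
move=> t0; have h s : s <= 0 -> 1 <= 1 - (s - c) / dl.
  by move=> s0; rewrite lerBrDr gerDl pmulr_lle0 ?invr_gt0//; have := c0; lra.
rewrite /trunc {2 4}/clamp !(min_idPl (h _ _))// (max_idPr ler01).
by rewrite /clamp (min_idPr (le_trans t0 (ltW c0))) (max_idPl t0) (min_idPr (ltW c0)) maxxx.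
Qed.

(** [trunc] factors through a compact interval, whence its boundedness and uniform continuity. *)
Let trunc_clamp t : trunc t = trunc (clamp 0 (c + dl) t).
Proof.
have cd : 0 <= c + dl by rewrite ltW// addr_gt0.
case: (leP t 0) => t0.
  by rewrite /clamp (min_idPr (le_trans t0 cd)) (max_idPl t0) trunc_neg.
case: (leP t (c + dl)) => tc; first by rewrite clamp_id// ltW.
by rewrite /clamp (min_idPl (ltW tc)) (max_idPr cd) !trunc_out// ltW.
Qed.

Lemma trunc_bounded : exists M, forall t, `|trunc t| <= M.
Proof.
have cd : 0 <= c + dl by rewrite ltW// addr_gt0.
have [M MP] := clamp_bounded continuous_trunc cd.
by exists M => t; rewrite trunc_clamp.
Qed.

Lemma trunc_uniform_continuous (e : R) : 0 < e -> exists2 d : R, 0 < d &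
  forall s t, `|s - t| <= d -> `|trunc s - trunc t| <= e.
Proof.
move=> e0; have cd : 0 <= c + dl by rewrite ltW// addr_gt0.
have [d d0 dP] := clamp_uniform_continuous continuous_trunc cd e0.
by exists d => // s t st; rewrite (trunc_clamp s) (trunc_clamp t); exact: dP.
Qed.

Lemma primitive_trunc_ndecr s t : s <= t -> primitive trunc s <= primitive trunc t.
Proof.
move=> st; have [M MP] := trunc_bounded.
have := @primitive_bounds R trunc s t 0 M continuous_trunc st _; rewrite mul0r subr_ge0.
by case/(_ _)/andP => // x _ _; rewrite trunc_ge0 (le_trans (ler_norm _)).
Qed.

Lemma primitive_trunc t : 0 <= t -> t <= c -> primitive trunc t = primitive g t.
Proof. by move=> t0 tc; apply: eq_primitive => // s s0 st; rewrite trunc_id// (le_trans st). Qed.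

(** Beyond [c] the integrand is at most [g c] on an interval of length [dl], and zero afterwards. *)
Lemma primitive_trunc_le t : primitive trunc t <= primitive g c + g c * dl.
Proof.
have tcc : primitive trunc c = primitive g c by rewrite primitive_trunc// ltW.
have gdl : 0 <= g c * dl by rewrite mulr_ge0 ?(ltW dl0)// g0// ltW.
have H : primitive trunc (c + dl) <= primitive g c + g c * dl.
  have cc : c <= c + dl by rewrite lerDl ltW.
  have := @primitive_bounds R trunc c (c + dl) 0 (g c) continuous_trunc cc _.
  rewrite tcc addrAC subrr add0r; case/(_ _)/andP; first by move=> s h _; rewrite trunc_ge0 trunc_le.
  by move=> _ ?; lra.
case: (leP t (c + dl)) => tc; first exact: (le_trans (primitive_trunc_ndecr tc)).
have := @primitive_bounds R trunc (c + dl) t 0 0 continuous_trunc (ltW tc) _.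
rewrite mul0r; case/(_ _)/andP; first by move=> s h _; rewrite trunc_out// lexx.
by move=> _ ?; lra.
Qed.
End truncation.

(** * Energy levels *)

Section tent_energy.
Variables (R : realType) (N : nat).
Local Notation E := 'rV[R]_N.
Local Notation mu := (lebesgue_rV R N).
Local Notation V := (sobolev_pair R N).
Variables (p : R) (x0 : E) (r d : R).
Hypotheses (N0 : (0 < N)%N) (Np : N%:R < p) (r0 : 0 < r) (d0 : 0 < d).
Let N1 : 1 <= N%:R :> R. Proof. by rewrite ler1n. Qed.
Let p1 : 1 < p. Proof. exact: le_lt_trans Np. Qed.
Let p0 : 0 < p. Proof. exact: lt_trans p1. Qed.
Variables (a : E -> R) (alo ahi : R).
Hypotheses (ma : measurable_fun setT a) (alo0 : 0 < alo)
  (a_alo : forall x, alo <= a x) (a_ahi : forall x, a x <= ahi).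
Let ahi0 : 0 <= ahi. Proof. exact: le_trans (ltW alo0) (le_trans (a_alo 0) (a_ahi 0)). Qed.

Lemma Rintegral_eball (c : E) (s : R) : 0 < s ->
  mu.-integrable setT (EFin \o (\1_(eball c s) : E -> R)) /\
  \int[mu]_x (\1_(eball c s) x : R) = s ^+ N * ball_vol R N.
Proof.
move=> s0; have mB := @measurable_eball R N c s.
have e : (\int[mu]_x ((\1_(eball c s) x : R)%:E) = (s ^+ N * ball_vol R N)%:E)%E.
  by rewrite integral_indic// setIT; exact: mu_eball.
split; last by rewrite /Rintegral e.
apply/integrableP; split; first by apply/measurable_EFinP; exact: measurable_indic.
rewrite (eq_integral (fun x => (\1_(eball c s) x : R)%:E)) ?e ?ltry// => x _.
by rewrite /= ger0_norm// indicE ler0n.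
Qed.

Definition tent_pair : V := (tent x0 r d, tent_grad x0 r d).

Lemma tent_pair_in_W1p : in_W1p p tent_pair.
Proof. by split; [exact: Lp_tent|exact: weak_gradient_tent]. Qed.

(** The slope is [2 d / r] on the shell between the radii [r / 2] and [r], whose volume accounts for
    [2^p - 2^(p-N)]; the potential is bounded by [ahi d^p] on the whole ball. This is the origin of
    the denominator of [K_R]. *)
Lemma energy_tent_le : energy p a tent_pair <=
  d `^ p * ball_vol R N * (2 `^ p - 2 `^ (p - N%:R) + r `^ p * ahi) / r `^ (p - N%:R).
Proof.
have r20 : 0 < r / 2 by rewrite divr_gt0.
have [I1 E1] := Rintegral_eball x0 r0; have [I2 E2] := Rintegral_eball x0 r20.
have W := tent_pair_in_W1p.
have h1 : \int[mu]_x (enorm (tent_grad x0 r d x) `^ p) <=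
    (2 * d / r) `^ p * (r ^+ N * ball_vol R N - (r / 2) ^+ N * ball_vol R N).
  rewrite -E1 -E2 -(RintegralB measurableT I1 I2) -(RintegralZl _ measurableT (integrableRB measurableT I1 I2)).
  apply: le_Rintegral => //.
  - exact: (in_W1p_integrable_grad N0 Np W).
  - exact: (integrableRZ _ measurableT (integrableRB measurableT I1 I2)).
  move=> x _; rewrite tent_grad_norm// !indicE /eball.
  have dr : 0 <= 2 * d / r by rewrite divr_ge0 ?(ltW r0)// mulr_ge0// ltW.
  have e1 s : (x \in eball x0 s) = (enorm (x - x0) < s) by rewrite -[RHS]asboolb.
  rewrite !e1 -[x \in _]/(_ \in [set y : E | r / 2 < enorm (y - x0) < r]).
  have -> : (x \in [set y : E | r / 2 < enorm (y - x0) < r]) = (r / 2 < enorm (x - x0) < r).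
    by rewrite -[RHS]asboolb.
  have [h|h] := boolP (r / 2 < enorm (x - x0) < r).
    by case/andP: h => ha hb; rewrite hb ltNge (ltW ha)/= subr0 !mulr1.
  rewrite mulr0 powR0 ?gt_eqF// mulr_ge0 ?powR_ge0// subr_ge0 ler_nat.
  case: ltP => // hx; rewrite (lt_trans hx)//.
  by rewrite ltr_pdivrMr// ltr_pMr// ltr1n.
have h2 : \int[mu]_x (a x * `|tent x0 r d x| `^ p) <= (ahi * d `^ p) * (r ^+ N * ball_vol R N).
  rewrite -E1 -(RintegralZl _ measurableT I1); apply: le_Rintegral => //.
  - exact: (in_W1p_integrable_pot ma alo0 a_alo a_ahi W).
  - exact: (integrableRZ _ measurableT I1).
  move=> x _; have [h|h] := ltP (enorm (x - x0)) r.
    rewrite indicE mem_set// mulr1 ler_pM//; first exact: le_trans (ltW alo0) (a_alo x).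
    apply: ge0_ler_powR; rewrite ?nnegrE ?(ltW p0) ?(ltW d0)//.
    by rewrite ger0_norm ?tent_ge0// tent_le.
  by rewrite tent_out// normr0 powR0 ?gt_eqF// mulr0 mulr_ge0// mulr_ge0// powR_ge0.
apply: (le_trans (lerD h1 h2)); rewrite le_eqVlt; apply/orP; left; apply/eqP.
have rn : r `^ (p - N%:R) != 0 by rewrite gt_eqF// powR_gt0.
have dr : (2 * d / r) `^ p = 2 `^ p * d `^ p / r `^ p.
  by rewrite powRM ?mulr_ge0 ?invr_ge0 ?(ltW d0) ?(ltW r0)// powRM ?(ltW d0)// -[r^-1]powR_inv1 ?(ltW r0)// -powRrM mulN1r powRN.
have rp : r `^ p = r `^ (p - N%:R) * r ^+ N.
  by rewrite -powR_mulrn ?(ltW r0)// -powRD ?subrK// ?(gt_eqF r0) ?implybT.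
have tp : 2 `^ p = 2 `^ (p - N%:R) * 2 ^+ N :> R.
  by rewrite -powR_mulrn// -powRD ?subrK// ?implybT//; apply/implyP => _; rewrite gt_eqF.
rewrite dr expr_div_n rp tp.
move: (ball_vol R N) (d `^ p) (2 `^ (p - N%:R)) (r `^ (p - N%:R)) rn => b dp t rr rn.
have rN : r ^+ N != 0 by rewrite expf_neq0// gt_eqF.
have tN : 2 ^+ N != 0 :> R by rewrite expf_neq0// gt_eqF.
move: (r ^+ N) (2 ^+ N) rN tN => rN tN rN0 tN0.
by field; apply/and3P.
Qed.

(** The tent equals [d] on a ball of positive measure, where the almost everywhere bound of the
    embedding must hold at some point. *)
Lemma energy_tent_ge : d <= embedding_cst N p alo * energy p a tent_pair `^ p^-1.
Proof.
have h := energy_sup N0 Np ma alo0 a_alo a_ahi tent_pair_in_W1p.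
rewrite leNgt; apply/negP => hd.
have r20 : 0 < r / 2 by rewrite divr_gt0.
have [A [mA A0 AP]] := h.
have : (((r / 2) ^+ N * ball_vol R N)%:E <= 0)%E.
  rewrite -(mu_eball x0 r20) -[leRHS]A0; apply: le_measure; rewrite ?inE//; first exact: measurable_eball.
  move=> x Bx; apply: AP => /=.
  rewrite tent_in//; last exact: ltW.
  by rewrite gtr0_norm// => h'; move: hd; rewrite ltNge h'.
move=> hle; have : (r / 2) ^+ N * ball_vol R N <= 0 by rewrite -lee_fin; exact: hle.
rewrite leNgt => /negP; apply.
by rewrite mulr_gt0 ?exprn_gt0// ball_vol_gt0.
Qed.

(** Only the ball of radius [r / 2], where the tent equals [d], is kept; elsewhere the integrand is
    nonnegative. Hence the integral of [h] over this ball in the statement. *)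
Lemma reaction_potential_tent_ge (h : E -> R) (lam Gm : R) (Gt : R -> R) :
  mu.-integrable setT (EFin \o h) -> (forall x, 0 <= h x) -> 0 < lam ->
  continuous Gt -> (forall t, `|Gt t| <= Gm * `|t|) -> (forall t : R, 0 <= t -> 0 <= Gt t) ->
  lam * (Gt d * \int[mu]_(x in eball x0 (r / 2)) h x) <= reaction_potential h lam Gt tent_pair.
Proof.
move=> ih h0 lam0 cG Gl G0; rewrite /reaction_potential ler_pM2l//.
have mB := @measurable_eball R N x0 (r / 2).
have iB : mu.-integrable (eball x0 (r / 2)) (EFin \o h) by apply: (integrableS _ mB _ ih).
have e : \int[mu]_(x in eball x0 (r / 2)) (Gt d * h x) =
    \int[mu]_x ((Gt d * h x) * \1_(eball x0 (r / 2)) x).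
  rewrite [LHS]Rintegral_mkcond; apply: eq_Rintegral => x _; rewrite patchE indicE.
  by case: (x \in _); rewrite ?mulr1 ?mulr0.
rewrite -(RintegralZl _ mB iB) e.
have mt := @measurable_tent R N x0 r d.
have i1 : mu.-integrable setT (EFin \o fun x => h x * Gt (tent x0 r d x)).
  apply: (@weight_integrable R N h ih h0 _ (Gm * d)).
    by apply: (measurableT_comp _ mt); exact: continuous_measurable_fun.
  apply: aeW => x; apply: (le_trans (Gl _)); rewrite ger0_norm ?tent_ge0//.
  rewrite ler_wpM2l ?tent_le//.
  have := Gl d; rewrite (gtr0_norm d0) => /(le_trans (normr_ge0 _)); rewrite pmulr_lge0//.
apply: le_Rintegral => //.
  apply: (ae_bound_integrable _ (integrableRZ (Gt d) measurableT ih)).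
    apply: measurable_funM; last exact: measurable_indic.
    apply: measurable_funM => //; by have /integrableP[/measurable_EFinP] := ih.
  apply: aeW => x; have Gd : 0 <= Gt d * h x by rewrite mulr_ge0// G0// ltW.
  by rewrite indicE; case: (_ \in _); rewrite ?mulr1 ?mulr0 ?normr0// ger0_norm.
move=> x _; rewrite indicE; case: (boolP (_ \in _)) => [/set_mem/= xB|_].
  by rewrite mulr1 mulrC tent_in// ltW.
by rewrite mulr0 mulr_ge0// G0// tent_ge0.
Qed.
End tent_energy.

Section bounded_weight.
Variables (R : realType) (N : nat).
Local Notation E := 'rV[R]_N.
Local Notation mu := (lebesgue_rV R N).
Local Notation V := (sobolev_pair R N).
Variable p : R.
Hypotheses (N0 : (0 < N)%N) (Np : N%:R < p).
Let N1 : 1 <= N%:R :> R. Proof. by rewrite ler1n. Qed.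
Let p1 : 1 < p. Proof. exact: le_lt_trans Np. Qed.
Let p0 : 0 < p. Proof. exact: lt_trans p1. Qed.
Variables (a h : E -> R) (alo ahi : R) (g : R -> R).
Hypotheses (ma : measurable_fun setT a) (alo0 : 0 < alo)
  (a_alo : forall x, alo <= a x) (a_ahi : forall x, a x <= ahi).
Hypotheses (ih : mu.-integrable setT (EFin \o h)) (h0 : forall x, 0 <= h x).
Hypotheses (cg : continuous g) (g0 : forall t : R, 0 <= t -> 0 <= g t).
Variables (x0 : E) (r c1 c2 d lam : R).
Hypotheses (r0 : 0 < r) (c10 : 0 < c1) (d0 : 0 < d) (lam0 : 0 < lam).
Hypotheses (c1d : 2 `^ (1 / p) * c1 < d) (dc2 : d < c2).

Local Notation k := (embedding_cst N p alo).
Local Notation G := (primitive g).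
(** The value of [energy / p] at which the norm is [c / k], so that the embedding gives
    [|u| <= c]. *)
Local Notation rho c := (c `^ p / (p * k `^ p)).
Local Notation H := (\int[mu]_x h x).
Local Notation v0 := (tent_pair x0 r d : V).
Local Notation nm v := (energy p a v `^ p^-1).

(** [level1] makes the barrier positive, [gain] makes the level of the tent negative, and [level2]
    with [cost] keep the norms of the solutions below [c2 / k]. *)
Hypotheses (level1 : lam * (H * G c1) < rho c1)
  (level2 : lam * (H * G c2) < rho c2 / 2)
  (gain : energy p a v0 / p < lam * (G d * \int[mu]_(x in eball x0 (r / 2)) h x))
  (cost : energy p a v0 / p < rho c2 / 3).

Let k0 : 0 < k. Proof. exact: embedding_cst_gt0. Qed.
Let c20 : 0 < c2. Proof. exact: lt_trans d0 dc2. Qed.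
Let H0 : 0 <= H. Proof. by apply: Rintegral_ge0. Qed.
Let c1d' : c1 < d.
Proof.
apply: le_lt_trans c1d; rewrite ler_peMl ?(ltW c10)//.
by rewrite -[leLHS](powRr0 2) ler_powR ?ler1n// divr_ge0// ltW.
Qed.
Let rho0 (c : R) : 0 < c -> 0 < rho c.
Proof. by move=> c0; rewrite divr_gt0 ?mulr_gt0 ?powR_gt0. Qed.
Let rhoE (c : R) : 0 < c -> rho c * p = (c / k) `^ p.
Proof.
move=> cc; rewrite powRM ?invr_ge0 ?(ltW cc) ?(ltW k0)// -[k^-1]powR_inv1 ?(ltW k0)//.
rewrite -powRrM mulN1r powRN.
have kp : k `^ p != 0 by rewrite gt_eqF// powR_gt0.
have pn : p != 0 by rewrite gt_eqF.
by field; rewrite kp pn.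
Qed.
Let powK (x : R) : 0 <= x -> (x `^ p) `^ p^-1 = x.
Proof. by move=> x0'; rewrite -powRrM divff ?gt_eqF// powRr1. Qed.
Let energy0 (v : V) : 0 <= energy p a v. Proof. exact: (energy_ge0 p alo0 a_alo). Qed.

Let nm_lt (v : V) (c : R) : 0 < c -> energy p a v / p < rho c -> nm v < c / k.
Proof.
move=> cc; rewrite ltr_pdivrMr// rhoE// => vc.
have ck : 0 <= c / k by rewrite divr_ge0// ltW.
rewrite -(powK ck); apply: gt0_ltr_powR; rewrite ?invr_gt0// ?nnegrE// powR_ge0//.
Qed.

(** The embedding read backwards: a function that takes the value [d > c1] on a ball has norm at
    least [d / k]. *)
Let rho1_v0 : rho c1 < energy p a v0 / p.
Proof.
rewrite ltr_pdivlMr// rhoE//.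
have dk : d / k <= nm v0.
  by rewrite ler_pdivrMr// mulrC; exact: (energy_tent_ge x0 N0 Np r0 d0 ma alo0 a_alo a_ahi).
have c1k : c1 / k < d / k by rewrite ltr_pM2r// invr_gt0.
have -> : energy p a v0 = (nm v0) `^ p by rewrite powR_invK ?gt_eqF.
apply: gt0_ltr_powR; rewrite ?nnegrE ?powR_ge0 ?divr_ge0 ?(ltW c10) ?(ltW k0)//.
exact: lt_le_trans dk.
Qed.

(** The width of the cutoff: it grants the tail of the truncation [rho c2 / 6], which is what
    [level2] and [cost] leave of [rho c2]. The added 1 keeps the denominator positive. *)
Let dl : R := rho c2 / 6 / (lam * (H * g c2) + 1).
Let gc2 : 0 <= g c2. Proof. by rewrite g0// ltW. Qed.
Let den0 : 0 < lam * (H * g c2) + 1.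
Proof. by rewrite ltr_wpDl// mulr_ge0 ?mulr_ge0// ltW. Qed.
Let dl0 : 0 < dl. Proof. by apply: divr_gt0 => //; apply: divr_gt0 => //; exact: rho0. Qed.
Let dlE : lam * (H * (g c2 * dl)) <= rho c2 / 6.
Proof.
have -> : lam * (H * (g c2 * dl)) = rho c2 / 6 * ((lam * (H * g c2)) / (lam * (H * g c2) + 1)).
  by rewrite /dl; move: (rho c2) => q; field; rewrite gt_eqF.
rewrite ler_piMr//; first by rewrite divr_ge0// ltW// rho0.
by rewrite ler_pdivrMr// mul1r lerDl.
Qed.

Let gt := trunc g c2 dl.
Let Gt := primitive gt.
Let cgt : continuous gt. Proof. exact: continuous_trunc. Qed.

(** The energy is defined on pairs, but a weak gradient is determined almost everywhere by its
    function. Solutions told apart by their energies are therefore distinct as functions. *)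
Lemma energy_ae_eq (u v : V) : in_W1p p u -> in_W1p p v ->
  {ae mu, forall x, u.1 x = v.1 x} -> energy p a u = energy p a v.
Proof.
move=> Wu Wv uv.
have uvD := weak_gradient_unique N0 Np (weak_gradient_ae_eq Wu.1.1 Wv.1.1 uv Wu.2) Wv.2.
have me (w : V) : in_W1p p w -> measurable_fun setT (fun x => enorm (w.2 x) `^ p).
  by move=> Ww; have /integrableP[/measurable_EFinP] := in_W1p_integrable_grad N0 Np Ww.
have mp (w : V) : in_W1p p w -> measurable_fun setT (fun x => a x * `|w.1 x| `^ p).
  by move=> Ww; have /integrableP[/measurable_EFinP] := in_W1p_integrable_pot ma alo0 a_alo a_ahi Ww.
have e1 : \int[mu]_x (enorm (u.2 x) `^ p) = \int[mu]_x (enorm (v.2 x) `^ p).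
  by apply: (ae_eq_Rintegral (me _ Wu) (me _ Wv)); apply: filterS uvD => x ->.
have e2 : \int[mu]_x (a x * `|u.1 x| `^ p) = \int[mu]_x (a x * `|v.1 x| `^ p).
  by apply: (ae_eq_Rintegral (mp _ Wu) (mp _ Wv)); apply: filterS uv => x ->.
by rewrite /energy e1 e2.
Qed.

Let reaction_ae_eq (l : R) (f : R -> R) (u v : V) : continuous f -> in_W1p p u -> in_W1p p v ->
  {ae mu, forall x, u.1 x = v.1 x} -> reaction_potential h l f u = reaction_potential h l f v.
Proof.
move=> cf Wu Wv uv.
have mG (w : V) : in_W1p p w -> measurable_fun setT (fun x => h x * f (w.1 x)).
  move=> Ww; apply: measurable_funM; first by have /integrableP[/measurable_EFinP] := ih.
  by apply: (measurableT_comp _ Ww.1.1); exact: continuous_measurable_fun.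
have e : \int[mu]_x (h x * f (u.1 x)) = \int[mu]_x (h x * f (v.1 x)).
  by apply: (ae_eq_Rintegral (mG _ Wu) (mG _ Wv)); apply: filterS uv => x ->.
by rewrite /reaction_potential e.
Qed.

Let two_thirds (x y z : R) : x < z / 2 -> y <= z / 6 -> x + y < z * (2 / 3).
Proof. by move=> h1 h2; lra. Qed.

Let below (x y z q l : R) : x - y <= l -> z < q * (2 / 3) -> l < q / 3 -> y <= z -> x < q.
Proof. by move=> h1 h2 h3 h4; lra. Qed.

Theorem three_solutions : exists w : 'I_3 -> V,
  (forall i, [/\ in_W1p p (w i), {ae mu, forall x, 0 <= (w i).1 x}, nm (w i) < c2 / k &
     forall z, in_W1p p z ->
       energy_form p a (w i) z = lam * \int[mu]_x (h x * (g ((w i).1 x) * z.1 x))]) /\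
  (forall i j, i != j -> ~ {ae mu, forall x, (w i).1 x = (w j).1 x}).
Proof.
have [Gm gtb] := trunc_bounded cg c20 dl0.
have gt_uc := trunc_uniform_continuous cg c20 dl0.
have gt_ge0 t : 0 <= gt t by exact: trunc_ge0.
have Gt0 : Gt 0 = 0 by exact: primitive0.
have Gt_lip t : `|Gt t| <= Gm * `|t|.
  by have := primitive_lip 0 t cgt gtb; rewrite [primitive _ 0]Gt0 !subr0.
have Gt_diff := primitive_diff cgt gt_uc.
have cGt : continuous Gt := continuous_primitive cgt gtb.
have Gt_ndecr s t : s <= t -> Gt s <= Gt t by exact: primitive_trunc_ndecr.
have Gt_ge0 (t : R) : 0 <= t -> 0 <= Gt t by move=> t0; rewrite -Gt0 Gt_ndecr.
have GtE t : 0 <= t -> t <= c2 -> Gt t = G t by exact: primitive_trunc.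
have Gc1 : 0 <= G c1 by rewrite -GtE ?Gt_ge0 ?(ltW c10)// ltW// (lt_trans c1d').
have Gc2 : 0 <= G c2 by rewrite -GtE ?Gt_ge0 ?(ltW c20).
have M0 : 0 <= lam * Gm * k * H.
  by have Gm0 := le_trans (normr_ge0 _) (gtb 0); apply: mulr_ge0 => //; apply: mulr_ge0; [apply: mulr_ge0 => //; exact: ltW|exact: ltW].
have Wv0 := tent_pair_in_W1p x0 N0 Np r0 d0.
pose C := G c2 + g c2 * dl.
have C0 : 0 <= C by rewrite addr_ge0// mulr_ge0// ltW.
pose T := reaction_form h lam gt; pose Ps := reaction_potential h lam Gt.
have Ps_bnd u : in_W1p p u -> Ps u <= lam * (C * H).
  move=> Wu; apply: (reaction_potential_le N0 Np ma alo0 a_alo a_ahi ih h0 lam0 gtb cGt Gt_lip Wu) => //.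
  by apply: aeW => x; exact: primitive_trunc_le.
have CH : lam * (C * H) < rho c2 * (2 / 3).
  have -> : lam * (C * H) = lam * (H * G c2) + lam * (H * (g c2 * dl)) by rewrite /C; ring.
  exact: (two_thirds level2 dlE).
have Ps_ge0 (s : R) : 0 <= s -> 0 <= Ps (s *: v0).
  move=> s0; apply: mulr_ge0; first exact: ltW.
  apply: Rintegral_ge0 => x _; apply: mulr_ge0 => //; apply: Gt_ge0.
  by apply: mulr_ge0 => //; exact: tent_ge0.
(* [m] bounds [J] from below on the sphere, where [|u| <= c1]; [L] bounds it from above on the
   segment, where the potential is nonnegative. *)
pose m := rho c1 - lam * (H * G c1); pose L := energy p a v0 / p.
have m0 : 0 < m by rewrite subr_gt0.
have mr : m <= rho c1 by rewrite gerBl mulr_ge0 ?(ltW lam0)// mulr_ge0.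
have mL : m <= L by apply: (le_trans mr); exact: ltW.
have sup (u : V) : in_W1p p u -> {ae mu, forall x, `|u.1 x| <= k * nm u}.
  exact: (energy_sup N0 Np ma alo0 a_alo a_ahi).
have bar u : in_W1p p u -> energy p a u / p = rho c1 -> m <= energy p a u / p - Ps u.
  move=> Wu e; rewrite e lerD2l lerN2 [H * _]mulrC.
  apply: (reaction_potential_le N0 Np ma alo0 a_alo a_ahi ih h0 lam0 gtb cGt Gt_lip Wu) => //.
  apply: filterS (sup u Wu) => x; have -> : nm u = c1 / k.
    by rewrite -[energy p a u](divfK (lt0r_neq0 p0)) e rhoE// powK// divr_ge0// ltW.
  rewrite mulrC divfK ?gt_eqF// => ux.
  rewrite -GtE ?(ltW c10)//; last by rewrite ltW// (lt_trans c1d').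
  by rewrite Gt_ndecr// (le_trans (ler_norm _)).
have J0m : energy p a 0 / p - Ps 0 < m.
  have -> : Ps 0 = 0.
    rewrite /Ps /reaction_potential -[RHS](mulr0 lam); congr (_ * _).
    under eq_Rintegral do rewrite Gt0 mulr0.
    by rewrite Rintegral_cst// mul0r.
  have := energyZ N0 Np ma alo0 a_alo a_ahi 0 (in_W1p0 N0 Np).
  by rewrite scale0r normr0 powR0 ?gt_eqF// mul0r => ->; rewrite mul0r subr0.
have v0m : energy p a v0 / p - Ps v0 < m.
  apply: lt_trans m0; rewrite subr_lt0; apply: (lt_le_trans gain).
  have -> : G d = Gt d by rewrite GtE// ltW.
  exact: reaction_potential_tent_ge.
have segL (s : R) : 0 <= s -> s <= 1 -> energy p a (s *: v0) / p - Ps (s *: v0) <= L.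
  move=> s0 s1; have := Ps_ge0 s s0; rewrite (energyZ N0 Np ma alo0 a_alo a_ahi _ Wv0).
  have : `|s| `^ p * energy p a v0 / p <= L.
    rewrite -mulrA ler_piMl// ?divr_ge0 ?(ltW p0)// ger0_norm//.
    have -> : 1 = 1 `^ p :> R by rewrite powR1.
    by apply: ge0_ler_powR; rewrite ?nnegrE ?(ltW p0).
  by move=> h1 h2; apply: (le_trans _ h1); rewrite gerBl.
have TLl (u : V) (t : R) (v w : V) := @reaction_formL R N p N0 Np a alo ahi ma alo0 a_alo a_ahi h lam Gm gt ih h0 gtb cgt u t v w.
have [w1 [w2 [w3 [[W1 crit1 J1 q1] [W2 crit2 J2 q2] [W3 crit3 J3 J3L]]]]] :=
  @three_critical_points R V (in_W1p p) (energy p a) p T Ps (lam * Gm * k * H) (lam * (C * H)) p1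
  (in_W1p0 N0 Np) (in_W1pL N0 Np) energy0 (energyZ N0 Np ma alo0 a_alo a_ahi)
  (@energy_cvx R N p N0 Np a alo ahi ma alo0 a_alo a_ahi)
  (@energy_ucvx R N p N0 Np a alo ahi ma alo0 a_alo a_ahi)
  (@energy_complete R N p N0 Np a alo ahi ma alo0 a_alo a_ahi)
  M0 TLl (@reaction_form_bnd R N p N0 Np a alo ahi ma alo0 a_alo a_ahi h lam Gm gt ih h0 lam0 gtb cgt)
  (@reaction_form_ucont R N p N0 Np a alo ahi ma alo0 a_alo a_ahi h lam Gm gt ih h0 lam0 gtb gt_uc cgt)
  (@reaction_potential_diff R N p N0 Np a alo ahi ma alo0 a_alo a_ahi h lam Gm gt Gt ih h0 lam0 gtb Gt_diff cgt cGt Gt_lip)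
  Ps_bnd (@reaction_form_compact R N p N0 Np a alo ahi ma alo0 a_alo a_ahi h lam Gm gt ih h0 lam0 gtb cgt)
  L (rho c1) m v0 (rho0 c10) mL bar Wv0 J0m v0m rho1_v0 segL.
(* [energy / p] is the level plus the potential, hence at most [L] plus a number below two thirds of
   [rho c2], with [L] below one third of it. So [|w| < c2] almost everywhere, and [trunc] coincides
   with [g] at the values of [w]. *)
have sol w : in_W1p p w -> energy p a w / p - Ps w <= L ->
    (forall v, in_W1p p v -> energy p a w / p - T w w <= energy p a v / p - T w v) ->
    [/\ in_W1p p w, {ae mu, forall x, 0 <= w.1 x}, nm w < c2 / k &
     forall z, in_W1p p z ->
       energy_form p a w z = lam * \int[mu]_x (h x * (g (w.1 x) * z.1 x))].
  move=> Ww JL crit.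
  have small : nm w < c2 / k.
    by apply: nm_lt => //; exact: (below JL CH cost (Ps_bnd w Ww)).
  have ef z : in_W1p p z -> energy_form p a w z = T w z.
    move=> Wz; apply: (critical_energy_form N0 Np ma alo0 a_alo a_ahi Ww _ crit Wz).
    by move=> t u v Wu Wv; exact: TLl.
  have w0 : {ae mu, forall x, 0 <= w.1 x}.
    apply: (nonnegative_critical N0 Np ma alo0 a_alo a_ahi Ww (sup w Ww)) => z Wz z0.
    rewrite ef//; apply: mulr_ge0; first exact: ltW.
    by apply: Rintegral_ge0 => x _; apply: mulr_ge0 => //; apply: mulr_ge0.
  split => // z Wz; rewrite ef// /T /reaction_form; congr (_ * _).
  have mh : measurable_fun setT h by have /integrableP[/measurable_EFinP] := ih.
  have mm (f : R -> R) : continuous f -> measurable_fun setT (fun x => h x * (f (w.1 x) * z.1 x)).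
    move=> cf; apply: measurable_funM => //; apply: measurable_funM; last exact: Wz.1.1.
    by apply: (measurableT_comp _ Ww.1.1); exact: continuous_measurable_fun.
  apply: (ae_eq_Rintegral (mm _ cgt) (mm _ cg)).
  apply: filterS2 w0 (sup w Ww) => x h1 h2; congr (_ * (_ * _)); apply: trunc_id => //.
  apply: (le_trans (ler_norm _)); apply: (le_trans h2).
  by rewrite mulrC -ler_pdivlMr// ltW.
have wE (u v : V) : in_W1p p u -> in_W1p p v -> {ae mu, forall x, u.1 x = v.1 x} ->
    energy p a u = energy p a v /\ Ps u = Ps v.
  by move=> Wu Wv uv; split; [exact: (energy_ae_eq Wu Wv uv)|exact: (reaction_ae_eq lam cGt Wu Wv uv)].
(* The sphere separates the first two solutions; the level [m] separates both from the third. *)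
have n12 : ~ {ae mu, forall x, w1.1 x = w2.1 x}.
  by move=> /(wE _ _ W1 W2)[e _]; move: q1 q2; rewrite e => q1 /(lt_trans q1); rewrite ltxx.
have n13 : ~ {ae mu, forall x, w1.1 x = w3.1 x}.
  by move=> /(wE _ _ W1 W3)[e1 e2]; move: J1; rewrite e1 e2 => /(le_lt_trans J3); rewrite ltxx.
have n23 : ~ {ae mu, forall x, w2.1 x = w3.1 x}.
  by move=> /(wE _ _ W2 W3)[e1 e2]; move: J2; rewrite e1 e2 => /(le_lt_trans J3); rewrite ltxx.
have sym (u v : V) : ~ {ae mu, forall x, u.1 x = v.1 x} -> ~ {ae mu, forall x, v.1 x = u.1 x}.
  by move=> uv vu; apply: uv; apply: filterS vu => x.
have s1 := sol w1 W1 (le_trans (ltW J1) mL) crit1.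
have s2 := sol w2 W2 (le_trans (ltW J2) mL) crit2.
have s3 := sol w3 W3 J3L crit3.
exists (fun i : 'I_3 => if val i is 0 then w1 else if val i is 1 then w2 else w3); split.
  by case=> [[|[|[|//]]] ?].
move=> [[|[|[|//]]] ?] [[|[|[|//]]] ?] ij;
  first [by case/negP: ij | exact: n12 | exact: n13 | exact: n23 | exact: (sym _ _ n12) |
    exact: (sym _ _ n13) | exact: (sym _ _ n23)].
Qed.
End bounded_weight.

(** * Arithmetic of the energy levels *)

Section level_arithmetic.
(** Here [k] stands for the p-th power of [k_a]; [x1], [x2], [xd] for those of [c1], [c2], [d]; [H]
    and [hB] for the integrals of [h] over the space and over the ball of radius [R / 2]; [En] for
    the energy of the tent. *)
Variables (R : realFieldType) (p k H hB K Kt x1 x2 xd G1 G2 Gd lam En : R).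
Hypotheses (p0 : 0 < p) (k0 : 0 < k) (H0 : 0 < H) (hB0 : 0 < hB) (hBH : hB <= H) (K0 : 0 < K).
Hypothesis KtE : Kt = K * (hB / H).
Hypotheses (x20 : 0 < x2) (xd0 : 0 < xd).
Hypotheses (Gd0 : 0 <= Gd) (Gd2 : Gd <= G2).
Hypothesis level : G2 / x2 < 1 / 3 * Kt * (Gd / xd).
Hypothesis lam_gt : 3 / 2 * (1 / (p * k * H * Kt)) * (xd / Gd) < lam.
Hypothesis En_le : En <= xd / (k * K).

Let Kt0 : 0 < Kt. Proof. by rewrite KtE mulr_gt0// divr_gt0. Qed.

(** If [G(d)] vanished, the right side of [level] would be 0 and its left side negative. *)
Lemma level_gain_gt0 : 0 < Gd.
Proof.
rewrite lt_neqAle Gd0 andbT; apply/eqP => e; move: level; rewrite -e mul0r mulr0.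
by rewrite ltNge divr_ge0// ?(ltW x20)// (le_trans Gd0).
Qed.

Lemma level_lam_gt0 : 0 < lam.
Proof.
apply: lt_trans lam_gt; have Gd' := level_gain_gt0.
by rewrite mulr_gt0 ?divr_gt0// mulr_gt0 ?divr_gt0// !mulr_gt0.
Qed.

(** The lower bound on [lam] exceeds by the factor 3/2 the value that balances the potential of the
    tent with the bound on its energy divided by [p]. *)
Lemma level_gain : En / p < lam * (Gd * hB).
Proof.
have Gd' := level_gain_gt0.
have e1 : En / p <= xd / (k * K) / p by rewrite ler_pM2r// invr_gt0.
apply: (le_lt_trans e1).
have e2 : 3 / 2 * (1 / (p * k * H * Kt)) * (xd / Gd) * (Gd * hB) = 3 / 2 * (xd / (k * K) / p).
  by rewrite KtE; field; rewrite !gt_eqF.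
apply: (@lt_trans _ _ (3 / 2 * (xd / (k * K) / p))).
  have : 0 < xd / (k * K) / p by rewrite !divr_gt0// mulr_gt0.
  by move: (_ / p) => y y0; lra.
by rewrite -e2 ltr_pM2r// mulr_gt0.
Qed.

(** With [G(d) <= G(c2)] and [Kt <= K], the hypothesis [level] gives [3 d^p < K c2^p]. *)
Lemma level_cost : En / p < x2 / (p * k) / 3.
Proof.
have Gd' := level_gain_gt0; have G20 : 0 < G2 by exact: lt_le_trans Gd2.
have e1 : En / p <= xd / (k * K) / p by rewrite ler_pM2r// invr_gt0.
apply: (le_lt_trans e1).
have KtK : Kt <= K by rewrite KtE ler_piMr ?(ltW K0)// ler_pdivrMr// mul1r.
have h1 : xd * 3 < Kt * x2.
  have h2 : Gd / x2 < 1 / 3 * Kt * (Gd / xd).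
    by apply: le_lt_trans level; rewrite ler_pM2r// invr_gt0.
  have -> : xd * 3 = Gd / x2 * (xd * 3 * x2 / Gd) by field; rewrite !gt_eqF.
  have -> : Kt * x2 = 1 / 3 * Kt * (Gd / xd) * (xd * 3 * x2 / Gd) by field; rewrite !gt_eqF.
  by rewrite ltr_pM2r// divr_gt0// !mulr_gt0.
have h2 : xd * 3 < K * x2 by apply: (lt_le_trans h1); rewrite ler_pM2r.
have -> : xd / (k * K) / p = (xd * 3) / (3 * k * K * p) by field; rewrite !gt_eqF.
have -> : x2 / (p * k) / 3 = (K * x2) / (3 * k * K * p) by field; rewrite !gt_eqF.
by rewrite ltr_pM2r// invr_gt0 !mulr_gt0.
Qed.

Lemma level_one : 0 < G1 -> lam < 1 / (p * k * H) * (x1 / G1) -> lam * (H * G1) < x1 / (p * k).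
Proof.
move=> G10 h.
have -> : x1 / (p * k) = 1 / (p * k * H) * (x1 / G1) * (H * G1) by field; rewrite !gt_eqF.
by rewrite ltr_pM2r// mulr_gt0.
Qed.

Lemma level_two : lam < 1 / (2 * p * k * H) * (x2 / G2) -> lam * (H * G2) < x2 / (p * k) / 2.
Proof.
move=> h; have G20 : 0 < G2 by exact: lt_le_trans level_gain_gt0 Gd2.
have -> : x2 / (p * k) / 2 = 1 / (2 * p * k * H) * (x2 / G2) * (H * G2) by field; rewrite !gt_eqF.
by rewrite ltr_pM2r// mulr_gt0.
Qed.
End level_arithmetic.

(** * Essential bounds of the potential *)

Section essential_bounds.
Variables (R : realType) (N : nat).
Local Notation E := 'rV[R]_N.
Local Notation mu := (lebesgue_rV R N).

Lemma lebesgue_rV_setT_gt0 : (0 < mu [set: E])%E.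
Proof.
have b : (0 < mu (eball 0 1))%E.
  rewrite mu_eball//.
  by rewrite lte_fin mulr_gt0 ?exprn_gt0 ?ball_vol_gt0.
by apply: (lt_le_trans b); apply: le_measure; rewrite ?inE//; exact: measurable_eball.
Qed.

(** The space has positive measure. Witnesses of almost everywhere statements show that the
    essential infimum is finite and at most the sup norm. *)
Lemma ae_ex (P : E -> Prop) : {ae mu, forall x, P x} -> exists x, P x.
Proof.
have pf := ae_properfilter_algebraOfSetsType lebesgue_rV_setT_gt0.
by move=> /filter_ex.
Qed.

Lemma Lnorm_oo_le (u : E -> R) (C : R) : {ae mu, forall x, `|u x| <= C} ->
  ('N[mu]_+oo[EFin \o u] <= C%:E)%E.
Proof.
move=> uC; rewrite unlock lebesgue_rV_setT_gt0; apply/ess_supP.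
by apply: filterS uC => x ux; rewrite /= lee_fin.
Qed.

Variable a : E -> R.
Hypotheses (aoo : a \in Lfun mu +oo%E) (a_gt0 : (0 < ess_inf mu (EFin \o a))%E).

Lemma Lfun_oo_measurable : measurable_fun setT a.
Proof. by move: aoo; rewrite inE => /andP[/[!inE]]. Qed.

Lemma normoo_ae : {ae mu, forall x, `|a x| <= normoo a}.
Proof.
move: aoo; rewrite inE => /andP[_ /[!inE]/=]; rewrite /finite_norm => foo.
have fin : 'N[mu]_+oo[EFin \o a]%E \is a fin_num by rewrite ge0_fin_numE// Lnorm_ge0.
have : {ae mu, forall x, (`|(a x)%:E| <= ess_sup mu (abse \o (EFin \o a)))%E}.
  exact: ess_sup_ge.
apply: filterS => x; rewrite -lee_fin /normoo fineK//.
by rewrite unlock lebesgue_rV_setT_gt0.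
Qed.

Lemma essinf_ae : {ae mu, forall x, essinf a <= a x}.
Proof.
have h := ess_inf_le mu (EFin \o a).
have [y hy] := ae_ex h.
have fin : ess_inf mu (EFin \o a) \is a fin_num.
  by rewrite ge0_fin_numE ?ltW//; apply: (le_lt_trans hy); rewrite /= ltry.
by apply: filterS h => x; rewrite -lee_fin /essinf fineK.
Qed.

Lemma essinf_gt0 : 0 < essinf a.
Proof.
have [y hy] := ae_ex (ess_inf_le mu (EFin \o a)).
by apply: fine_gt0; rewrite a_gt0/=; apply: (le_lt_trans hy); rewrite /= ltry.
Qed.

Lemma essinf_le_normoo : essinf a <= normoo a.
Proof.
have [x [h1 h2]] : exists x, essinf a <= a x /\ `|a x| <= normoo a.
  by apply: ae_ex; apply: filterS2 essinf_ae normoo_ae => x.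
by apply: (le_trans h1); apply: (le_trans (ler_norm _)).
Qed.
End essential_bounds.

(** * From pairs and modified coefficients to weak solutions *)

Section transfer.
Variables (R : realType) (N : nat).
Local Notation E := 'rV[R]_N.
Local Notation mu := (lebesgue_rV R N).
Local Notation V := (sobolev_pair R N).
Variable p : R.
Hypotheses (N0 : (0 < N)%N) (Np : N%:R < p).
Let N1 : 1 <= N%:R :> R. Proof. by rewrite ler1n. Qed.
Let p1 : 1 < p. Proof. exact: le_lt_trans Np. Qed.
Let p0 : 0 < p. Proof. exact: lt_trans p1. Qed.
Variables (a aa h hh : E -> R) (alo ahi lam : R) (g : R -> R).
Hypotheses (ma : measurable_fun setT a) (maa : measurable_fun setT aa) (alo0 : 0 < alo)
  (a_alo : forall x, alo <= aa x) (a_ahi : forall x, aa x <= ahi).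
Hypotheses (mh : measurable_fun setT h) (mhh : measurable_fun setT hh) (cg : continuous g).
Hypotheses (a_ae : {ae mu, forall x, aa x = a x}) (h_ae : {ae mu, forall x, hh x = h x}).

Lemma W1p_grad (v : E -> R) : W1p p v -> in_W1p p ((v, grad p v) : V).
Proof.
by move=> [vp [D vD]]; split; [exact/(LfunP_Lp _ _ p0)|exact: (xgetI _ vD)].
Qed.

Lemma in_W1p_W1p (w : V) : in_W1p p w -> W1p p w.1.
Proof. by move=> [wp wD]; split; [exact/(LfunP_Lp _ _ p0)|exists w.2]. Qed.

Lemma energy_W1p_norm (w : V) : in_W1p p w -> W1p_norm p a w.1 = energy p aa w `^ p^-1.
Proof.
move=> Ww; have Wg := W1p_grad (in_W1p_W1p Ww).
have eqe := energy_ae_eq N0 Np maa alo0 a_alo a_ahi Wg Ww (aeW _ (fun x => erefl)).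
rewrite -eqe /W1p_norm /energy.
have -> : \int[mu]_x (a x * `|w.1 x| `^ p) = \int[mu]_x (aa x * `|w.1 x| `^ p).
  have mw := measurable_powR_norm p Ww.1.1.
  by apply: ae_eq_Rintegral; [exact: measurable_funM|exact: measurable_funM|apply: filterS a_ae => x ->].
by [].
Qed.

Lemma energy_form_ae_eq (u w z : V) : in_W1p p u -> in_W1p p w -> in_W1p p z -> u.1 = w.1 ->
  energy_form p aa u z = energy_form p aa w z.
Proof.
move=> Wu Ww Wz uw.
have uwD : {ae mu, forall x, u.2 x = w.2 x}.
  by apply: (weak_gradient_unique N0 Np Wu.2); rewrite uw; exact: Ww.2.
have e : \int[mu]_x pform p (u.2 x) (z.2 x) = \int[mu]_x pform p (w.2 x) (z.2 x).
  have i1 := energy_form_integrable1 N0 Np Wu Wz; have i2 := energy_form_integrable1 N0 Np Ww Wz.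
  have /integrableP[/measurable_EFinP m1 _] := i1; have /integrableP[/measurable_EFinP m2 _] := i2.
  by apply: (ae_eq_Rintegral m1 m2); apply: filterS uwD => x ->.
by rewrite /energy_form e uw.
Qed.

(** The weak formulation uses the gradient selected by [grad] and the given coefficients; these
    differ from [w.2], [aa] and [hh] on null sets only. *)
Lemma weak_solution_pair (w : V) : in_W1p p w -> {ae mu, forall x, 0 <= w.1 x} ->
  (forall z, in_W1p p z -> energy_form p aa w z = lam * \int[mu]_x (hh x * (g (w.1 x) * z.1 x))) ->
  weak_solution p a h g lam w.1.
Proof.
move=> Ww w0 weq; split => //; first exact: in_W1p_W1p.
move=> v Wv; have Wz := W1p_grad Wv; have Wg := W1p_grad (in_W1p_W1p Ww).
have i1 := energy_form_integrable1 N0 Np Wg Wz.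
have i2 := energy_form_integrable2 N0 Np maa alo0 a_alo a_ahi Wg Wz.
have mw : measurable_fun setT w.1 := Ww.1.1.
have mv : measurable_fun setT v := Wz.1.1.
have mf (b : E -> R) : measurable_fun setT b ->
    measurable_fun setT (fun x => b x * `|w.1 x| `^ (p - 2) * w.1 x * v x).
  move=> mb; apply: measurable_funM => //; apply: measurable_funM => //; apply: measurable_funM => //.
  exact: measurable_powR_norm.
have /integrableP[/measurable_EFinP m1 _] := i1.
transitivity (energy_form p aa ((w.1, grad p w.1) : V) ((v, grad p v) : V)).
  transitivity (\int[mu]_x (pform p (grad p w.1 x) (grad p v x) +
      aa x * `|w.1 x| `^ (p - 2) * w.1 x * v x)).
    apply: ae_eq_Rintegral; [|exact: (measurable_funD m1 (mf _ maa))|].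
      exact: (measurable_funD m1 (mf _ ma)).
    by apply: filterS a_ae => x ->.
  exact: (RintegralD measurableT i1 i2).
rewrite (energy_form_ae_eq Wg Ww Wz erefl) (weq _ Wz); congr (_ * _).
have mg : measurable_fun setT (fun x => g (w.1 x)).
  by apply: (measurableT_comp _ mw); exact: continuous_measurable_fun.
apply: ae_eq_Rintegral.
- by apply: measurable_funM => //; exact: measurable_funM.
- by apply: measurable_funM => //; exact: measurable_funM.
- by apply: filterS h_ae => x -> /=; rewrite mulrA.
Qed.
End transfer.

Theorem corollary3p3 (R : realType) (N : nat) (p : R)
    (a h : 'rV[R]_N -> R) (g : R -> R) (x0 : 'rV[R]_N) (r c1 c2 d : R)
    (N_ge1 : (1 <= N)%N) (N_lt_p : N%:R < p)
    (a_Loo : a \in Lfun (lebesgue_rV R N) +oo%E)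
    (a_gt0 : (0 < ess_inf (lebesgue_rV R N) (EFin \o a))%E)
    (h_L1 : h \in Lfun (lebesgue_rV R N) 1%E)
    (h_ge0 : {ae lebesgue_rV R N, forall x, 0 <= h x})
    (h_neq0 : ~ {ae lebesgue_rV R N, forall x, h x = 0})
    (g_cont : continuous g)
    (g_ge0 : forall t : R, 0 <= t -> 0 <= g t)
    (g_neq0 : exists2 t : R, 0 <= t & g t != 0)
    (r_gt0 : 0 < r)
    (h_ball : 0 < \int[lebesgue_rV R N]_(x in eball x0 (r / 2)) h x)
    (c1_gt0 : 0 < c1) (c2_gt0 : 0 < c2) (d_gt0 : 0 < d)
    (c1_lt_d : 2 `^ (1 / p) * c1 < d) (d_lt_c2 : d < c2)
    (G_c1 : primitive g c1 / c1 `^ p <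
            2 / 3 * Ktilde p a h x0 r * (primitive g d / d `^ p))
    (G_c2 : primitive g c2 / c2 `^ p <
            1 / 3 * Ktilde p a h x0 r * (primitive g d / d `^ p))
    (lambda : R)
    (lambda_gt : lambda1 p a h g x0 r d < lambda)
    (lambda_lt : (lambda%:E < lambda2 p a h g c1 c2)%E) :
  exists u : 'I_3 -> 'rV[R]_N -> R,
    (forall i, [/\ weak_solution p a h g lambda (u i),
       W1p_norm p a (u i) < c2 / k_ p a &
       ('N[lebesgue_rV R N]_+oo[EFin \o u i] < c2%:E)%E]) /\
    (forall i j, i != j ->
       ~ {ae lebesgue_rV R N, forall x, u i x = u j x}).
Proof.
set mu := lebesgue_rV R N in a_Loo a_gt0 h_L1 h_ge0 h_neq0 h_ball *.
have N0 : (0 < N)%N by [].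
have p0 : 0 < p by apply: le_lt_trans N_lt_p; exact: ler0n.
(* Modified on a null set, the potential satisfies its essential bounds everywhere; [hh] below is
   likewise nonnegative everywhere. *)
pose aa x := clamp (essinf a) (normoo a) (a x).
have alo0 := essinf_gt0 a_gt0.
have ale := essinf_le_normoo a_Loo a_gt0.
have ma := Lfun_oo_measurable a_Loo.
have maa : measurable_fun setT aa.
  by apply: (measurableT_comp _ ma); apply: continuous_measurable_fun; exact: continuous_clamp.
have a_alo x : essinf a <= aa x by have /andP[] := clamp_itv (a x) ale.
have a_ahi x : aa x <= normoo a by have /andP[] := clamp_itv (a x) ale.
have a_ae : {ae mu, forall x, aa x = a x}.
  apply: filterS2 (essinf_ae a_gt0) (normoo_ae a_Loo) => x h1 h2.
  by rewrite /aa clamp_id// (le_trans (ler_norm _)).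
have ih' : mu.-integrable setT (EFin \o h) by apply/Lfun1_integrable.
have /integrableP[/measurable_EFinP mh _] := ih'.
pose hh x := Num.max 0 (h x).
have mhh : measurable_fun setT hh by exact: measurable_maxr.
have hh0 x : 0 <= hh x by rewrite le_max lexx.
have h_ae : {ae mu, forall x, hh x = h x} by apply: filterS h_ge0 => x /max_idPr.
have ih : mu.-integrable setT (EFin \o hh).
  apply: (ae_bound_integrable mhh ih'); apply: filterS h_ge0 => x h0.
  by rewrite ger0_norm// /hh (max_idPr h0).
have norm1E : norm1 h = \int[mu]_x hh x.
  rewrite /norm1 Lnorm1; apply: ae_eq_Rintegral => //; first exact: measurableT_comp.
  by apply: filterS h_ge0 => x h0; rewrite /hh (max_idPr h0) /= ger0_norm.
have mB := measurable_eball x0 (r / 2).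
have ballE : \int[mu]_(x in eball x0 (r / 2)) h x = \int[mu]_(x in eball x0 (r / 2)) hh x.
  rewrite /Rintegral; congr fine; apply: ae_eq_integral => //.
  - by apply/measurable_EFinP; apply: measurable_funS mh.
  - by apply/measurable_EFinP; apply: measurable_funS mhh.
  - by apply: filterS h_ae => x -> _.
set k := embedding_cst N p (essinf a).
have k0 : 0 < k by exact: embedding_cst_gt0.
have kE : k_ p a = k by [].
have kp0 : 0 < k `^ p by exact: powR_gt0.
have hB0 : 0 < \int[mu]_(x in eball x0 (r / 2)) hh x by rewrite -ballE.
have hBH : \int[mu]_(x in eball x0 (r / 2)) hh x <= \int[mu]_x hh x.
  have ihB : mu.-integrable (eball x0 (r / 2)) (EFin \o hh) by apply: (integrableS _ mB _ ih).
  apply: fine_le; [exact: integrable_fin_num ihB|exact: integrable_fin_num ih|].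
  apply: ge0_subset_integral => //; first exact/measurable_EFinP.
  by move=> x _; rewrite lee_fin.
have H0 := lt_le_trans hB0 hBH.
have ahi0 : 0 < normoo a := lt_le_trans alo0 ale.
have den0 : 0 < 2 `^ p - 2 `^ (p - N%:R) + r `^ p * normoo a.
  rewrite ltr_wpDl//; last by rewrite mulr_gt0// powR_gt0.
  by rewrite subr_ge0 ler_powR ?ler1n// gerBl.
have K0 : 0 < K_ p a r.
  rewrite /K_ kE inv_ball_volumeE; apply: mulr_gt0; last by rewrite divr_gt0 ?powR_gt0.
  by rewrite mulr_gt0 ?invr_gt0 ?ball_vol_gt0// divr_gt0.
have En := energy_tent_le x0 N0 N_lt_p r_gt0 d_gt0 maa alo0 a_alo a_ahi.
have {}En : energy p aa (tent_pair x0 r d) <= d `^ p / (k `^ p * K_ p a r).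
  apply: (le_trans En); rewrite le_eqVlt; apply/orP; left; apply/eqP.
  rewrite /K_ kE inv_ball_volumeE.
  have vn : ball_vol R N != 0 by rewrite gt_eqF// ball_vol_gt0.
  have rn : r `^ (p - N%:R) != 0 by rewrite gt_eqF// powR_gt0.
  move: den0 kp0 vn rn; move: (_ + _) (k `^ p) (ball_vol R N) (r `^ (p - N%:R)) (d `^ p) => x y z s t.
  by move=> /lt0r_neq0 h1 /lt0r_neq0 h2 h3 h4; field; rewrite h1 h2 h3 h4.
have KtE : Ktilde p a h x0 r = K_ p a r * (\int[mu]_(x in eball x0 (r / 2)) hh x / \int[mu]_x hh x).
  by rewrite /Ktilde -norm1E -ballE.
have x10 : 0 < c1 `^ p by exact: powR_gt0.
have x20 : 0 < c2 `^ p by exact: powR_gt0.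
have xd0 : 0 < d `^ p by exact: powR_gt0.
have Gmono (s t : R) : 0 <= s -> s <= t -> primitive g s <= primitive g t.
  move=> s0 st; rewrite -subr_ge0 primitiveB//; apply: Rintegral_ge0 => x.
  by rewrite /= in_itv/= => /andP[sx _]; apply: g_ge0; exact: le_trans sx.
have G1_ge0 : 0 <= primitive g c1 by rewrite -(primitive0 g) Gmono// ltW.
have Gd_ge0 : 0 <= primitive g d by rewrite -(primitive0 g) Gmono// ltW.
have Gd2 : primitive g d <= primitive g c2 by rewrite Gmono// ltW.
move: lambda_gt; rewrite /lambda1 kE norm1E => lambda_gt.
have lam0 := level_lam_gt0 p0 kp0 H0 hB0 K0 KtE x20 xd0 Gd_ge0 Gd2 G_c2 lambda_gt.
have gain := level_gain p0 kp0 H0 hB0 K0 KtE x20 xd0 Gd_ge0 Gd2 G_c2 lambda_gt En.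
have cost := level_cost p0 kp0 H0 hBH K0 KtE x20 xd0 Gd_ge0 Gd2 G_c2 En.
move: lambda_lt; rewrite /lambda2 kE norm1E lt_min => /andP[lt1 lt2].
have level2 : lambda * (\int[mu]_x hh x * primitive g c2) < c2 `^ p / (p * k `^ p) / 2.
  apply: (level_two p0 kp0 H0 x20 Gd_ge0 Gd2 G_c2).
  by rewrite -lte_fin.
have level1 : lambda * (\int[mu]_x hh x * primitive g c1) < c1 `^ p / (p * k `^ p).
  (* If [G(c1)] vanishes the quotient is infinite and gives no bound on [lambda]; the left side is
     then 0 and the inequality is immediate. *)
  move: lt1; rewrite /quotoo; case: eqP => [-> _|/eqP Gn lt1].
    by rewrite !mulr0 divr_gt0// mulr_gt0.
  have G1p : 0 < primitive g c1 by rewrite lt_neqAle eq_sym Gn.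
  by apply: (level_one p0 kp0 H0 G1p); rewrite -lte_fin EFinM.
have [w [wP wD]] := three_solutions N0 N_lt_p maa alo0 a_alo a_ahi ih hh0 g_cont g_ge0 r_gt0
  c1_gt0 d_gt0 lam0 c1_lt_d d_lt_c2 level1 level2 gain cost.
exists (fun i => (w i).1); split; last exact: wD.
move=> i; have [Ww w0 wn weq] := wP i; split.
- exact: (weak_solution_pair N0 N_lt_p ma maa alo0 a_alo a_ahi mh mhh g_cont a_ae h_ae Ww w0 weq).
- by rewrite (energy_W1p_norm N0 N_lt_p ma maa alo0 a_alo a_ahi a_ae Ww).
- have sup := energy_sup N0 N_lt_p maa alo0 a_alo a_ahi Ww.
  apply: (le_lt_trans (Lnorm_oo_le sup)).
  by rewrite lte_fin mulrC -ltr_pdivlMr.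
Qed.
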